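(* In the setting described in the context: (a) For every $3\le p<\infty$ there is a constant $c_p>0$, depending only on $p$, such that if $\lim_{T\to\infty}\|P_Tg\|_p=0$ for every $g\in L^p(m)$ (strong stability), then for every $f\in L^p(m)$ $$c_p\|f\|_p\le\|\widetilde H\|_p .$$ (b) For every $2\le p<\infty$ there is a constant $C_p>0$, depending only on $p$, such that if $\lim_{T\to\infty}\|P_Tg\|_p=0$ for every $g\in L^p(m)$ and additionally $P_t1=1$ $m$-a.e. for every $t>0$ (conservativeness), then for every $f\in L^p(m)$ $$\|\widetilde H\|_p\le C_p\|f\|_p .$$
   Context: Setting. $E$ is a locally compact separable metric space with Borel $\sigma$-algebra $\mathcal B(E)$, and $m$ is a Radon measure on $E$ with $\operatorname{supp} m=E$. $L^p(m)$ is the real $L^p$-space with norm $\|\cdot\|_p$. Let $d=\{(x,y)\in E\times E: x=y\}$. $(\mathcal E,\mathcal D(\mathcal E))$ is a regular (symmetric) Dirichlet form on $L^2(m)$ which is pure-jump: there is a symmetric jumping measure $J$ on $E\times E\setminus d$ such that $$\mathcal E(u,v)=\tfrac12\iint_{E\times E\setminus d}(u(y)-u(x))(v(y)-v(x))\,J(dx,dy)$$ for all $u,v\in\mathcal D(\mathcal E)$ (taken in quasi-continuous versions). It is assumed that $J$ is given by a kernel: $J(dx,dy)=J(x,dy)\,m(dx)$. $X=(X_t)$ is the associated $m$-symmetric Hunt process, with laws $\mathbb P_x$, expectations $\mathbb E_x$ and cemetery $\Delta$. Its semigroup $P_tg(x)=\mathbb E_x g(X_t)$ (with $g(\Delta)=0$;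 also used for non-negative measurable $g$, with values in $[0,\infty]$) extends to a semigroup of sub-Markovian contractions on $L^p(m)$, $1\le p\le\infty$, strongly continuous for $1\le p<\infty$ and symmetric on $L^2(m)$. $P_t(x,dz)$ denotes its transition kernel. Square function. Let $\chi(s,t)=1$ if $|s|>|t|$, $\chi(s,t)=\tfrac12$ if $|s|=|t|$, $\chi(s,t)=0$ if $|s|<|t|$. For $f\in L^p(m)$, $1<p<\infty$, $$\widetilde H(x)=\Big(\int_0^\infty\int_E\int_{E\setminus\{z\}}(P_tf(y)-P_tf(z))^2\,\chi(P_tf(z),P_tf(y))\,J(z,dy)\,P_t(x,dz)\,dt\Big)^{1/2}\in[0,\infty].$$ *)

(* Defs.v *)
From HB Require Import structures.
From mathcomp Require Import all_boot all_order all_algebra.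
From mathcomp Require Import all_classical all_reals all_analysis.
From mathcomp Require Import measurable_realfun.

Set Implicit Arguments.
Unset Strict Implicit.
Unset Printing Implicit Defensive.

Import Order.TTheory GRing.Theory Num.Theory.
Import numFieldNormedType.Exports.

Local Open Scope classical_set_scope.
Local Open Scope ring_scope.

(* The library's measurable types are pointed, so a metric space carrying a
   Borel sigma-algebra has to be nonempty. *)
#[short(type="pmetricType")]
HB.structure Definition PointedMetric (K : numDomainType) :=
  {M of Metric K M & isPointed M}.

Notation borel T := (g_sigma_algebraType (@open T)).

(* [option T] with the one-point compactification topology; [None] is the
   cemetery, and it is isolated when [T] is compact. *)
Notation cemetery T := (one_point_compactification T).

HB.instance Definition _ (T : topologicalType) :=
  isPointed.Build (cemetery T) None.

Section cemetery_borel.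
Context {R : realType} {E : pmetricType R}.

Lemma measurable_image_Some (B : set (borel E)) :
  measurable B -> measurable (Some @` B : set (borel (cemetery E))).
Proof.
have mO (U : set E) : open U ->
    measurable (Some @` U : set (borel (cemetery E))).
  by move=> oU; apply: sub_sigma_algebra;
    exact: one_point_compactification_open_some.
pose S := [set A : set E | measurable (Some @` A : set (borel (cemetery E)))].
suff : <<s @open E >> `<=` S by exact.
apply: smallest_sub; last by move=> U; exact: mO.
rewrite /S; split => [|A mA|A mA] /=.
- by rewrite image_set0; exact: (@measurable0 _ (borel (cemetery E))).
- rewrite setTD (_ : _ @` _ = Some @` [set: E] `\` Some @` A).
    by apply: (@measurableD _ (borel (cemetery E))); [apply: mO; exact: openT|exact: mA].
  apply/seteqP; split => [_ [x nAx <-]|_ [[x _ <-] nAx]].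
    by split; [exists x | case=> y Ay [yx]; apply: nAx; rewrite -yx].
  by exists x => // Ax; apply: nAx; exists x.
- rewrite image_bigcup.
  exact: (@bigcupT_measurable _ (borel (cemetery E))).
Qed.

End cemetery_borel.

Section state_space.
Context {R : realType} {E : pmetricType R}.
Implicit Type m : {measure set (borel E) -> \bar R}.

Definition locally_compact_separable : Prop :=
  locally_compact [set: E] /\
  exists2 S : set E, countable S & dense S.

Definition radon_measure m : Prop :=
  (forall C : set E, compact C -> (m C < +oo)%E) /\
  (forall B : set (borel E), measurable B ->
     m B = ereal_sup [set m C | C in [set C : set E | compact C /\ C `<=` B]]).

Definition full_support m : Prop :=
  forall U : set E, open U -> U !=set0 -> (0 < m U)%E.

End state_space.

(* A form on L^2(m) is given by a set [D] of square integrable functions, stable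
   under m-a.e. modification, and by [a : (E -> R) -> (E -> R) -> R], which is
   relevant only on [D]. *)
Section dirichlet_form.
Context {R : realType} {E : pmetricType R}.
Variables (m : {measure set (borel E) -> \bar R}).
Variables (D : set (E -> R)) (a : (E -> R) -> (E -> R) -> R).
Implicit Types (u v w : E -> R) (A B : set (borel E)).

Definition L2dot u v : R := \int[m]_x (u x * v x).

Definition form1 u v : R := a u v + L2dot u v.

Record symmetric_form : Prop := {
  form_domL2 : forall u, D u -> (u : borel E -> R) \in Lfun m 2%:E;
  form_dom_ae : forall u v, D u -> (v : borel E -> R) \in Lfun m 2%:E ->
    u = v %[ae m] -> D v;
  form_dom_lin : forall (c : R) u v, D u -> D v ->
    D (fun x => c * u x + v x);
  form_dom_dense : forall u, (u : borel E -> R) \in Lfun m 2%:E ->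
    forall e : R, 0 < e ->
    exists2 v, D v & ('N[m]_2%:E[EFin \o (u \- v)%R] < e%:E)%E;
  form_ae : forall u u' v, D u -> D u' -> D v ->
    u = u' %[ae m] -> a u v = a u' v;
  form_sym : forall u v, D u -> D v -> a u v = a v u;
  form_lin : forall (c : R) u v w, D u -> D v -> D w ->
    a (fun x => c * u x + v x) w = c * a u w + a v w;
  form_ge0 : forall u, D u -> 0 <= a u u
}.

Definition closed_form : Prop :=
  forall u_ : nat -> E -> R, (forall n, D (u_ n)) ->
    (forall e : R, 0 < e -> exists N, forall n k, (N <= n)%N -> (N <= k)%N ->
       form1 (u_ n \- u_ k) (u_ n \- u_ k) < e) ->
    exists2 u, D u & form1 (u_ n \- u) (u_ n \- u) @[n --> \oo] --> (0 : R).

Definition markovian_form : Prop :=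
  forall u, D u ->
    let v x := Num.min (Num.max 0 (u x)) 1 in D v /\ a v v <= a u u.

Definition dirichlet_form : Prop :=
  [/\ symmetric_form, closed_form & markovian_form].

Definition Cc u : Prop :=
  continuous u /\ compact (closure [set x | u x != 0]).

Definition regular_form : Prop :=
  (forall u, Cc u -> forall e : R, 0 < e ->
     exists v, [/\ D v, Cc v & forall x, `|u x - v x| <= e]) /\
  (forall u, D u -> forall e : R, 0 < e ->
     exists v, [/\ D v, Cc v & form1 (u \- v) (u \- v) < e]).

(* The 1-capacity of an open set. *)
Definition capacity (U : set E) : \bar R :=
  ereal_inf [set (form1 u u)%:E | u in
    [set u | D u /\ {ae m, forall x, U x -> 1 <= u x}]].

Definition quasi_continuous u : Prop :=
  forall e : R, 0 < e -> exists U : set E,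
    [/\ open U, (capacity U < e%:E)%E & {within ~` U, continuous u}].

Definition off_diagonal : set (borel E * borel E) := [set z | z.1 <> z.2].

(* [J] is a measure on [E * E] of which only the restriction to the complement
   of the diagonal is ever used. *)
Variables (J : {measure set (borel E * borel E) -> \bar R}).
Variables (K : R.-sfker borel E ~> borel E).

Definition symmetric_jump_measure : Prop :=
  forall B : set (borel E * borel E), measurable B -> B `<=` off_diagonal ->
    J [set z | B (z.2, z.1)] = J B.

(* Quantifying over the quasi-continuous elements of [D] amounts to taking
   quasi-continuous versions, as [a] is invariant under a.e. modification. *)
Definition pure_jump_form : Prop :=
  forall u v, D u -> D v -> quasi_continuous u -> quasi_continuous v ->
    (a u v)%:E = ((2^-1)%:E *
      \int[J]_(z in off_diagonal)
        ((u z.2 - u z.1) * (v z.2 - v z.1))%:E)%E.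

Definition jump_kernel : Prop :=
  forall B : set (borel E * borel E), measurable B -> B `<=` off_diagonal ->
    J B = (\int[m]_x K x (xsection B x))%E.

End dirichlet_form.

(* Sample space [Omega], filtration [F], paths [X] (only times [t >= 0] matter)
   and laws [P]. The sigma-algebra of [Omega] is one for which [x |-> P x A] is
   measurable for every event [A], e.g. the one generated by [X]; the filtration
   is not completed. Under these conventions the identities below for all the
   laws [P x] are equivalent to those for all initial distributions. *)
Section hunt_process.
Context {R : realType} {E : pmetricType R} {d : measure_display}
  {Omega : measurableType d}.
Variables (F : R -> set (set Omega)).
Variables (X : R -> {mfun Omega >-> borel (cemetery E)}).
Variables (P : R.-pker (borel (cemetery E)) ~> Omega).
Implicit Types (s t : R) (sigma : Omega -> \bar R).

(* X_s for s in [0, +oo], with X_oo the cemetery. *)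
Definition at_time (s : \bar R) (w : Omega) : cemetery E :=
  if s is t%:E then X t w else None.

Definition lifetime (w : Omega) : \bar R :=
  ereal_inf [set t%:E | t in [set t | 0 <= t /\ X t w = None]].

Record admissible_filtration : Prop := {
  filtration_sigma : forall t, 0 <= t ->
    sigma_algebra [set: Omega] (F t) /\ F t `<=` measurable;
  filtration_mono : forall s t, 0 <= s -> s <= t -> F s `<=` F t;
  filtration_right : forall t, 0 <= t ->
    \bigcap_(s in [set s | t < s]) F s `<=` F t;
  filtration_adapted : forall t (B : set (borel (cemetery E))), 0 <= t ->
    measurable B -> F t (X t @^-1` B)
}.

Definition stopping_time sigma : Prop :=
  (forall w, (0 <= sigma w)%E) /\
  (forall t, 0 <= t -> F t [set w | (sigma w <= t%:E)%E]).

Definition stopped_event sigma (A : set Omega) : Prop :=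
  measurable A /\
  forall t, 0 <= t -> F t (A `&` [set w | (sigma w <= t%:E)%E]).

(* The simple Markov property is the case of a constant [sigma]. *)
Definition strong_markov : Prop :=
  forall sigma, stopping_time sigma ->
  forall (x : cemetery E) s (A : set Omega) (B : set (borel (cemetery E))),
    0 <= s -> stopped_event sigma A -> measurable B ->
    P x (A `&` [set w | B (at_time (sigma w + s%:E)%E w)]) =
    (\int[P x]_(w in A) P (at_time (sigma w) w) (X s @^-1` B))%E.

Definition quasi_left_continuous : Prop :=
  forall (sigma_ : nat -> Omega -> \bar R) sigma,
    (forall n, stopping_time (sigma_ n)) -> stopping_time sigma ->
    (forall w, {homo sigma_ ^~ w : n k / (n <= k)%N >-> (n <= k)%E}) ->
    (forall w, sigma_ n w @[n --> \oo] --> sigma w) ->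
  forall x : cemetery E,
    {ae P x, forall w, (sigma w < +oo)%E ->
      at_time (sigma_ n w) w @[n --> \oo] --> at_time (sigma w) w}.

Record hunt_process : Prop := {
  hunt_filtration : admissible_filtration;
  hunt_normal : forall x : cemetery E, P x [set w | X 0 w = x] = 1%E;
  hunt_cemetery : forall t, 0 <= t -> P None [set w | X t w = None] = 1%E;
  hunt_lifetime : forall w t, 0 <= t -> (lifetime w <= t%:E)%E ->
    X t w = None;
  hunt_shift : exists theta : R -> Omega -> Omega,
    forall s t w, 0 <= s -> 0 <= t -> X s (theta t w) = X (s + t) w;
  hunt_right_continuous : forall w t, 0 <= t ->
    (X s w : cemetery E) @[s --> t^'+] --> (X t w : cemetery E);
  hunt_left_limits : forall w t, 0 < t ->
    exists l : cemetery E, (X s w : cemetery E) @[s --> t^'-] --> l;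
  hunt_strong_markov : strong_markov;
  hunt_quasi_left_continuous : quasi_left_continuous
}.

(* E_x g(X_t), with g extended by 0 at the cemetery. *)
Definition semigroup t (g : E -> \bar R) (x : E) : \bar R :=
  (\int[P (Some x)]_w oapp g 0%E (X t w : option E))%E.

(* For [f] in L^p(m), [p >= 1], E_x |f(X_t)| is finite for m-a.e. x; [fine]
   only fixes junk values on the exceptional null set. *)
Definition Pt t (f : E -> R) (x : E) : R := fine (semigroup t (EFin \o f) x).

Definition transition t (x : E) (B : set (borel E)) : \bar R :=
  P (Some x) (X t @^-1` (Some @` B)).

Section transition_measure.
Variables (t : R) (x : E).

Let mX (B : set (borel E)) : measurable B ->
  measurable (X t @^-1` (Some @` B)).
Proof.
move=> mB; rewrite -[_ @^-1` _]setTI.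
by apply: (@measurable_funPT _ _ _ _ (X t)) => //; exact: measurable_image_Some.
Qed.

Let transition0 : transition t x set0 = 0%E.
Proof.
rewrite /transition (_ : _ @^-1` _ = set0) ?measure0//.
by apply/seteqP; split => // w [].
Qed.

Let transition_ge0 B : (0 <= transition t x B)%E.
Proof. exact: measure_ge0. Qed.

Let transition_sigma_additive : semi_sigma_additive (transition t x).
Proof.
move=> B mB tB mUB; rewrite /transition.
have -> : X t @^-1` (Some @` \bigcup_n B n) =
    \bigcup_n X t @^-1` (Some @` B n).
  apply/seteqP; split => [w [y [n _ By] yw]|w [n _ [y By yw]]].
    by exists n => //; exists y.
  by exists y => //; exists n.
apply: measure_semi_sigma_additive => [n||].
- exact: mX.
- apply/trivIsetP => i j _ _ ij; apply/seteqP.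
  split => // w [[y By yw] [z Bz zw]].
  have yz : y = z by move: zw; rewrite -yw => -[].
  have Bij : (B i `&` B j) y by split; [exact: By | rewrite yz].
  by move/trivIsetP : tB Bij => /(_ i j I I ij) ->.
- by apply: bigcupT_measurable => n; exact: mX.
Qed.

HB.instance Definition _ := isMeasure.Build _ _ _ (transition t x)
  transition0 transition_ge0 transition_sigma_additive.

End transition_measure.

Variables (m : {measure set (borel E) -> \bar R}).
Variables (D : set (E -> R)) (a : (E -> R) -> (E -> R) -> R).

Definition m_symmetric : Prop :=
  forall t (f g : borel E -> \bar R), 0 < t ->
    measurable_fun setT f -> measurable_fun setT g ->
    (forall x, 0 <= f x)%E -> (forall x, 0 <= g x)%E ->
    (\int[m]_x (f x * semigroup t g x) = \int[m]_x (semigroup t f x * g x))%E.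

Definition approximating_form t (u v : E -> R) : R :=
  t^-1 * L2dot m (u \- Pt t u) v.

(* [(a, D)] is the form of the semigroup:
   D = {u in L^2 : lim (u - P_t u, u) / t < oo}, a(u, v) = lim (u - P_t u, v) / t
   as t decreases to 0; the quotient (u - P_t u, u) / t is monotone in t. *)
Definition associated : Prop :=
  (forall u : borel E -> R, u \in Lfun m 2%:E ->
     (D u <-> exists l : R,
        approximating_form t u u @[t --> (0 : R)^'+] --> l)) /\
  (forall u v : E -> R, D u -> D v ->
     approximating_form t u v @[t --> (0 : R)^'+] --> a u v).

Definition strongly_stable (p : R) : Prop :=
  forall g : borel E -> R, g \in Lfun m p%:E ->
    ('N[m]_p%:E[EFin \o Pt T g])%E @[T --> +oo%R] --> 0%E.

Definition conservative : Prop :=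
  forall t, 0 < t -> {ae m, forall x, semigroup t (cst 1%E) x = 1%E}.

Definition chi (s t : R) : R :=
  if `|t| < `|s| then 1 else if `|s| == `|t| then 2^-1 else 0.

Variables (K : R.-sfker borel E ~> borel E).

Definition square_function (f : E -> R) (x : E) : \bar R :=
  ((\int[lebesgue_measure]_(t in `[0%R, +oo[)
      \int[transition t x]_z
        \int[K z]_(y in ~` [set z])
          ((Pt t f y - Pt t f z) ^+ 2 * chi (Pt t f z) (Pt t f y))%:E)
     `^ (2^-1)%R)%E.

End hunt_process.

Record pure_jump_setting (R : realType) (E : pmetricType R)
    (m : {measure set (borel E) -> \bar R})
    (D : set (E -> R)) (a : (E -> R) -> (E -> R) -> R)
    (J : {measure set (borel E * borel E) -> \bar R})
    (K : R.-sfker borel E ~> borel E)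
    (d : measure_display) (Omega : measurableType d)
    (F : R -> set (set Omega)) (X : R -> {mfun Omega >-> borel (cemetery E)})
    (P : R.-pker (borel (cemetery E)) ~> Omega) : Prop := {
  setting_space : @locally_compact_separable R E;
  setting_radon : radon_measure m;
  setting_support : full_support m;
  setting_dirichlet : dirichlet_form m D a;
  setting_regular : regular_form m D a;
  setting_symmetric_jump : symmetric_jump_measure J;
  setting_pure_jump : pure_jump_form m D a J;
  setting_kernel : jump_kernel m J K;
  setting_hunt : hunt_process F X P;
  setting_m_symmetric : m_symmetric X P m;
  setting_associated : associated X P m D a
}.

(* Main.v *)
(* Write p = 2r, u_t = P_t f and w_t = |u_t|^(r-1) u_t. The decrement of t |-> |u_t|_p^p is
   comparable with the energy E(w_t) (Hardy-Stein): over a time step h both are bounded through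
   the elementary inequalities for powers, and tiling the half-line by steps of dyadic length h -> 0
   gives |f|_p^p <= C int_0^oo E(w_t) dt under strong stability. For a pure-jump form,
   E(w_t) <= C int |u_t|^(p-2) Gamma(u_t) dm, where Gamma is the carre du champ restricted by chi,
   because symmetry of J lets each jump be counted from its end of larger modulus.
   If p >= 3, Jensen gives |u_t|^(p-2) <= P_t |f|^(p-2), and moving P_t to the other factor turns the
   bound into |f|_p^p <= C int |f|^(p-2) H^2 dm; Hoelder's inequality concludes.

   For p = 2 the upper bound is the same identity read backwards. For p > 2 one tests H^2 against
   g >= 0 in the dual of L^(p/2), which leads to int_0^oo int P_t g Gamma(u_t) dm dt. For a time step h,
   Gamma(u_t) is replaced by the conditional variance P_h (v^2) - (P_h v)^2 of v = u_t, and the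
   discrete sum is bounded by |f|_p^p and |g|^(p/2)' by a pointwise backward induction with the
   Bellman function a^r - r a^(r-1) u^2; conservativeness is used to integrate it. The limit
   h -> 0 is identified by polarization, which writes int phi (P_h (v^2) - (P_h v)^2) through
   energies of v, v^2, phi and their combinations.

   The energy of the semigroup, the dyadic limit of (w - P_h w, w) / h, is identified with
   (1/2) int int (w(y) - w(x))^2 J(dx, dy), first for continuous w in the domain, where the pure-jump
   representation applies, and then by regularity of the form and Fatou's lemma. *)
Require Import Defs.
From HB Require Import structures.
From mathcomp Require Import all_boot all_order all_algebra.
From mathcomp Require Import all_classical all_reals all_analysis.
From mathcomp Require Import measurable_realfun ring lra.

Set Implicit Arguments.
Unset Strict Implicit.
Unset Printing Implicit Defensive.

Import Order.TTheory GRing.Theory Num.Theory.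
Import numFieldNormedType.Exports.

Local Open Scope classical_set_scope.
Local Open Scope ring_scope.

(** * Signed powers *)

(** There is no derivative in time and no spectral theorem: every estimate is made for a finite step
    h, and h tends to 0 only through monotone limits, Fatou's lemma or convergent dyadic quotients.
    Write E_h(w) = (w - P_h w, w). The engine is |w - P_h w|_2^2 = 2 E_h(w) - E_2h(w): its sign
    makes E_h(w)/h grow when h is halved, and convergence of these quotients makes |w - P_h w|_2^2 /
    h vanish, which is the error term of the upper bound. Kernels may lose mass, so the energy
    identity carries a killing term, and comparison inequalities are required of values as well as
    of increments. In the upper bound the polarization needs v^2 and phi v of finite energy, so it
    is done for bounded functions; lower semicontinuity of the weighted jump integral reaches a
    general f. Both bounds end with Young's inequality and absorption: a fraction of a quantity
    known to be finite is moved to the other side. This is why the upper bound first cuts the square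
    function in height and in space. *)

Section signed_power.
Context {R : realType}.
Implicit Types r a b s x y : R.

(* For [p = 2 * r], [spow r] is the map s |-> |s|^(p/2) sgn(s). *)
Definition spow r s : R := s * `|s| `^ (r - 1).

Lemma mulr_powRB1_ge0 r x : 1 <= r -> 0 <= x -> x * x `^ (r - 1) = x `^ r.
Proof.
move=> r1 x0; have [->|xn0] := eqVneq x 0.
  by rewrite mul0r powR0// gt_eqF// (lt_le_trans ltr01).
rewrite -[X in X * _]powRr1// -powRD; first by congr (_ `^ _); ring.
by rewrite xn0 implybT.
Qed.

Lemma norm_spow r s : 1 <= r -> `|spow r s| = `|s| `^ r.
Proof.
by move=> r1; rewrite normrM (ger0_norm (powR_ge0 _ _)) mulr_powRB1_ge0.
Qed.

Lemma spow_sqr r s : 1 <= r -> spow r s ^+ 2 = `|s| `^ (2 * r).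
Proof.
by move=> r1; rewrite -real_normK ?num_real// norm_spow// -powR_mulrn ?powR_ge0// -powRrM mulrC.
Qed.

Lemma spow1 s : spow 1 s = s.
Proof. by rewrite /spow subrr powRr0 mulr1. Qed.

Lemma powR_sqr_sub1 r s : (`|s| `^ (r - 1)) ^+ 2 = `|s| `^ (2 * r - 2).
Proof. by rewrite -powR_mulrn ?powR_ge0// -powRrM; congr (_ `^ _); ring. Qed.

(** Convexity of x^r: the graph lies above the tangent at [y]. The powers stay factored as a product
    with the exponent r - 1, so that the sign cases below become polynomial inequalities in a, b and
    their powers of exponent r - 1. *)
Lemma powR_tangent r x y : 1 <= r -> 0 <= x -> 0 <= y ->
  r * y `^ (r - 1) * x <= x * x `^ (r - 1) + (r - 1) * (y * y `^ (r - 1)).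
Proof.
move=> r1 x0 y0; rewrite !mulr_powRB1_ge0//.
have [->|rn1] := eqVneq r 1.
  by rewrite subrr powRr0 mul0r !mul1r addr0 powRr1.
have {rn1}r1' : 1 < r by rewrite lt_neqAle eq_sym rn1.
have rp : 0 < r by lra.
have rm : 0 < r - 1 by lra.
(* Young's inequality with exponents [r] and [r / (r - 1)] for x and y^(r-1); the tangent inequality
   is [r] times it. *)
have := @conjugate_powR R x (y `^ (r - 1)) r (r / (r - 1)) x0 (powR_ge0 _ _) rp.
rewrite divr_gt0//= => /(_ isT).
have -> : r^-1 + (r / (r - 1))^-1 = 1 by field; rewrite ?gt_eqF.
move=> /(_ erefl); rewrite -powRrM.
have -> : (r - 1) * (r / (r - 1)) = r by field; rewrite ?gt_eqF.
have -> : y `^ r / (r / (r - 1)) = (r - 1) * y `^ r / r by field; rewrite ?gt_eqF.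
rewrite -mulrDl ler_pdivlMr// => H.
by rewrite -mulrA mulrC (mulrC _ x).
Qed.

Let powRB1_mono r x y : 1 <= r -> 0 <= x -> x <= y ->
  x `^ (r - 1) <= y `^ (r - 1).
Proof.
move=> r1 x0 xy; apply: ge0_ler_powR => //; rewrite ?nnegrE ?subr_ge0//.
exact: le_trans xy.
Qed.

(** The inequalities below are invariant under (a, b) -> (-a, -b), so only equal and opposite signs
    remain. *)
Let sgn_cases a b (P : R -> R -> Prop) :
  (forall a b, 0 <= a -> 0 <= b -> P a b) ->
  (forall a b, 0 <= a -> 0 <= b -> P a (- b)) ->
  (forall a b, P a b -> P (- a) (- b)) -> P a b.
Proof.
move=> pp pn pN; case: (lerP 0 a) => a0; case: (lerP 0 b) => b0.
- exact: pp.
- by rewrite -[b]opprK; apply: pn => //; rewrite oppr_ge0 ltW.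
- rewrite -[a]opprK -[b]opprK; apply: (pN); apply: pn => //.
  by rewrite oppr_ge0 ltW.
- by rewrite -[a]opprK -[b]opprK; apply: pN; apply: pp; rewrite oppr_ge0 ltW.
Qed.

Lemma spowN r s : spow r (- s) = - spow r s.
Proof. by rewrite /spow normrN mulNr. Qed.

Lemma spow_mono r a b : 1 <= r -> 0 <= (a - b) * (spow r a - spow r b).
Proof.
move=> r1; apply: (@sgn_cases a b ( fun a b => 0 <= (a - b) * (spow r a - spow r b))).
- move=> {a b} a b a0 b0; rewrite /spow !ger0_norm//.
  case: (lerP a b) => ab.
    by rewrite mulr_le0 ?subr_le0// ler_pM ?powR_ge0// powRB1_mono.
  rewrite mulr_ge0 ?subr_ge0 ?(ltW ab)//.
  by apply: ler_pM; rewrite ?powR_ge0// ?(ltW ab)// powRB1_mono// ltW.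
- move=> {a b} a b a0 b0; rewrite spowN !opprK mulr_ge0// addr_ge0//.
    by rewrite /spow mulr_ge0 ?powR_ge0.
  by rewrite /spow mulr_ge0 ?powR_ge0.
- move=> {a b} a b; rewrite !spowN => H.
  by rewrite [leRHS](_ : _ = (a - b) * (spow r a - spow r b))//; ring.
Qed.

Let spowE r s : spow (2 * r - 1) s = s * (`|s| `^ (r - 1)) ^+ 2.
Proof. by rewrite /spow powR_sqr_sub1; congr (_ * _ `^ _); ring. Qed.

Let psqr r s : 1 <= r -> `|s| `^ (2 * r) = s ^+ 2 * (`|s| `^ (r - 1)) ^+ 2.
Proof. by move=> r1; rewrite -spow_sqr// exprMn. Qed.

(** With A = |a|^(r-1) and B = |b|^(r-1): for equal signs the right side minus the left is (aA -
    bB)^2 + ab (A - B)^2; for opposite signs the claim follows from the monotonicity of x^(2r-1) on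
    the moduli. *)
Lemma spow_energy_le r a b : 1 <= r ->
  (a - b) * (spow (2 * r - 1) a - spow (2 * r - 1) b) <=
  2 * (spow r a - spow r b) ^+ 2.
Proof.
move=> r1; rewrite !spowE /spow.
apply: (@sgn_cases a b ( fun a b => (a - b) * (a * (`|a| `^ (r - 1)) ^+ 2
  - b * (`|b| `^ (r - 1)) ^+ 2) <= 2 * (a * `|a| `^ (r - 1) - b * `|b| `^ (r - 1)) ^+ 2)).
- move=> {a b} a b a0 b0; rewrite !ger0_norm//.
  set A := a `^ _; set B := b `^ _.
  have H : 0 <= (a * b) * (A - B) ^+ 2 by rewrite mulr_ge0 ?sqr_ge0// mulr_ge0.
  have H2 := sqr_ge0 (a * A - b * B); nra.
- move=> {a b} a b a0 b0; rewrite normrN !ger0_norm//.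
  set A := a `^ _; set B := b `^ _.
  have A0 : 0 <= A by exact: powR_ge0.
  have B0 : 0 <= B by exact: powR_ge0.
  have H : 0 <= (a - b) * (a * A ^+ 2 - b * B ^+ 2).
    case: (lerP a b) => ab.
      rewrite mulr_le0 ?subr_le0// ler_pM ?sqr_ge0// lerXn2r ?nnegrE//.
      exact: powRB1_mono.
    rewrite mulr_ge0 ?subr_ge0 ?(ltW ab)//.
    apply: ler_pM; rewrite ?sqr_ge0// ?(ltW ab)// lerXn2r ?nnegrE//.
    by apply: powRB1_mono => //; exact: ltW.
  have H2 : 0 <= (a * A) * (b * B) by rewrite !mulr_ge0.
  rewrite [leLHS](_ : _ = (a * A) ^+ 2 + (b * B) ^+ 2 + a * b * A ^+ 2 + a * b * B ^+ 2); last by ring.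
  rewrite [leRHS](_ : _ = 2 * ((a * A) ^+ 2 + (b * B) ^+ 2) + 4 * ((a * A) * (b * B))); last by ring.
  move: H; rewrite [X in 0 <= X](_ : _ = (a * A) ^+ 2 + (b * B) ^+ 2 - a * b * A ^+ 2 - a * b * B ^+ 2); last by ring.
  lra.
- move=> {a b} a b; rewrite !normrN => H.
  rewrite [leLHS](_ : _ = (a - b) * (a * (`|a| `^ (r - 1)) ^+ 2
  - b * (`|b| `^ (r - 1)) ^+ 2)); last by ring.
  by rewrite [leRHS](_ : _ = 2 * (a * `|a| `^ (r - 1) - b * `|b| `^ (r - 1)) ^+ 2)//; ring.
Qed.

(** With p = 2r the bracket is the Bregman divergence |b|^p - |a|^p - p [spow (p - 1) a] (b - a).
    Its positivity gives one Hardy-Stein inequality, the quantitative lower bound the other. *)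
Lemma spow_bregman r a b : 1 <= r ->
  (spow r a - spow r b) ^+ 2 <= 2 * (`|b| `^ (2 * r)
    + (2 * r - 1) * `|a| `^ (2 * r) - 2 * r * spow (2 * r - 1) a * b).
Proof.
move=> r1; rewrite !spowE !psqr// /spow.
apply: (@sgn_cases a b ( fun a b => (a * `|a| `^ (r - 1) - b * `|b| `^ (r - 1)) ^+ 2 <= 2 *
  (b ^+ 2 * (`|b| `^ (r - 1)) ^+ 2 + (2 * r - 1) * (a ^+ 2 * (`|a| `^ (r - 1)) ^+ 2)
   - 2 * r * (a * (`|a| `^ (r - 1)) ^+ 2) * b))).
- move=> {a b} a b a0 b0; rewrite !ger0_norm//.
  have := powR_tangent r1 b0 a0.
  set A := a `^ _; set B := b `^ _ => T.
  have A0 : 0 <= A by exact: powR_ge0.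
  have := ler_wpM2l (mulr_ge0 a0 A0) T.
  have := sqr_ge0 (a * A - b * B).
  set X := (a * A - b * B) ^+ 2 => X0 H.
  rewrite [leRHS](_ : _ = 2 * X + 4 * (a * A * (b * B + (r - 1) * (a * A)) - a * A * (r * A * b))).
    lra.
  by rewrite /X; ring.
- move=> {a b} a b a0 b0; rewrite normrN !ger0_norm//.
  set A := a `^ _; set B := b `^ _.
  have H : 0 <= r * (a * A ^+ 2) * b by rewrite !mulr_ge0 ?powR_ge0// (le_trans _ r1).
  have H2 := sqr_ge0 (a * A - b * B).
  have H3 : 0 <= (r - 1) * (a * A) ^+ 2 by rewrite mulr_ge0 ?sqr_ge0// subr_ge0.
  move: H H2 H3; rewrite !sqrrB sqrrN !exprMn; lra.
- move=> {a b} a b; rewrite !normrN => H.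
  apply: (le_trans _ (le_trans H _)); rewrite le_eqVlt; apply/orP; left; apply/eqP; ring.
Qed.

Let spow_lip_aux r a b : 1 <= r -> `|b| <= `|a| ->
  (spow r a - spow r b) ^+ 2 <= r ^+ 2 * ((a - b) ^+ 2 * (`|a| `^ (r - 1)) ^+ 2).
Proof.
move=> r1; apply: (@sgn_cases a b ( fun a b => `|b| <= `|a| ->
  (spow r a - spow r b) ^+ 2 <= r ^+ 2 * ((a - b) ^+ 2 * (`|a| `^ (r - 1)) ^+ 2))).
- move=> {a b} a b a0 b0; rewrite /spow !ger0_norm// => ab.
  have := powR_tangent r1 b0 a0; have := powRB1_mono r1 b0 ab.
  set A := a `^ _; set B := b `^ _ => BA T.
  rewrite -!exprMn ler_pXn2r ?nnegrE//.
  + have -> : r * ((a - b) * A) = r * (a * A) - r * A * b by ring.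
    by move: T; lra.
  + by rewrite subr_ge0 ler_pM ?powR_ge0.
  + by rewrite !mulr_ge0 ?powR_ge0 ?subr_ge0//; exact: le_trans r1.
- move=> {a b} a b a0 b0; rewrite /spow normrN !ger0_norm// => ab.
  have := powRB1_mono r1 b0 ab.
  have A0 : 0 <= a `^ (r - 1) by exact: powR_ge0.
  have B0 : 0 <= b `^ (r - 1) by exact: powR_ge0.
  move: A0 B0; set A := a `^ _; set B := b `^ _ => A0 B0 BA.
  rewrite mulNr !opprK -!exprMn ler_pXn2r ?nnegrE//.
  + rewrite [leLHS](_ : _ = 1 * ((a + b) * A) - b * (A - B)); last by ring.
    apply: (@le_trans _ _ (1 * ((a + b) * A))).
      by rewrite gerBl mulr_ge0// subr_ge0.
    by rewrite ler_wpM2r// mulr_ge0// addr_ge0.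
  + by rewrite addr_ge0 ?mulr_ge0.
  + by rewrite !mulr_ge0 ?addr_ge0//; exact: le_trans r1.
- move=> {a b} a b; rewrite !normrN !spowN => H /H{H} H.
  by apply: (le_trans _ (le_trans H _)); rewrite le_eqVlt; apply/orP; left; apply/eqP; ring.
Qed.

(** The slope of [spow r] at s is r |s|^(r-1), so an increment is controlled by the end of larger
    modulus. This is the end that [chi] selects; for equal moduli both weights are 1/2. *)
Lemma spow_lip r a b : 1 <= r ->
  (spow r a - spow r b) ^+ 2 <= r ^+ 2 * (
    ((a - b) ^+ 2 * chi a b) * `|a| `^ (2 * r - 2) +
    ((a - b) ^+ 2 * chi b a) * `|b| `^ (2 * r - 2)).
Proof.
move=> r1; rewrite /chi -!powR_sqr_sub1.
case: (ltgtP `|a| `|b|) => ab.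
- have := spow_lip_aux r1 (ltW ab).
  by rewrite -sqrrN opprB -(sqrrN (b - a)) opprB mulr1 mulr0 mul0r add0r.
- have := spow_lip_aux r1 (ltW ab).
  by rewrite mulr1 mulr0 mul0r addr0.
- have := @spow_lip_aux r a b r1; rewrite ab lexx => /(_ isT) /le_trans; apply.
  by rewrite le_eqVlt; apply/orP; left; apply/eqP; field.
Qed.

Lemma chi_ge0 a b : 0 <= chi a b.
Proof. by rewrite /chi; case: ifP => // _; case: ifP => // _; rewrite invr_ge0. Qed.

Lemma chi_le1 a b : chi a b <= 1.
Proof. by rewrite /chi; case: ifP => // _; case: ifP => // _; lra. Qed.

Lemma chiC a b : chi a b + chi b a = 1.
Proof. by rewrite /chi; case: (ltgtP `|a| `|b|) => _; lra. Qed.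

(* One step of the Bellman induction: [d] is the conditional variance added to [u], and the
   optimal new slope is [a + d]. *)
Lemma spow_bellman r a d u : 1 <= r -> 0 <= a -> 0 <= d -> 0 <= u ->
  (a + d) `^ r - r * (a + d) `^ (r - 1) * (d + u) <= a `^ r - r * a `^ (r - 1) * u.
Proof.
move=> r1 a0 d0 u0.
have ad0 : 0 <= a + d by rewrite addr_ge0.
have := powR_tangent r1 a0 ad0; rewrite !mulr_powRB1_ge0//.
have := @powRB1_mono r a (a + d) r1 a0; rewrite lerDl => /(_ d0).
move=> H T.
have := ler_wpM2r u0 (ler_wpM2l (le_trans ler01 r1) H).
rewrite [r * (a + d) `^ (r - 1) * (d + u)]mulrDr.
have : r * (a + d) `^ (r - 1) * (a + d) = r * (a + d) `^ r.
  by rewrite -mulrA; congr (_ * _); rewrite mulrC mulr_powRB1_ge0.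
rewrite mulrDr; move: T; lra.
Qed.

(** Terminal inequality of the Bellman induction, from two Young inequalities with exponents r and
    r/(r-1), for the products a g and (r f^2) a^(r-1). Their shares a^r / r and (1 - 1/r) a^r add up
    to a^r, and (r f^2)^r / r is the origin of the constant r^(r-1). *)
Lemma bellman_end r a f g : 1 < r -> 0 <= a -> 0 <= g ->
  a * g <= r `^ (r - 1) * `|f| `^ (2 * r) + (r - 1) / r * g `^ (r / (r - 1))
     + (a `^ r - r * a `^ (r - 1) * f ^+ 2).
Proof.
move=> r1 a0 g0.
have rp : 0 < r by lra.
have rm : 0 < r - 1 by lra.
have cj : r^-1 + (r / (r - 1))^-1 = 1 by field; rewrite ?gt_eqF.
have rr : 0 < r / (r - 1) by rewrite divr_gt0.
have H1 := @conjugate_powR R a g r (r / (r - 1)) a0 g0 rp rr cj.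
have H2 := @conjugate_powR R (r * f ^+ 2) (a `^ (r - 1)) r (r / (r - 1))
   (mulr_ge0 (ltW rp) (sqr_ge0 _)) (powR_ge0 _ _) rp rr cj.
rewrite -powRrM (_ : (r - 1) * (r / (r - 1)) = r) in H2; last by field; rewrite ?gt_eqF.
rewrite powRM ?(ltW rp) ?sqr_ge0// in H2.
have fE : (f ^+ 2) `^ r = `|f| `^ (2 * r).
  by rewrite -real_normK ?num_real// -powR_mulrn// -powRrM.
rewrite fE -(@mulr_powRB1_ge0 r r (ltW r1) (ltW rp)) in H2.
have e1 X : X / (r / (r - 1)) = (r - 1) / r * X by field; rewrite ?gt_eqF.
rewrite !e1 in H1 H2.
have e2 X : r * r `^ (r - 1) * X / r = r `^ (r - 1) * X by field; rewrite ?gt_eqF.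
rewrite e2 in H2.
have e3 : (r - 1) / r * a `^ r = a `^ r - a `^ r / r by field; rewrite ?gt_eqF.
rewrite e3 in H2.
move: H1 H2; rewrite mulrAC; lra.
Qed.

Lemma powR_add_le r x y : 0 <= r -> 0 <= x -> 0 <= y ->
  (x + y) `^ r <= 2 `^ r * (x `^ r + y `^ r).
Proof.
move=> r0 x0 y0.
wlog xy : x y x0 y0 / x <= y.
  by move=> W; case/orP: (le_total x y) => ?; [exact: W|rewrite addrC (addrC (x `^ r)); exact: W].
apply: (@le_trans _ _ ((2 * y) `^ r)).
  by apply: ge0_ler_powR; rewrite ?nnegrE ?addr_ge0 ?mulr_ge0//; lra.
by rewrite powRM// ler_wpM2l ?powR_ge0// lerDr powR_ge0.
Qed.

Lemma mul_powR_le r x y : 1 <= r -> 0 <= x -> 0 <= y ->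
  x * y `^ (r - 1) <= x `^ r + y `^ r.
Proof.
move=> r1 x0 y0; case: (lerP x y) => xy.
  rewrite -(mulr_powRB1_ge0 r1 y0); apply: ler_wpDl; first exact: powR_ge0.
  by rewrite ler_wpM2r ?powR_ge0.
rewrite -(mulr_powRB1_ge0 r1 x0); apply: ler_wpDr; first exact: powR_ge0.
by rewrite ler_wpM2l// powRB1_mono// ltW.
Qed.

End signed_power.

Lemma cvg_norm_powR {R : realType} (p : R) (u : nat -> R) (a : R) : a != 0 ->
  u n @[n --> \oo] --> a -> `|u n| `^ p @[n --> \oo] --> `|a| `^ p.
Proof.
move=> a0 ua; have uNa : `|u n| @[n --> \oo] --> `|a| by exact: cvg_norm.
have na0 : 0 < `|a| by rewrite normr_gt0.
rewrite [X in _ --> X]/powR gt_eqF//.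
have : expR (p * ln `|u n|) @[n --> \oo] --> expR (p * ln `|a|).
  apply: continuous_cvg; first exact: continuous_expR.
  apply: cvgM; first exact: cvg_cst.
  by apply: continuous_cvg => //; exact: continuous_ln.
apply: cvg_trans; apply: near_eq_cvg; near=> n.
rewrite /powR gt_eqF//; near: n.
exact: (cvgr_gt `|a|).
Unshelve. all: by end_near. Qed.

(** * Sub-Markov kernels and symmetric semigroups *)

Section integrable_lemmas.
Context {R : realType} {d} {T : measurableType d} (mu : {measure set T -> \bar R}).
Implicit Types f g : T -> R.

Lemma integrable_dom f g : measurable_fun setT f -> (forall x, `|f x| <= g x) ->
  mu.-integrable setT (EFin \o g) -> mu.-integrable setT (EFin \o f).
Proof.
move=> mf fg ig; apply: (le_integrable _ _ _ ig) => //; first exact/measurable_EFinP.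
by move=> x _; rewrite /= lee_fin (le_trans (fg x))// ler_norm.
Qed.

Lemma integrable_ge0P g : measurable_fun setT g -> (forall x, 0 <= g x) ->
  (\int[mu]_x (g x)%:E < +oo)%E <-> mu.-integrable setT (EFin \o g).
Proof.
move=> mg g0; have e : (\int[mu]_x `|(g x)%:E| = \int[mu]_x (g x)%:E)%E.
  by apply: eq_integral => x _; rewrite gee0_abs// lee_fin.
split=> [h|/integrableP[_]]; last by rewrite e.
by apply/integrableP; split; [exact/measurable_EFinP|rewrite e].
Qed.

Lemma fineK_integral f : mu.-integrable setT (EFin \o f) ->
  (\int[mu]_x f x)%:E = (\int[mu]_x (f x)%:E)%E.
Proof. by move=> intf; rewrite /Rintegral fineK//; exact: integrable_fin_num. Qed.

Lemma RintegralDf f g : mu.-integrable setT (EFin \o f) ->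
  mu.-integrable setT (EFin \o g) ->
  \int[mu]_x (f x + g x) = \int[mu]_x f x + \int[mu]_x g x.
Proof. exact: RintegralD. Qed.

Lemma eq_integrablef f g : (forall x, f x = g x) ->
  mu.-integrable setT (EFin \o f) -> mu.-integrable setT (EFin \o g).
Proof. by move=> /funext ->. Qed.

Lemma RintegralBf f g : mu.-integrable setT (EFin \o f) ->
  mu.-integrable setT (EFin \o g) ->
  \int[mu]_x (f x - g x) = \int[mu]_x f x - \int[mu]_x g x.
Proof. exact: RintegralB. Qed.

Lemma RintegralZf c f : mu.-integrable setT (EFin \o f) ->
  \int[mu]_x (c * f x) = c * \int[mu]_x f x.
Proof. exact: RintegralZl. Qed.

Lemma le_Rintegralf f g : mu.-integrable setT (EFin \o f) ->
  mu.-integrable setT (EFin \o g) -> (forall x, f x <= g x) ->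
  \int[mu]_x f x <= \int[mu]_x g x.
Proof. by move=> fi gi fg; apply: le_Rintegral => // x _; exact: fg. Qed.

Lemma integrable_addf f g : mu.-integrable setT (EFin \o f) ->
  mu.-integrable setT (EFin \o g) -> mu.-integrable setT (EFin \o (fun x => f x + g x)).
Proof. by move=> fi gi; apply: eq_integrable (integrableD _ fi gi). Qed.

Lemma integrable_subf f g : mu.-integrable setT (EFin \o f) ->
  mu.-integrable setT (EFin \o g) -> mu.-integrable setT (EFin \o (fun x => f x - g x)).
Proof. by move=> fi gi; apply: eq_integrable (integrableB _ fi gi). Qed.

Lemma integrable_scalef c f : mu.-integrable setT (EFin \o f) ->
  mu.-integrable setT (EFin \o (fun x => c * f x)).
Proof. by move=> fi; apply: eq_integrable (integrableZl _ c fi). Qed.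

Lemma ae_RintegralE f g : measurable_fun setT f -> measurable_fun setT g ->
  {ae mu, forall x, f x = g x} -> \int[mu]_x f x = \int[mu]_x g x.
Proof.
move=> mf mg fg; congr fine; apply: ae_eq_integral => //.
- exact/measurable_EFinP.
- exact/measurable_EFinP.
- by apply: filterS fg => x /= -> _.
Qed.

Lemma integrable_ae_dom f g : measurable_fun setT f -> measurable_fun setT g ->
  {ae mu, forall x, `|f x| <= g x} ->
  mu.-integrable setT (EFin \o g) -> mu.-integrable setT (EFin \o f).
Proof.
move=> mf mg fg /integrableP[_ ig]; apply/integrableP; split; first exact/measurable_EFinP.
apply: le_lt_trans ig; apply: ae_ge0_le_integral => //.
- by apply: measurableT_comp => //; exact/measurable_EFinP.
- by apply: measurableT_comp => //; exact/measurable_EFinP.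
- by apply: filterS fg => x h _; rewrite /= lee_fin (le_trans h)// ler_norm.
Qed.

Lemma ae_le_Rintegral f g : mu.-integrable setT (EFin \o f) ->
  mu.-integrable setT (EFin \o g) -> {ae mu, forall x, f x <= g x} ->
  \int[mu]_x f x <= \int[mu]_x g x.
Proof.
move=> fi gi fg; rewrite -subr_ge0 -RintegralB//.
have mf : measurable_fun setT f by move/measurable_int/measurable_EFinP : fi.
have mg : measurable_fun setT g by move/measurable_int/measurable_EFinP : gi.
rewrite (@ae_RintegralE _ (fun x => Num.max 0 (g x - f x))).
- by apply: Rintegral_ge0 => x _; rewrite le_max lexx.
- exact: measurable_funB.
- by apply: measurable_maxr => //; exact: measurable_funB.
- by apply: filterS fg => x h; apply/esym/max_idPr; rewrite subr_ge0.
Qed.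

Lemma fin_ae_bounded (g : T -> \bar R) : measurable_fun setT g ->
  (forall x, 0 <= g x)%E -> (\int[mu]_x g x < +oo)%E -> {ae mu, forall x, (g x < +oo)%E}.
Proof.
move=> mg g0 h.
have gi : mu.-integrable setT g.
  apply/integrableP; split => //.
  by under eq_integral do rewrite gee0_abs//.
by apply: filterS (integrable_ae measurableT gi) => x /(_ I); rewrite ge0_fin_numE.
Qed.

End integrable_lemmas.

Lemma measurable_norm_powR {R : realType} {d} {T : measurableType d} (p : R) (f : T -> R) :
  measurable_fun setT f -> measurable_fun setT (fun x => `|f x| `^ p).
Proof.
by move=> mf; apply: measurableT_comp (measurable_powR _) _; exact: measurableT_comp.
Qed.

Lemma measurable_spow {R : realType} {d} {T : measurableType d} (p : R) (f : T -> R) :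
  measurable_fun setT f -> measurable_fun setT (fun x => spow p (f x)).
Proof. by move=> mf; apply: measurable_funM => //; exact: measurable_norm_powR. Qed.

Lemma spow_mul {R : realType} (r a : R) : 1 <= r ->
  spow (2 * r - 1) a * a = `|a| `^ (2 * r).
Proof.
move=> r1; rewrite -spow_sqr// /spow (_ : 2 * r - 1 - 1 = 2 * r - 2); last by ring.
by rewrite -powR_sqr_sub1; ring.
Qed.

Section subprobability.
Context {R : realType} {d} {T : measurableType d} (mu : {measure set T -> \bar R}).
Hypothesis mu1 : (mu setT <= 1)%E.
Implicit Types f g : T -> R.

Lemma subprob_cst (c : R) : mu.-integrable setT (EFin \o cst c).
Proof.
apply: (@measurable_bounded_integrable _ _ _ mu (cst c)) => //.
  by rewrite (le_lt_trans mu1)// ltry.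
by exists `|c|; split; [exact: num_real|move=> y cy x _ /=; exact: ltW].
Qed.

Lemma subprob_fin : mu setT \is a fin_num.
Proof. by rewrite ge0_fin_numE// (le_lt_trans mu1)// ltry. Qed.

Lemma subprob_fine_le1 : fine (mu setT) <= 1.
Proof. by rewrite -lee_fin fineK// subprob_fin. Qed.

Lemma subprob_Rintegral_cst c : \int[mu]_x c = c * fine (mu setT).
Proof. exact: Rintegral_cst. Qed.

Lemma subprob_integrable_pow r f : 1 <= r -> measurable_fun setT f ->
  (\int[mu]_x (`|f x| `^ r)%:E < +oo)%E -> mu.-integrable setT (EFin \o f).
Proof.
move=> r1 mf h; apply: (@integrable_dom _ _ _ _ _ (fun x => 1 + `|f x| `^ r)) => //.
  move=> x; have := @mul_powR_le R r `|f x| 1 r1 (normr_ge0 _) ler01.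
  by rewrite !powR1 mulr1 addrC.
apply: integrable_addf; first exact: subprob_cst.
apply/integrable_ge0P => //.
  by apply: measurableT_comp (measurable_powR _) _; exact: measurableT_comp.
Qed.

(** The tangent inequality at c, the integral of |f|, is integrated. Mass q below 1 does no harm:
    the constant term is (r - 1) c^r q, at most (r - 1) c^r. *)
Lemma subprob_jensen r f : 1 <= r -> measurable_fun setT f ->
  ((`|\int[mu]_x f x| `^ r)%:E <= \int[mu]_x (`|f x| `^ r)%:E)%E.
Proof.
move=> r1 mf.
have mpow : measurable_fun setT (fun x => `|f x| `^ r).
  by apply: measurableT_comp (measurable_powR _) _; exact: measurableT_comp.
have [->|/eqP] := pselect ((\int[mu]_x (`|f x| `^ r)%:E = +oo)%E); first by rewrite leey.
rewrite -ltey => h.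
have fi := subprob_integrable_pow r1 mf h.
have nfi : mu.-integrable setT (EFin \o (fun x => `|f x|)) by exact: integrable_norm.
have pfi : mu.-integrable setT (EFin \o (fun x => `|f x| `^ r)).
  exact/integrable_ge0P.
rewrite -(fineK_integral pfi) lee_fin.
set c := \int[mu]_x `|f x|.
have c0 : 0 <= c by exact: Rintegral_ge0.
apply: (@le_trans _ _ (c `^ r)).
  apply: ge0_ler_powR; rewrite ?nnegrE ?(le_trans _ r1)//.
  exact: le_normr_Rintegral.
set q := fine (mu setT).
have q1 : q <= 1 := subprob_fine_le1.
have : \int[mu]_x (r * c `^ (r - 1) * `|f x|) <= \int[mu]_x (`|f x| `^ r + (r - 1) * c `^ r).
  apply: le_Rintegral => //.
  - exact: integrable_scalef.
  - by apply: integrable_addf => //; exact: subprob_cst.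
  - move=> x _; have := powR_tangent r1 (normr_ge0 (f x)) c0.
    by rewrite !mulr_powRB1_ge0.
rewrite RintegralZl// RintegralDf//; last exact: subprob_cst.
rewrite subprob_Rintegral_cst -/c -/q.
rewrite -mulrA (mulrC _ c) mulr_powRB1_ge0// => H.
have : (r - 1) * c `^ r * q <= (r - 1) * c `^ r.
  by rewrite ler_piMr// mulr_ge0 ?powR_ge0// subr_ge0.
move: H; rewrite !mulrBl !mul1r; lra.
Qed.

(** [spow_bregman] at the mean a, integrated; the linear term collapses because the integral of v is
    a. For a probability measure the left side is the integral of (spow r v - spow r a)^2. *)
Lemma subprob_spow_variance (r : R) (v : T -> R) : 1 <= r -> measurable_fun setT v ->
  (\int[mu]_x (`|v x| `^ (2 * r))%:E < +oo)%E ->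
  spow r (\int[mu]_x v x) ^+ 2
    - 2 * spow r (\int[mu]_x v x) * \int[mu]_x spow r (v x)
    + \int[mu]_x (`|v x| `^ (2 * r)) <=
  2 * (\int[mu]_x (`|v x| `^ (2 * r)) - `|\int[mu]_x v x| `^ (2 * r)).
Proof.
move=> r1 mv h; have r21 : 1 <= 2 * r by lra.
have mpow : measurable_fun setT (fun x => `|v x| `^ (2 * r)).
  by apply: measurableT_comp (measurable_powR _) _; exact: measurableT_comp.
have vi := subprob_integrable_pow r21 mv h.
have pvi : mu.-integrable setT (EFin \o (fun x => `|v x| `^ (2 * r))).
  exact/integrable_ge0P.
have msv : measurable_fun setT (fun x => spow r (v x)).
  apply: measurable_funM => //.
  by apply: measurableT_comp (measurable_powR _) _; exact: measurableT_comp.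
have svi : mu.-integrable setT (EFin \o (fun x => spow r (v x))).
  apply: (@subprob_integrable_pow 2); [lra|exact: msv|].
  rewrite (_ : (fun x => _) = (fun x => (`|v x| `^ (2 * r))%:E))//.
  by apply/funext => x; rewrite norm_spow// -powRrM mulrC.
set a := \int[mu]_x v x; set q := fine (mu setT).
have q1 : q <= 1 := subprob_fine_le1.
have : 0 <= \int[mu]_x (`|v x| `^ (2 * r) + (2 * (2 * r - 1) * `|a| `^ (2 * r) - spow r a ^+ 2
   + (- (4 * r * spow (2 * r - 1) a) * v x + 2 * spow r a * spow r (v x)))).
  apply: Rintegral_ge0 => x _.
  have := spow_bregman a (v x) r1; rewrite sqrrB (spow_sqr (v x) r1); lra.
have i1 := integrable_scalef (- (4 * r * spow (2 * r - 1) a)) vi.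
have i2 := integrable_scalef (2 * spow r a) svi.
rewrite RintegralDf//; last first.
  by apply: integrable_addf; [exact: subprob_cst|exact: integrable_addf].
rewrite RintegralDf//; [|exact: subprob_cst|exact: integrable_addf].
rewrite subprob_Rintegral_cst RintegralDf// !RintegralZl// -/a -/q.
have e : spow (2 * r - 1) a * a = `|a| `^ (2 * r).
  exact: spow_mul.
rewrite spow_sqr//.
(* The constants under the integral amount to 2 (2r - 1) - 1 = 4r - 3 times |a|^(2r); this is where
   the missing mass is discarded. *)
have : (4 * r - 3) * `|a| `^ (2 * r) * q <= (4 * r - 3) * `|a| `^ (2 * r).
  by rewrite ler_piMr// mulr_ge0 ?powR_ge0//; lra.
have -> : - (4 * r * spow (2 * r - 1) a) * a = - (4 * r * `|a| `^ (2 * r)).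
  by rewrite -e; ring.
rewrite !mulrBl; lra.
Qed.

End subprobability.

Section integral_mixture.
Context {R : realType} {d d'} {Y : measurableType d} {Z : measurableType d'}.
Variables (mu : {measure set Y -> \bar R}) (kappa : Y -> {measure set Z -> \bar R})
  (nu : {measure set Z -> \bar R}).
Hypothesis mkappa : forall B, measurable B -> measurable_fun setT (kappa ^~ B).
Hypothesis nuE : forall B, measurable B -> nu B = (\int[mu]_y kappa y B)%E.
Import HBNNSimple.

Let mixture_nnsfun (f : {nnsfun Z >-> R}) :
  (\int[nu]_z (f z)%:E = \int[mu]_y \int[kappa y]_z (f z)%:E)%E.
Proof.
under [in LHS]eq_integral do rewrite fimfunE -fsumEFin//.
rewrite ge0_integral_fsum//; last 2 first.
  - by move=> r; exact/measurable_EFinP/measurableT_comp.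
  - by move=> r z _; rewrite EFinM nnfun_muleindic_ge0.
under [in RHS]eq_integral.
  move=> y _.
  under eq_integral.
    by move=> z _; rewrite fimfunE -fsumEFin//; over.
  rewrite /= ge0_integral_fsum//; last 2 first.
    - by move=> r; exact/measurable_EFinP/measurableT_comp.
    - by move=> r z _; rewrite EFinM nnfun_muleindic_ge0.
  under eq_fsbigr.
    move=> r _.
    rewrite (integralZl_indic _ (fun r => f @^-1` [set r]))//; last first.
      by move=> r0; rewrite preimage_nnfun0.
    rewrite integral_indic// setIT.
    over.
  over.
rewrite /= ge0_integral_fsum//; last 2 first.
  - by move=> r; apply: measurable_funeM; exact: mkappa.
  - move=> n y _.
    have := mulemu_ge0 (fun n => f @^-1` [set n]).
    by apply; exact: preimage_nnfun0.
apply: eq_fsbigr => r _.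
rewrite (integralZl_indic _ (fun r => f @^-1` [set r]))//; last first.
  exact: preimage_nnfun0.
rewrite /= integral_indic// setIT nuE//.
have [r0|r0] := leP 0 r; first by rewrite ge0_integralZl//; exact: mkappa.
rewrite !integral0_eq ?mule0//.
  by move=> y _; rewrite preimage_nnfun0// measure0 mule0.
by move=> y _; rewrite preimage_nnfun0// measure0.
Qed.

(** Tonelli for a measure given as a mixture of kernels, by approximation with simple functions. It
    serves Chapman-Kolmogorov, the passage from E_x g(X_t) to the transition measure, restrictions
    of measures, and the disintegration of J. *)
Lemma integral_mixture (f : Z -> \bar R) : measurable_fun setT f ->
  (forall z, 0 <= f z)%E -> (\int[nu]_z f z = \int[mu]_y \int[kappa y]_z f z)%E.
Proof.
move=> mf f0.
pose f_ := nnsfun_approx measurableT mf.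
transitivity (\int[nu]_z (lim ((f_ n z)%:E @[n --> \oo])))%E.
  by apply/eq_integral => z _; apply/esym/cvg_lim => //=; exact: cvg_nnsfun_approx.
rewrite monotone_convergence//; last 3 first.
  by move=> n; exact/measurable_EFinP.
  by move=> n z _; rewrite lee_fin.
  by move=> z _ a b ab; rewrite lee_fin; exact/lefP/nd_nnsfun_approx.
rewrite (_ : (fun _ => _) =
    (fun n => \int[mu]_y (\int[kappa y]_z (f_ n z)%:E)))%E//; last first.
  by apply/funext => n; rewrite mixture_nnsfun.
transitivity (\int[mu]_y lim ((\int[kappa y]_z (f_ n z)%:E) @[n --> \oo]))%E.
  rewrite -monotone_convergence//; last 3 first.
  - move=> n; apply: measurable_fun_integral_kernel => //.
    + by move=> z; rewrite lee_fin.
    + exact/measurable_EFinP.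
  - by move=> n y _; apply: integral_ge0 => // z _; rewrite lee_fin.
  - move=> y _ a b ab; apply: ge0_le_integral => //.
    + by move=> z _; rewrite lee_fin.
    + exact/measurable_EFinP.
    + exact/measurable_EFinP.
    + by move=> z _; rewrite lee_fin; exact/lefP/nd_nnsfun_approx.
apply: eq_integral => y _; rewrite -monotone_convergence//; last 3 first.
  - by move=> n; exact/measurable_EFinP.
  - by move=> n z _; rewrite lee_fin.
  - by move=> z _ a b ab; rewrite lee_fin; exact/lefP/nd_nnsfun_approx.
by apply: eq_integral => z _; apply/cvg_lim => //; exact: cvg_nnsfun_approx.
Qed.

End integral_mixture.

Lemma measurable_Rintegral_kernel {R : realType} {d d'} {X : measurableType d}
    {Y : measurableType d'} (l : R.-sfker X ~> Y) (f : X * Y -> R) :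
  measurable_fun setT f -> measurable_fun setT (fun x => \int[l x]_y f (x, y)).
Proof.
move=> mf; apply: measurableT_comp; first exact: fine_measurable.
under eq_fun do rewrite integralE.
have mF : measurable_fun setT (EFin \o f) by exact/measurable_EFinP.
apply: emeasurable_funB.
  have := measurable_fun_integral_sfinite_kernel ((EFin \o f)^\+)%E l
    (funepos_ge0 _) (measurable_funepos mF).
  by apply: eq_measurable_fun => x _; apply: eq_integral => y _; rewrite !funeposE.
have := measurable_fun_integral_sfinite_kernel ((EFin \o f)^\-)%E l
  (funeneg_ge0 _) (measurable_funeneg mF).
by apply: eq_measurable_fun => x _; apply: eq_integral => y _; rewrite !funenegE.
Qed.

Section semigroup_operators.
Context {R : realType} {d} {T : measurableType d}.
Variables (m : {measure set T -> \bar R}) (k : R.-spker (measurableTypeR R * T) ~> T).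
Implicit Types (t s : R) (f u v w : T -> R) (g : T -> \bar R).

(** Two versions of one operator: [Pe] acts on functions with values in [0, +oo], [Pr] on real
    functions, with the junk value 0 where the integral is infinite. Time is a variable of the
    kernel, so that everything is jointly measurable in (t, x) and Tonelli in time applies. *)
Definition Pe t g x : \bar R := (\int[k (t, x)]_y g y)%E.
Definition Pr t f x : R := \int[k (t, x)]_y f y.

Lemma PrE t f x : Pr t f x = \int[k (t, x)]_y f y. Proof. by []. Qed.

Lemma Pe_def t g x : Pe t g x = (\int[k (t, x)]_y g y)%E. Proof. by []. Qed.

Record symmetric_semigroup : Prop := {
  chapman_kolmogorov : forall s t x B, 0 < s -> 0 < t -> measurable B ->
    k (s + t, x) B = (\int[k (s, x)]_y k (t, y) B)%E;
  Pe_sym : forall t (f g : T -> \bar R), 0 < t -> measurable_fun setT f -> measurable_fun setT g ->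
    (forall x, 0 <= f x)%E -> (forall x, 0 <= g x)%E ->
    (\int[m]_x (f x * Pe t g x) = \int[m]_x (Pe t f x * g x))%E
}.

Hypothesis sg : symmetric_semigroup.

Lemma k_le1 z : (k z setT <= 1)%E.
Proof. exact: sprob_kernel_le1. Qed.

Lemma measurable_time_pair t : measurable_fun setT (fun x : T => (t : measurableTypeR R, x)).
Proof. exact: measurable_pair1. Qed.

Lemma measurable_k t B : measurable B -> measurable_fun setT (fun x => k (t, x) B).
Proof.
move=> mB; have := measurableT_comp (measurable_kernel k _ mB) (measurable_time_pair t).
exact.
Qed.

Lemma measurable_Pe_joint (g : measurableTypeR R * T -> \bar R) :
  measurable_fun setT g -> (forall z, 0 <= g z)%E ->
  measurable_fun setT (fun z : measurableTypeR R * T => Pe z.1 (fun y => g (z.1, y)) z.2).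
Proof.
move=> mg g0.
pose G (w : (measurableTypeR R * T) * T) := g (w.1.1, w.2).
have mG : measurable_fun setT G.
  apply: (measurableT_comp mg).
  apply/measurable_fun_pairP; split => /=; last exact: measurable_snd.
  exact: measurableT_comp measurable_fst measurable_fst.
have := measurable_fun_integral_sfinite_kernel G k (fun z => g0 (z.1.1, z.2)) mG.
by rewrite (_ : (fun z => _) = (fun z : measurableTypeR R * T => Pe z.1 (fun y => g (z.1, y)) z.2))//;
  apply/funext => -[].
Qed.

Lemma measurable_Pe_joint_cst (g : T -> \bar R) :
  measurable_fun setT g -> (forall z, 0 <= g z)%E ->
  measurable_fun setT (fun z : measurableTypeR R * T => Pe z.1 g z.2).
Proof.
move=> mg g0; apply: (@measurable_Pe_joint (g \o snd)).
  exact: measurableT_comp mg measurable_snd.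
by move=> z; exact: g0.
Qed.

Lemma measurable_Pe t g : measurable_fun setT g -> (forall z, 0 <= g z)%E ->
  measurable_fun setT (Pe t g).
Proof.
by move=> mg g0; exact: measurableT_comp (measurable_Pe_joint_cst mg g0) (measurable_time_pair t).
Qed.

Lemma Pe_ge0 t g x : (forall z, 0 <= g z)%E -> (0 <= Pe t g x)%E.
Proof. by move=> g0; exact: integral_ge0. Qed.

Lemma measurable_Pr_joint f : measurable_fun setT f ->
  measurable_fun setT (fun z : measurableTypeR R * T => Pr z.1 f z.2).
Proof.
move=> mf.
have := @measurable_Rintegral_kernel _ _ _ _ _ k (f \o snd) (measurableT_comp mf measurable_snd).
by rewrite (_ : (fun z => _) = (fun z : measurableTypeR R * T => Pr z.1 f z.2))//;
  apply/funext => -[].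
Qed.

Lemma measurable_Pr t f : measurable_fun setT f -> measurable_fun setT (Pr t f).
Proof.
by move=> mf; exact: measurableT_comp (measurable_Pr_joint mf) (measurable_time_pair t).
Qed.

Lemma PeD s t g x : 0 < s -> 0 < t -> measurable_fun setT g -> (forall z, 0 <= g z)%E ->
  Pe (s + t) g x = Pe s (Pe t g) x.
Proof.
move=> s0 t0 mg g0; apply: (@integral_mixture _ _ _ _ _ (k (s, x)) (fun y => k (t, y))) => //.
  by move=> B mB; exact: measurable_k.
by move=> B mB; exact: chapman_kolmogorov.
Qed.

Lemma Pe_le t g g' x : measurable_fun setT g -> measurable_fun setT g' ->
  (forall z, 0 <= g z)%E -> (forall z, g z <= g' z)%E -> (Pe t g x <= Pe t g' x)%E.
Proof.
move=> mg mg' g0 gg'; apply: ge0_le_integral => //.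
Qed.

(** Symmetry against the constant 1 turns the integral of P_t g into that of (P_t 1) g, and P_t 1 is
    at most 1. *)
Lemma integral_Pe_le t g : 0 < t -> measurable_fun setT g -> (forall z, 0 <= g z)%E ->
  (\int[m]_x Pe t g x <= \int[m]_x g x)%E.
Proof.
move=> t0 mg g0.
have := @Pe_sym sg t (cst 1%E) g t0 (measurable_cst _) mg (fun=> lee01) g0.
under eq_integral do rewrite mul1e; move=> ->.
apply: ge0_le_integral => //.
- by move=> x _; rewrite mule_ge0// Pe_ge0// => z; rewrite lee01.
- apply: emeasurable_funM => //; exact: measurable_Pe (measurable_cst _) (fun=> lee01).
- by move=> x _; rewrite -[leRHS]mul1e lee_wpmul2r// /Pe integral_cst// mul1e k_le1.
Qed.

Lemma Pe_ae0 t g : 0 < t -> measurable_fun setT g -> (forall z, 0 <= g z)%E ->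
  {ae m, forall x, g x = 0%E} -> {ae m, forall x, Pe t g x = 0%E}.
Proof.
move=> t0 mg g0 gz.
have i0 : (\int[m]_x g x = 0)%E.
  rewrite (@ge0_ae_eq_integral _ _ _ m setT g (cst 0%E)) ?integral0//.
  by apply: filterS gz => x /= ->.
have : (\int[m]_x `|Pe t g x| = 0)%E.
  under eq_integral do rewrite gee0_abs ?Pe_ge0//.
  by apply/eqP; rewrite eq_le integral_ge0 ?andbT; [rewrite -i0 integral_Pe_le//|move=> x _; rewrite Pe_ge0].
have mP := measurable_Pe t mg g0.
move/(ae_eq_integral_abs m measurableT mP).
by apply: filterS => x /= /(_ I).
Qed.

Lemma Pe_ae_null t (Q : T -> Prop) : 0 < t -> {ae m, forall x, Q x} ->
  {ae m, forall x, {ae k (t, x), forall y, Q y}}.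
Proof.
move=> t0 [N [mN mN0 QN]].
have : {ae m, forall x, Pe t (fun y => (\1_N y)%:E) x = 0%E}.
  apply: Pe_ae0 => //.
  - exact/measurable_EFinP.
  exists N; split => // x /= Nx; apply: contrapT => xN; apply: Nx.
    by rewrite indicE memNset.
apply: filterS => x; rewrite /Pe integral_indic// setIT => kN.
by exists N; split.
Qed.

End semigroup_operators.

Local Opaque Rintegral integral Pr Pe.

Lemma le_intT {R : realType} {d} {T : measurableType d} (mu : {measure set T -> \bar R})
  (f g : T -> \bar R) : (forall x, 0 <= f x)%E -> measurable_fun setT f ->
  measurable_fun setT g -> (forall x, f x <= g x)%E -> (\int[mu]_x f x <= \int[mu]_x g x)%E.
Proof. by move=> f0 mf mg fg; exact: ge0_le_integral. Qed.

Lemma measurable_abse_EFin {R : realType} {d} {T : measurableType d} (h : T -> R) :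
  measurable_fun setT h -> measurable_fun setT (fun y => `|h y|%:E).
Proof. by move=> mh; apply/measurable_EFinP; exact: measurableT_comp. Qed.

Section Lp.
Context {R : realType} {d} {T : measurableType d} (mu : {measure set T -> \bar R}).
Implicit Types (p : R) (f : T -> R).

(** The p-th power of the norm, so that no root appears before the final statements. *)
Definition Np p f : \bar R := (\int[mu]_x (`|f x| `^ p)%:E)%E.

Lemma Np_def p f : Np p f = (\int[mu]_x (`|f x| `^ p)%:E)%E. Proof. by []. Qed.

Record Lp p f : Prop := {
  Lp_meas : measurable_fun setT f;
  Lp_fin : (Np p f < +oo)%E }.

Lemma Lp_integrable p f : Lp p f -> mu.-integrable setT (EFin \o (fun x => `|f x| `^ p)).
Proof. by move=> [mf h]; apply/integrable_ge0P => //; exact: measurable_norm_powR. Qed.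

Lemma Np_ge0 p f : (0 <= Np p f)%E.
Proof. by apply: integral_ge0 => x _; rewrite lee_fin powR_ge0. Qed.

Lemma Lp_dom p f g : Lp p g -> measurable_fun setT f -> 0 <= p ->
  (forall x, `|f x| <= `|g x|) -> Lp p f.
Proof.
move=> [mg hg] mf p0 fg; split; first exact: mf.
apply: le_lt_trans hg.
apply: le_intT.
- by move=> x; rewrite lee_fin powR_ge0.
- exact/measurable_EFinP/measurable_norm_powR.
- exact/measurable_EFinP/measurable_norm_powR.
- by move=> x; rewrite lee_fin ge0_ler_powR// ?nnegrE.
Qed.

Lemma Np_le p (f g : T -> R) : measurable_fun setT g -> measurable_fun setT f -> 0 <= p ->
  (forall x, `|f x| <= `|g x|) -> (Np p f <= Np p g)%E.
Proof.
move=> mg mf p0 fg; apply: le_intT.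
- by move=> x; rewrite lee_fin powR_ge0.
- exact/measurable_EFinP/measurable_norm_powR.
- exact/measurable_EFinP/measurable_norm_powR.
- by move=> x; rewrite lee_fin ge0_ler_powR// ?nnegrE.
Qed.

Lemma powR2 (x : R) : `|x| `^ 2 = x ^+ 2.
Proof. by rewrite powR_mulrn// real_normK ?num_real. Qed.

Lemma Lp2P f : Lp 2 f <-> measurable_fun setT f /\ mu.-integrable setT (EFin \o (fun x => f x ^+ 2)).
Proof.
split=> [Lf|[mf fi]].
  split; first by case: Lf.
  by have := Lp_integrable Lf; apply: eq_integrable => // x _ /=; rewrite powR2.
split=> //; rewrite /Np; under eq_integral do rewrite powR2.
by apply/integrable_ge0P => //; [exact: measurable_funX|move=> x; exact: sqr_ge0].
Qed.

Lemma Lp2_mul f g : Lp 2 f -> Lp 2 g -> mu.-integrable setT (EFin \o (fun x => f x * g x)).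
Proof.
move=> /Lp2P[mf fi] /Lp2P[mg gi].
apply: (@integrable_dom _ _ _ _ _ (fun x => f x ^+ 2 + g x ^+ 2)).
- exact: measurable_funM.
- move=> x; rewrite ler_norml; apply/andP.
  have := sqr_ge0 (f x + g x); have := sqr_ge0 (f x - g x).
  have := sqr_ge0 (f x); have := sqr_ge0 (g x); rewrite sqrrB sqrrD; split; lra.
- exact: integrable_addf.
Qed.

Lemma Lp2_add c f g : Lp 2 f -> Lp 2 g -> Lp 2 (fun x => c * f x + g x).
Proof.
move=> Lf Lg; apply/Lp2P; have /Lp2P[mf fi] := Lf; have /Lp2P[mg gi] := Lg; split.
  by apply: measurable_funD => //; exact: measurable_funM.
rewrite (_ : (fun x => _) = (fun x => c ^+ 2 * f x ^+ 2 + (2 * c * (f x * g x) + g x ^+ 2))).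
  apply: integrable_addf; first exact: integrable_scalef.
  by apply: integrable_addf => //; apply: integrable_scalef; exact: Lp2_mul.
by apply/funext => x; ring.
Qed.

Lemma spow_Lp2 r f : 1 <= r -> Lp (2 * r) f -> Lp 2 (fun x => spow r (f x)).
Proof.
move=> r1 Lf; have mf := Lp_meas Lf; apply/Lp2P; split; first exact: measurable_spow.
have := Lp_integrable Lf; apply: eq_integrable => // x _ /=; by rewrite spow_sqr.
Qed.

End Lp.

Local Opaque Np powR spow.

Section semigroup_Lp.
Context {R : realType} {d} {T : measurableType d}.
Variables (m : {measure set T -> \bar R}) (k : R.-spker (measurableTypeR R * T) ~> T).
Hypothesis sg : symmetric_semigroup m k.
Implicit Types (t s p : R) (f u v w : T -> R) (g : T -> \bar R).
Local Notation Pe := (Pe k).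
Local Notation Pr := (Pr k).

Lemma PeE t f x : (forall y, 0 <= f y) -> (Pe t (EFin \o f) x < +oo)%E ->
  (Pr t f x)%:E = Pe t (EFin \o f) x.
Proof.
move=> f0; rewrite Pe_def PrE => h; apply: fineK.
by rewrite ge0_fin_numE// integral_ge0// => y _; rewrite lee_fin.
Qed.

Lemma Lp_Pe_ae t p f : 0 < t -> Lp m p f ->
  {ae m, forall x, (Pe t (fun y => (`|f y| `^ p)%:E) x < +oo)%E}.
Proof.
move=> t0 [mf h]; have mp : measurable_fun setT (fun y => (`|f y| `^ p)%:E).
  exact/measurable_EFinP/measurable_norm_powR.
have p0 y : (0 <= (`|f y| `^ p)%:E)%E by rewrite lee_fin powR_ge0.
apply: fin_ae_bounded.
- exact: measurable_Pe.
- by move=> x; exact: Pe_ge0.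
- by apply: le_lt_trans h; exact: integral_Pe_le.
Qed.

Lemma Lp_ae_integrable t p f : 0 < t -> 1 <= p -> Lp m p f ->
  {ae m, forall x, (k (t, x)).-integrable setT (EFin \o f)}.
Proof.
move=> t0 p1 Lf; apply: filterS (Lp_Pe_ae t0 Lf) => x /=.
by apply: (subprob_integrable_pow (k_le1 k _)) => //; case: Lf.
Qed.

Lemma Pr_jensen t p f x : 1 <= p -> measurable_fun setT f ->
  ((`|Pr t f x| `^ p)%:E <= Pe t (fun y => (`|f y| `^ p)%:E) x)%E.
Proof. by move=> p1 mf; exact: (subprob_jensen (k_le1 k _)). Qed.

Lemma Np_Pr t p f : 0 < t -> 1 <= p -> measurable_fun setT f -> (Np m p (Pr t f) <= Np m p f)%E.
Proof.
move=> t0 p1 mf.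
have mp : measurable_fun setT (fun y => (`|f y| `^ p)%:E).
  exact/measurable_EFinP/measurable_norm_powR.
have p0 y : (0 <= (`|f y| `^ p)%:E)%E by rewrite lee_fin powR_ge0.
apply: le_trans (integral_Pe_le sg t0 mp p0).
apply: le_intT.
- by move=> x; rewrite lee_fin powR_ge0.
- by apply/measurable_EFinP/measurable_norm_powR; exact: measurable_Pr.
- exact: measurable_Pe.
- by move=> x; exact: Pr_jensen.
Qed.

Lemma Lp_Pr t p f : 0 < t -> 1 <= p -> Lp m p f -> Lp m p (Pr t f).
Proof.
move=> t0 p1 [mf h]; split; first exact: measurable_Pr.
exact: le_lt_trans (Np_Pr t0 p1 mf) h.
Qed.

Definition rpos f x : R := Num.max (f x) 0.
Definition rneg f x : R := Num.max (- f x) 0.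

Lemma rposneg f x : f x = rpos f x - rneg f x.
Proof. by rewrite /rpos /rneg; case: (lerP 0 (f x)) => h; case: (lerP 0 (- f x)) => h'; lra. Qed.
Lemma rpos_ge0 f x : 0 <= rpos f x. Proof. by rewrite le_max lexx orbT. Qed.
Lemma rneg_ge0 f x : 0 <= rneg f x. Proof. by rewrite le_max lexx orbT. Qed.
Lemma rpos_le f x : rpos f x <= `|f x|.
Proof. by rewrite ge_max ler_norm normr_ge0. Qed.
Lemma rneg_le f x : rneg f x <= `|f x|.
Proof. by rewrite ge_max -normrN ler_norm normr_ge0. Qed.
Lemma measurable_rpos f : measurable_fun setT f -> measurable_fun setT (rpos f).
Proof. by move=> mf; exact: measurable_maxr. Qed.
Lemma measurable_rneg f : measurable_fun setT f -> measurable_fun setT (rneg f).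
Proof. by move=> mf; apply: measurable_maxr => //; exact: measurableT_comp. Qed.

Lemma integrable_rpos (mu : {measure set T -> \bar R}) f : mu.-integrable setT (EFin \o f) ->
  mu.-integrable setT (EFin \o rpos f).
Proof.
move=> fi; apply: (@integrable_dom _ _ _ _ _ (fun x => `|f x|)).
- by apply: measurable_rpos; move/measurable_int/measurable_EFinP : fi.
- by move=> x; rewrite ger0_norm ?rpos_ge0// rpos_le.
- exact: integrable_norm.
Qed.

Lemma integrable_rneg (mu : {measure set T -> \bar R}) f : mu.-integrable setT (EFin \o f) ->
  mu.-integrable setT (EFin \o rneg f).
Proof.
move=> fi; apply: (@integrable_dom _ _ _ _ _ (fun x => `|f x|)).
- by apply: measurable_rneg; move/measurable_int/measurable_EFinP : fi.
- by move=> x; rewrite ger0_norm ?rneg_ge0// rneg_le.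
- exact: integrable_norm.
Qed.

Lemma Pr_rposneg t f x : (k (t, x)).-integrable setT (EFin \o f) ->
  Pr t f x = Pr t (rpos f) x - Pr t (rneg f) x.
Proof.
move=> fi; rewrite !PrE -RintegralB//; [|exact: integrable_rpos|exact: integrable_rneg].
by apply: eq_Rintegral => y _; exact: rposneg.
Qed.

Lemma PrD_pt s t f x : 0 < s -> 0 < t -> measurable_fun setT f ->
  (k (s + t, x)).-integrable setT (EFin \o f) ->
  Pr (s + t) f x = Pr s (Pr t f) x.
Proof.
move=> s0 t0 mf.
have ge0_case (h : T -> R) : measurable_fun setT h -> (forall y, 0 <= h y) ->
    (k (s + t, x)).-integrable setT (EFin \o h) ->
    [/\ Pr (s + t) h x = Pr s (Pr t h) x,
     {ae k (s, x), forall y, (Pe t (EFin \o h) y < +oo)%E} &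
     (k (s, x)).-integrable setT (EFin \o Pr t h)].
  move=> mh h0 hi.
  have mh' : measurable_fun setT (EFin \o h) by exact/measurable_EFinP.
  have h0' y : (0 <= (EFin \o h) y)%E by rewrite lee_fin.
  have fin : (Pe s (Pe t (EFin \o h)) x < +oo)%E.
    by rewrite -(PeD sg x s0 t0 mh' h0'); exact/integrable_ge0P.
  have mPh := measurable_Pe k t mh' h0'.
  have ae1 : {ae k (s, x), forall y, (Pe t (EFin \o h) y < +oo)%E}.
    by apply: fin_ae_bounded => //; move=> y; exact: Pe_ge0.
  have ae2 : {ae k (s, x), forall y, (Pr t h y)%:E = Pe t (EFin \o h) y}.
    by apply: filterS ae1 => y; exact: PeE.
  have mPr := measurable_Pr k t mh.
  have i1 : (\int[k (s, x)]_y (Pr t h y)%:E = Pe s (Pe t (EFin \o h)) x)%E.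
    apply: ge0_ae_eq_integral => //.
    - exact/measurable_EFinP.
    - by move=> y _; rewrite lee_fin Rintegral_ge0.
    - by move=> y _; exact: Pe_ge0.
    - by apply: filterS ae2 => y ->.
  split => //.
    by congr fine; rewrite i1 -(PeD sg x s0 t0 mh' h0').
  apply/integrable_ge0P => //; last by rewrite i1.
  by move=> y; exact: Rintegral_ge0.
move=> fi.
have [e1 a1 j1] := ge0_case _ (measurable_rpos mf) (@rpos_ge0 f) (integrable_rpos fi).
have [e2 a2 j2] := ge0_case _ (measurable_rneg mf) (@rneg_ge0 f) (integrable_rneg fi).
rewrite (Pr_rposneg fi) e1 e2 [X in X - _]PrE [X in _ - X]PrE [RHS]PrE -(RintegralB measurableT j1 j2).
apply: ae_RintegralE.
- apply: measurable_funB; apply: measurable_Pr; [exact: measurable_rpos|exact: measurable_rneg].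
- exact: measurable_Pr.
- near=> y; rewrite [RHS]Pr_rposneg//.
  have h1 : (Pe t (EFin \o rpos f) y < +oo)%E by near: y.
  have h2 : (Pe t (EFin \o rneg f) y < +oo)%E by near: y.
  have k1 : (k (t, y)).-integrable setT (EFin \o rpos f).
    by apply/integrable_ge0P => //; [exact: measurable_rpos|exact: rpos_ge0].
  have k2 : (k (t, y)).-integrable setT (EFin \o rneg f).
    by apply/integrable_ge0P => //; [exact: measurable_rneg|exact: rneg_ge0].
  by apply: eq_integrable (integrable_subf k1 k2) => // z _ /=; rewrite -rposneg.
Unshelve. all: by end_near. Qed.

Lemma PrD p s t f : 0 < s -> 0 < t -> 1 <= p -> Lp m p f ->
  {ae m, forall x, Pr (s + t) f x = Pr s (Pr t f) x}.
Proof.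
move=> s0 t0 p1 Lf; have st0 : 0 < s + t by rewrite addr_gt0.
by apply: filterS (Lp_ae_integrable st0 p1 Lf) => x; apply: PrD_pt => //; case: Lf.
Qed.

(** Finiteness of the double integral of |u(x)| |v(y)| against P_t(x, dy) m(dx), which licenses the
    use of symmetry. The split into G1(x) + G2(y) covers pairs in L^2 as well as the dual pair u,
    [spow (2 * r - 1) u]. *)
Lemma cross_fin t u v (G1 G2 : T -> R) : 0 < t -> measurable_fun setT u -> measurable_fun setT v ->
  measurable_fun setT G1 -> measurable_fun setT G2 ->
  (forall x, 0 <= G1 x) -> (forall x, 0 <= G2 x) ->
  (forall x y, `|u x| * `|v y| <= G1 x + G2 y) ->
  (\int[m]_x (G1 x)%:E < +oo)%E -> (\int[m]_x (G2 x)%:E < +oo)%E ->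
  (\int[m]_x (`|u x|%:E * Pe t (fun y => `|v y|%:E) x) < +oo)%E.
Proof.
move=> t0 mu mv mG1 mG2 G10 G20 uv i1 i2.
have mG2' : measurable_fun setT (EFin \o G2) by exact/measurable_EFinP.
have G20' y : (0 <= (EFin \o G2) y)%E by rewrite lee_fin.
have mv' : measurable_fun setT (fun y => `|v y|%:E).
  by apply/measurable_EFinP; exact: measurableT_comp.
have mu' : measurable_fun setT (fun y => `|u y|%:E).
  by apply/measurable_EFinP; exact: measurableT_comp.
have v0 y : (0 <= `|v y|%:E)%E by rewrite lee_fin.
apply: (@le_lt_trans _ _ (\int[m]_x ((G1 x)%:E + Pe t (EFin \o G2) x))%E).
  apply: le_intT => [x|||x].
  - by rewrite mule_ge0// Pe_ge0.
  - by apply: emeasurable_funM => //; exact: measurable_Pe.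
  - by apply: emeasurable_funD; [exact/measurable_EFinP|exact: measurable_Pe].
  - rewrite !Pe_def -ge0_integralZl//.
    apply: (@le_trans _ _ (\int[k (t, x)]_y ((G1 x)%:E + (G2 y)%:E))%E).
      apply: le_intT => [y|||y].
      - by rewrite mule_ge0.
      - exact: emeasurable_funM.
      - exact: emeasurable_funD.
      - by rewrite -EFinM -EFinD lee_fin.
    rewrite ge0_integralD//; [|by move=> y _; rewrite lee_fin|by move=> y _; rewrite lee_fin].
    - rewrite leeD2r// integral_cst// -[leRHS]mule1 lee_wpmul2l// ?lee_fin//.
      exact: k_le1.
rewrite ge0_integralD//.
- by rewrite lte_add_pinfty//; exact: le_lt_trans (integral_Pe_le sg t0 mG2' G20') i2.
- by move=> x _; rewrite lee_fin.
- exact/measurable_EFinP.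
- by move=> x _; exact: Pe_ge0.
- exact: measurable_Pe.
Qed.

Lemma Pr_sym_ge0 t u v : 0 < t -> measurable_fun setT u -> measurable_fun setT v ->
  (forall x, 0 <= u x) -> (forall x, 0 <= v x) ->
  (\int[m]_x ((u x)%:E * Pe t (EFin \o v) x) < +oo)%E ->
  m.-integrable setT (EFin \o (fun x => u x * Pr t v x)) /\
  (\int[m]_x (u x * Pr t v x))%:E = (\int[m]_x ((u x)%:E * Pe t (EFin \o v) x))%E.
Proof.
move=> t0 mu mv u0 v0 fin.
have mv' : measurable_fun setT (EFin \o v) by exact/measurable_EFinP.
have v0' y : (0 <= (EFin \o v) y)%E by rewrite lee_fin.
have mu' : measurable_fun setT (EFin \o u) by exact/measurable_EFinP.
have ae1 : {ae m, forall x, ((u x)%:E * Pe t (EFin \o v) x < +oo)%E}.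
  apply: fin_ae_bounded => //.
  - by apply: emeasurable_funM => //; exact: measurable_Pe.
  - by move=> x; rewrite mule_ge0 ?lee_fin// Pe_ge0.
have i1 : (\int[m]_x (u x * Pr t v x)%:E = \int[m]_x ((u x)%:E * Pe t (EFin \o v) x))%E.
  apply: ge0_ae_eq_integral => //.
  - by apply/measurable_EFinP; apply: measurable_funM => //; exact: measurable_Pr.
  - by apply: emeasurable_funM => //; exact: measurable_Pe.
  - by move=> x _; rewrite lee_fin mulr_ge0// Rintegral_ge0.
  - by move=> x _; rewrite mule_ge0 ?lee_fin// Pe_ge0.
  apply: filterS ae1 => x /= h _; rewrite EFinM.
  have [->|ux] := eqVneq (u x) 0; first by rewrite !mul0e.
  congr (_ * _)%E; apply: PeE => //; move: h; rewrite ltNge leye_eq; apply: contraNT.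
  rewrite -leNgt leye_eq => /eqP ->; rewrite gt0_muley// lte_fin lt_neqAle eq_sym ux u0//.
have ii : m.-integrable setT (EFin \o (fun x => u x * Pr t v x)).
  apply/integrable_ge0P.
  - by apply: measurable_funM => //; exact: measurable_Pr.
  - by move=> x; rewrite mulr_ge0// Rintegral_ge0.
  - by rewrite i1.
by split => //; rewrite fineK_integral.
Qed.

(** Symmetry is available for nonnegative functions. The finite double integral makes the four
    products of positive and negative parts integrable, and the two mixed ones are exchanged. *)
Lemma Pr_sym t u v : 0 < t -> measurable_fun setT u -> measurable_fun setT v ->
  (\int[m]_x (`|u x|%:E * Pe t (fun y => `|v y|%:E) x) < +oo)%E ->
  [/\ m.-integrable setT (EFin \o (fun x => u x * Pr t v x)),
      m.-integrable setT (EFin \o (fun x => v x * Pr t u x)) &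
      \int[m]_x (u x * Pr t v x) = \int[m]_x (v x * Pr t u x)].
Proof.
move=> t0 mu mv fin.
have mabs := @measurable_abse_EFin R _ T.
have main (u' v' : T -> R) : measurable_fun setT u' -> measurable_fun setT v' ->
    (\int[m]_x (`|u' x|%:E * Pe t (fun y => `|v' y|%:E) x) < +oo)%E ->
    m.-integrable setT (EFin \o (fun x => u' x * Pr t v' x)) /\
    (\int[m]_x (u' x * Pr t v' x) =
     \int[m]_x (rpos u' x * Pr t (rpos v') x) - \int[m]_x (rpos u' x * Pr t (rneg v') x)
     - \int[m]_x (rneg u' x * Pr t (rpos v') x) + \int[m]_x (rneg u' x * Pr t (rneg v') x)).
  move=> mu' mv' fin'.
  have part (a b : T -> R) : measurable_fun setT a -> measurable_fun setT b -> (forall x, 0 <= a x) ->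
      (forall x, 0 <= b x) -> (forall x, a x <= `|u' x|) -> (forall x, b x <= `|v' x|) ->
      m.-integrable setT (EFin \o (fun x => a x * Pr t b x)).
    move=> ma mb a0 b0 au bv; apply: (proj1 (Pr_sym_ge0 t0 ma mb a0 b0 _)).
    have mb' : measurable_fun setT (EFin \o b) by exact/measurable_EFinP.
    apply: le_lt_trans fin'; apply: le_intT.
    - by move=> x; rewrite mule_ge0 ?lee_fin// Pe_ge0// => y; rewrite lee_fin.
    - apply: emeasurable_funM; first exact/measurable_EFinP.
      by apply: measurable_Pe => // y; rewrite lee_fin.
    - apply: emeasurable_funM; first exact: mabs.
      by apply: measurable_Pe => //; exact: mabs.
    - move=> x; apply: lee_pmul; rewrite ?lee_fin ?Pe_ge0//.
      by apply: Pe_le => //; exact: mabs.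
  have mp := measurable_rpos; have mn := measurable_rneg.
  have pp := part _ _ (mp _ mu') (mp _ mv') (@rpos_ge0 _) (@rpos_ge0 _) (@rpos_le _) (@rpos_le _).
  have pn := part _ _ (mp _ mu') (mn _ mv') (@rpos_ge0 _) (@rneg_ge0 _) (@rpos_le _) (@rneg_le _).
  have np := part _ _ (mn _ mu') (mp _ mv') (@rneg_ge0 _) (@rpos_ge0 _) (@rneg_le _) (@rpos_le _).
  have nn := part _ _ (mn _ mu') (mn _ mv') (@rneg_ge0 _) (@rneg_ge0 _) (@rneg_le _) (@rneg_le _).
  have ae0 : {ae m, forall x, (`|u' x|%:E * Pe t (fun y => `|v' y|%:E) x < +oo)%E}.
    apply: fin_ae_bounded => //.
      apply: emeasurable_funM; first exact: mabs.
      by apply: measurable_Pe => //; exact: mabs.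
    by move=> x; rewrite mule_ge0// Pe_ge0.
  have ae1 : {ae m, forall x, u' x * Pr t v' x =
     rpos u' x * Pr t (rpos v') x - rpos u' x * Pr t (rneg v') x
     - rneg u' x * Pr t (rpos v') x + rneg u' x * Pr t (rneg v') x}.
    apply: filterS ae0 => x h.
    have [ux|ux] := eqVneq (u' x) 0.
      by rewrite /rpos /rneg ux oppr0 maxxx !mul0r; ring.
    rewrite {1}(rposneg u') [Pr t v' x]Pr_rposneg; first by ring.
    apply/integrableP; split; first exact/measurable_EFinP.
    move: h; rewrite ltNge leye_eq Pe_def => h; rewrite ltNge leye_eq; apply: contraNN h.
    by move=> /eqP ->; rewrite gt0_muley// lte_fin normr_gt0.
  have i1 := integrable_subf pp pn.
  have i2 := integrable_subf i1 np.
  have i3 := integrable_addf i2 nn.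
  have mI : measurable_fun setT (fun x => u' x * Pr t v' x).
    by apply: measurable_funM => //; exact: measurable_Pr.
  have mJ := measurable_int _ i3; move/measurable_EFinP in mJ.
  split.
    apply: (integrable_ae_dom mI _ _ (integrable_norm i3)).
      exact: measurableT_comp.
    by apply: filterS ae1 => x -> /=.
  rewrite (ae_RintegralE mI mJ ae1) RintegralDf// RintegralB// RintegralB//.
have mabs0 (h : T -> R) y : (0 <= `|h y|%:E)%E by rewrite lee_fin.
have fin2 : (\int[m]_x (`|v x|%:E * Pe t (fun y => `|u y|%:E) x) < +oo)%E.
  rewrite (Pe_sym sg)//; [|exact: mabs|exact: mabs].
  by under eq_integral do rewrite muleC.
have [i1 e1] := main _ _ mu mv fin.
have [i2 e2] := main _ _ mv mu fin2.
split; [exact: i1|exact: i2|].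
have symm (a b : T -> R) : measurable_fun setT a -> measurable_fun setT b -> (forall x, 0 <= a x) ->
      (forall x, 0 <= b x) -> (forall x, a x <= `|u x|) -> (forall x, b x <= `|v x|) ->
      \int[m]_x (a x * Pr t b x) = \int[m]_x (b x * Pr t a x).
  move=> ma mb a0 b0 au bv.
  have mb' : measurable_fun setT (EFin \o b) by exact/measurable_EFinP.
  have ma' : measurable_fun setT (EFin \o a) by exact/measurable_EFinP.
  have b0' y : (0 <= (EFin \o b) y)%E by rewrite lee_fin.
  have a0' y : (0 <= (EFin \o a) y)%E by rewrite lee_fin.
  have fab : (\int[m]_x ((a x)%:E * Pe t (EFin \o b) x) < +oo)%E.
    apply: le_lt_trans fin; apply: le_intT.
    - by move=> x; rewrite mule_ge0 ?lee_fin// Pe_ge0.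
    - by apply: emeasurable_funM => //; exact: measurable_Pe.
    - apply: emeasurable_funM; first exact: mabs.
      by apply: measurable_Pe => //; exact: mabs.
    - move=> x; apply: lee_pmul; rewrite ?lee_fin ?Pe_ge0//.
      by apply: Pe_le => //; exact: mabs.
  have fba : (\int[m]_x ((b x)%:E * Pe t (EFin \o a) x) < +oo)%E.
    rewrite (Pe_sym sg t0 mb' ma' b0' a0').
    by rewrite (eq_integral (fun x => (a x)%:E * Pe t (EFin \o b) x)%E)// => x _; rewrite muleC.
  have [_ E1] := Pr_sym_ge0 t0 ma mb a0 b0 fab.
  have [_ E2] := Pr_sym_ge0 t0 mb ma b0 a0 fba.
  apply/EFin_inj; rewrite E1 E2 (Pe_sym sg t0 ma' mb' a0' b0').
  by apply: eq_integral => x _; rewrite muleC.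
have mp := measurable_rpos; have mn := measurable_rneg.
have aux (x y a b c e a' b' c' e' : R) : x = a - b - c + e -> y = a' - b' - c' + e' ->
    a = a' -> b = c' -> c = b' -> e = e' -> x = y.
  by move=> -> -> -> -> -> ->; ring.
apply: (aux _ _ _ _ _ _ _ _ _ _ e1 e2); apply: symm; (exact: mp || exact: mn ||
  exact: rpos_ge0 || exact: rneg_ge0 || exact: rpos_le || exact: rneg_le).
Qed.

End semigroup_Lp.

(** * Energy identities and Hardy-Stein inequalities *)

Section energy.
Context {R : realType} {d} {T : measurableType d}.
Variables (m : {measure set T -> \bar R}) (k : R.-spker (measurableTypeR R * T) ~> T).
Hypothesis sg : symmetric_semigroup m k.
Implicit Types (t s p h : R) (f u v w : T -> R) (g : T -> \bar R).
Local Notation Pe := (Pe k).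
Local Notation Pr := (Pr k).
Local Notation Lp := (Lp m).

Lemma measurable_k2 t (F : T * T -> \bar R) : measurable_fun setT F -> (forall z, 0 <= F z)%E ->
  measurable_fun setT (fun x => \int[k (t, x)]_y F (x, y))%E.
Proof.
move=> mF F0.
pose G (w : (measurableTypeR R * T) * T) := F (w.1.2, w.2).
have mG : measurable_fun setT G.
  apply: (measurableT_comp mF).
  apply/measurable_fun_pairP; split => /=; last exact: measurable_snd.
  exact: measurableT_comp measurable_snd measurable_fst.
have := measurable_fun_integral_sfinite_kernel G k (fun z => F0 (z.1.2, z.2)) mG.
move=> H; exact: measurableT_comp H (measurable_time_pair t).
Qed.

(** Expand (u(x) - u(y)) (v(x) - v(y)). The two mixed terms agree by symmetry; the diagonal terms
    contribute uv P_t 1 and P_t(uv), whose integrals agree too, and the killing term raises their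
    sum to 2uv. A pair (u, v) is needed because the decrement of the p-norm pairs u with
    [spow (2 * r - 1) u]. *)
Lemma energy_identity t p q u v : 0 < t -> 1 <= p -> 1 <= q -> Lp p u -> Lp q v ->
  m.-integrable setT (EFin \o (fun x => u x * v x)) ->
  (\int[m]_x (`|u x|%:E * Pe t (fun y => `|v y|%:E) x) < +oo)%E ->
  (forall x y, 0 <= (u x - u y) * (v x - v y)) -> (forall x, 0 <= u x * v x) ->
  (\int[m]_x (\int[k (t, x)]_y ((u x - u y) * (v x - v y))%:E
     + (2 * (u x * v x) * (1 - fine (k (t, x) setT)))%:E))%E
  = (2 * \int[m]_x ((u x - Pr t u x) * v x))%:E.
Proof.
move=> t0 p1 q1 Lu Lv uvi cf mono uv0; have mu := (Lp_meas Lu); have mv := (Lp_meas Lv).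
pose q_ x := fine (k (t, x) setT).
have q_01 x : 0 <= q_ x <= 1 by rewrite fine_ge0//= (subprob_fine_le1 (k_le1 k _)).
have mq : measurable_fun setT q_.
  apply: measurableT_comp; first exact: fine_measurable.
  exact: (@measurable_k _ _ _ k).
have muv : measurable_fun setT (fun x => u x * v x) by exact: measurable_funM.
have Luv : Lp 1 (fun x => u x * v x).
  split => //; rewrite Np_def; under eq_integral do rewrite powRr1//.
  by case/integrableP : uvi.
have [i1 i2 e12] := Pr_sym sg t0 mu mv cf.
have one_int x : (k (t, x)).-integrable setT (EFin \o cst 1) by exact: subprob_cst (k_le1 k _) _.
have Pr1 x : Pr t (cst 1) x = q_ x by rewrite PrE Rintegral_cst// mul1r.
have cf1 : (\int[m]_x (`|u x * v x|%:E * Pe t (fun y => `|cst 1 y|%:E) x) < +oo)%E.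
  apply: le_lt_trans (Lp_fin Luv); apply: le_intT.
  - by move=> x; rewrite mule_ge0// Pe_ge0// => y; rewrite lee_fin.
  - apply: emeasurable_funM; first exact: measurable_abse_EFin.
    by apply: measurable_Pe => //; exact: measurable_abse_EFin.
  - exact/measurable_EFinP/measurable_norm_powR.
  - move=> x; rewrite powRr1// -[leRHS]mule1 lee_wpmul2l//.
    rewrite Pe_def (eq_integral (cst 1%E)); first by rewrite integral_cst// mul1e k_le1.
    by move=> y _ /=; rewrite normr1.
have [i3 i4 e34] := Pr_sym sg t0 muv (measurable_cst (1:R)) cf1.
have {}i3 : m.-integrable setT (EFin \o (fun x => u x * v x * q_ x)).
  by apply: eq_integrablef i3 => x; rewrite Pr1.
have {}i4 : m.-integrable setT (EFin \o (Pr t (fun x => u x * v x))).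
  by apply: eq_integrablef i4 => x; rewrite mul1r.
have {}e34 : \int[m]_x (u x * v x * q_ x) = \int[m]_x (Pr t (fun x => u x * v x) x).
  by under eq_Rintegral do rewrite -Pr1; rewrite e34; under eq_Rintegral do rewrite mul1r.
pose S x := 2 * (u x * v x) - u x * v x * q_ x - u x * Pr t v x - v x * Pr t u x
  + Pr t (fun x => u x * v x) x.
have j1 := integrable_scalef 2 uvi.
have j2 := integrable_subf j1 i3.
have j3 := integrable_subf j2 i1.
have j4 := integrable_subf j3 i2.
have Si : m.-integrable setT (EFin \o S) by exact: integrable_addf j4 i4.
have mF : measurable_fun setT (fun z : T * T => ((u z.1 - u z.2) * (v z.1 - v z.2))%:E).
  apply/measurable_EFinP; apply: measurable_funM; apply: measurable_funB;
  by apply: measurableT_comp.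
have nn x : 0 <= 2 * (u x * v x) * (1 - q_ x).
  apply: mulr_ge0; first by rewrite mulr_ge0.
  by rewrite subr_ge0; case/andP : (q_01 x).
transitivity (\int[m]_x (S x)%:E)%E.
  apply: ae_eq_integral; first exact: measurableT.
  - apply: emeasurable_funD.
      by apply: (measurable_k2 t mF) => -[x y]; rewrite lee_fin mono.
    apply/measurable_EFinP; apply: measurable_funM; first exact: measurable_funM.
    exact: measurable_funB.
  - by have := measurable_int _ Si.
  - near=> x => _.
    have ku : (k (t, x)).-integrable setT (EFin \o u) by near: x; exact: Lp_ae_integrable Lu.
    have kv : (k (t, x)).-integrable setT (EFin \o v) by near: x; exact: Lp_ae_integrable Lv.
    have kuv : (k (t, x)).-integrable setT (EFin \o (fun x => u x * v x)).
      by near: x; exact: (Lp_ae_integrable sg t0 _ Luv).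
    have k1 : (k (t, x)).-integrable setT (EFin \o cst (u x * v x)).
      exact: subprob_cst (k_le1 k _) _.
    have l1 := integrable_scalef (u x) kv.
    have l2 := integrable_scalef (v x) ku.
    have l3 := integrable_subf k1 l1.
    have l4 := integrable_subf l3 l2.
    have l5 := integrable_addf l4 kuv.
    have -> : (\int[k (t, x)]_y ((u x - u y) * (v x - v y))%:E =
       (u x * v x * q_ x - u x * Pr t v x - v x * Pr t u x + Pr t (fun y => u y * v y) x)%:E)%E.
      transitivity (\int[k (t, x)]_y (cst (u x * v x) y - u x * v y - v x * u y + u y * v y))%:E.
        by rewrite fineK_integral//; apply: eq_integral => y _ /=; congr EFin; ring.
      congr EFin; rewrite (RintegralDf l4 kuv) (RintegralBf l3 l2) (RintegralBf k1 l1).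
      by rewrite (RintegralZf _ kv) (RintegralZf _ ku) Rintegral_cst// !PrE.
    rewrite -EFinD /S -/(q_ x); congr EFin; ring.
rewrite -(fineK_integral Si) /S; congr EFin.
rewrite (RintegralDf j4 i4) (RintegralBf j3 i2) (RintegralBf j2 i1) (RintegralBf j1 i3).
rewrite (RintegralZf _ uvi) -e34 e12.
have -> : \int[m]_x ((u x - Pr t u x) * v x) = \int[m]_x (u x * v x - v x * Pr t u x).
  by apply: eq_Rintegral => x _; ring.
rewrite (RintegralBf uvi i2).
set A := Rintegral _ _ _; set B := Rintegral _ _ _; set C := Rintegral _ _ _; move: A B C => A B C; ring.
Unshelve. all: by end_near. Qed.

Lemma cross_Lp2 t u v : 0 < t -> Lp 2 u -> Lp 2 v ->
  (\int[m]_x (`|u x|%:E * Pe t (fun y => `|v y|%:E) x) < +oo)%E.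
Proof.
move=> t0 /Lp2P[mu ui] /Lp2P[mv vi].
apply: (@cross_fin _ _ _ m k sg t u v (fun x => u x ^+ 2) (fun x => v x ^+ 2)) => //.
- exact: measurable_funX.
- exact: measurable_funX.
- by move=> x; exact: sqr_ge0.
- by move=> x; exact: sqr_ge0.
- move=> x y; have := sqr_ge0 (`|u x| - `|v y|).
  have := sqr_ge0 `|u x|; have := sqr_ge0 `|v y|.
  by rewrite sqrrB !real_normK ?num_real//; lra.
- by apply/integrable_ge0P => //; [exact: measurable_funX|move=> x; exact: sqr_ge0].
- by apply/integrable_ge0P => //; [exact: measurable_funX|move=> x; exact: sqr_ge0].
Qed.

Definition pform t u v : R := \int[m]_x ((u x - Pr t u x) * v x).

(* The second summand is the killing part, for a kernel of mass less than one. *)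
Definition jump_energy t (u v : T -> R) : \bar R :=
  (\int[m]_x (\int[k (t, x)]_y ((u x - u y) * (v x - v y))%:E
     + (2 * (u x * v x) * (1 - fine (k (t, x) setT)))%:E))%E.

Lemma pform_def t u v : pform t u v = \int[m]_x ((u x - Pr t u x) * v x).
Proof. by []. Qed.

Lemma jump_energy_def t u v : jump_energy t u v =
  (\int[m]_x (\int[k (t, x)]_y ((u x - u y) * (v x - v y))%:E
     + (2 * (u x * v x) * (1 - fine (k (t, x) setT)))%:E))%E.
Proof. by []. Qed.

Lemma form_identity t w : 0 < t -> Lp 2 w -> jump_energy t w w = (2 * pform t w w)%:E.
Proof.
move=> t0 Lw; apply: (@energy_identity t 2 2) => //; rewrite ?ler1n//.
- exact: Lp2_mul.
- exact: cross_Lp2.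
- by move=> x y; rewrite -expr2 sqr_ge0.
- by move=> x; rewrite -expr2 sqr_ge0.
Qed.

Lemma form_ge0 t w : 0 < t -> Lp 2 w -> 0 <= pform t w w.
Proof.
move=> t0 Lw; rewrite -(@pmulr_rge0 _ 2)// -lee_fin -form_identity//.
apply: integral_ge0 => x _; apply: adde_ge0.
  by apply: integral_ge0 => y _; rewrite lee_fin -expr2 sqr_ge0.
rewrite lee_fin; apply: mulr_ge0; first by rewrite -expr2 mulr_ge0 ?sqr_ge0.
by rewrite subr_ge0 (subprob_fine_le1 (k_le1 k _)).
Qed.

Let je_meas t u v : measurable_fun setT u -> measurable_fun setT v ->
  (forall x y, 0 <= (u x - u y) * (v x - v y)) ->
  measurable_fun setT (fun x => (\int[k (t, x)]_y ((u x - u y) * (v x - v y))%:E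
     + (2 * (u x * v x) * (1 - fine (k (t, x) setT)))%:E))%E.
Proof.
move=> mu mv mono.
have mF : measurable_fun setT (fun z : T * T => ((u z.1 - u z.2) * (v z.1 - v z.2))%:E).
  apply/measurable_EFinP; apply: measurable_funM; apply: measurable_funB;
  by apply: measurableT_comp.
apply: emeasurable_funD.
  by apply: (measurable_k2 t mF) => -[x y]; rewrite lee_fin mono.
apply/measurable_EFinP; apply: measurable_funM.
  by apply: measurable_funM => //; exact: measurable_funM.
apply: measurable_funB => //; apply: measurableT_comp; first exact: fine_measurable.
exact: (@measurable_k _ _ _ k).
Qed.

Lemma jump_energy_le t (C1 C2 : R) (u v w1 w2 : T -> R) : 0 <= C1 -> 0 <= C2 ->
  measurable_fun setT u -> measurable_fun setT v -> measurable_fun setT w1 -> measurable_fun setT w2 ->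
  (forall x y, 0 <= (u x - u y) * (v x - v y)) -> (forall x, 0 <= u x * v x) ->
  (forall x y, (u x - u y) * (v x - v y) <= C1 * (w1 x - w1 y) ^+ 2 + C2 * (w2 x - w2 y) ^+ 2) ->
  (forall x, u x * v x <= C1 * w1 x ^+ 2 + C2 * w2 x ^+ 2) ->
  (jump_energy t u v <= C1%:E * jump_energy t w1 w1 + C2%:E * jump_energy t w2 w2)%E.
Proof.
move=> C10 C20 mu mv mw1 mw2 mono uv0 H1 H2.
have sqm (w : T -> R) x y : 0 <= (w x - w y) * (w x - w y) by rewrite -expr2 sqr_ge0.
have q0 x : 0 <= 1 - fine (k (t, x) setT).
  by rewrite subr_ge0 (subprob_fine_le1 (k_le1 k _)).
have je0 (a b : T -> R) x : (forall x y, 0 <= (a x - a y) * (b x - b y)) -> (forall x, 0 <= a x * b x) ->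
   (0 <= \int[k (t, x)]_y ((a x - a y) * (b x - b y))%:E
     + (2 * (a x * b x) * (1 - fine (k (t, x) setT)))%:E)%E.
  move=> ab ab0; apply: adde_ge0; last by rewrite lee_fin; apply: mulr_ge0 => //; apply: mulr_ge0.
  by apply: integral_ge0 => y _; rewrite lee_fin.
have sq0 (w : T -> R) x : 0 <= w x * w x by rewrite -expr2 sqr_ge0.
rewrite /jump_energy -!ge0_integralZl//; last 4 first.
- exact: je_meas.
- by move=> x _; exact: je0.
- exact: je_meas.
- by move=> x _; exact: je0.
rewrite -ge0_integralD//; last 4 first.
- by move=> x _; rewrite mule_ge0// ?lee_fin// je0.
- by apply: measurable_funeM; exact: je_meas.
- by move=> x _; rewrite mule_ge0// ?lee_fin// je0.
- by apply: measurable_funeM; exact: je_meas.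
apply: le_intT.
- by move=> x; exact: je0.
- exact: je_meas.
- by apply: emeasurable_funD; apply: measurable_funeM; exact: je_meas.
move=> x.
have mw (w : T -> R) : measurable_fun setT w ->
    measurable_fun setT (fun y => ((w x - w y) * (w x - w y))%:E).
  by move=> mw_; apply/measurable_EFinP; apply: measurable_funM; exact: measurable_funB.
have I0 (w : T -> R) : (0 <= \int[k (t, x)]_y ((w x - w y) * (w x - w y))%:E)%E.
  by apply: integral_ge0 => y _; rewrite lee_fin.
have J0 (w : T -> R) : (0 <= (2 * (w x * w x) * (1 - fine (k (t, x) setT)))%:E)%E.
  by rewrite lee_fin; apply: mulr_ge0 => //; apply: mulr_ge0.
rewrite (ge0_muleDr _ (I0 w1) (J0 w1)) (ge0_muleDr _ (I0 w2) (J0 w2)).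
rewrite addeACA; apply: leeD.
  rewrite -!ge0_integralZl//; last 4 first.
  - exact: mw.
  - by move=> y _; rewrite lee_fin.
  - exact: mw.
  - by move=> y _; rewrite lee_fin.
  rewrite -ge0_integralD//; last 4 first.
  - by move=> y _; rewrite -EFinM lee_fin mulr_ge0.
  - by apply: measurable_funeM; exact: mw.
  - by move=> y _; rewrite -EFinM lee_fin mulr_ge0.
  - by apply: measurable_funeM; exact: mw.
  apply: le_intT.
  - by move=> y; rewrite lee_fin.
  - by apply/measurable_EFinP; apply: measurable_funM; exact: measurable_funB.
  - by apply: emeasurable_funD; apply: measurable_funeM; exact: mw.
  - by move=> y; rewrite -!EFinM -EFinD lee_fin -!expr2.
rewrite -!EFinM -EFinD lee_fin.
have := ler_wpM2r (q0 x) (H2 x); set Q := 1 - _ => ?.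
rewrite -!expr2; lra.
Qed.

(** The normal contraction property of the approximating form, relative to two functions. The
    inequality for increments handles the jump part, the one for values the killing part. *)
Lemma form_contraction t (C1 C2 : R) (w w1 w2 : T -> R) : 0 < t -> 0 <= C1 -> 0 <= C2 ->
  Lp 2 w -> Lp 2 w1 -> Lp 2 w2 ->
  (forall x y, (w x - w y) ^+ 2 <= C1 * (w1 x - w1 y) ^+ 2 + C2 * (w2 x - w2 y) ^+ 2) ->
  (forall x, w x ^+ 2 <= C1 * w1 x ^+ 2 + C2 * w2 x ^+ 2) ->
  pform t w w <= C1 * pform t w1 w1 + C2 * pform t w2 w2.
Proof.
move=> t0 C10 C20 Lw Lw1 Lw2 H1 H2.
have := @jump_energy_le t C1 C2 w w w1 w2 C10 C20 (Lp_meas Lw) (Lp_meas Lw) (Lp_meas Lw1) (Lp_meas Lw2).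
have sqm x y : 0 <= (w x - w y) * (w x - w y) by rewrite -expr2 sqr_ge0.
have sq0 x : 0 <= w x * w x by rewrite -expr2 sqr_ge0.
move=> /(_ sqm sq0 H1 H2).
by rewrite !form_identity// -!EFinM -EFinD lee_fin; lra.
Qed.

End energy.

Local Opaque pform jump_energy.

Section power_energy.
Context {R : realType} {d} {T : measurableType d}.
Variables (m : {measure set T -> \bar R}) (k : R.-spker (measurableTypeR R * T) ~> T).
Hypothesis sg : symmetric_semigroup m k.
Implicit Types (t s p r : R) (f u v w : T -> R) (g : T -> \bar R).
Local Notation Pe := (Pe k).
Local Notation Pr := (Pr k).
Local Notation Lp := (Lp m).
Local Notation pform := (pform m k).

Lemma Lp2_Pr t w : 0 < t -> Lp 2 w -> Lp 2 (Pr t w).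
Proof. by move=> t0 Lw; apply: (Lp_Pr sg) => //; rewrite ler1n. Qed.

Lemma Pr_sym2 t u v : 0 < t -> Lp 2 u -> Lp 2 v ->
  \int[m]_x (u x * Pr t v x) = \int[m]_x (v x * Pr t u x).
Proof. by move=> t0 Lu Lv; have [] := Pr_sym sg t0 (Lp_meas Lu) (Lp_meas Lv) (cross_Lp2 sg t0 Lu Lv). Qed.

Lemma pformE t u v : 0 < t -> Lp 2 u -> Lp 2 v ->
  pform t u v = \int[m]_x (u x * v x) - \int[m]_x (Pr t u x * v x).
Proof.
move=> t0 Lu Lv; rewrite pform_def -(RintegralBf (Lp2_mul Lu Lv) (Lp2_mul (Lp2_Pr t0 Lu) Lv)).
by apply: eq_Rintegral => x _; ring.
Qed.

Lemma Pr_double t w : 0 < t -> Lp 2 w ->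
  \int[m]_x (Pr (t + t) w x * w x) = \int[m]_x (Pr t w x * Pr t w x).
Proof.
move=> t0 Lw; have LP := Lp2_Pr t0 Lw.
rewrite -(Pr_sym2 t0 Lw LP); apply: ae_RintegralE.
- by apply: measurable_funM; [apply: measurable_Pr|]; case: Lw.
- by apply: measurable_funM; [|apply: measurable_Pr; apply: measurable_Pr]; case: Lw.
- apply: filterS (PrD sg t0 t0 _ Lw); last by rewrite ler1n.
  by move=> x ->; rewrite mulrC.
Qed.

Lemma form_double t w : 0 < t -> Lp 2 w ->
  pform (t + t) w w = \int[m]_x (w x * w x) - \int[m]_x (Pr t w x * Pr t w x).
Proof. by move=> t0 Lw; rewrite pformE ?addr_gt0// Pr_double. Qed.

(** The source of all monotonicity in time: the left side is nonnegative, and divided by t it is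
    twice the gain of the quotient form/time when 2t is halved to t. *)
Lemma form_defect t w : 0 < t -> Lp 2 w ->
  \int[m]_x ((w x - Pr t w x) ^+ 2) = 2 * pform t w w - pform (t + t) w w.
Proof.
move=> t0 Lw; have LP := Lp2_Pr t0 Lw.
rewrite form_double// pformE//.
have i1 := Lp2_mul Lw Lw; have i2 := Lp2_mul LP Lw; have i3 := Lp2_mul LP LP.
have i4 := integrable_scalef 2 i2; have i5 := integrable_subf i1 i4.
transitivity (\int[m]_x (w x * w x - 2 * (Pr t w x * w x) + Pr t w x * Pr t w x)).
  by apply: eq_Rintegral => x _; ring.
rewrite (RintegralDf i5 i3) (RintegralBf i1 i4) (RintegralZf _ i2).
set A := Rintegral _ _ _; set B := Rintegral _ _ _; set C := Rintegral _ _ _; move: A B C => A B C; ring.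
Qed.

Lemma form_half t w : 0 < t -> Lp 2 w -> pform (t + t) w w <= 2 * pform t w w.
Proof.
by move=> t0 Lw; rewrite -subr_ge0 -form_defect//; apply: Rintegral_ge0 => x _; exact: sqr_ge0.
Qed.

Definition nu p f : R := \int[m]_x (`|f x| `^ p).

Lemma spow_conj_Lp r u : 1 <= r -> Lp (2 * r) u ->
  Lp (2 * r / (2 * r - 1)) (fun x => spow (2 * r - 1) (u x)).
Proof.
move=> r1 Lu; split; first by apply: measurable_spow; case: Lu.
apply: le_lt_trans ((Lp_fin Lu)); rewrite Np_def le_eqVlt; apply/orP; left; apply/eqP.
apply: eq_integral => x _; rewrite norm_spow; last by lra.
rewrite -powRrM; congr (_ `^ _)%:E; rewrite mulrC divfK//; lra.
Qed.

(** Positivity of the Bregman divergence gives |u|^p - |P_t u|^p <= p f (u - P_t u) with f =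
    [spow (p - 1) u]. The energy identity turns the integral into a jump energy of the pair (u, f),
    which [spow_energy_le] compares with that of [spow r u]. *)
Lemma Np_decrement_le t r u : 0 < t -> 1 <= r -> Lp (2 * r) u ->
  nu (2 * r) u - nu (2 * r) (Pr t u) <=
  4 * r * pform t (fun x => spow r (u x)) (fun x => spow r (u x)).
Proof.
have aux (A B C D F : R) : 0 <= F -> F <= 2 * (D + (2 * r - 1) * (B * A) - 2 * r * B * C) ->
  B * A - D <= 2 * r * ((A - C) * B) by move=> *; nra.
have aux' (I Q : R) : 1 <= r -> 2 * I <= 2 * (2 * Q) -> 2 * r * I <= 4 * r * Q by move=> *; nra.
move=> t0 r1 Lu; have mu := (Lp_meas Lu).
have r21 : 1 <= 2 * r by lra.
set f := fun x => spow (2 * r - 1) (u x).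
have Lf := spow_conj_Lp r1 Lu.
have mf : measurable_fun setT f by case: Lf.
have Lps : Lp 2 (fun x => spow r (u x)) by exact: (spow_Lp2 r1 Lu).
have LP : Lp (2 * r) (Pr t u) by exact: (Lp_Pr sg).
have cf : (\int[m]_x (`|u x|%:E * Pe t (fun y => `|f y|%:E) x) < +oo)%E.
  apply: (@cross_fin _ _ _ m k sg t u f (fun x => `|u x| `^ (2 * r)) (fun x => `|u x| `^ (2 * r))) => //.
  - exact: measurable_norm_powR.
  - exact: measurable_norm_powR.
  - by move=> x y; rewrite norm_spow; [exact: mul_powR_le|lra].
  - exact: (Lp_fin Lu).
  - exact: (Lp_fin Lu).
have q1 : 1 <= 2 * r / (2 * r - 1) by rewrite ler_pdivlMr; lra.
have ufi : m.-integrable setT (EFin \o (fun x => u x * f x)).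
  by apply: eq_integrablef (Lp_integrable Lu) => x; rewrite [u x * _]mulrC /f spow_mul.
have mono x y : 0 <= (u x - u y) * (f x - f y) by apply: spow_mono; lra.
have uf0 x : 0 <= u x * f x by rewrite /f mulrC spow_mul// powR_ge0.
have E := energy_identity sg t0 r21 q1 Lu Lf ufi cf mono uf0.
(* The comparison is stated with two functions; the second is taken to be zero. *)
have le : (jump_energy m k t u f <= 2%:E * jump_energy m k t (fun x => spow r (u x)) (fun x => spow r (u x))
     + 0%:E * jump_energy m k t (cst 0%R) (cst 0%R))%E.
  apply: jump_energy_le => //.
  - exact: (Lp_meas Lps).
  - by move=> x y; rewrite mul0r addr0; exact: spow_energy_le.
  - move=> x; rewrite mul0r addr0 spow_sqr// /f mulrC spow_mul//.
    by rewrite ler_peMl ?powR_ge0// ler1n.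
move: le; rewrite mul0e adde0 form_identity// jump_energy_def E -EFinM lee_fin => le.
apply: (@le_trans _ _ (2 * r * \int[m]_x ((u x - Pr t u x) * f x))); last exact: aux'.
have [_ i2 _] := Pr_sym sg t0 mu mf cf.
have i3 : m.-integrable setT (EFin \o (fun x => (u x - Pr t u x) * f x)).
  by apply: eq_integrablef (integrable_subf ufi i2) => x; move: (u x) (f x) (Pr t u x) => A B C; ring.
have i4 := Lp_integrable Lu; have i5 := Lp_integrable LP.
rewrite /nu -(RintegralBf i4 i5) -(RintegralZf _ i3); apply: le_Rintegralf.
- exact: integrable_subf i4 i5.
- exact: integrable_scalef i3.
- move=> x; have := spow_bregman (u x) (Pr t u x) r1.
  have := sqr_ge0 (spow r (u x) - spow r (Pr t u x)).
  rewrite -(spow_mul (u x) r1) -/(f x).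
  exact: aux.
Qed.

(** The doubled time makes the form a difference of squares: with w = spow r (P_t v) and w' = spow r
    v it is |w|^2 - |P_t w|^2. Bound |P_t w|^2 from below by 2 (P_t w, w') - |w'|^2, move P_t to w'
    by symmetry, and integrate [subprob_spow_variance]. *)
Lemma form_decrement_le t r v : 0 < t -> 1 <= r -> Lp (2 * r) v ->
  pform (t + t) (fun x => spow r (Pr t v x)) (fun x => spow r (Pr t v x)) <=
  2 * (nu (2 * r) v - nu (2 * r) (Pr t v)).
Proof.
have aux1 (A B C D : R) : A - 2 * B * C + D <= 2 * (D - A) -> A - 2 * (B * C) <= D - 2 * A.
  lra.
have aux3 (A B : R) : 2 * (A * B) - A * A <= B * B.
  by have := sqr_ge0 (A - B); rewrite sqrrB !expr2; lra.
have aux2 (A B C D E : R) : B - 2 * C <= D - 2 * B -> 2 * C - E <= A -> D <= E ->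
  B - A <= 2 * (E - B) by lra.
move=> t0 r1 Lv; have mv := (Lp_meas Lv).
have r21 : 1 <= 2 * r by lra.
have LP : Lp (2 * r) (Pr t v) by exact: (Lp_Pr sg).
set w := fun x => spow r (Pr t v x); set w' := fun x => spow r (v x).
have Lw : Lp 2 w by exact: (spow_Lp2 r1 LP).
have Lw' : Lp 2 w' by exact: (spow_Lp2 r1 Lv).
have LPw := Lp2_Pr t0 Lw; have LPw' := Lp2_Pr t0 Lw'.
rewrite form_double//.
have i1 := Lp2_mul LPw Lw'; have i2 := Lp2_mul Lw' Lw'; have i3 := Lp2_mul LPw LPw.
have i4 := Lp2_mul Lw Lw; have i5 := Lp2_mul Lw LPw'.
have h1 : 2 * \int[m]_x (w x * Pr t w' x) - \int[m]_x (w' x * w' x) <= \int[m]_x (Pr t w x * Pr t w x).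
  have i1' := Lp2_mul Lw' LPw; have i6 := integrable_scalef 2 i1'.
  rewrite (Pr_sym2 t0 Lw Lw') -(RintegralZf _ i1') -(RintegralBf i6 i2).
  apply: le_Rintegralf; [exact: (integrable_subf i6 i2)|exact: i3|].
  by move=> x; exact: aux3.
have w2 : \int[m]_x (w x * w x) = nu (2 * r) (Pr t v).
  by apply: eq_Rintegral => x _; rewrite -expr2 spow_sqr.
have w'2 : \int[m]_x (w' x * w' x) = nu (2 * r) v.
  by apply: eq_Rintegral => x _; rewrite -expr2 spow_sqr.
pose V x := `|v x| `^ (2 * r).
have mV : measurable_fun setT V by exact: measurable_norm_powR.
have LV : Lp 1 V.
  split => //; rewrite Np_def; under eq_integral do rewrite powRr1// ger0_norm ?powR_ge0//.
  exact: (Lp_fin Lv).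
have PVi : m.-integrable setT (EFin \o Pr t V).
  have [mPV h] := Lp_Pr sg t0 (lexx 1) LV.
  apply/integrable_ge0P => //; first by move=> x; apply: Rintegral_ge0 => y _; exact: powR_ge0.
  apply: le_lt_trans h; apply: le_intT.
  - by move=> x; rewrite lee_fin Rintegral_ge0// => y _; exact: powR_ge0.
  - exact/measurable_EFinP.
  - exact/measurable_EFinP/measurable_norm_powR.
  - by move=> x; rewrite lee_fin powRr1// ler_norm.
have PVle : \int[m]_x Pr t V x <= nu (2 * r) v.
  rewrite -lee_fin fineK_integral// fineK_integral; last exact: Lp_integrable.
  have := Np_Pr sg t0 (lexx 1) mV; rewrite !Np_def.
  under eq_integral => x _.
    rewrite powRr1// ger0_norm; last by apply: Rintegral_ge0 => y _; exact: powR_ge0.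
    over.
  move/le_trans; apply; rewrite le_eqVlt; apply/orP; left; apply/eqP.
  by apply: eq_integral => x _; rewrite powRr1// ger0_norm// powR_ge0.
have LPi := Lp_integrable LP; have LVi := Lp_integrable Lv.
have h2 : \int[m]_x (w x * w x - 2 * (w x * Pr t w' x)) <=
    \int[m]_x (Pr t V x - 2 * `|Pr t v x| `^ (2 * r)).
  apply: ae_le_Rintegral.
  - exact: (integrable_subf i4 (integrable_scalef 2 i5)).
  - exact: (integrable_subf PVi (integrable_scalef 2 LPi)).
  - apply: filterS (Lp_Pe_ae sg t0 Lv) => x hx.
    have := subprob_spow_variance (k_le1 k _) r1 mv hx.
    rewrite -![Rintegral _ _ _]PrE -/w' -/V -/(w x) expr2.
    have -> : w x * w x = `|Pr t v x| `^ (2 * r) by rewrite -expr2 spow_sqr.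
    exact: aux1.
move: h2; rewrite (RintegralBf i4 (integrable_scalef 2 i5)).
rewrite (RintegralBf PVi (integrable_scalef 2 LPi)).
rewrite (RintegralZf _ i5) (RintegralZf _ LPi) -/(nu _ _).
move: h1 PVle; rewrite w2 w'2 => h1 h3 h2; exact: (aux2 _ _ _ _ _ h2 h1 h3).
Qed.

End power_energy.

(** * Tiling the half-line by time steps *)

Section tiling.
Context {R : realType}.
Local Notation mu := (@lebesgue_measure R).
Implicit Types (a h c : R) (g : measurableTypeR R -> \bar R).

Lemma lebesgue_measure_shift c (A : set (measurableTypeR R)) : measurable A ->
  pushforward mu (fun x => x + c : measurableTypeR R) A = mu A.
Proof.
have mshift : measurable_fun setT (fun x : measurableTypeR R => x + c : measurableTypeR R).
  exact: measurable_funD.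
move=> mA; apply/esym/lebesgue_measure_unique => //= _ [[x y]] _ <-.
rewrite /pushforward /=.
have -> : (fun z => z + c) @^-1` `]x, y] = `](x - c), (y - c)]%classic.
  by apply/seteqP; split => z /=; rewrite !in_itv/= ltrBlDr lerBrDr.
rewrite !lebesgue_measure_itv/= !lte_fin ltrD2r.
by case: ifP => // _; rewrite -!EFinB; congr EFin; ring.
Qed.

Lemma integral_shift h c g : measurable_fun setT g -> (forall t, 0 <= g t)%E ->
  (\int[mu]_(t in `[c, (c + h)%R[) g t = \int[mu]_(t in `[0%R, h[) g (t + c)%R)%E.
Proof.
move=> mg g0.
have mshift : measurable_fun setT (fun x : measurableTypeR R => x + c : measurableTypeR R).
  exact: measurable_funD.
have e : `[0%R, h[%classic = (fun x : measurableTypeR R => x + c : measurableTypeR R) @^-1` `[c, c + h[.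
  apply/seteqP; split => z /=; rewrite !in_itv/= => /andP[z1 z2]; apply/andP; split; lra.
rewrite e -(@ge0_integral_pushforward _ _ _ _ _ _ mshift mu `[c, c + h[%classic g)//=.
  by apply: eq_measure_integral => //= A mA _; exact/esym/lebesgue_measure_shift.
exact: measurable_funTS.
Qed.

Lemma integral_tile h a g : 0 < h -> measurable_fun setT g -> (forall t, 0 <= g t)%E ->
  (\int[mu]_(t in `[a, +oo[) g t =
   \int[mu]_(t in `[0%R, h[) \sum_(k <oo) g (t + (a + k%:R * h))%R)%E.
Proof.
move=> h0 mg g0.
pose F (k : nat) : set (measurableTypeR R) := `[a + k%:R * h, a + k%:R * h + h[%classic.
have -> : `[a, +oo[%classic = \bigcup_k F k.
  apply/seteqP; split => x /=; rewrite ?in_itv/= ?andbT.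
    move=> ax; exists (Num.truncn ((x - a) / h)) => //; rewrite /F/= in_itv/=.
    have x0 : 0 <= (x - a) / h by rewrite divr_ge0 ?subr_ge0// ltW.
    have /andP[t1 t2] := truncn_itv x0.
    move: t1 t2; rewrite ler_pdivlMr// ltr_pdivrMr//.
    move: (Num.Def.trunc _) => n; rewrite -addn1 natrD mulrDl mul1r => t1 t2.
    apply/andP; split; lra.
  move=> [k _]; rewrite /F/= in_itv/= => /andP[+ _]; apply: le_trans.
  by rewrite lerDl mulr_ge0// ltW.
rewrite ge0_integral_bigcup//; last 2 first.
- exact: measurable_funTS.
- apply/trivIsetP => i j _ _; wlog ij : i j / (i < j)%N.
    move=> W; rewrite neq_lt => /orP[ij|ji]; first by apply: W => //; rewrite lt_eqF.
    by rewrite setIC; apply: W => //; rewrite lt_eqF.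
  move=> _; apply/seteqP; split => // x []; rewrite /F/= !in_itv/= => /andP[_ x1] /andP[x2 _].
  have : (i.+1%:R : R) * h <= j%:R * h by rewrite ler_wpM2r ?ler_nat// ltW.
  rewrite -addn1 natrD mulrDl mul1r; lra.
- rewrite integral_nneseries//; last first.
  move=> n; apply: measurable_funTS; apply: measurableT_comp => //.
  exact: measurable_funD.
  by apply: eq_eseriesr => k _; exact: integral_shift.
by move=> k; exact: measurable_itv.
Qed.

Lemma nondec_limn_ge (u : (\bar R)^nat) n : nondecreasing_seq u -> (u n <= limn u)%E.
Proof.
move=> nd; rewrite (cvg_lim _ (ereal_nondecreasing_cvgn nd))//.
by apply: ereal_sup_ubound; exists n.
Qed.

Section telescoping.
Variables (g : measurableTypeR R -> R) (N : R -> R) (h : R).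
Hypotheses (mg : measurable_fun setT g) (g0 : forall t, 0 <= g t).
Hypotheses (h0 : 0 < h) (N0 : forall t, 0 < t -> 0 <= N t).

Let G t : \bar R := (g t)%:E.
Let mG : measurable_fun setT G. Proof. exact/measurable_EFinP. Qed.
Let G0 t : (0 <= G t)%E. Proof. by rewrite lee_fin. Qed.

Let mshift c : measurable_fun setT (fun t : measurableTypeR R => G (t + c)).
Proof.
have msh : measurable_fun setT (fun t : measurableTypeR R => (t + c : measurableTypeR R)) by exact: measurable_funD.
exact: (measurableT_comp mG msh).
Qed.

Let mseries a : measurable_fun setT
  (fun t : measurableTypeR R => \sum_(0 <= j <oo) G (t + (a + j%:R * h))%R)%E.
Proof.
apply: (@ge0_emeasurable_sum _ _ _ setT (fun j (t : measurableTypeR R) => G (t + (a + j%:R * h))) xpredT) => j.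
- by move=> t _ _; exact: G0.
- by move=> _; exact: mshift.
Qed.

Let tel (t : R) M : \sum_(0 <= j < M) (N (t + j%:R * h) - N (t + j.+1%:R * h)) = N t - N (t + M%:R * h).
Proof.
elim: M => [|M IH]; first by rewrite big_geq// mul0r addr0 subrr.
by rewrite big_nat_recr//= IH; ring.
Qed.

Let pos (t : R) j : 0 < t -> 0 < t + j%:R * h.
Proof. by move=> t0; rewrite ltr_wpDr// mulr_ge0// ltW. Qed.

Let next (t : R) (j : nat) : t + j.+1%:R * h = (t + j%:R * h) + h.
Proof. by rewrite -addn1 natrD; ring. Qed.

(** For each phase t in (0, h) the sum over the grid t + jh telescopes and is at most c M; the
    integral over the phase supplies the factor h. *)
Lemma tile_upper (c M : R) : 0 <= c ->
  (forall s, 0 < s -> g (s + h) <= c * (N s - N (s + h))) ->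
  (forall s, 0 < s -> N s <= M) ->
  (\int[mu]_(t in `[h, +oo[) G t <= (c * M * h)%:E)%E.
Proof.
move=> c0 step NM.
(* The phase 0 is dropped as a null set, since the hypotheses concern positive times. *)
rewrite (integral_tile h h0 mG G0) -integral_itv_obnd_cbnd; last first.
  exact: measurable_funTS (mseries h).
apply: (@le_trans _ _ (\int[mu]_(t in `]0%R, h[) (c * M)%:E)%E); last first.
  by rewrite integral_cst//= lebesgue_measure_itv/= lte_fin h0 oppr0 adde0 -EFinM.
apply: ge0_le_integral => //.
- by move=> t _; apply: nneseries_ge0 => j _ _; exact: G0.
- exact: measurable_funTS (mseries h).
move=> t; rewrite /= in_itv/= => /andP[t0 th].
apply: lime_le; first by apply: is_cvg_nneseries => j _ _; exact: G0.
apply: nearW => n; rewrite sumEFin lee_fin.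
apply: (@le_trans _ _ (\sum_(0 <= j < n) c * (N (t + j%:R * h) - N (t + j.+1%:R * h)))).
  apply: ler_sum => j _.
  have -> : t + (h + j%:R * h) = (t + j%:R * h) + h by ring.
  by rewrite next; apply: step; exact: pos.
rewrite -mulr_sumr ler_wpM2l// tel (le_trans _ (NM t t0))// gerBl N0//.
exact: pos.
Qed.

(** The same telescoping from below: the far end N(t + nh) tends to 0, and N(t) >= N(h) for each
    phase t in (0, h). *)
Lemma tile_lower (c : R) : 0 <= c ->
  (forall s, 0 < s -> N s - N (s + h) <= c * g s) ->
  (forall s t, 0 < s -> s <= t -> N t <= N s) ->
  N s @[s --> +oo%R] --> (0 : R) ->
  ((N h * h)%:E <= c%:E * \int[mu]_(t in `]0%R, +oo[) G t)%E.
Proof.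
move=> c0 step mono lim0.
rewrite integral_itv_obnd_cbnd; last exact: measurable_funTS mG.
rewrite (integral_tile 0 h0 mG G0) -integral_itv_obnd_cbnd; last first.
  exact: measurable_funTS (mseries 0).
have -> : ((N h * h)%:E = \int[mu]_(t in `]0%R, h[) (N h)%:E)%E.
  by rewrite integral_cst//= lebesgue_measure_itv/= lte_fin h0 oppr0 adde0 -EFinM.
have S0 t : (0 <= \sum_(0 <= j <oo) G (t + (0 + j%:R * h))%R)%E.
  by apply: nneseries_ge0 => j _ _; exact: G0.
have mS := mseries 0.
rewrite -ge0_integralZl//; last exact: measurable_funTS mS.
apply: ge0_le_integral => //.
- by move=> t _; rewrite lee_fin N0.
- by apply: measurable_funeM; exact: measurable_funTS mS.
move=> t; rewrite /= in_itv/= => /andP[t0 th].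
have part n : ((N t - N (t + n%:R * h))%:E <= c%:E * \sum_(0 <= j <oo) G (t + (0 + j%:R * h))%R)%E.
  apply: (@le_trans _ _ (c%:E * \sum_(0 <= j < n) G (t + (0 + j%:R * h))%R)%E); last first.
    rewrite lee_wpmul2l ?lee_fin//.
    by apply: nneseries_lim_ge => j _ _; exact: G0.
  rewrite sumEFin -EFinM lee_fin mulr_sumr -tel.
  by apply: ler_sum => j _; rewrite next add0r; apply: step; exact: pos.
apply: (@le_trans _ _ (N t)%:E); first by rewrite lee_fin mono// ltW.
apply/lee_addgt0Pr => e e0.
have : \forall n \near \oo, N (t + n%:R * h) < e.
  have : \forall s \near +oo%R, N s < e by exact: (cvgr_lt (0:R)).
  move=> [A [Ar HA]]; near=> n; apply: HA.
  apply: (@lt_le_trans _ _ (n%:R * h)); last by rewrite lerDr ltW.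
  rewrite -ltr_pdivrMr//; near: n; exact: nbhs_infty_gtr.
move=> [n _ Hn]; have {}Hn := Hn n (leqnn n).
apply: le_trans (leeD2r e%:E (part n)); rewrite -EFinD lee_fin.
by move: Hn => /=; move: (N t) (N _) => A B; lra.
Unshelve. all: by end_near. Qed.

End telescoping.

Lemma monotone_sup_integral (e : nat -> measurableTypeR R -> R) (h : nat -> R) (M : R) :
  (forall n, measurable_fun setT (e n)) ->
  (forall n t, 0 <= e n t) -> (forall n t, 0 < t -> e n t <= e n.+1 t) ->
  (forall n, 0 < h n) -> (forall n, h n.+1 <= h n) -> h n @[n --> \oo] --> (0 : R) ->
  (forall n, \int[mu]_(t in `[h n, +oo[) (e n t)%:E <= M%:E)%E ->
  (\int[mu]_(t in `]0%R, +oo[) limn (fun n => (e n t)%:E) <= M%:E)%E.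
Proof.
move=> me e0 nde h0 ndh h_0 bd.
pose g n (t : measurableTypeR R) := ((e n t)%:E * (\1_(`[h n, +oo[%classic) t)%:E)%E.
have mg n : measurable_fun setT (g n).
  by apply: emeasurable_funM; apply/measurable_EFinP => //; exact: measurable_indic.
have g0 n t : (0 <= g n t)%E by rewrite mule_ge0// lee_fin.
have nd t : 0 < t -> nondecreasing_seq (g ^~ t).
  move=> t0; apply/nondecreasing_seqP => n; rewrite /g.
  apply: lee_pmul; rewrite ?lee_fin// ?nde//.
  rewrite !indicE ler_nat; case: (boolP (t \in `[h n, +oo[%classic)) => //.
  rewrite inE/= in_itv/= andbT => hn; rewrite mem_set//= in_itv/= andbT.
  exact: le_trans hn.
have lim_g t : 0 < t -> limn (fun n => (e n t)%:E) = limn (g ^~ t).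
  move=> t0; apply/esym/cvg_lim => //.
  have c : nondecreasing_seq (fun n => (e n t)%:E).
    by apply/nondecreasing_seqP => n; rewrite lee_fin nde.
  have ht : \forall n \near \oo, h n < t by exact: (cvgr_lt (0:R)).
  apply: cvg_trans (ereal_nondecreasing_is_cvgn c); apply: near_eq_cvg.
  near=> n; rewrite /g indicE mem_set ?mule1//=.
  by rewrite in_itv/= andbT; apply: ltW; near: n; exact: ht.
rewrite (eq_integral (fun t => limn (g ^~ t))); last first.
  by move=> t; rewrite inE/= in_itv/= andbT => tt; exact: lim_g.
rewrite monotone_convergence//; last 2 first.
- by move=> n; exact: measurable_funTS.
- by move=> t; rewrite /= in_itv/= andbT => tt; exact: nd.
apply: lime_le.
  apply: ereal_nondecreasing_is_cvgn => i j ij; apply: ge0_le_integral => //.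
  - exact: measurable_funTS.
  - exact: measurable_funTS.
  - by move=> t; rewrite /= in_itv/= andbT => tt; exact: nd.
apply: nearW => n; apply: le_trans (bd n).
rewrite [leRHS]integral_mkcond [leLHS]integral_mkcond.
have mge : measurable_fun setT (fun t => (e n t)%:E) by exact/measurable_EFinP.
apply: ge0_le_integral => //.
- by move=> t _; rewrite patchE; case: ifP.
- by apply/(measurable_restrictT _ _).1 => //; exact: measurable_funTS.
- by apply/(measurable_restrictT _ _).1 => //; exact: measurable_funTS.
- move=> t _; rewrite !patchE /g indicE.
  by case: (boolP (t \in `[h n, +oo[%classic)) => _; case: ifP => _;
    rewrite ?mule0 ?mule1// lee_fin.
Unshelve. all: by end_near. Qed.

End tiling.

Section kernel_reindex.
Context {R : realType} {d d' d1} {X : measurableType d1} {Z : measurableType d'} {T : measurableType d}.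
Variables (phi : X -> Z).
Hypothesis mphi : measurable_fun setT phi.

(** The measurability of [phi] is an argument so that the kernel instances below attach to the term
    itself. *)
Definition kreindex (k : Z -> {measure set T -> \bar R}) (_ : measurable_fun setT phi) :
  X -> {measure set T -> \bar R} := fun x => k (phi x).

Section kernel.
Variable k : R.-ker Z ~> T.

Let kreindex_measurable U : measurable U -> measurable_fun setT (kreindex k mphi ^~ U).
Proof. by move=> mU; exact: measurableT_comp (measurable_kernel k _ mU) mphi. Qed.

HB.instance Definition _ := isKernel.Build _ _ X T R (kreindex k mphi) kreindex_measurable.

End kernel.

Section sfinite.
Variable k : R.-sfker Z ~> T.

Let kreindex_sfinite : exists2 k_ : (R.-ker X ~> T)^nat,
    forall n, measure_fam_uub (k_ n) &
    forall x U, measurable U -> kreindex k mphi x U = kseries k_ x U.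
Proof.
have [k_ kE] := sfinite_kernel k.
exists (fun n => kreindex (k_ n) mphi).
  by move=> n; have [r kr] := measure_uub (k_ n); exists r => x; exact: kr.
by move=> x U mU; rewrite /kreindex kE.
Qed.

HB.instance Definition _ := isSFiniteKernel_subdef.Build _ _ X T R (kreindex k mphi) kreindex_sfinite.

Lemma measurable_int_reindex (F : X * T -> \bar R) : measurable_fun setT F ->
  (forall z, 0 <= F z)%E -> measurable_fun setT (fun x => \int[k (phi x)]_y F (x, y))%E.
Proof. by move=> mF F0; exact: (measurable_fun_integral_sfinite_kernel F (kreindex k mphi)). Qed.

Lemma measurable_Rint_reindex (F : X * T -> R) : measurable_fun setT F ->
  measurable_fun setT (fun x => \int[k (phi x)]_y F (x, y)).
Proof. by move=> mF; exact: (measurable_Rintegral_kernel (kreindex k mphi) mF). Qed.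

End sfinite.

End kernel_reindex.

Lemma measurable_Rint_param {R : realType} {d d'} {X : measurableType d} {T : measurableType d'}
  (m : {sigma_finite_measure set T -> \bar R}) (F : X * T -> R) : measurable_fun setT F ->
  measurable_fun setT (fun x => \int[m]_y F (x, y)).
Proof.
move=> mf.
have mF : measurable_fun setT (EFin \o F) by exact/measurable_EFinP.
have -> : (fun x => \int[m]_y F (x, y)) = (fun x => fine (\int[m]_y (EFin \o F)^\+ (x, y)
   - \int[m]_y (EFin \o F)^\- (x, y)))%E.
  apply/funext => x; transitivity (fine (\int[m]_y (F (x, y))%:E)%E); first by [].
  rewrite integralE; congr (fine (_ - _)%E).
    by apply: eq_integral => y _; rewrite !funeposE.
  by apply: eq_integral => y _; rewrite !funenegE.
apply: measurableT_comp; first exact: fine_measurable.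
apply: emeasurable_funB.
  have := @measurable_fun_fubini_tonelli_F _ _ _ _ R m _ (measurable_funepos mF) (funepos_ge0 _).
  exact.
have := @measurable_fun_fubini_tonelli_F _ _ _ _ R m _ (measurable_funeneg mF) (funeneg_ge0 _).
exact.
Qed.

Lemma measurable_Pr_param {R : realType} {d d'} {X : measurableType d'} {T : measurableType d}
  (k : R.-spker (measurableTypeR R * T) ~> T) (h : measurableTypeR R) (F : X * T -> R) :
  measurable_fun setT F ->
  measurable_fun setT (fun z : X * T => Pr k h (fun y => F (z.1, y)) z.2).
Proof.
move=> mF.
have mphi : measurable_fun setT (fun z : X * T => (h, z.2)).
  apply: (@measurable_fun_pair _ _ _ _ _ _ (fun _ : X * T => h) snd).
    exact: measurable_cst.
  exact: measurable_snd.
under eq_fun do rewrite PrE.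
apply: (measurable_Rint_reindex mphi k (F := fun z : (X * T) * T => F (z.1.1, z.2))).
have mp : measurable_fun setT (fun z : (X * T) * T => (z.1.1, z.2)).
  apply: (@measurable_fun_pair _ _ _ _ _ _ (fun z : (X * T) * T => z.1.1) snd).
    exact: measurableT_comp measurable_fst measurable_fst.
  exact: measurable_snd.
exact: (measurableT_comp mF mp).
Qed.

Section pform_ae.
Context {R : realType} {d} {T : measurableType d}.
Variables (m : {measure set T -> \bar R}) (k : R.-spker (measurableTypeR R * T) ~> T).
Hypothesis sg : symmetric_semigroup m k.
Implicit Types (t s p r : R) (f u v w : T -> R).
Local Notation Pe := (Pe k).
Local Notation Pr := (Pr k).
Local Notation Lp := (Lp m).
Local Notation pform := (pform m k).

Lemma Pr_ae t (f g : T -> R) : 0 < t -> measurable_fun setT f -> measurable_fun setT g ->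
  {ae m, forall x, f x = g x} -> {ae m, forall x, Pr t f x = Pr t g x}.
Proof.
move=> t0 mf mg fg; apply: filterS (Pe_ae_null sg t0 fg) => x h.
by rewrite !PrE; exact: ae_RintegralE.
Qed.

Lemma pform_ae t w w' : 0 < t -> Lp 2 w -> Lp 2 w' ->
  {ae m, forall x, w x = w' x} -> pform t w w = pform t w' w'.
Proof.
move=> t0 Lw Lw' ww'; have mw := Lp_meas Lw; have mw' := Lp_meas Lw'.
rewrite !pform_def; apply: ae_RintegralE.
- by apply: measurable_funM => //; apply: measurable_funB => //; exact: measurable_Pr.
- by apply: measurable_funM => //; apply: measurable_funB => //; exact: measurable_Pr.
- by apply: filterS2 ww' (Pr_ae t0 mw mw' ww') => x -> ->.
Qed.

Lemma nu_ae p (f g : T -> R) : measurable_fun setT f -> measurable_fun setT g ->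
  {ae m, forall x, f x = g x} -> nu m p f = nu m p g.
Proof.
move=> mf mg fg; apply: ae_RintegralE; [exact: measurable_norm_powR|exact: measurable_norm_powR|].
by apply: filterS fg => x ->.
Qed.

Lemma nu_ge0 p f : 0 <= nu m p f.
Proof. by apply: Rintegral_ge0 => x _; exact: powR_ge0. Qed.

Lemma Np_nu p f : Lp p f -> Np m p f = (nu m p f)%:E.
Proof. by move=> Lf; rewrite Np_def fineK_integral//; exact: Lp_integrable. Qed.

Lemma nu_Pr t p f : 0 < t -> 1 <= p -> Lp p f -> nu m p (Pr t f) <= nu m p f.
Proof.
move=> t0 p1 Lf; have LP := Lp_Pr sg t0 p1 Lf.
by have := Np_Pr sg t0 p1 (Lp_meas Lf); rewrite (Np_nu Lf) (Np_nu LP) lee_fin.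
Qed.

Lemma nu_PrD s t p f : 0 < s -> 0 < t -> 1 <= p -> Lp p f ->
  nu m p (Pr (s + t) f) = nu m p (Pr s (Pr t f)).
Proof.
move=> s0 t0 p1 Lf; have mf := Lp_meas Lf; apply: nu_ae.
- exact: measurable_Pr.
- by apply: measurable_Pr; exact: measurable_Pr.
- exact: (PrD sg s0 t0 p1 Lf).
Qed.

Lemma nu_mono s t p f : 0 < s -> s <= t -> 1 <= p -> Lp p f ->
  nu m p (Pr t f) <= nu m p (Pr s f).
Proof.
move=> s0; rewrite le_eqVlt => /predU1P[->//|st] p1 Lf.
have ts : 0 < t - s by rewrite subr_gt0.
have -> : t = (t - s) + s by ring.
by rewrite (nu_PrD ts s0 p1 Lf); exact: (nu_Pr ts p1 (Lp_Pr sg s0 p1 Lf)).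
Qed.

End pform_ae.

Local Opaque nu.

(** * Dyadic energies and the Hardy-Stein bounds *)

Section dyadic_energy.
Context {R : realType} {d} {T : measurableType d}.
Variables (m : {sigma_finite_measure set T -> \bar R}) (k : R.-spker (measurableTypeR R * T) ~> T).
Hypothesis sg : symmetric_semigroup m k.
Implicit Types (t s p r : R) (f u v w : T -> R).
Local Notation Pe := (Pe k).
Local Notation Pr := (Pr k).
Local Notation Lp := (Lp m).
Local Notation pform := (pform m k).

Definition dy (n : nat) : R := (2^-1) ^+ n.

Lemma dy_gt0 n : 0 < dy n.
Proof. by rewrite exprn_gt0// invr_gt0. Qed.

Lemma dyS n : dy n.+1 + dy n.+1 = dy n.
Proof. by rewrite /dy exprS -mulrDl; rewrite (_ : 2^-1 + 2^-1 = 1) ?mul1r//; field. Qed.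

Lemma cvg_dy : dy n @[n --> \oo] --> 0.
Proof. by apply: cvg_expr; rewrite ger0_norm ?invr_ge0// invf_lt1 ?ltr1n. Qed.

(* Halving the time increases the approximating form, so that along dyadic times its limit is
   a supremum which exists without reference to the Dirichlet form. *)
Definition En n w : R := pform (dy n) w w / dy n.

Lemma En_def n w : En n w = pform (dy n) w w / dy n.
Proof. by []. Qed.

Lemma En_ge0 n w : Lp 2 w -> 0 <= En n w.
Proof. by move=> Lw; rewrite divr_ge0 ?(ltW (dy_gt0 n))//; exact: (form_ge0 sg (dy_gt0 n)). Qed.

Lemma En_ndS n w : Lp 2 w -> En n w <= En n.+1 w.
Proof.
move=> Lw; rewrite /En ler_pdivrMr ?dy_gt0//.
have := form_half sg (dy_gt0 n.+1) Lw; rewrite dyS => /le_trans; apply.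
rewrite -[X in _ / _ * X]dyS mulrDr divfK ?gt_eqF ?dy_gt0//.
by rewrite (_ : 2 = 1 + 1) ?mulrDl ?mul1r.
Qed.

Lemma En_nd w : Lp 2 w -> nondecreasing_seq (fun n => (En n w)%:E).
Proof. by move=> Lw; apply/nondecreasing_seqP => n; rewrite lee_fin; exact: En_ndS. Qed.

Definition Esup w : \bar R := limn (fun n => (En n w)%:E).

Lemma En_le_Esup n w : Lp 2 w -> ((En n w)%:E <= Esup w)%E.
Proof. by move=> Lw; exact: (nondec_limn_ge n (En_nd Lw)). Qed.

Lemma Esup_ge0 w : Lp 2 w -> (0 <= Esup w)%E.
Proof. by move=> Lw; apply: le_trans (En_le_Esup 0 Lw); rewrite lee_fin; exact: En_ge0. Qed.

Variables (r : R) (f : T -> R).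
Hypotheses (r1 : 1 <= r) (Lf : Lp (2 * r) f).
Let r21 : 1 <= 2 * r. Proof. by move: r1; lra. Qed.
Let mf : measurable_fun setT f := Lp_meas Lf.

Definition psit t x : R := spow r (Pr t f x).

Lemma psitE t : psit t = fun x => spow r (Pr t f x). Proof. by []. Qed.

Lemma psit_Lp2 t : 0 < t -> Lp 2 (psit t).
Proof. by move=> t0; apply: spow_Lp2 => //; exact: (Lp_Pr sg). Qed.

Lemma measurable_psit : measurable_fun setT (fun z : measurableTypeR R * T => psit z.1 z.2).
Proof. by apply: measurable_spow; exact: measurable_Pr_joint. Qed.

Lemma measurable_pform_psit h : measurable_fun setT (fun t : measurableTypeR R => pform h (psit t) (psit t)).
Proof.
have -> : (fun t : measurableTypeR R => pform h (psit t) (psit t)) =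
    (fun t => \int[m]_x (fun z : measurableTypeR R * T =>
       (psit z.1 z.2 - Pr h (psit z.1) z.2) * psit z.1 z.2) (t, x)).
  by apply/funext => t; rewrite pform_def.
apply: (@measurable_Rint_param R _ _ (measurableTypeR R) T m (fun z : measurableTypeR R * T =>
       (psit z.1 z.2 - Pr h (psit z.1) z.2) * psit z.1 z.2)); apply: measurable_funM; last exact: measurable_psit.
apply: measurable_funB; first exact: measurable_psit.
exact: (@measurable_Pr_param R _ _ (measurableTypeR R) T k h (fun z : measurableTypeR R * T => psit z.1 z.2) measurable_psit).
Qed.

Lemma measurable_En_psit n : measurable_fun setT (fun t : measurableTypeR R => (En n (psit t))%:E).
Proof.
by apply/measurable_EFinP; apply: measurable_funM => //; exact: measurable_pform_psit.
Qed.

Let step_up h s : 0 < h -> 0 < s ->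
  pform (h + h) (psit (s + h)) (psit (s + h)) <=
  2 * (nu m (2 * r) (Pr s f) - nu m (2 * r) (Pr (s + h) f)).
Proof.
move=> h0 s0; have LP := Lp_Pr sg s0 r21 Lf.
have hh0 : 0 < h + h by rewrite addr_gt0.
have := form_decrement_le sg h0 r1 LP.
rewrite -(nu_PrD sg h0 s0 r21 Lf) (addrC h s) => H.
have LPP : Lp (2 * r) (Pr h (Pr s f)) by exact: (Lp_Pr sg).
rewrite (pform_ae sg hh0 (psit_Lp2 (addr_gt0 s0 h0)) (spow_Lp2 r1 LPP))//.
by rewrite addrC; apply: filterS (PrD sg h0 s0 r21 Lf) => x; rewrite /psit => ->.
Qed.

Let step_low h s : 0 < h -> 0 < s ->
  nu m (2 * r) (Pr s f) - nu m (2 * r) (Pr (s + h) f) <= 4 * r * pform h (psit s) (psit s).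
Proof.
move=> h0 s0; have LP := Lp_Pr sg s0 r21 Lf.
have := Np_decrement_le sg h0 r1 LP.
by rewrite -(nu_PrD sg h0 s0 r21 Lf) (addrC h s).
Qed.

Local Notation mu := (@lebesgue_measure R).

(** Nothing is known about the kernel at times t <= 0; the maximum makes the integrand nonnegative
    everywhere, and it changes nothing for t > 0. *)
Let e n (t : measurableTypeR R) : R := Num.max 0 (En n (psit t)).

Let me n : measurable_fun setT (e n).
Proof. by apply: measurable_maxr => //; apply/measurable_EFinP; exact: measurable_En_psit. Qed.

Let e0 n t : 0 <= e n t. Proof. by rewrite le_max lexx. Qed.

Let eE n t : 0 < t -> e n t = En n (psit t).
Proof. by move=> t0; apply/max_idPr; apply: En_ge0; exact: psit_Lp2. Qed.

Let N t := nu m (2 * r) (Pr t f).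

Let N0 t : 0 < t -> 0 <= N t. Proof. by move=> _; exact: nu_ge0. Qed.

Lemma integral_En_le n :
  (\int[mu]_(t in `[dy n.+1, +oo[) (e n t)%:E <= (nu m (2 * r) f)%:E)%E.
Proof.
(* The step is half of [dy n], because [form_decrement_le] bounds the form at the doubled time; then
   c M h is exactly the p-th power of the norm. *)
have := @tile_upper R (e n) N (dy n.+1) (me n) (e0 n) (dy_gt0 n.+1) N0 (2 / dy n) (nu m (2 * r) f).
have -> : 2 / dy n * nu m (2 * r) f * dy n.+1 = nu m (2 * r) f.
  rewrite -(dyS n); move: (dy_gt0 n.+1); move: (dy n.+1) (nu _ _ _) => D M D0.
  by field; rewrite gt_eqF// addr_gt0.
apply => [|s s0|s s0].
- by rewrite divr_ge0 ?(ltW (dy_gt0 n)).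
- rewrite eE ?addr_gt0 ?dy_gt0// /En ler_pdivrMr ?dy_gt0//.
  rewrite -[X in pform X]dyS; apply: (le_trans (step_up (dy_gt0 n.+1) s0)).
  by rewrite mulrAC divfK ?gt_eqF ?dy_gt0.
- exact: (nu_Pr sg).
Qed.

(** One half of Hardy-Stein. Besides its use for p = 2 it shows that the energy of [psit t] is
    finite for almost every t. *)
Lemma integral_Esup_le :
  (\int[mu]_(t in `]0%R, +oo[) Esup (psit t) <= (nu m (2 * r) f)%:E)%E.
Proof.
have := @monotone_sup_integral R e (fun n => dy n.+1) (nu m (2 * r) f) me e0.
rewrite (@eq_integral _ _ R mu `]0%R, +oo[%classic (fun t => Esup (psit t)) (fun t => limn (fun n => (e n t)%:E))) => [|t]; last first.
  rewrite inE/= in_itv/= andbT => t0; rewrite /Esup; congr (limn _).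
  by apply/funext => n; rewrite eE.
apply => [n t t0|n|n||n].
- by rewrite !eE//; apply: En_ndS; exact: psit_Lp2.
- exact: dy_gt0.
- by rewrite -(dyS n.+1) lerDl ltW// dy_gt0.
- by have := cvg_dy; rewrite -cvg_shiftS.
- exact: integral_En_le.
Qed.

(** The tiling needs N at a positive time, so the bound is on P_h f with h = [dy n]; the passage to
    f itself is [nu_le_approx]. *)
Lemma nu_dy_le n : nu m (2 * r) (Pr t f) @[t --> +oo%R] --> (0:R) ->
  ((nu m (2 * r) (Pr (dy n) f))%:E <= (4 * r)%:E * \int[mu]_(t in `]0%R, +oo[) Esup (psit t))%E.
Proof.
move=> stable; have d0 := dy_gt0 n.
have r40 : 0 <= 4 * r by move: r1; lra.
have := @tile_lower R (e n) N (dy n) (me n) (e0 n) d0 N0 (4 * r * dy n).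
rewrite mulr_ge0 ?(ltW d0)// => /(_ isT) H.
have {}H := H _ _ stable.
have : ((N (dy n) * dy n)%:E <= (4 * r * dy n)%:E * \int[mu]_(t in `]0%R, +oo[) (e n t)%:E)%E.
  apply: H => [s s0|s t s0 st].
    apply: (le_trans (step_low d0 s0)); rewrite eE// /En -[leRHS]mulrA.
    by rewrite (mulrC (dy n)) divfK ?gt_eqF.
  exact: (nu_mono sg).
rewrite [X in (X%:E <= _)%E]mulrC [4 * r * _]mulrC !EFinM -muleA lee_pmul2l// ?lte_fin// => /le_trans; apply.
rewrite lee_wpmul2l// ?lee_fin//; last first.
have mEsup : measurable_fun (`]0%R, +oo[%classic : set (measurableTypeR R)) (fun t : measurableTypeR R => Esup (psit t)).
  apply: (@emeasurable_fun_cvg _ _ _ _ (fun n t => (En n (psit t))%:E)).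
    by move=> i; apply: measurable_funTS; exact: measurable_En_psit.
  move=> t; rewrite /= in_itv/= andbT => t0.
  exact: ereal_nondecreasing_is_cvgn (En_nd (psit_Lp2 t0)).
apply: ge0_le_integral => //.
- by move=> t _; rewrite lee_fin.
- by apply: measurable_funTS; exact/measurable_EFinP.
- move=> t; rewrite /= in_itv/= andbT => t0.
  by rewrite eE//; apply: En_le_Esup; exact: psit_Lp2.
Qed.

End dyadic_energy.

Local Opaque En Esup psit.

Lemma limn_einf_le {R : realType} (u : (\bar R)^nat) (M : \bar R) :
  (forall n, u n <= M)%E -> (limn_einf u <= M)%E.
Proof.
move=> uM; rewrite limn_einf_lim; apply: lime_le; first exact: is_cvg_einfs.
apply: nearW => n; apply: le_trans (uM n); rewrite /einfs.
by apply: ereal_inf_lbound; exists n => /=.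
Qed.

Lemma limn_einf_ge0 {R : realType} (u : (\bar R)^nat) :
  (forall n, 0 <= u n)%E -> (0 <= limn_einf u)%E.
Proof.
move=> u0; rewrite limn_einf_lim; apply: lime_ge; first exact: is_cvg_einfs.
by apply: nearW => n; apply/le_ereal_inf_tmp => _ [k _ <-].
Qed.

Section almost_everywhere_limits.
Context {R : realType} {d} {T : measurableType d} (mu : {measure set T -> \bar R}).

Lemma fatou_einf (g : nat -> T -> \bar R) (G : T -> \bar R) :
  (forall n, measurable_fun setT (g n)) -> (forall n x, 0 <= g n x)%E ->
  measurable_fun setT G -> (forall x, 0 <= G x)%E ->
  {ae mu, forall x, (G x <= limn_einf (g ^~ x))%E} ->
  (\int[mu]_x G x <= limn_einf (fun n => \int[mu]_x g n x))%E.
Proof.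
move=> mg g0 mG G0 Gg.
apply: (@le_trans _ _ (\int[mu]_x limn_einf (g ^~ x))%E); last first.
  exact: (fatou mu measurableT mg (fun n x _ => g0 n x)).
apply: ae_ge0_le_integral => //.
- by move=> x _; apply: limn_einf_ge0 => n.
- rewrite (_ : (fun x => _) = (fun x => limn (einfs (g ^~ x)))); last first.
    by apply/funext => x; rewrite limn_einf_lim.
  apply: (emeasurable_fun_cvg (fun n x => einfs (g ^~ x) n)).
    exact: measurable_fun_einfs.
  by move=> x _; exact: is_cvg_einfs.
- by apply: filterS Gg.
Qed.

Lemma fatou_ae (g : nat -> T -> \bar R) (G : T -> \bar R) (M : \bar R) :
  (forall n, measurable_fun setT (g n)) -> (forall n x, 0 <= g n x)%E ->
  measurable_fun setT G -> (forall x, 0 <= G x)%E ->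
  {ae mu, forall x, (G x <= limn_einf (g ^~ x))%E} ->
  (forall n, \int[mu]_x g n x <= M)%E -> (\int[mu]_x G x <= M)%E.
Proof.
move=> mg g0 mG G0 Gg bd.
by apply: (le_trans (fatou_einf mg g0 mG G0 Gg)); exact: limn_einf_le.
Qed.

(** Along indices where the integrals are at most 2^(-i) the series has a finite integral, hence
    converges almost everywhere, and its terms tend to 0. *)
Lemma ae_subseq (g : nat -> T -> R) :
  (forall n, measurable_fun setT (g n)) -> (forall n x, 0 <= g n x) ->
  (forall e : R, 0 < e -> forall N, exists2 n, (N <= n)%N & (\int[mu]_x (g n x)%:E <= e%:E)%E) ->
  exists2 phi : nat -> nat, (forall i, (i <= phi i)%N) &
    {ae mu, forall x, g (phi i) x @[i --> \oo] --> (0 : R)}.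
Proof.
move=> mg g0 small.
have /choice[phi phiP] : forall i, exists n, (i <= n)%N /\ (\int[mu]_x (g n x)%:E <= (@dy R i)%:E)%E.
  by move=> i; have [n iN h] := small _ (@dy_gt0 R i) i; exists n.
exists phi; first by move=> i; have [] := phiP i.
have mgE n : measurable_fun setT (fun x => (g (phi n) x)%:E) by exact/measurable_EFinP.
pose S x := (\sum_(0 <= i <oo) (g (phi i) x)%:E)%E.
have mS : measurable_fun setT S.
  by apply: ge0_emeasurable_sum => // i x _ _; rewrite lee_fin.
have S0 x : (0 <= S x)%E by apply: nneseries_ge0 => i _ _; rewrite lee_fin.
have : (\int[mu]_x S x < +oo)%E.
  rewrite /S integral_nneseries//; last by move=> n x _; rewrite lee_fin.
  apply: (@le_lt_trans _ _ 2%:E); last exact: ltry.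
  apply: lime_le; first by apply: is_cvg_nneseries => n _ _; apply: integral_ge0 => x _; rewrite lee_fin.
  apply: nearW => n.
  apply: (@le_trans _ _ (\sum_(0 <= i < n) (@dy R i)%:E)%E).
    by apply: lee_sum => i _; have [] := phiP i.
  rewrite sumEFin lee_fin.
  suff -> : \sum_(0 <= i < n) (@dy R i) = 2 - 2 * dy n by rewrite gerBl mulr_ge0// ltW// dy_gt0.
  elim: n => [|n IH]; first by rewrite big_geq// /dy expr0 mulr1 subrr.
  by rewrite big_nat_recr//= IH -(dyS n); ring.
move=> /(fin_ae_bounded mS S0); apply: filterS => x Sx.
apply: cvg_series_cvg_0; apply: nondecreasing_is_cvgn.
  by apply: nondecreasing_series => n _ _; exact: g0.
exists (fine (S x)) => _ [n _ <-].
rewrite -lee_fin fineK ?ge0_fin_numE// /series/= -sumEFin.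
by apply: nneseries_lim_ge => i _ _; rewrite lee_fin.
Qed.

End almost_everywhere_limits.

(** * Recovering the norm at time zero *)

Section strong_continuity.
Context {R : realType} {d} {T : measurableType d}.
Variables (m : {measure set T -> \bar R}) (k : R.-spker (measurableTypeR R * T) ~> T).
Hypothesis sg : symmetric_semigroup m k.
Implicit Types (p M : R) (f w : T -> R).
Local Notation Pr := (Pr k).
Local Notation Lp := (Lp m).

Hypothesis cont : forall f, Lp 2 f -> forall e : R, 0 < e ->
  exists N, forall n, (N <= n)%N -> (Np m 2 (fun x => (Pr (dy n) f x - f x)%R) <= e%:E)%E.

Let nu_le_approx2 p w M : 0 < p -> Lp 2 w -> Lp p w ->
  (forall n, Np m p (Pr (dy n) w) <= M%:E)%E -> (Np m p w <= M%:E)%E.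
Proof.
move=> p0 Lw2 Lw bd.
have mw := Lp_meas Lw.
have mP n : measurable_fun setT (Pr (dy n) w) by exact: measurable_Pr.
have [phi _ ae_phi] : exists2 phi : nat -> nat, (forall i, (i <= phi i)%N) &
    {ae m, forall x, `|Pr (dy (phi i)) w x - w x| `^ 2 @[i --> \oo] --> (0 : R)}.
  apply: (@ae_subseq _ _ _ m (fun n x => `|Pr (dy n) w x - w x| `^ 2)).
  - by move=> n; apply: measurable_norm_powR; exact: measurable_funB.
  - by move=> n x; exact: powR_ge0.
  - move=> e e0 N; have [N' HN'] := cont Lw2 e0.
    exists (maxn N N'); first exact: leq_maxl.
    by have := HN' _ (leq_maxr N N'); rewrite Np_def.
rewrite Np_def; apply: (@fatou_ae _ _ _ m (fun i x => (`|Pr (dy (phi i)) w x| `^ p)%:E)).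
- by move=> n; apply/measurable_EFinP; exact: measurable_norm_powR.
- by move=> n x; rewrite lee_fin powR_ge0.
- by apply/measurable_EFinP; exact: measurable_norm_powR.
- by move=> x; rewrite lee_fin powR_ge0.
- apply: filterS ae_phi => x xphi.
  have c0 : Pr (dy (phi i)) w x - w x @[i --> \oo] --> 0.
    have : Num.sqrt (`|Pr (dy (phi i)) w x - w x| `^ 2) @[i --> \oo] --> Num.sqrt (0 : R).
      by apply: continuous_cvg => //; exact: sqrt_continuous.
    rewrite sqrtr0 => h; apply/norm_cvg0P; apply: cvg_trans h.
    by apply: near_eq_cvg; near=> i; rewrite powR2 sqrtr_sqr.
  have [->|wx0] := eqVneq (w x) 0.
    rewrite normr0 powR0 ?gt_eqF//; apply: limn_einf_ge0 => n.
    by rewrite lee_fin powR_ge0.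
  have c1 : Pr (dy (phi i)) w x @[i --> \oo] --> w x by exact/subr_cvg0.
  rewrite (@cvg_limn_einf_sup _ _ (`|w x| `^ p)%:E _).1//.
  by apply: cvg_EFin; [exact: nearW|exact: cvg_norm_powR].
- by move=> n; rewrite -Np_def.
Unshelve. all: by end_near. Qed.

Section truncation.
Variables (p : R) (f : T -> R).
Hypotheses (p2 : 2 <= p) (Lf : Lp p f).
Let mf : measurable_fun setT f := Lp_meas Lf.
Let p0 : 0 < p. Proof. by move: p2; lra. Qed.
Let p1 : 1 <= p. Proof. by move: p2; lra. Qed.

(** The small values are the ones removed: since p >= 2, they alone can keep a function of L^p out
    of L^2. *)
Definition trunc j x : R := if (j.+1%:R^-1 < `|f x|) then f x else 0.
Let rest j x : R := if (j.+1%:R^-1 < `|f x|) then 0 else f x.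

Lemma measurable_large j : measurable_fun setT (fun x => j.+1%:R^-1 < `|f x|).
Proof. by apply: measurable_fun_ltr => //; exact: measurableT_comp. Qed.

Lemma Lp_trunc j : Lp p (trunc j).
Proof.
apply: (Lp_dom Lf); last 2 first; first exact: ltW.
  by move=> x; rewrite /trunc; case: ifP => // _; rewrite normr0.
by apply: measurable_fun_ifT => //; exact: measurable_large.
Qed.

Let Lp_rest j : Lp p (rest j).
Proof.
apply: (Lp_dom Lf); last 2 first; first exact: ltW.
  by move=> x; rewrite /rest; case: ifP => // _; rewrite normr0.
by apply: measurable_fun_ifT => //; exact: measurable_large.
Qed.

Lemma Lp2_trunc j : Lp 2 (trunc j).
Proof.
split; first exact: Lp_meas (Lp_trunc j).
pose c : R := j.+1%:R `^ (p - 2).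
apply: (@le_lt_trans _ _ (c%:E * Np m p f)%E); last first.
  by apply: lte_mul_pinfty; rewrite ?lee_fin ?powR_ge0//; exact: Lp_fin Lf.
have mfp : measurable_fun setT (fun x => (`|f x| `^ p)%:E).
  by apply/measurable_EFinP; exact: measurable_norm_powR.
have c0 : (0 <= c%:E)%E by rewrite lee_fin powR_ge0.
rewrite !Np_def -ge0_integralZl//.
apply: le_intT => [x|||x].
- by rewrite lee_fin powR_ge0.
- by apply/measurable_EFinP; apply: measurable_norm_powR; exact: Lp_meas (Lp_trunc j).
- exact: measurable_funeM.
rewrite -EFinM lee_fin /trunc; case: ifPn => [lt|_]; last first.
  by rewrite normr0 powR0 ?mulr_ge0 ?powR_ge0// gt_eqF.
have f0 : 0 < `|f x| by apply: lt_trans lt; rewrite invr_gt0.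
have -> : `|f x| `^ p = `|f x| `^ (p - 2) * `|f x| `^ 2.
  by rewrite -powRD ?subrK// (gt_eqF f0) implybT.
rewrite mulrA /c -powRM ?normr_ge0// ler_peMl ?powR_ge0//.
rewrite -[leLHS](powRr0 (j.+1%:R * `|f x|)) ler_powR ?subr_ge0//.
by rewrite -ler_pdivrMl// mulr1 ltW.
Qed.

Let nu_split j : nu m p f = nu m p (trunc j) + nu m p (rest j).
Proof.
have e : nu m p f = \int[m]_x (`|trunc j x| `^ p + `|rest j x| `^ p).
  apply: (@ae_RintegralE _ _ _ m).
  - exact: measurable_norm_powR.
  - by apply: measurable_funD; apply: measurable_norm_powR; [exact: Lp_meas (Lp_trunc j)|exact: Lp_meas (Lp_rest j)].
  - apply: nearW => x; rewrite /trunc /rest; case: ifP => _; rewrite normr0 powR0 ?gt_eqF//.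
      by rewrite addr0.
    by rewrite add0r.
rewrite e (RintegralDf (Lp_integrable (Lp_trunc j)) (Lp_integrable (Lp_rest j))).
by [].
Qed.

Let nu_Pr_trunc n j : nu m p (Pr (dy n) (trunc j)) <=
  2 `^ p * (nu m p (Pr (dy n) f) + nu m p (rest j)).
Proof.
have d0 := @dy_gt0 R n.
have Lt := Lp_Pr sg d0 p1 (Lp_trunc j); have LPf := Lp_Pr sg d0 p1 Lf.
have Lr := Lp_Pr sg d0 p1 (Lp_rest j).
apply: (@le_trans _ _ (2 `^ p * (nu m p (Pr (dy n) f) + nu m p (Pr (dy n) (rest j))))); last first.
  by rewrite ler_wpM2l ?powR_ge0// lerD2l; exact: (nu_Pr sg d0 p1 (Lp_rest j)).
rewrite -(RintegralDf (Lp_integrable LPf) (Lp_integrable Lr)).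
have isum := integrable_addf (Lp_integrable LPf) (Lp_integrable Lr).
rewrite -(RintegralZf _ isum); apply: (ae_le_Rintegral (Lp_integrable Lt) (integrable_scalef _ isum)).
apply: filterS2 (Lp_ae_integrable sg d0 p1 Lf) (Lp_ae_integrable sg d0 p1 (Lp_rest j)) => x ifx irx.
have -> : Pr (dy n) (trunc j) x = Pr (dy n) f x - Pr (dy n) (rest j) x.
  rewrite !PrE -(RintegralBf ifx irx); apply: eq_Rintegral => y _.
  by rewrite /trunc /rest; case: ifP => _; rewrite ?subr0// subrr.
apply: le_trans (powR_add_le (ltW p0) (normr_ge0 _) (normr_ge0 _)).
by rewrite ge0_ler_powR ?nnegrE ?addr_ge0// ?(ltW p0)// ler_normB.
Qed.

Let nu_rest : nu m p (rest j) @[j --> \oo] --> (0 : R).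
Proof.
have mr j : measurable_fun setT (fun x => (`|rest j x| `^ p)%:E).
  by apply/measurable_EFinP; apply: measurable_norm_powR; exact: Lp_meas (Lp_rest j).
have : (\int[m]_x (`|rest j x| `^ p)%:E)%E @[j --> \oo] --> (\int[m]_x (cst 0 x))%E.
  apply: (@dominated_cvg _ _ _ m setT measurableT _ (cst 0%E) (fun x => (`|f x| `^ p)%:E)) => //.
  - move=> x _; apply: cvg_near_cst.
    have [fx0|fx0] := eqVneq (f x) 0.
      by apply: nearW => j; rewrite /rest fx0 if_same normr0 powR0// gt_eqF.
    near=> j; rewrite /rest ifT ?normr0 ?powR0 ?gt_eqF//.
    near: j; apply: near_infty_natSinv_lt (PosNum _) => /=; rewrite ?normr_gt0//.
  - exact: (Lp_integrable Lf).
  - move=> j x _; rewrite gee0_abs ?lee_fin ?powR_ge0//.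
    rewrite ge0_ler_powR ?nnegrE// ?(ltW p0)// /rest; case: ifP => // _.
    by rewrite normr0.
rewrite integral0 => h.
apply: (cvg_trans _ (fine_cvg h)); apply: near_eq_cvg; apply: nearW => j.
by have := Np_nu (Lp_rest j); rewrite Np_def /= => ->.
Unshelve. all: by end_near. Qed.

(** Continuity at time 0 is known in L^2 only. It is applied to the truncations, through an almost
    everywhere convergent subsequence and Fatou; comparing P_h of a truncation with P_h f costs the
    factor 2^p, and the norm of the rest tends to 0. *)
Lemma nu_le_approx M : (forall n, nu m p (Pr (dy n) f) <= M) -> nu m p f <= 2 `^ p * M.
Proof.
move=> bd.
have bd' j : nu m p f <= 2 `^ p * M + (2 `^ p + 1) * nu m p (rest j).
  rewrite (nu_split j) mulrDl mul1r addrA lerD2r -mulrDr -lee_fin.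
  rewrite -(Np_nu (Lp_trunc j)).
  apply: (nu_le_approx2 p0 (Lp2_trunc j) (Lp_trunc j)) => n.
  rewrite (Np_nu (Lp_Pr sg (dy_gt0 n) p1 (Lp_trunc j))) lee_fin.
  by apply: (le_trans (nu_Pr_trunc n j)); rewrite ler_wpM2l ?powR_ge0// lerD2r.
have lim : 2 `^ p * M + (2 `^ p + 1) * nu m p (rest j) @[j --> \oo] --> 2 `^ p * M + (2 `^ p + 1) * 0.
  by apply: cvgD; [exact: cvg_cst|apply: cvgM; [exact: cvg_cst|exact: nu_rest]].
rewrite mulr0 addr0 in lim.
by apply: (cvgr_to_ge lim); apply: nearW.
Qed.

End truncation.

End strong_continuity.

(** * The lower bound *)

Section tonelli.
Context {R : realType} {d} {T : measurableType d}.
Variable m : {sigma_finite_measure set T -> \bar R}.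
Local Notation mu := (@lebesgue_measure R).

Lemma tonelli_itv (D : set (measurableTypeR R)) (F : measurableTypeR R * T -> \bar R) :
  measurable D -> measurable_fun setT F -> (forall z, 0 <= F z)%E ->
  (\int[mu]_(t in D) \int[m]_x F (t, x) = \int[m]_x \int[mu]_(t in D) F (t, x))%E.
Proof.
move=> mD mF F0.
pose G (z : measurableTypeR R * T) : \bar R := (F z * (\1_D z.1)%:E)%E.
have mG : measurable_fun setT G.
  apply: emeasurable_funM => //; apply/measurable_EFinP.
  exact: measurableT_comp (measurable_indic _) measurable_fst.
have G0 z : (0 <= G z)%E by rewrite /G mule_ge0// lee_fin.
transitivity (\int[mu]_t \int[m]_x G (t, x))%E.
  rewrite integral_mkcond; apply: eq_integral => t _; rewrite patchE /G/=.
  case: (boolP (t \in D)) => tD; rewrite indicE ?tD ?(negbTE tD)/=.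
    by apply: eq_integral => x _; rewrite mule1.
  by rewrite integral0_eq// => x _; rewrite mule0.
rewrite (@fubini_tonelli _ _ (measurableTypeR R) T R mu m G mG G0).
apply: eq_integral => x _; rewrite [RHS]integral_mkcond; apply: eq_integral => t _.
by rewrite patchE /G/= indicE; case: (t \in D); rewrite ?mule1 ?mule0.
Qed.

End tonelli.

Lemma measurable_chi {R : realType} {d} {T : measurableType d} (f g : T -> R) :
  measurable_fun setT f -> measurable_fun setT g ->
  measurable_fun setT (fun x => chi (f x) (g x)).
Proof.
move=> mf mg; have mnf : measurable_fun setT (fun x => `|f x|) by exact: measurableT_comp.
have mng : measurable_fun setT (fun x => `|g x|) by exact: measurableT_comp.
apply: measurable_fun_ifT; [exact: measurable_fun_ltr|exact: measurable_cst|].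
by apply: measurable_fun_ifT => //; exact: measurable_fun_eqr.
Qed.

(** The factors come from [nu_le_approx], from the Hardy-Stein step [Np_decrement_le], and from the
    Lipschitz bound [spow_lip]. *)
Definition sqf_lower_cst {R : realType} (r : R) : R := 2 `^ (2 * r) * (4 * r) * r ^+ 2.

(** The tangent inequality for s at the point dl a^2, divided by dl^(r-1). Integrated, it plays the
    part of Hoelder's inequality and leaves a small multiple of the norm to absorb. *)
Lemma young_weight {R : realType} (r dl a s : R) : 1 <= r -> 0 < dl -> 0 <= s ->
  `|a| `^ (2 * r - 2) * s <= dl * `|a| `^ (2 * r) + (dl `^ (r - 1))^-1 * s `^ r.
Proof.
move=> r1 dl0 s0.
have aux (E W N S d q t : R) : 1 <= q -> 0 <= S -> 0 <= N -> 0 < d -> 0 < E ->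
    q * (E * W) * t <= S + (q - 1) * (d * (E * N)) -> W * t <= d * N + E^-1 * S.
  move=> q1 S0 N0 d0 E0 h.
  rewrite -(ler_pM2l E0) mulrDr (mulrA E (E^-1)) divff ?gt_eqF// mul1r.
  have : 0 <= d * (E * N) by rewrite !mulr_ge0// ltW.
  by move: h; move: (d * (E * N)) (mulrA d E N) => X; nra.
have a2W : a ^+ 2 * `|a| `^ (2 * r - 2) = `|a| `^ (2 * r).
  rewrite -powR2 -powRD ?[2 + _]addrC ?subrK//.
  by apply/implyP => /eqP h; exfalso; move: r1 h; lra.
have yr : (dl * a ^+ 2) `^ (r - 1) = dl `^ (r - 1) * `|a| `^ (2 * r - 2).
  by rewrite (powRM _ (ltW dl0) (sqr_ge0 a)) -powR2 -powRrM; congr (_ * _ `^ _); ring.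
have := powR_tangent r1 s0 (mulr_ge0 (ltW dl0) (sqr_ge0 a)).
rewrite mulr_powRB1_ge0// yr (_ : dl * a ^+ 2 * _ = dl * (dl `^ (r - 1) * `|a| `^ (2 * r))); last first.
  by rewrite -a2W; ring.
by apply: aux => //; rewrite ?powR_ge0 ?powR_gt0.
Qed.

Section jump_structure.
Context {R : realType} {d} {T : measurableType d}.
Variables (m : {sigma_finite_measure set T -> \bar R}).
Variables (k : R.-spker (measurableTypeR R * T) ~> T) (K : R.-sfker T ~> T).
Local Notation mu := (@lebesgue_measure R).
Local Notation Pe := (Pe k).
Local Notation Pr := (Pr k).
Local Notation Lp := (Lp m).
Implicit Types (t s r : R) (f w : T -> R).

(** Twice the jump energy. Integrating over all y is harmless, as the integrand vanishes on the
    diagonal. *)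
Definition jform w : \bar R := (\int[m]_x \int[K x]_y ((w y - w x) ^+ 2)%:E)%E.

Lemma jform_def w : jform w = (\int[m]_x \int[K x]_y ((w y - w x) ^+ 2)%:E)%E.
Proof. by []. Qed.

Definition symmetric_jumps : Prop := forall F : T * T -> \bar R, measurable_fun setT F ->
  (forall z, 0 <= F z)%E -> (forall x, F (x, x) = 0)%E ->
  (\int[m]_x \int[K x]_y F (x, y) = \int[m]_x \int[K x]_y F (y, x))%E.

(* What the inequalities use of the setting: the Dirichlet form enters only through [js_energy]. *)
Record jump_semigroup : Prop := {
  js_semigroup : symmetric_semigroup m k;
  js_symmetric : symmetric_jumps;
  js_energy : forall w, Lp 2 w -> (Esup m k w < +oo)%E ->
    Esup m k w = ((2^-1)%:E * jform w)%E;
  js_continuous : forall f, Lp 2 f -> forall e : R, 0 < e ->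
    exists N, forall n, (N <= n)%N -> (Np m 2 (fun x => (Pr (dy n) f x - f x)%R) <= e%:E)%E
}.

Hypothesis js : jump_semigroup.
Let sg := js_semigroup js.

Definition carre (u : T -> R) z : \bar R :=
  (\int[K z]_y ((u y - u z) ^+ 2 * chi (u z) (u y))%:E)%E.

(** The square of the square function; the exponent 1/2 returns only in the norms. *)
Definition sqf f x : \bar R :=
  (\int[mu]_(t in `[0%R, +oo[) Pe t (carre (Pr t f)) x)%E.

Lemma carre_def u z : carre u z = (\int[K z]_y ((u y - u z) ^+ 2 * chi (u z) (u y))%:E)%E.
Proof. by []. Qed.

Lemma sqf_def f x : sqf f x = (\int[mu]_(t in `[0%R, +oo[) Pe t (carre (Pr t f)) x)%E.
Proof. by []. Qed.

Let integrand_ge0 (u : T -> R) y z : 0 <= (u y - u z) ^+ 2 * chi (u z) (u y).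
Proof. by rewrite mulr_ge0 ?sqr_ge0 ?chi_ge0. Qed.

Lemma carre_ge0 u z : (0 <= carre u z)%E.
Proof. by apply: integral_ge0 => y _; rewrite lee_fin integrand_ge0. Qed.

Lemma measurable_carre_joint f : measurable_fun setT f ->
  measurable_fun setT (fun z : measurableTypeR R * T => carre (Pr z.1 f) z.2).
Proof.
move=> mf; have mP := measurable_Pr_joint k mf.
have mphi : measurable_fun setT (fun z : measurableTypeR R * T => z.2) by exact: measurable_snd.
apply: (measurable_int_reindex mphi K (F := fun z : (measurableTypeR R * T) * T =>
  ((Pr z.1.1 f z.2 - Pr z.1.1 f z.1.2) ^+ 2 * chi (Pr z.1.1 f z.1.2) (Pr z.1.1 f z.2))%:E)); last first.
  by move=> z; rewrite lee_fin integrand_ge0.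
have m1 : measurable_fun setT (fun z : (measurableTypeR R * T) * T => Pr z.1.1 f z.1.2).
  exact: (measurableT_comp mP measurable_fst).
have m2 : measurable_fun setT (fun z : (measurableTypeR R * T) * T => Pr z.1.1 f z.2).
  have h : measurable_fun setT (fun z : (measurableTypeR R * T) * T => (z.1.1, z.2)).
    apply: (@measurable_fun_pair _ _ _ _ _ _ (fun z : (measurableTypeR R * T) * T => z.1.1) snd).
      exact: measurableT_comp measurable_fst measurable_fst.
    exact: measurable_snd.
  exact: (measurableT_comp mP h).
apply/measurable_EFinP; apply: measurable_funM; last exact: measurable_chi.
by apply: measurable_funX; exact: measurable_funB.
Qed.

Lemma measurable_carre t f : measurable_fun setT f -> measurable_fun setT (carre (Pr t f)).
Proof.
by move=> mf; exact: (measurableT_comp (measurable_carre_joint mf) (measurable_time_pair t)).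
Qed.

Lemma measurable_Pe_carre f : measurable_fun setT f ->
  measurable_fun setT (fun z : measurableTypeR R * T => Pe z.1 (carre (Pr z.1 f)) z.2).
Proof.
move=> mf; apply: (measurable_Pe_joint k (measurable_carre_joint mf)).
by move=> z; exact: carre_ge0.
Qed.

Lemma measurable_sqf f : measurable_fun setT f -> measurable_fun setT (sqf f).
Proof.
move=> mf; pose F (z : T * measurableTypeR R) := (Pe z.2 (carre (Pr z.2 f)) z.1 * (\1_`[0%R, +oo[ z.2)%:E)%E.
have -> : sqf f = fun x => (\int[mu]_t F (x, t))%E.
  apply/funext => x; rewrite /sqf integral_mkcond; apply: eq_integral => t _.
  by rewrite patchE /F/= indicE; case: (t \in _); rewrite ?mule1 ?mule0.
apply: (@measurable_fun_fubini_tonelli_F _ _ _ _ R mu F).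
  apply: emeasurable_funM.
    have h : measurable_fun setT (fun z : T * measurableTypeR R => (z.2, z.1)).
      exact: measurable_swap.
    exact: (measurableT_comp (measurable_Pe_carre mf) h).
  apply/measurable_EFinP.
  have mI : measurable (`[0%R, +oo[%classic : set (measurableTypeR R)) by exact: measurable_itv.
  exact: (measurableT_comp (measurable_indic mI) measurable_snd).
by move=> z; rewrite /F mule_ge0 ?lee_fin// Pe_ge0// => y; exact: carre_ge0.
Qed.

Lemma sqf_ge0 f x : (0 <= sqf f x)%E.
Proof. by apply: integral_ge0 => t _; apply: Pe_ge0 => y; exact: carre_ge0. Qed.

Lemma sqfE (g : T -> \bar R) f : measurable_fun setT f -> measurable_fun setT g ->
  (forall x, 0 <= g x)%E ->
  (\int[m]_x (g x * sqf f x) = \int[mu]_(t in `]0%R, +oo[) \int[m]_x (Pe t g x * carre (Pr t f) x))%E.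
Proof.
move=> mf mg g0.
have mPe := measurable_Pe_carre mf.
have mF : measurable_fun setT (fun z : measurableTypeR R * T => (g z.2 * Pe z.1 (carre (Pr z.1 f)) z.2)%E).
  by apply: emeasurable_funM => //; exact: measurableT_comp mg measurable_snd.
transitivity (\int[m]_x \int[mu]_(t in `]0%R, +oo[) (g x * Pe t (carre (Pr t f)) x))%E.
  apply: eq_integral => x _.
  have mx : measurable_fun setT (fun t : measurableTypeR R => Pe t (carre (Pr t f)) x).
    by have := measurableT_comp mPe (@pair2_measurable _ _ (measurableTypeR R) T x).
  rewrite /sqf -integral_itv_obnd_cbnd; last exact: measurable_funTS.
  rewrite ge0_integralZl//; first exact: measurable_funTS.
  by move=> t _; apply: Pe_ge0 => y; exact: carre_ge0.
have F0 z : (0 <= g z.2 * Pe z.1 (carre (Pr z.1 f)) z.2)%E.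
  by rewrite mule_ge0// Pe_ge0// => y; exact: carre_ge0.
have mI : measurable (`]0%R, +oo[%classic : set (measurableTypeR R)) by exact: measurable_itv.
apply: (eq_trans (esym (tonelli_itv m mI mF F0))).
apply: eq_integral => t; rewrite inE/= in_itv/= andbT => t0.
exact: (Pe_sym sg t0 mg (measurable_carre _ mf) g0 (carre_ge0 _)).
Qed.

Lemma measurable_int_jump (B : T * T -> R) : measurable_fun setT B -> (forall z, 0 <= B z) ->
  measurable_fun setT (fun x => \int[K x]_y (B (x, y))%:E)%E.
Proof.
move=> mB B0; apply: (measurable_fun_integral_sfinite_kernel (EFin \o B) K) => //.
exact/measurable_EFinP.
Qed.

Lemma measurable_EFin_slice (B : T * T -> R) x : measurable_fun setT B -> measurable_fun setT (fun y => (B (x, y))%:E).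
Proof.
move=> mB; apply/measurable_EFinP.
exact: (measurableT_comp mB (@pair1_measurable _ _ T T x)).
Qed.

Lemma integral_jump_sym (B : T * T -> R) : measurable_fun setT B -> (forall z, 0 <= B z) ->
  (forall x, B (x, x) = 0) ->
  (\int[m]_x \int[K x]_y (B (x, y) + B (y, x))%:E =
   2%:E * \int[m]_x \int[K x]_y (B (x, y))%:E)%E.
Proof.
move=> mB B0 Bd.
have mB' : measurable_fun setT (fun z : T * T => B (z.2, z.1)).
  by have ms : measurable_fun setT (fun z : T * T => (z.2, z.1)) by [exact: measurable_swap]; exact: (measurableT_comp mB ms).
have B0' z : 0 <= B (z.2, z.1) by exact: B0.
have e : (\int[m]_x \int[K x]_y (B (y, x))%:E = \int[m]_x \int[K x]_y (B (x, y))%:E)%E.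
  have mEB : measurable_fun setT (EFin \o B) by exact/measurable_EFinP.
  have EB0 z : (0 <= (EFin \o B) z)%E by rewrite lee_fin.
  have EBd x : ((EFin \o B) (x, x) = 0)%E by rewrite /= Bd.
  exact: (esym (js_symmetric js mEB EB0 EBd)).
transitivity (\int[m]_x (\int[K x]_y (B (x, y))%:E + \int[K x]_y (B (y, x))%:E))%E.
  apply: eq_integral => x _; rewrite -ge0_integralD//.
  - by move=> y _; rewrite lee_fin.
  - exact: measurable_EFin_slice.
  - by move=> y _; rewrite lee_fin.
  - exact: (measurable_EFin_slice x mB').
rewrite ge0_integralD//.
- by rewrite e -[X in (X + X)%E]mul1e -ge0_muleDl ?lee_fin.
- by move=> x _; apply: integral_ge0 => y _; rewrite lee_fin.
- exact: measurable_int_jump.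
- by move=> x _; apply: integral_ge0 => y _; rewrite lee_fin.
- exact: (measurable_int_jump mB').
Qed.

Section carre_du_champ.
Variable u : T -> R.
Hypothesis mu' : measurable_fun setT u.

Let mu1 : measurable_fun setT (fun z : T * T => u z.1).
Proof. exact: measurableT_comp measurable_fst. Qed.

Let mu2 : measurable_fun setT (fun z : T * T => u z.2).
Proof. exact: measurableT_comp measurable_snd. Qed.

Let mchi : measurable_fun setT (fun z : T * T => (u z.2 - u z.1) ^+ 2 * chi (u z.1) (u z.2)).
Proof.
apply: measurable_funM; last exact: measurable_chi.
by apply: measurable_funX; exact: measurable_funB.
Qed.

(** The weights chi(a, b) and chi(b, a) add up to 1, so symmetrizing the restricted integrand gives
    the full square. *)
Lemma integral_carre : (\int[m]_x carre u x = (2^-1)%:E * jform u)%E.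
Proof.
pose A (z : T * T) : R := (u z.2 - u z.1) ^+ 2 * chi (u z.1) (u z.2).
have A0 z : 0 <= A z by exact: integrand_ge0.
have Ad x : A (x, x) = 0 by rewrite /A/= subrr expr0n/= mul0r.
have := integral_jump_sym mchi A0 Ad.
rewrite (_ : (fun x => \int[K x]_y _)%E = (fun x => \int[K x]_y ((u y - u x) ^+ 2)%:E)%E); last first.
  apply/funext => x; apply: eq_integral => y _; rewrite /=.
  by rewrite -(opprB (u x)) sqrrN -mulrDr chiC mulr1.
by rewrite /jform => ->; rewrite muleA -EFinM mulVf// mul1e.
Qed.

(** [spow_lip] bounds the increment by contributions of the two ends, which have equal integrals by
    symmetry of the jumps; hence the factor 2. *)
Lemma jform_spow_le r : 1 <= r -> (jform (fun x => spow r (u x)) <=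
  (2 * r ^+ 2)%:E * \int[m]_x ((`|u x| `^ (2 * r - 2))%:E * carre u x))%E.
Proof.
move=> r1.
pose A (z : T * T) : R := (u z.2 - u z.1) ^+ 2 * chi (u z.1) (u z.2) * `|u z.1| `^ (2 * r - 2).
have mA : measurable_fun setT A by apply: measurable_funM => //; exact: measurable_norm_powR.
have A0 z : 0 <= A z by rewrite mulr_ge0 ?powR_ge0//; exact: integrand_ge0.
have Ad x : A (x, x) = 0 by rewrite /A/= subrr expr0n/= !mul0r.
have mA' : measurable_fun setT (fun z : T * T => A (z.2, z.1)).
  by have ms : measurable_fun setT (fun z : T * T => (z.2, z.1)) by [exact: measurable_swap]; exact: (measurableT_comp mA ms).
have E1 : (\int[m]_x \int[K x]_y (A (x, y))%:E =
    \int[m]_x ((`|u x| `^ (2 * r - 2))%:E * carre u x))%E.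
  apply: eq_integral => x _; rewrite /carre -ge0_integralZl//.
  - by apply: eq_integral => y _; rewrite -EFinM /A/= mulrC.
  - exact: (measurable_EFin_slice x mchi).
  - by move=> y _; rewrite lee_fin integrand_ge0.
rewrite -E1 mulrC EFinM -muleA -(integral_jump_sym mA A0 Ad).
pose B (z : T * T) : R := A z + A (z.2, z.1).
have mB : measurable_fun setT B by exact: measurable_funD.
have B0 z : 0 <= B z by rewrite addr_ge0.
have r0 : 0 <= r ^+ 2 by rewrite sqr_ge0.
have E2 : ((r ^+ 2)%:E * (\int[m]_x \int[K x]_y (B (x, y))%:E) =
    \int[m]_x \int[K x]_y (r ^+ 2 * B (x, y))%:E)%E.
  rewrite -ge0_integralZl//.
  - apply: eq_integral => x _; rewrite -ge0_integralZl//.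
    + exact: (measurable_EFin_slice x mB).
    + by move=> y _; rewrite lee_fin.
  - exact: measurable_int_jump.
  - by move=> x _; apply: integral_ge0 => y _; rewrite lee_fin.
rewrite [leRHS]E2; apply: le_intT.
- by move=> x; apply: integral_ge0 => y _; rewrite lee_fin sqr_ge0.
- apply: (@measurable_int_jump (fun z => (spow r (u z.2) - spow r (u z.1)) ^+ 2)).
    by apply: measurable_funX; apply: measurable_funB; exact: measurable_spow.
  by move=> z; rewrite sqr_ge0.
- apply: (@measurable_int_jump (fun z => r ^+ 2 * B z)).
    by apply: measurable_funM.
  by move=> z; rewrite mulr_ge0.
move=> x; apply: le_intT.
- by move=> y; rewrite lee_fin sqr_ge0.
- apply: (@measurable_EFin_slice (fun z => (spow r (u z.2) - spow r (u z.1)) ^+ 2)).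
  by apply: measurable_funX; apply: measurable_funB; exact: measurable_spow.
- apply: (@measurable_EFin_slice (fun z => r ^+ 2 * B z)).
  by apply: measurable_funM.
move=> y; rewrite lee_fin -(opprB (spow r (u x))) sqrrN.
apply: (le_trans (spow_lip (u x) (u y) r1)).
by rewrite /B /A/= -(opprB (u x) (u y)) sqrrN.
Qed.

End carre_du_champ.

Section energy_bounds.
Variables (r : R) (f : T -> R).
Hypotheses (r1 : 1 <= r) (Lf : Lp (2 * r) f).
Let r21 : 1 <= 2 * r. Proof. by move: r1; lra. Qed.
Let mf : measurable_fun setT f := Lp_meas Lf.

Lemma measurable_Esup :
  measurable_fun (`]0%R, +oo[%classic : set (measurableTypeR R)) (fun t : measurableTypeR R => Esup m k (psit k r f t)).
Proof.
Local Transparent Esup.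
apply: (@emeasurable_fun_cvg _ _ _ _ (fun n t => (En m k n (psit k r f t))%:E)).
  by move=> i; apply: measurable_funTS; exact: measurable_En_psit.
move=> t; rewrite /= in_itv/= andbT => t0.
exact: ereal_nondecreasing_is_cvgn (En_nd sg (psit_Lp2 sg r1 Lf t0)).
Local Opaque Esup.
Qed.

Lemma Esup_fin : {ae mu, forall t : measurableTypeR R, 0 < t -> (Esup m k (psit k r f t) < +oo)%E}.
Proof.
pose g : measurableTypeR R -> \bar R := (fun t : measurableTypeR R => Esup m k (psit k r f t)) \_ `]0%R, +oo[%classic.
have mg : measurable_fun setT g by apply/(measurable_restrictT _ _).1 => //; exact: measurable_Esup.
have g0 t : (0 <= g t)%E.
  rewrite /g patchE; case: ifPn => //; rewrite inE/= in_itv/= andbT => t0.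
  exact: (Esup_ge0 sg (psit_Lp2 sg r1 Lf t0)).
have : (\int[mu]_t g t < +oo)%E.
  rewrite -integral_mkcond; apply: le_lt_trans (integral_Esup_le sg r1 Lf) _; exact: ltry.
move=> gfin; apply: filterS (fin_ae_bounded mg g0 gfin) => t + t0.
by rewrite /g patchE mem_set//= in_itv/= t0.
Qed.

Lemma Esup_le_carre t : 0 < t -> (Esup m k (psit k r f t) < +oo)%E ->
  (Esup m k (psit k r f t) <=
   (r ^+ 2)%:E * \int[m]_x ((`|Pr t f x| `^ (2 * r - 2))%:E * carre (Pr t f) x))%E.
Proof.
move=> t0 Efin; rewrite (js_energy js (psit_Lp2 sg r1 Lf t0) Efin).
have half0 : (0 <= (2^-1 : R)%:E)%E by rewrite lee_fin invr_ge0.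
apply: (le_trans (lee_wpmul2l half0 (jform_spow_le (measurable_Pr k t mf) r1))).
by rewrite muleA -EFinM mulrA mulVf// mul1r.
Qed.

Lemma hardy_stein_lower : nu m (2 * r) (Pr t f) @[t --> +oo%R] --> (0 : R) ->
  ((nu m (2 * r) f)%:E <=
   (2 `^ (2 * r) * (4 * r))%:E * \int[mu]_(t in `]0%R, +oo[) Esup m k (psit k r f t))%E.
Proof.
move=> stable; pose I := (\int[mu]_(t in `]0%R, +oo[) Esup m k (psit k r f t))%E.
have I0 : (0 <= I)%E.
  apply: integral_ge0 => t; rewrite /= in_itv/= andbT => t0.
  exact: (Esup_ge0 sg (psit_Lp2 sg r1 Lf t0)).
have Ifin : I \is a fin_num.
  rewrite ge0_fin_numE//; apply: le_lt_trans (integral_Esup_le sg r1 Lf) _; exact: ltry.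
rewrite -/I -(fineK Ifin) -EFinM lee_fin -mulrA.
have r22 : 2 <= 2 * r by move: r1; lra.
apply: (nu_le_approx sg (js_continuous js) r22 Lf) => n.
by have := nu_dy_le sg r1 Lf n stable; rewrite -/I -(fineK Ifin) -EFinM lee_fin.
Qed.

Let weight x : \bar R := (`|f x| `^ (2 * r - 2))%:E.

Let mweight : measurable_fun setT weight.
Proof. by apply/measurable_EFinP; exact: measurable_norm_powR. Qed.

Let weight0 x : (0 <= weight x)%E. Proof. by rewrite lee_fin powR_ge0. Qed.

Lemma nu_le_weighted_sqf : 3 <= 2 * r -> nu m (2 * r) (Pr t f) @[t --> +oo%R] --> (0 : R) ->
  ((nu m (2 * r) f)%:E <=
   (2 `^ (2 * r) * (4 * r) * r ^+ 2)%:E * \int[m]_x (weight x * sqf f x))%E.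
Proof.
move=> r3 stable; apply: (le_trans (hardy_stein_lower stable)).
have c0 : 0 <= 2 `^ (2 * r) * (4 * r) by rewrite mulr_ge0 ?powR_ge0//; move: r1; lra.
rewrite [leRHS](_ : _ = (2 `^ (2 * r) * (4 * r))%:E * ((r ^+ 2)%:E * \int[m]_x (weight x * sqf f x)))%E; last first.
  by rewrite muleA -EFinM.
rewrite lee_wpmul2l ?lee_fin// (sqfE mf mweight weight0).
have mPw : measurable_fun setT (fun z : measurableTypeR R * T => (Pe z.1 weight z.2 * carre (Pr z.1 f) z.2)%E).
  apply: emeasurable_funM; last exact: measurable_carre_joint.
  exact: measurable_Pe_joint_cst.
have Pw0 t x : (0 <= Pe t weight x * carre (Pr t f) x)%E.
  by rewrite mule_ge0// ?carre_ge0// Pe_ge0.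
have mJ : measurable_fun setT (fun t : measurableTypeR R => \int[m]_x (Pe t weight x * carre (Pr t f) x))%E.
  exact: (@measurable_fun_fubini_tonelli_F _ _ (measurableTypeR R) T R m _ mPw (fun z => Pw0 z.1 z.2)).
have J0 t : (0 <= \int[m]_x (Pe t weight x * carre (Pr t f) x))%E.
  by apply: integral_ge0 => x _; exact: Pw0.
have r20 : 0 <= r ^+ 2 by exact: sqr_ge0.
rewrite -ge0_integralZl ?lee_fin//; last exact: measurable_funTS.
apply: ae_ge0_le_integral => //.
- move=> t; rewrite /= in_itv/= andbT => t0.
  exact: (Esup_ge0 sg (psit_Lp2 sg r1 Lf t0)).
- exact: measurable_Esup.
- by move=> t _; rewrite mule_ge0 ?lee_fin.
- by apply: measurable_funeM; exact: measurable_funTS.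
apply: filterS Esup_fin => t Efin; rewrite /= in_itv/= andbT => t0.
apply: (le_trans (Esup_le_carre t0 (Efin t0))).
rewrite lee_wpmul2l ?lee_fin//; apply: le_intT.
- by move=> x; rewrite mule_ge0 ?carre_ge0// lee_fin powR_ge0.
- apply: emeasurable_funM; last exact: measurable_carre.
  by apply/measurable_EFinP; apply: measurable_norm_powR; exact: measurable_Pr.
- by apply: emeasurable_funM; [exact: measurable_Pe|exact: measurable_carre].
move=> x; rewrite lee_wpmul2r ?carre_ge0//.
(* Jensen for the exponent 2r - 2, which is at least 1 exactly when p = 2r is at least 3. *)
by apply: Pr_jensen => //; move: r3; lra.
Qed.

Lemma nu_le_sqf : 3 <= 2 * r -> nu m (2 * r) (Pr t f) @[t --> +oo%R] --> (0 : R) ->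
  ((nu m (2 * r) f)%:E <=
   (2 * sqf_lower_cst r * ((2 * sqf_lower_cst r)^-1 `^ (r - 1))^-1)%:E * \int[m]_x (sqf f x `^ r))%E.
Proof.
(* With dl = 1/(2C) Young's inequality returns half of the p-th power of the norm, which is a finite
   number and can be moved to the left. *)
move=> r3 stable; set C := sqf_lower_cst r; set dl := (2 * C)^-1; set D := (dl `^ (r - 1))^-1.
have C0 : 0 < C.
  have r0 : 0 < r by move: r1; lra.
  by rewrite /C /sqf_lower_cst !mulr_gt0 ?exprn_gt0// powR_gt0.
have dl0 : 0 < dl by rewrite invr_gt0 mulr_gt0.
have D0 : 0 < D by rewrite invr_gt0 powR_gt0.
have r0 : r != 0 by move: r1; rewrite -subr_ge0 => h; apply/eqP => e; move: h; rewrite e; lra.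
have mS := measurable_sqf mf.
have mSr : measurable_fun setT (fun x => sqf f x `^ r)%E by exact: measurableT_comp (measurable_poweR r) mS.
have mfp : measurable_fun setT (fun x => (`|f x| `^ (2 * r))%:E).
  by apply/measurable_EFinP; exact: measurable_norm_powR.
have young x : (weight x * sqf f x <= dl%:E * (`|f x| `^ (2 * r))%:E + D%:E * sqf f x `^ r)%E.
  have := sqf_ge0 f x; case: (sqf f x) => [s|_|//]; last first.
    by rewrite poweRE (negbTE r0) eqxx [X in (_ <= _ + X)%E]gt0_muley ?lte_fin// addey// leey.
  rewrite lee_fin poweR_EFin -!EFinM -EFinD lee_fin => s0.
  exact: young_weight.
have : ((nu m (2 * r) f)%:E <= C%:E * (dl%:E * (nu m (2 * r) f)%:E + D%:E * \int[m]_x (sqf f x `^ r)))%E.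
  apply: (le_trans (nu_le_weighted_sqf r3 stable)); rewrite lee_wpmul2l ?lee_fin ?(ltW C0)//.
  have dlE : (0 <= dl%:E)%E by rewrite lee_fin ltW.
  have DE : (0 <= D%:E)%E by rewrite lee_fin ltW.
  have N0 x : setT x -> (0 <= (`|f x| `^ (2 * r))%:E)%E by move=> _; rewrite lee_fin powR_ge0.
  have S0 x : setT x -> (0 <= sqf f x `^ r)%E by move=> _; exact: poweR_ge0.
  rewrite -(Np_nu Lf) Np_def -(ge0_integralZl m measurableT mfp N0 dlE).
  rewrite -(ge0_integralZl m measurableT mSr S0 DE).
  rewrite -ge0_integralD//; last 4 first.
  - by move=> x _; rewrite mule_ge0 ?N0.
  - exact: measurable_funeM.
  - by move=> x _; rewrite mule_ge0 ?S0.
  - exact: measurable_funeM.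
  apply: le_intT young => [x||].
  - by rewrite mule_ge0 ?sqf_ge0.
  - exact: emeasurable_funM.
  - by apply: emeasurable_funD; exact: measurable_funeM.
have : (0 <= \int[m]_x (sqf f x `^ r))%E by apply: integral_ge0 => x _; exact: poweR_ge0.
case: (\int[m]_x (sqf f x `^ r))%E => [I|_ _|//]; last first.
  have CD0 : (0 < (2 * C * D)%:E)%E by rewrite lte_fin; apply: mulr_gt0 => //; exact: mulr_gt0.
  by rewrite (gt0_muley CD0) leey.
rewrite lee_fin => I0; rewrite -(EFinM dl) -(EFinM D) -EFinD -(EFinM C) -(EFinM _ I) !lee_fin.
have dlC : C * dl = 1 / 2 by rewrite /dl; field; rewrite gt_eqF.
rewrite mulrDr mulrA dlC.
have aux (B N : R) : N <= 1 / 2 * N + B -> N <= 2 * B by lra.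
by move=> h; have := aux _ _ h; rewrite !mulrA.
Qed.

End energy_bounds.

End jump_structure.

Local Opaque jform carre sqf.

(** * The upper bound *)

Section square_function_L2.
Context {R : realType} {d} {T : measurableType d}.
Variables (m : {sigma_finite_measure set T -> \bar R}).
Variables (k : R.-spker (measurableTypeR R * T) ~> T) (K : R.-sfker T ~> T).
Hypothesis js : jump_semigroup m k K.
Let sg := js_semigroup js.
Local Notation mu := (@lebesgue_measure R).

Lemma psit1 f t : psit k 1 f t = Pr k t f.
Proof. by apply/funext => x; rewrite psitE spow1. Qed.

(** With weight 1 the moved factor is P_t 1 <= 1, and the integral of [carre] is the energy of P_t
    f; the bound is [integral_Esup_le] for r = 1. *)
Lemma integral_sqf_le f : Lp m 2 f -> (\int[m]_x sqf k K f x <= (nu m 2 f)%:E)%E.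
Proof.
have e2 : 2 = 2 * 1 :> R by rewrite mulr1.
rewrite [in Lp m 2 f]e2 => Lf; rewrite [in nu m 2 f]e2.
have mf := Lp_meas Lf.
have m1 : measurable_fun setT (cst 1%E : T -> \bar R) by exact: measurable_cst.
have one0 x : (0 <= (cst 1%E : T -> \bar R) x)%E by rewrite lee01.
have -> : (\int[m]_x sqf k K f x = \int[m]_x ((cst 1%E : T -> \bar R) x * sqf k K f x))%E.
  by apply: eq_integral => x _; rewrite mul1e.
rewrite (sqfE js mf m1 one0); apply: le_trans (integral_Esup_le sg (lexx 1) Lf).
apply: ae_ge0_le_integral => //.
- move=> t _; apply: integral_ge0 => x _; rewrite mule_ge0 ?carre_ge0 ?Pe_ge0//.
- apply: measurable_funTS.
  apply: (@measurable_fun_fubini_tonelli_F _ _ (measurableTypeR R) T R m (fun z => Pe k z.1 (cst 1%E) z.2 * carre K (Pr k z.1 f) z.2)%E).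
    by apply: emeasurable_funM; [exact: measurable_Pe_joint_cst|exact: measurable_carre_joint].
  by move=> z; rewrite mule_ge0 ?carre_ge0 ?Pe_ge0.
- move=> t; rewrite /= in_itv/= andbT => t0.
  exact: (Esup_ge0 sg (psit_Lp2 sg (lexx 1) Lf t0)).
- exact: (measurable_Esup js (lexx 1) Lf).
apply: filterS (Esup_fin js (lexx 1) Lf) => t Efin; rewrite /= in_itv/= andbT => t0.
rewrite (js_energy js (psit_Lp2 sg (lexx 1) Lf t0) (Efin t0)) psit1.
rewrite -(integral_carre js (measurable_Pr k t mf)); apply: le_intT.
- by move=> x; rewrite mule_ge0 ?carre_ge0 ?Pe_ge0.
- by apply: emeasurable_funM; [exact: measurable_Pe|exact: measurable_carre].
- exact: measurable_carre.
move=> x; rewrite -[leRHS]mul1e lee_wpmul2r ?carre_ge0//.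
rewrite Pe_def integral_cst// mul1e; exact: (k_le1 _ (t, x)).
Qed.

End square_function_L2.

(** * Bellman induction for bounded functions *)

Section bounded_functions.
Context {R : realType} {d} {T : measurableType d}.
Implicit Types (u v w f g : T -> R).

(** Under kernels of mass at most 1, bounded functions have finite integrals at every point, so the
    induction runs pointwise, free of exceptional sets and integrability conditions. *)
Record bdd w : Prop := {
  bdd_meas : measurable_fun setT w;
  bdd_bound : exists M, forall x, `|w x| <= M }.

Lemma bdd_cst (c : R) : bdd (fun=> c).
Proof. by split=> //; exists `|c| => x. Qed.

Lemma bddD u v : bdd u -> bdd v -> bdd (fun x => u x + v x).
Proof.
move=> [mu' [M uM]] [mv [N vN]]; split; first exact: measurable_funD.
by exists (M + N) => x; rewrite (le_trans (ler_normD _ _))// lerD.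
Qed.

Lemma bddM u v : bdd u -> bdd v -> bdd (fun x => u x * v x).
Proof.
move=> [mu' [M uM]] [mv [N vN]]; split; first exact: measurable_funM.
by exists (M * N) => x; rewrite normrM ler_pM.
Qed.

Lemma bddN u : bdd u -> bdd (fun x => - u x).
Proof.
move=> [mu' [M uM]]; split; first exact: measurableT_comp.
by exists M => x; rewrite normrN.
Qed.

Lemma bddB u v : bdd u -> bdd v -> bdd (fun x => u x - v x).
Proof. by move=> bu bv; apply: (bddD bu); exact: bddN. Qed.

Lemma bdd_pow (p : R) u : 0 <= p -> bdd u -> bdd (fun x => `|u x| `^ p).
Proof.
move=> p0 [mu' [M uM]]; split; first exact: measurable_norm_powR.
exists (M `^ p) => x; rewrite ger0_norm ?powR_ge0// ge0_ler_powR ?nnegrE//.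
exact: le_trans (uM x).
Qed.

Lemma bdd_sqr u : bdd u -> bdd (fun x => u x ^+ 2).
Proof. by move=> bu; exact: bddM. Qed.

Lemma bdd_integrable (mu : {measure set T -> \bar R}) w : (mu setT <= 1)%E ->
  bdd w -> mu.-integrable setT (EFin \o w).
Proof.
move=> mu1 [mw [M wM]]; apply: (integrable_dom mw wM).
exact: subprob_cst.
Qed.

End bounded_functions.

Section bounded_semigroup.
Context {R : realType} {d} {T : measurableType d}.
Variables (m : {measure set T -> \bar R}) (k : R.-spker (measurableTypeR R * T) ~> T).
Hypothesis sg : symmetric_semigroup m k.
Implicit Types (u v w f g : T -> R) (s t h : R).
Local Notation Pr := (Pr k).

Lemma Pr_int t w x : bdd w -> (k (t, x)).-integrable setT (EFin \o w).
Proof. by apply: bdd_integrable; exact: k_le1. Qed.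

Lemma Pr_add t u v x : bdd u -> bdd v -> Pr t (fun y => u y + v y) x = Pr t u x + Pr t v x.
Proof. by move=> bu bv; rewrite !PrE; apply: RintegralDf; exact: Pr_int. Qed.

Lemma Pr_sub t u v x : bdd u -> bdd v -> Pr t (fun y => u y - v y) x = Pr t u x - Pr t v x.
Proof. by move=> bu bv; rewrite !PrE; apply: RintegralBf; exact: Pr_int. Qed.

Lemma Pr_scale t c u x : bdd u -> Pr t (fun y => c * u y) x = c * Pr t u x.
Proof. by move=> bu; rewrite !PrE; apply: RintegralZf; exact: Pr_int. Qed.

Lemma Pr_le t u v x : bdd u -> bdd v -> (forall y, u y <= v y) -> Pr t u x <= Pr t v x.
Proof. by move=> bu bv uv; rewrite !PrE; apply: le_Rintegralf => //; exact: Pr_int. Qed.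

Lemma Pr_cst_le t (c : R) x : 0 <= c -> Pr t (fun=> c) x <= c.
Proof.
move=> c0; rewrite PrE subprob_Rintegral_cst ler_piMr//.
exact: (subprob_fine_le1 (k_le1 _ (t, x))).
Qed.

Lemma Pr_ge0 t u x : (forall y, 0 <= u y) -> 0 <= Pr t u x.
Proof. by move=> u0; rewrite PrE; apply: Rintegral_ge0 => y _; exact: u0. Qed.

Lemma Pr_norm_le t u (M : R) x : measurable_fun setT u -> (forall y, `|u y| <= M) -> `|Pr t u x| <= M.
Proof.
move=> mu' uM; have bu : bdd u by split=> //; exists M.
have M0 : 0 <= M by exact: le_trans (uM x).
have bM : bdd (fun _ : T => M) by exact: bdd_cst.
rewrite ler_norml; apply/andP; split.
  rewrite lerNl -mulN1r -(Pr_scale t (-1) x bu).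
  apply: le_trans (Pr_cst_le t x M0).
  apply: Pr_le => // [|y]; first by apply: bddM => //; exact: bdd_cst.
  by rewrite mulN1r; have := uM y; rewrite ler_norml => /andP[+ _]; rewrite lerNl.
apply: le_trans (Pr_cst_le t x M0); apply: Pr_le => // y.
by have := uM y; rewrite ler_norml => /andP[_].
Qed.

Lemma bdd_Pr t w : bdd w -> bdd (Pr t w).
Proof.
move=> [mw [M wM]]; split; first exact: measurable_Pr.
by exists M => x; exact: Pr_norm_le.
Qed.

Lemma PrDb s t w x : 0 < s -> 0 < t -> bdd w -> Pr (s + t) w x = Pr s (Pr t w) x.
Proof. by move=> s0 t0 bw; apply: (PrD_pt sg) => //; [exact: bdd_meas|exact: Pr_int]. Qed.

Lemma PeEb t w x : bdd w -> (forall y, 0 <= w y) -> (Pr t w x)%:E = Pe k t (EFin \o w) x.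
Proof.
move=> bw w0; apply: PeE => //; rewrite Pe_def.
by apply/(integrable_ge0P _ (bdd_meas bw) w0); exact: Pr_int.
Qed.

Lemma iter_Pr h s w j : 0 < h -> 0 < s -> bdd w -> iter j (Pr h) (Pr s w) = Pr (s + j%:R * h) w.
Proof.
move=> h0 s0 bw; elim: j => [|j IH]; first by rewrite mul0r addr0.
rewrite iterS IH; apply/funext => x; rewrite -PrDb//.
  by congr (Pr _ w x); rewrite -(addn1 j) natrD; ring.
by rewrite ltr_wpDr// mulr_ge0// ltW.
Qed.

Definition vard h v x : R := Pr h (fun y => v y ^+ 2) x - Pr h v x ^+ 2.

Lemma vardE h v x : vard h v x = Pr h (fun y => v y ^+ 2) x - Pr h v x ^+ 2.
Proof. by []. Qed.

Lemma vard_ge0 h v x : bdd v -> 0 <= vard h v x.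
Proof.
move=> bv; rewrite subr_ge0.
have bv2 := bdd_sqr bv.
have aux (A c q : R) : q <= 1 -> 0 <= A - 2 * c * c + c ^+ 2 * q -> c ^+ 2 <= A by move=> *; nra.
set c := Pr h v x; set q := Pr h (cst 1) x.
have q1 : q <= 1 by exact: Pr_cst_le.
have : 0 <= Pr h (fun y => (v y ^+ 2 - 2 * c * v y) + c ^+ 2 * 1) x.
  by apply: Pr_ge0 => y; rewrite (_ : _ + _ = (v y - c) ^+ 2) ?sqr_ge0//; ring.
have bl : bdd (fun y => 2 * c * v y) by apply: bddM => //; exact: bdd_cst.
rewrite Pr_add ?Pr_sub ?Pr_scale//; last 3 first.
- exact: bdd_cst.
- exact: bddB.
- by apply: bddM; exact: bdd_cst.
rewrite -/c -/q.
exact: aux.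
Qed.

Lemma bdd_vard h v : bdd v -> bdd (vard h v).
Proof.
move=> bv; apply: bddB; first by apply: bdd_Pr; exact: bdd_sqr.
by apply: bdd_sqr; exact: bdd_Pr.
Qed.

(** Unrolled, this is the sum over i < j of P_h^(j-1-i) applied to vard(P_h^i f) P_h^(i+1) g:
    weighted variances collected backwards in time. *)
Fixpoint bellman_sum h f g j x : R :=
  if j is i.+1 then vard h (iter i (Pr h) f) x * iter i.+1 (Pr h) g x
     + Pr h (bellman_sum h f g i) x
  else 0.

Lemma bdd_iter_Pr h w j : bdd w -> bdd (iter j (Pr h) w).
Proof. by move=> bw; elim: j => // j IH; rewrite iterS; exact: bdd_Pr. Qed.

Lemma bdd_bellman_sum h f g j : bdd f -> bdd g -> bdd (bellman_sum h f g j).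
Proof.
move=> bf bg; elim: j => [|j IH]; first exact: bdd_cst.
apply: bddD; last exact: bdd_Pr.
by apply: bddM; [apply: bdd_vard|]; exact: bdd_iter_Pr.
Qed.

Lemma iter_Pr_ge0 h w j x : (forall y, 0 <= w y) -> 0 <= iter j (Pr h) w x.
Proof. by move=> w0; elim: j x => // j IH x; rewrite iterS; exact: Pr_ge0. Qed.

Lemma bellman_sum_ge0 h f g j x : bdd f -> bdd g -> (forall y, 0 <= g y) -> 0 <= bellman_sum h f g j x.
Proof.
move=> bf bg g0; elim: j x => //= j IH x; rewrite addr_ge0//; last exact: Pr_ge0.
rewrite mulr_ge0//; first by apply: vard_ge0; exact: bdd_iter_Pr.
exact: (iter_Pr_ge0 h j.+1).
Qed.

(* The slope [a] has to be arbitrary for the induction; the case [a = 0] is the one of interest. *)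
Lemma bellman_sum_le h r f g j x (a : R) : 1 < r -> bdd f -> bdd g -> (forall y, 0 <= g y) -> 0 <= a ->
  a * iter j (Pr h) g x + bellman_sum h f g j x <=
  r `^ (r - 1) * iter j (Pr h) (fun y => `|f y| `^ (2 * r)) x
  + (r - 1) / r * iter j (Pr h) (fun y => `|g y| `^ (r / (r - 1))) x
  + (a `^ r - r * a `^ (r - 1) * iter j (Pr h) f x ^+ 2).
Proof.
move=> r1 bf bg g0; elim: j x a => [|j IH] x a a0.
  by rewrite /= addr0; have := bellman_end (f x) r1 a0 (g0 x); rewrite (ger0_norm (g0 x)).
have r0 : 0 < r by move: r1; lra.
have bF : bdd (iter j (Pr h) (fun y => `|f y| `^ (2 * r))).
  by apply: bdd_iter_Pr; apply: bdd_pow => //; rewrite mulr_ge0// ltW.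
have bH : bdd (iter j (Pr h) (fun y => `|g y| `^ (r / (r - 1)))).
  by apply: bdd_iter_Pr; apply: bdd_pow => //; rewrite divr_ge0 ?subr_ge0// ltW.
have bG := bdd_iter_Pr h j bg; have bu := bdd_iter_Pr h j bf.
have bS := bdd_bellman_sum h j bf bg.
rewrite !iterS /= -!iterS.
move: bF bH bG bu bS IH; rewrite !iterS.
move: (iter j (Pr h) (fun y => `|f y| `^ (2 * r))) (iter j (Pr h) (fun y => `|g y| `^ (r / (r - 1))))
  (iter j (Pr h) g) (iter j (Pr h) f) (bellman_sum h f g j) => F H G u S bF bH bG bu bS IH.
set D := vard h u x; have D0 : 0 <= D by exact: vard_ge0.
set a' := a + D; have a'0 : 0 <= a' by rewrite addr_ge0.
have bu2 := bdd_sqr bu.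
have bcst (c : R) : bdd (fun _ : T => c) by exact: bdd_cst.
have bscale c w : bdd w -> bdd (fun y => c * w y) by move=> bw; apply: bddM.
have bl : bdd (fun y => a' * G y) by exact: bscale.
have bcF : bdd (fun y => r `^ (r - 1) * F y) by exact: bscale.
have bcH : bdd (fun y => (r - 1) / r * H y) by exact: bscale.
have bq : bdd (fun y => r * a' `^ (r - 1) * u y ^+ 2) by exact: bscale.
have bFH := bddD bcF bcH; have bcq := bddB (bcst (a' `^ r)) bq.
(* The induction hypothesis at the slope a' = a + D, averaged by P_h. Since a' P_h G = a P_h G + D
   P_h G, the increase of the slope pays for the new variance term. *)
have := @Pr_le h _ _ x (bddD bl bS) (bddD bFH bcq) (fun y => IH y a' a'0).
rewrite (Pr_add h x bl bS) (Pr_add h x bFH bcq) (Pr_add h x bcF bcH) (Pr_sub h x (bcst _) bq).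
rewrite (Pr_scale h a' x bG) (Pr_scale h _ x bF) (Pr_scale h _ x bH) (Pr_scale h _ x bu2).
have -> : Pr h (fun y => u y ^+ 2) x = D + Pr h u x ^+ 2 by rewrite /D /vard subrK.
have := Pr_cst_le h x (powR_ge0 a' r).
have := spow_bellman (ltW r1) a0 D0 (sqr_ge0 (Pr h u x)).
rewrite -/a'.
move: (Pr h (fun=> a' `^ r) x) (Pr h G x) (Pr h S x) (Pr h F x) (Pr h H x) (Pr h u x ^+ 2) (a' `^ r)
  (a' `^ (r - 1)) (a `^ r) (a `^ (r - 1)) (r `^ (r - 1)) ((r - 1) / r) => q PG PS PF PH U A1 A2 A3 A4 A5 A6.
rewrite /a'; lra.
Qed.

Lemma integral_iter_Pr_le h w j : 0 < h -> bdd w -> (forall y, 0 <= w y) ->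
  (\int[m]_x (iter j (Pr h) w x)%:E <= \int[m]_x (w x)%:E)%E.
Proof.
move=> h0 bw w0; elim: j => // j IH; apply: le_trans IH.
have bI := bdd_iter_Pr h j bw; have I0 := iter_Pr_ge0 h j _ w0.
rewrite iterS (eq_integral (Pe k h (EFin \o iter j (Pr h) w))); last first.
  by move=> x _; exact: PeEb.
apply: (integral_Pe_le sg h0) => [|x]; last by rewrite lee_fin.
by apply/measurable_EFinP; exact: bdd_meas.
Qed.

Section conservative.
Variable h : R.
Hypothesis h0 : 0 < h.
Hypothesis Ph1 : {ae m, forall x, Pe k h (cst 1%E) x = 1%E}.

Lemma integral_Pe_conservative (S : T -> \bar R) : measurable_fun setT S -> (forall x, 0 <= S x)%E ->
  (\int[m]_x Pe k h S x = \int[m]_x S x)%E.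
Proof.
move=> mS S0.
have m1 : measurable_fun setT (cst 1%E : T -> \bar R) by exact: measurable_cst.
have one0 x : (0 <= (cst 1%E : T -> \bar R) x)%E by rewrite lee01.
have := Pe_sym sg h0 m1 mS one0 S0.
under eq_integral do rewrite mul1e.
move=> ->; apply: ge0_ae_eq_integral => //.
- by apply: emeasurable_funM => //; exact: measurable_Pe.
- by move=> x _; rewrite mule_ge0 ?Pe_ge0.
- by apply: filterS Ph1 => x -> _; rewrite mul1e.
Qed.

(** Integration removes the powers of P_h in front of the terms. Mass loss would give only that the
    integral of P_h S is at most that of S, which bounds the sum of the variances from the wrong
    side; conservativeness supplies the equality. *)
Lemma integral_bellman_sum f g n : bdd f -> bdd g -> (forall y, 0 <= g y) ->
  (\sum_(0 <= j < n) \int[m]_x (vard h (iter j (Pr h) f) x * iter j.+1 (Pr h) g x)%:E =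
   \int[m]_x (bellman_sum h f g n x)%:E)%E.
Proof.
move=> bf bg g0; elim: n => [|n IH]; first by rewrite big_geq//= integral0.
have bS := bdd_bellman_sum h n bf bg.
have S0 x : 0 <= bellman_sum h f g n x by exact: bellman_sum_ge0.
have mS : measurable_fun setT (EFin \o bellman_sum h f g n).
  by apply/measurable_EFinP; exact: bdd_meas.
have bV : bdd (fun x => vard h (iter n (Pr h) f) x * iter n.+1 (Pr h) g x).
  by apply: bddM; [apply: bdd_vard|]; exact: bdd_iter_Pr.
have V0 x : 0 <= vard h (iter n (Pr h) f) x * iter n.+1 (Pr h) g x.
  rewrite mulr_ge0//; last exact: (iter_Pr_ge0 h n.+1).
  by apply: vard_ge0; exact: bdd_iter_Pr.
have ES x : (0 <= (EFin \o bellman_sum h f g n) x)%E by rewrite lee_fin.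
rewrite big_nat_recr//= IH -(integral_Pe_conservative mS ES) addeC -ge0_integralD//.
- by apply: eq_integral => x _; rewrite EFinD -PeEb.
- by move=> x _; rewrite lee_fin V0.
- by apply/measurable_EFinP; exact: bdd_meas.
- by move=> x _; exact: Pe_ge0.
- exact: measurable_Pe.
Qed.

Lemma bellman_total r f g n : 1 < r -> bdd f -> bdd g -> (forall y, 0 <= g y) ->
  (\sum_(0 <= j < n) \int[m]_x (vard h (iter j (Pr h) f) x * iter j.+1 (Pr h) g x)%:E <=
   (r `^ (r - 1))%:E * \int[m]_x (`|f x| `^ (2 * r))%:E +
   ((r - 1) / r)%:E * \int[m]_x (`|g x| `^ (r / (r - 1)))%:E)%E.
Proof.
move=> r1 bf bg g0; rewrite integral_bellman_sum//.
have r0 : 0 < r by move: r1; lra.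
have bF : bdd (fun y => `|f y| `^ (2 * r)) by apply: bdd_pow => //; rewrite mulr_ge0// ltW.
have bH : bdd (fun y => `|g y| `^ (r / (r - 1))).
  by apply: bdd_pow => //; rewrite divr_ge0 ?subr_ge0// ltW.
have F0 x : 0 <= `|f x| `^ (2 * r) by exact: powR_ge0.
have H0 x : 0 <= `|g x| `^ (r / (r - 1)) by exact: powR_ge0.
have c0 : (0 <= (r `^ (r - 1))%:E)%E by rewrite lee_fin powR_ge0.
have c1 : (0 <= ((r - 1) / r)%:E)%E by rewrite lee_fin divr_ge0 ?subr_ge0// ltW.
apply: (le_trans _ (leeD (lee_wpmul2l c0 (integral_iter_Pr_le n h0 bF F0))
  (lee_wpmul2l c1 (integral_iter_Pr_le n h0 bH H0)))).
have bIF := bdd_iter_Pr h n bF; have bIH := bdd_iter_Pr h n bH.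
have mF : measurable_fun setT (fun x => (iter n (Pr h) (fun y => `|f y| `^ (2 * r)) x)%:E).
  by apply/measurable_EFinP; exact: bdd_meas.
have mH : measurable_fun setT (fun x => (iter n (Pr h) (fun y => `|g y| `^ (r / (r - 1))) x)%:E).
  by apply/measurable_EFinP; exact: bdd_meas.
have IF0 x : setT x -> (0 <= (iter n (Pr h) (fun y => `|f y| `^ (2 * r)) x)%:E)%E.
  by move=> _; rewrite lee_fin iter_Pr_ge0.
have IH0 x : setT x -> (0 <= (iter n (Pr h) (fun y => `|g y| `^ (r / (r - 1))) x)%:E)%E.
  by move=> _; rewrite lee_fin iter_Pr_ge0.
rewrite -(ge0_integralZl m measurableT mF IF0 c0) -(ge0_integralZl m measurableT mH IH0 c1).
rewrite -ge0_integralD//; last 4 first.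
- by move=> x _; rewrite mule_ge0 ?IF0.
- exact: measurable_funeM.
- by move=> x _; rewrite mule_ge0 ?IH0.
- exact: measurable_funeM.
apply: le_intT => [x|||x].
- by rewrite lee_fin bellman_sum_ge0.
- by apply/measurable_EFinP; apply: bdd_meas; exact: bdd_bellman_sum.
- by apply: emeasurable_funD; exact: measurable_funeM.
have r10 : r - 1 != 0 by rewrite gt_eqF// subr_gt0.
(* At slope 0 the last term of the Bellman bound vanishes, both exponents r and r - 1 being
   nonzero. *)
have := bellman_sum_le h n x r1 bf bg g0 (lexx 0).
rewrite mul0r add0r (powR0 r10) (powR0 (lt0r_neq0 r0)) mulr0 mul0r subr0 addr0.
by rewrite -lee_fin EFinD !EFinM.
Qed.

End conservative.

End bounded_semigroup.

Local Opaque vard bellman_sum.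

Section variance_time.
Context {R : realType} {d} {T : measurableType d}.
Variables (m : {sigma_finite_measure set T -> \bar R}) (k : R.-spker (measurableTypeR R * T) ~> T).
Hypothesis sg : symmetric_semigroup m k.
Local Notation Pr := (Pr k).
Local Notation mu := (@lebesgue_measure R).
Hypothesis cons : forall t, 0 < t -> {ae m, forall x, Pe k t (cst 1%E) x = 1%E}.
Variables (r : R) (f g : T -> R).
Hypotheses (r1 : 1 < r) (bf : bdd f) (bg : bdd g) (g0 : forall x, 0 <= g x).

Let F h (z : measurableTypeR R * T) : \bar R := (vard k h (Pr z.1 f) z.2 * Pr z.1 g z.2)%:E.

Let mF h : measurable_fun setT (F h).
Proof.
have mPf := measurable_Pr_joint k (bdd_meas bf); have mPg := measurable_Pr_joint k (bdd_meas bg).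
apply/measurable_EFinP; apply: measurable_funM => //; apply: measurable_funB.
  apply: (@measurable_Pr_param R _ _ (measurableTypeR R) T k h (fun z => Pr z.1 f z.2 ^+ 2)).
  exact: measurable_funX.
apply: measurable_funX.
exact: (@measurable_Pr_param R _ _ (measurableTypeR R) T k h (fun z => Pr z.1 f z.2)).
Qed.

Let F0 h z : (0 <= F h z)%E.
Proof.
rewrite lee_fin mulr_ge0//; last exact: Pr_ge0.
by apply: vard_ge0; exact: bdd_Pr.
Qed.

Definition varint h (t : measurableTypeR R) : \bar R :=
  (\int[m]_x (vard k h (Pr t f) x * Pr t g x)%:E)%E.

Lemma measurable_varint h : measurable_fun setT (varint h).
Proof. exact: (@measurable_fun_fubini_tonelli_F _ _ (measurableTypeR R) T R m _ (mF h) (F0 h)). Qed.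

Lemma varint_ge0 h t : (0 <= varint h t)%E.
Proof. by apply: integral_ge0 => x _; exact: (F0 h (t, x)). Qed.

Lemma integral_varint_le h (M : R) : 0 < h ->
  ((r `^ (r - 1))%:E * \int[m]_x (`|f x| `^ (2 * r))%:E +
   ((r - 1) / r)%:E * \int[m]_x (`|g x| `^ (r / (r - 1)))%:E <= M%:E)%E ->
  (\int[mu]_(t in `[h, +oo[) varint h t <= (M * h)%:E)%E.
Proof.
move=> h0 bd; rewrite (integral_tile h h0 (measurable_varint h) (varint_ge0 h)).
have mS : measurable_fun setT
    (fun t : measurableTypeR R => \sum_(0 <= j <oo) varint h (t + (h + j%:R * h))%R)%E.
  apply: (@ge0_emeasurable_sum _ _ _ setT (fun j (t : measurableTypeR R) => varint h (t + (h + j%:R * h))) xpredT) => j.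
  - by move=> t _ _; exact: varint_ge0.
  - move=> _; have msh : measurable_fun setT (fun t : measurableTypeR R => (t + (h + j%:R * h) : measurableTypeR R)) by exact: measurable_funD.
    exact: (measurableT_comp (measurable_varint h) msh).
rewrite -integral_itv_obnd_cbnd; last exact: measurable_funTS mS.
apply: (@le_trans _ _ (\int[mu]_(t in `]0%R, h[) M%:E)%E); last first.
  by rewrite integral_cst//= lebesgue_measure_itv/= lte_fin h0 oppr0 adde0 -EFinM.
have M0 : (0 <= M%:E)%E.
  apply: le_trans bd; rewrite adde_ge0// mule_ge0 ?lee_fin ?powR_ge0 ?divr_ge0 ?subr_ge0//.
  - by apply: integral_ge0 => x _; rewrite lee_fin powR_ge0.
  - exact: ltW.
  - by move: r1; lra.
  - by apply: integral_ge0 => x _; rewrite lee_fin powR_ge0.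
apply: ge0_le_integral => //.
- by move=> t _; apply: nneseries_ge0 => j _ _; exact: varint_ge0.
- exact: measurable_funTS mS.
move=> t; rewrite /= in_itv/= => /andP[t0 th].
apply: lime_le; first by apply: is_cvg_nneseries => j _ _; exact: varint_ge0.
apply: nearW => n; apply: le_trans bd.
have th0 : 0 < t + h by rewrite addr_gt0.
have bf' : bdd (Pr (t + h) f) by exact: bdd_Pr.
have bg' : bdd (Pr t g) by exact: bdd_Pr.
have g0' x : 0 <= Pr t g x by exact: Pr_ge0.
(* The induction starts from P_(t+h) f and P_t g. The j-th term carries one more P_h on the second
   function, so both factors sit at the time t + h + jh required by [varint]. *)
have := bellman_total sg h0 (cons h0) n r1 bf' bg' g0'.
have -> : (\sum_(0 <= j < n) \int[m]_x (vard k h (iter j (Pr h) (Pr (t + h) f)) x *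
    iter j.+1 (Pr h) (Pr t g) x)%:E)%E = \sum_(0 <= j < n) varint h (t + (h + j%:R * h)).
  apply: eq_bigr => j _; rewrite (iter_Pr sg j h0 th0 bf) (iter_Pr sg j.+1 h0 t0 bg) /varint.
  have -> : t + h + j%:R * h = t + (h + j%:R * h) by ring.
  have -> // : t + j.+1%:R * h = t + (h + j%:R * h).
  by rewrite -addn1 natrD; ring.
move=> /le_trans; apply.
have r21 : 1 <= 2 * r by move: r1; lra.
have r'1 : 1 <= r / (r - 1) by rewrite ler_pdivlMr ?subr_gt0// mul1r lerBlDr lerDl.
have := Np_Pr sg th0 r21 (bdd_meas bf); have := Np_Pr sg t0 r'1 (bdd_meas bg).
rewrite !Np_def => hg hf.
have c0 : (0 <= (r `^ (r - 1))%:E)%E by rewrite lee_fin powR_ge0.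
have c1 : (0 <= ((r - 1) / r)%:E)%E.
  by rewrite lee_fin divr_ge0 ?subr_ge0//; move: r1; lra.
exact: (leeD (lee_wpmul2l c0 hf) (lee_wpmul2l c1 hg)).
Qed.

End variance_time.

(** * Small-time limit of conditional variances *)

Section perturbation_bounds.
Context {R : realType}.
Implicit Types M N a b p q e : R.

(** The bounds with e = 1 and e = -1 feed [form_contraction], for increments and for values of v^2 +
    e phi and v + e phi v. Here 8M is 2 times the bound 4M of (a + b)^2. *)
Lemma sqr_perturb_incr_le M a b p q e : 0 <= M -> a ^+ 2 <= M -> b ^+ 2 <= M -> e ^+ 2 = 1 ->
  ((a ^+ 2 + e * p) - (b ^+ 2 + e * q)) ^+ 2 <= 8 * M * (a - b) ^+ 2 + 2 * (p - q) ^+ 2.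
Proof.
move=> M0 aM bM e1.
have ab : (a + b) ^+ 2 <= 4 * M by nra.
have s : 0 <= ((a ^+ 2 - b ^+ 2) - e * (p - q)) ^+ 2 by exact: sqr_ge0.
have epq : e ^+ 2 * (p - q) ^+ 2 = (p - q) ^+ 2 by rewrite e1 mul1r.
have h : (a + b) ^+ 2 * (a - b) ^+ 2 <= 4 * M * (a - b) ^+ 2 by rewrite ler_wpM2r ?sqr_ge0.
nra.
Qed.

Lemma sqr_perturb_le M a p e : 0 <= M -> a ^+ 2 <= M -> e ^+ 2 = 1 ->
  (a ^+ 2 + e * p) ^+ 2 <= 8 * M * a ^+ 2 + 2 * p ^+ 2.
Proof.
move=> M0 aM e1.
have s : 0 <= (a ^+ 2 - e * p) ^+ 2 by exact: sqr_ge0.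
have ep : e ^+ 2 * p ^+ 2 = p ^+ 2 by rewrite e1 mul1r.
have h : a ^+ 2 * a ^+ 2 <= M * a ^+ 2 by rewrite ler_wpM2r ?sqr_ge0.
have Ma : 0 <= M * a ^+ 2 by rewrite mulr_ge0 ?sqr_ge0.
nra.
Qed.

Lemma mul_perturb_incr_le M N a b p q e : 0 <= M -> 0 <= N -> b ^+ 2 <= M -> p ^+ 2 <= N ->
  e ^+ 2 = 1 -> ((a + e * (p * a)) - (b + e * (q * b))) ^+ 2 <=
  (2 + 4 * N) * (a - b) ^+ 2 + (4 * M) * (p - q) ^+ 2.
Proof.
move=> M0 N0 bM pN e1.
have h1 : p ^+ 2 * (a - b) ^+ 2 <= N * (a - b) ^+ 2 by rewrite ler_wpM2r ?sqr_ge0.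
have h2 : b ^+ 2 * (p - q) ^+ 2 <= M * (p - q) ^+ 2 by rewrite ler_wpM2r ?sqr_ge0.
have s1 : 0 <= ((a - b) - e * (p * a - q * b)) ^+ 2 by exact: sqr_ge0.
have ee : e ^+ 2 * (p * a - q * b) ^+ 2 = (p * a - q * b) ^+ 2 by rewrite e1 mul1r.
have s2 : 0 <= (p * (a - b) - b * (p - q)) ^+ 2 by exact: sqr_ge0.
nra.
Qed.

Lemma mul_perturb_le N a p e : p ^+ 2 <= N -> e ^+ 2 = 1 ->
  (a + e * (p * a)) ^+ 2 <= (2 + 4 * N) * a ^+ 2.
Proof.
move=> pN e1.
have h : p ^+ 2 * a ^+ 2 <= N * a ^+ 2 by rewrite ler_wpM2r ?sqr_ge0.
have s : 0 <= (a - e * (p * a)) ^+ 2 by exact: sqr_ge0.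
have ee : e ^+ 2 * (p * a) ^+ 2 = p ^+ 2 * a ^+ 2 by rewrite e1 mul1r exprMn.
have h0 : 0 <= p ^+ 2 * a ^+ 2 by rewrite mulr_ge0 ?sqr_ge0.
nra.
Qed.

(* The identity behind the polarization of [int phi D_h(v)]. *)
Lemma polar_identity a b p q :
  2^-1 * ((b - a) ^+ 2 * (p + q))
    + (8^-1 * ((b ^+ 2 + 1 * q) - (a ^+ 2 + 1 * p)) ^+ 2
    + 4^-1 * ((b + -1 * (q * b)) - (a + -1 * (p * a))) ^+ 2) =
  8^-1 * ((b ^+ 2 + -1 * q) - (a ^+ 2 + -1 * p)) ^+ 2
    + 4^-1 * ((b + 1 * (q * b)) - (a + 1 * (p * a))) ^+ 2.
Proof. by field. Qed.

End perturbation_bounds.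

Section jump_integral.
Context {R : realType} {d} {T : measurableType d}.
Variables (m : {sigma_finite_measure set T -> \bar R}).
Variables (k : R.-spker (measurableTypeR R * T) ~> T) (K : R.-sfker T ~> T).
Implicit Types (B : T * T -> R).

Definition jint B : \bar R := (\int[m]_x \int[K x]_y (B (x, y))%:E)%E.

Lemma jint_def B : jint B = (\int[m]_x \int[K x]_y (B (x, y))%:E)%E.
Proof. by []. Qed.

Lemma jint_ge0 B : (forall z, 0 <= B z) -> (0 <= jint B)%E.
Proof. by move=> B0; apply: integral_ge0 => x _; apply: integral_ge0 => y _; rewrite lee_fin. Qed.

Lemma jform_jint w : jform m K w = jint (fun z => (w z.2 - w z.1) ^+ 2).
Proof. by rewrite jform_def. Qed.

Lemma jintD B1 B2 : measurable_fun setT B1 -> measurable_fun setT B2 ->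
  (forall z, 0 <= B1 z) -> (forall z, 0 <= B2 z) ->
  jint (fun z => B1 z + B2 z) = (jint B1 + jint B2)%E.
Proof.
move=> m1 m2 B10 B20.
transitivity (\int[m]_x (\int[K x]_y (B1 (x, y))%:E + \int[K x]_y (B2 (x, y))%:E))%E.
  apply: eq_integral => x _; rewrite -ge0_integralD//.
  - by move=> y _; rewrite lee_fin.
  - exact: measurable_EFin_slice.
  - by move=> y _; rewrite lee_fin.
  - exact: measurable_EFin_slice.
rewrite ge0_integralD//.
- by move=> x _; apply: integral_ge0 => y _; rewrite lee_fin.
- exact: measurable_int_jump.
- by move=> x _; apply: integral_ge0 => y _; rewrite lee_fin.
- exact: measurable_int_jump.
Qed.

Lemma jintZ c B : 0 <= c -> measurable_fun setT B -> (forall z, 0 <= B z) ->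
  jint (fun z => c * B z) = (c%:E * jint B)%E.
Proof.
move=> c0 mB B0; have cE : (0 <= c%:E)%E by rewrite lee_fin.
rewrite /jint -ge0_integralZl//; last 2 first.
- exact: measurable_int_jump.
- by move=> x _; apply: integral_ge0 => y _; rewrite lee_fin.
apply: eq_integral => x _; rewrite -ge0_integralZl//.
- exact: measurable_EFin_slice.
- by move=> y _; rewrite lee_fin.
Qed.

End jump_integral.

Local Opaque jint.

Section variance_limit.
Context {R : realType} {d} {T : measurableType d}.
Variables (m : {sigma_finite_measure set T -> \bar R}).
Variables (k : R.-spker (measurableTypeR R * T) ~> T) (K : R.-sfker T ~> T).
Hypothesis js : jump_semigroup m k K.
Let sg := js_semigroup js.
Local Notation Pr := (Pr k).
Local Notation Lp := (Lp m).
Local Notation pform := (pform m k).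
Implicit Types (u v w phi : T -> R).

(** Bounded functions in L^2 are closed under products, so that v^2 and phi v stay in L^2. *)
Definition L2b w : Prop := Lp 2 w /\ bdd w.

Lemma L2b_add u v : L2b u -> L2b v -> L2b (fun x => u x + v x).
Proof.
move=> [Lu bu] [Lv bv]; split; last exact: bddD.
apply: (Lp_dom (Lp2_add 1 Lu Lv)) => // [|x]; last by rewrite mul1r.
exact: bdd_meas (bddD bu bv).
Qed.

Lemma L2bM u v : bdd u -> L2b v -> L2b (fun x => u x * v x).
Proof.
move=> bu [Lv bv]; split; last exact: bddM.
have [M uM] := bdd_bound bu; have M0 := le_trans (normr_ge0 _) (uM point).
apply: (Lp_dom (Lp2_add M Lv Lv)) => // [|x]; first exact: bdd_meas (bddM bu bv).
have M1 : 0 <= M + 1 by rewrite addr_ge0.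
have -> : M * v x + v x = (M + 1) * v x by rewrite mulrDl mul1r.
rewrite !normrM (ger0_norm M1) ler_wpM2r//.
by rewrite (le_trans (uM x))// lerDl.
Qed.

Lemma L2b_scale c v : L2b v -> L2b (fun x => c * v x).
Proof. by apply: L2bM; exact: bdd_cst. Qed.

Lemma L2b_sub u v : L2b u -> L2b v -> L2b (fun x => u x - v x).
Proof.
move=> Lu Lv; have := L2b_add Lu (L2b_scale (-1) Lv).
by under eq_fun do rewrite mulN1r.
Qed.

Lemma L2b_Pr t w : 0 < t -> L2b w -> L2b (Pr t w).
Proof. by move=> t0 [Lw bw]; split; [exact: Lp2_Pr|exact: bdd_Pr]. Qed.

Lemma pform_polar h u w (c : R) : 0 < h -> L2b u -> L2b w ->
  pform h (fun x => u x + c * w x) (fun x => u x + c * w x) =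
  pform h u u + 2 * c * pform h u w + c ^+ 2 * pform h w w.
Proof.
move=> h0 Lu Lw; have LPu := L2b_Pr h0 Lu; have LPw := L2b_Pr h0 Lw.
have Du := L2b_sub Lu LPu; have Dw := L2b_sub Lw LPw.
have sym : pform h w u = pform h u w.
  rewrite (pformE sg h0 Lw.1 Lu.1) (pformE sg h0 Lu.1 Lw.1); congr (_ - _).
    by apply: eq_Rintegral => x _; rewrite mulrC.
  have := Pr_sym2 sg h0 Lu.1 Lw.1 => e.
  rewrite -(eq_Rintegral _ (fun x _ => mulrC (u x) (Pr h w x))) e.
  by apply: eq_Rintegral => x _; rewrite mulrC.
have i1 := Lp2_mul Du.1 Lu.1; have i2 := Lp2_mul Du.1 Lw.1.
have i3 := Lp2_mul Dw.1 Lu.1; have i4 := Lp2_mul Dw.1 Lw.1.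
have -> : 2 * c * pform h u w = c * pform h u w + c * pform h w u by rewrite sym; ring.
rewrite !pform_def -(RintegralZf c i2) -(RintegralZf c i3) -(RintegralZf (c ^+ 2) i4).
have j2 := integrable_scalef c i2; have j3 := integrable_scalef c i3.
have j4 := integrable_scalef (c ^+ 2) i4; have j23 := integrable_addf j2 j3.
rewrite -(RintegralDf j2 j3) -(RintegralDf i1 j23) -(RintegralDf (integrable_addf i1 j23) j4).
apply: eq_Rintegral => x _.
rewrite (Pr_add k h x Lu.2 (L2b_scale c Lw).2) (Pr_scale k h c x Lw.2); ring.
Qed.

Definition elim_ w : R := fine (Esup m k w).

Lemma cvg_En w : Lp 2 w -> (Esup m k w < +oo)%E ->
  En m k n w @[n --> \oo] --> elim_ w.
Proof.
move=> Lw Ew.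
Local Transparent Esup.
have h := ereal_nondecreasing_is_cvgn (En_nd sg Lw).
have F : Esup m k w = (elim_ w)%:E by rewrite fineK// ge0_fin_numE// (Esup_ge0 sg).
have {}h : (En m k n w)%:E @[n --> \oo] --> (elim_ w)%:E by rewrite -F.
exact: (fine_cvg h).
Local Opaque Esup.
Qed.

(** Behind the fact that bounded functions of finite energy form an algebra: with the perturbation
    bounds it gives finite energy to v^2 and phi v in the combinations that polarization needs. *)
Lemma Esup_comb C1 C2 w w1 w2 : 0 <= C1 -> 0 <= C2 -> Lp 2 w -> Lp 2 w1 -> Lp 2 w2 ->
  (forall x y, (w x - w y) ^+ 2 <= C1 * (w1 x - w1 y) ^+ 2 + C2 * (w2 x - w2 y) ^+ 2) ->
  (forall x, w x ^+ 2 <= C1 * w1 x ^+ 2 + C2 * w2 x ^+ 2) ->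
  (Esup m k w1 < +oo)%E -> (Esup m k w2 < +oo)%E -> (Esup m k w < +oo)%E.
Proof.
move=> C10 C20 Lw Lw1 Lw2 incr pt E1 E2.
have F1 : Esup m k w1 \is a fin_num by rewrite ge0_fin_numE ?(Esup_ge0 sg).
have F2 : Esup m k w2 \is a fin_num by rewrite ge0_fin_numE ?(Esup_ge0 sg).
apply: (@le_lt_trans _ _ (C1 * elim_ w1 + C2 * elim_ w2)%:E); last exact: ltry.
Local Transparent Esup.
apply: lime_le; first exact: ereal_nondecreasing_is_cvgn (En_nd sg Lw).
Local Opaque Esup.
apply: nearW => n; rewrite lee_fin.
have e1 : En m k n w1 <= elim_ w1 by rewrite -lee_fin fineK//; exact: En_le_Esup.
have e2 : En m k n w2 <= elim_ w2 by rewrite -lee_fin fineK//; exact: En_le_Esup.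
apply: (@le_trans _ _ (C1 * En m k n w1 + C2 * En m k n w2)); last first.
  by apply: lerD; apply: ler_wpM2l.
have dn := @dy_gt0 R n.
have := form_contraction sg dn C10 C20 Lw Lw1 Lw2 incr pt.
rewrite !En_def !mulrA -mulrDl ler_pM2r// invr_gt0//.
Qed.

Section limit.
Variables v phi : T -> R.
Hypotheses (Lv : L2b v) (Lphi : L2b phi) (phi0 : forall x, 0 <= phi x).
Hypotheses (Ev : (Esup m k v < +oo)%E) (Ephi : (Esup m k phi < +oo)%E).

Let v2 x := v x ^+ 2.
Let vphi x := phi x * v x.
Let Lv2 : L2b v2. Proof. exact: (L2bM Lv.2 Lv). Qed.
Let Lvphi : L2b vphi. Proof. exact: (L2bM Lphi.2 Lv). Qed.

(** Polarization: the forms of (v^2, phi) and (v, phi v) are a quarter of the differences between w1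
    and w2, and between w3 and w4. *)
Let w1 x := v2 x + 1 * phi x.
Let w2 x := v2 x + -1 * phi x.
Let w3 x := v x + 1 * vphi x.
Let w4 x := v x + -1 * vphi x.

Let L1 : L2b w1. Proof. exact: L2b_add Lv2 (L2b_scale 1 Lphi). Qed.
Let L2 : L2b w2. Proof. exact: L2b_add Lv2 (L2b_scale (-1) Lphi). Qed.
Let L3 : L2b w3. Proof. exact: L2b_add Lv (L2b_scale 1 Lvphi). Qed.
Let L4 : L2b w4. Proof. exact: L2b_add Lv (L2b_scale (-1) Lvphi). Qed.

Let err n : R := \int[m]_x ((v x - Pr (dy n) v x) ^+ 2 * phi x).

(** With P = P_h, the pointwise identity P(v^2) - (P v)^2 = 2 (v - P v) v - (v^2 - P(v^2)) - (v - P
    v)^2, multiplied by phi and integrated, gives 2 E_h(v, phi v) - E_h(v^2, phi) minus an error. *)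
Lemma vard_En n : (\int[m]_x (vard k (dy n) v x * phi x)) / dy n =
  4^-1 * (En m k n w2 - En m k n w1) + 2^-1 * (En m k n w3 - En m k n w4) - err n / dy n.
Proof.
set h := dy n; have h0 : 0 < h by exact: dy_gt0.
have LPv := L2b_Pr h0 Lv; have LPv2 := L2b_Pr h0 Lv2.
have Dv := L2b_sub Lv LPv; have Dv2 := L2b_sub Lv2 LPv2.
have i1 := Lp2_mul Dv2.1 Lphi.1; have i2 := Lp2_mul Dv.1 Lvphi.1.
have i3 := Lp2_mul (L2bM Dv.2 Dv).1 Lphi.1.
have main : \int[m]_x (vard k h v x * phi x) = 2 * pform h v vphi - pform h v2 phi - err n.
  rewrite !pform_def -(RintegralZf 2 i2) -(RintegralBf (integrable_scalef 2 i2) i1).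
  rewrite /err -(RintegralBf (integrable_subf (integrable_scalef 2 i2) i1) i3).
  apply: eq_Rintegral => x _; rewrite vardE /v2 /vphi; ring.
rewrite !En_def -/h (pform_polar 1 h0 Lv2 Lphi) (pform_polar (-1) h0 Lv2 Lphi).
rewrite (pform_polar 1 h0 Lv Lvphi) (pform_polar (-1) h0 Lv Lvphi) main.
have hn : h != 0 by rewrite gt_eqF.
move: (pform h v v) (pform h v2 v2) (pform h v vphi) (pform h v2 phi) (pform h phi phi)
  (pform h vphi vphi) (err n) => A B C D E F G.
by field.
Qed.

(** Up to a bound of phi, the error divided by h is |v - P_h v|^2 / h, which [form_defect] equates
    with 2 (E_{n+1}(v) - E_n(v)); the dyadic energies converge, so it vanishes. *)
Let err_cvg : err n.+1 / dy n.+1 @[n --> \oo] --> (0 : R).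
Proof.
have aux (A B c : R) : c != 0 -> 2 * A - B = 2 * (A / c - B / (c + c)) * c.
  move=> c0; have cc : c + c != 0 by rewrite -mulr2n mulrn_eq0.
  by field; apply/andP.
have [M vM] := bdd_bound Lphi.2.
have M0 : 0 <= M by exact: le_trans (vM point).
have bd n : 0 <= err n.+1 / dy n.+1 <= M * (2 * (En m k n.+1 v - En m k n v)).
  set h := dy n.+1; have h0 : 0 < h by exact: dy_gt0.
  have Dv := L2b_sub Lv (L2b_Pr h0 Lv).
  have i3 := Lp2_mul Dv.1 Dv.1; have i4 := Lp2_mul (L2bM Dv.2 Dv).1 Lphi.1.
  apply/andP; split.
    apply: divr_ge0; last exact: ltW.
    by apply: Rintegral_ge0 => x _; rewrite mulr_ge0 ?sqr_ge0.
  have dn : dy n = h + h by rewrite dyS.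
  rewrite ler_pdivrMr// !En_def dn -/h.
  apply: (@le_trans _ _ (M * \int[m]_x ((v x - Pr h v x) ^+ 2))); last first.
    rewrite (form_defect sg h0 Lv.1) -mulrA ler_wpM2l// le_eqVlt; apply/orP; left; apply/eqP.
    have hn : h != 0 by rewrite gt_eqF.
    exact: aux.
  rewrite -(RintegralZf M i3).
  apply: (le_Rintegralf i4 (integrable_scalef M i3)) => x.
  by rewrite mulrC ler_wpM2r ?sqr_ge0// (le_trans _ (vM x))// ler_norm.
have lim0 : M * (2 * (En m k n.+1 v - En m k n v)) @[n --> \oo] --> M * (2 * (elim_ v - elim_ v)).
  have c := cvg_En Lv.1 Ev.
  apply: cvgM; first exact: cvg_cst.
  apply: cvgM; first exact: cvg_cst.
  by apply: cvgB => //; rewrite (cvg_shiftS (fun n => En m k n v)).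
rewrite subrr !mulr0 in lim0.
by apply: (squeeze_cvgr _ (cvg_cst 0) lim0); apply: nearW.
Qed.

Let bnd (f : T -> R) : bdd f -> exists2 M, 0 <= M & forall x, f x ^+ 2 <= M.
Proof.
move=> bf; have [M fM] := bdd_bound (bdd_sqr bf); exists M; first exact: le_trans (fM point).
by move=> x; apply: le_trans (fM x); exact: ler_norm.
Qed.

Let E12 : (Esup m k w1 < +oo)%E /\ (Esup m k w2 < +oo)%E.
Proof.
have [M M0 vM] := bnd Lv.2.
have C0 : 0 <= 8 * M by rewrite mulr_ge0.
have C2 : 0 <= 2 :> R by exact: ler0n.
split; apply: (Esup_comb C0 C2 (w1 := v) (w2 := phi)) => //; try by [case: L1|case: L2|case: Lv|case: Lphi].
- by move=> x y; apply: sqr_perturb_incr_le; rewrite ?vM ?expr1n.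
- by move=> x; apply: sqr_perturb_le; rewrite ?vM ?expr1n.
- by move=> x y; apply: sqr_perturb_incr_le; rewrite ?vM ?sqrrN ?expr1n.
- by move=> x; apply: sqr_perturb_le; rewrite ?vM ?sqrrN ?expr1n.
Qed.

Let E34 : (Esup m k w3 < +oo)%E /\ (Esup m k w4 < +oo)%E.
Proof.
have [M M0 vM] := bnd Lv.2; have [N N0 phiN] := bnd Lphi.2.
have C1 : 0 <= 2 + 4 * N by rewrite addr_ge0 ?mulr_ge0.
have C2 : 0 <= 4 * M by rewrite mulr_ge0.
have add2 (A B M' : R) : 0 <= M' -> A <= B -> A <= B + M' by move=> *; rewrite ler_wpDr.
split; apply: (Esup_comb C1 C2 (w1 := v) (w2 := phi)) => //; try by [case: L3|case: L4|case: Lv|case: Lphi].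
- by move=> x y; apply: mul_perturb_incr_le; rewrite ?expr1n.
- by move=> x; apply: add2; [rewrite mulr_ge0 ?sqr_ge0|apply: mul_perturb_le; rewrite ?expr1n].
- by move=> x y; apply: mul_perturb_incr_le; rewrite ?sqrrN ?expr1n.
- by move=> x; apply: add2; [rewrite mulr_ge0 ?sqr_ge0|apply: mul_perturb_le; rewrite ?sqrrN ?expr1n].
Qed.

Definition weighted_energy : \bar R := jint m K (fun z => (v z.2 - v z.1) ^+ 2 * phi z.1).

Let jfin w : L2b w -> (Esup m k w < +oo)%E ->
  jform m K w = (2 * elim_ w)%:E.
Proof.
move=> Lw Ew; have e := js_energy js Lw.1 Ew.
have F : Esup m k w = (elim_ w)%:E by rewrite fineK// ge0_fin_numE// (Esup_ge0 sg Lw.1).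
by rewrite EFinM -F e muleA -EFinM divff// mul1e.
Qed.

Let mv : measurable_fun setT v := bdd_meas Lv.2.
Let mphi : measurable_fun setT phi := bdd_meas Lphi.2.

Let mincr w : measurable_fun setT w -> measurable_fun setT (fun z : T * T => (w z.2 - w z.1) ^+ 2).
Proof.
move=> mw; apply: measurable_funX; apply: measurable_funB.
  exact: measurableT_comp measurable_snd.
exact: measurableT_comp measurable_fst.
Qed.

(** The polarized identity is integrated in the form of [polar_identity], with all negative terms
    moved across: each side is a sum of nonnegative integrals, so no possibly infinite integrals are
    subtracted. *)
Lemma weighted_energyE : weighted_energy =
  (4^-1 * (elim_ w2 - elim_ w1) + 2^-1 * (elim_ w3 - elim_ w4))%:E.
Proof.
pose B (z : T * T) : R := (v z.2 - v z.1) ^+ 2 * phi z.1.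
have mB : measurable_fun setT B.
  by apply: measurable_funM; [exact: mincr|exact: measurableT_comp measurable_fst].
have B0 z : 0 <= B z by rewrite mulr_ge0 ?sqr_ge0.
have Bd x : B (x, x) = 0 by rewrite /B/= subrr expr0n/= mul0r.
pose C (z : T * T) : R := (v z.2 - v z.1) ^+ 2 * (phi z.1 + phi z.2).
have mC : measurable_fun setT C.
  apply: measurable_funM; first exact: mincr.
  by apply: measurable_funD; apply: measurableT_comp.
have C0 z : 0 <= C z by rewrite mulr_ge0 ?sqr_ge0 ?addr_ge0.
have jC : jint m K C = (2%:E * weighted_energy)%E.
  have <- : (\int[m]_x \int[K x]_y (B (x, y))%:E)%E = weighted_energy.
    by rewrite /weighted_energy jint_def.
  rewrite -(integral_jump_sym js mB B0 Bd) jint_def.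
  apply: eq_integral => x _; apply: eq_integral => y _.
  by rewrite /B /C/=; congr EFin; ring.
pose I w (z : T * T) : R := (w z.2 - w z.1) ^+ 2.
have I0 w z : 0 <= I w z by exact: sqr_ge0.
have m_ w : L2b w -> measurable_fun setT (I w) by move=> Lw; apply: mincr; exact: bdd_meas Lw.2.
have c2 : 0 <= 2^-1 :> R by rewrite invr_ge0.
have c4 : 0 <= 4^-1 :> R by rewrite invr_ge0.
have c8 : 0 <= 8^-1 :> R by rewrite invr_ge0.
have sc c (A : T * T -> R) : 0 <= c -> measurable_fun setT A -> (forall z, 0 <= A z) ->
    measurable_fun setT (fun z => c * A z) /\ (forall z, 0 <= c * A z).
  by move=> c0 mA A0; split => [|z]; [exact: measurable_funM|rewrite mulr_ge0].
have [mC' C'0] := sc _ _ c2 mC C0.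
have [m1 p1] := sc _ _ c8 (m_ _ L1) (I0 w1); have [m4 p4] := sc _ _ c4 (m_ _ L4) (I0 w4).
have [m2 p2] := sc _ _ c8 (m_ _ L2) (I0 w2); have [m3 p3] := sc _ _ c4 (m_ _ L3) (I0 w3).
have m14 := measurable_funD m1 m4.
have p14 z : 0 <= 8^-1 * I w1 z + 4^-1 * I w4 z by rewrite addr_ge0.
have : (jint m K (fun z => 2^-1 * C z + (8^-1 * I w1 z + 4^-1 * I w4 z)) =
    jint m K (fun z => 8^-1 * I w2 z + 4^-1 * I w3 z)).
  congr (jint m K _); apply/funext => z; exact: polar_identity.
rewrite (jintD m K mC' m14 C'0 p14) (jintD m K m1 m4 p1 p4) (jintD m K m2 m3 p2 p3).
rewrite (jintZ m K c2 mC C0) (jintZ m K c8 (m_ _ L1) (I0 w1)) (jintZ m K c4 (m_ _ L4) (I0 w4)).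
rewrite (jintZ m K c8 (m_ _ L2) (I0 w2)) (jintZ m K c4 (m_ _ L3) (I0 w3)) jC -!jform_jint.
rewrite (jfin L1 E12.1) (jfin L2 E12.2) (jfin L3 E34.1) (jfin L4 E34.2).
have : (0 <= weighted_energy)%E by exact: jint_ge0.
(* An infinite value would make the left side infinite while the right side is finite. *)
case: weighted_energy => [e|_|//]; last first.
  by rewrite gt0_muley ?lte_fin// gt0_muley ?lte_fin ?invr_gt0// -!EFinM -!EFinD.
move=> _; rewrite -!EFinM -!EFinD => -[h]; congr EFin.
have -> : e = 2^-1 * (2 * e) by field.
have aux (x x1 x2 x3 x4 : R) : x + (8^-1 * (2 * x1) + 4^-1 * (2 * x4)) =
    8^-1 * (2 * x2) + 4^-1 * (2 * x3) -> x = 4^-1 * (x2 - x1) + 2^-1 * (x3 - x4) by move=> ?; lra.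
exact: aux h.
Qed.

Lemma cvg_vard :
  (\int[m]_x (vard k (dy n) v x * phi x)%:E * (dy n)^-1%:E)%E @[n --> \oo] --> weighted_energy.
Proof.
rewrite weighted_energyE -(cvg_shiftS (fun n => _)).
have e n : (\int[m]_x (vard k (dy n) v x * phi x)%:E * (dy n)^-1%:E)%E =
  (4^-1 * (En m k n w2 - En m k n w1) + 2^-1 * (En m k n w3 - En m k n w4) - err n / dy n)%:E.
  rewrite -vard_En EFinM fineK_integral//.
  have Lvar : L2b (vard k (dy n) v).
    have := L2b_sub (L2b_Pr (dy_gt0 n) Lv2) (L2bM (L2b_Pr (dy_gt0 n) Lv).2 (L2b_Pr (dy_gt0 n) Lv)).
    by under eq_fun do rewrite -expr2 -vardE.
  exact: (Lp2_mul Lvar.1 Lphi.1).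
rewrite /=; under eq_fun do rewrite e.
apply: cvg_EFin; first exact: nearW.
rewrite -[X in _ --> X]subr0; apply: cvgB; last exact: err_cvg.
have c w : L2b w -> (Esup m k w < +oo)%E -> En m k n.+1 w @[n --> \oo] --> elim_ w.
  by move=> Lw Ew; rewrite (cvg_shiftS (fun n => En m k n w)); exact: cvg_En Lw.1 Ew.
apply: cvgD; apply: cvgM; first exact: cvg_cst.
- exact: (cvgB (c _ L2 E12.2) (c _ L1 E12.1)).
- exact: cvg_cst.
- exact: (cvgB (c _ L3 E34.1) (c _ L4 E34.2)).
Qed.

End limit.

End variance_limit.

Lemma weighted_energy_def {R : realType} {d} {T : measurableType d}
  (m : {sigma_finite_measure set T -> \bar R}) (K : R.-sfker T ~> T) (v phi : T -> R) :
  weighted_energy m K v phi = jint m K (fun z => (v z.2 - v z.1) ^+ 2 * phi z.1).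
Proof. by []. Qed.

Local Opaque weighted_energy elim_.

(** * From bounded functions to the weighted square function *)

Section jump_null_sets.
Context {R : realType} {d} {T : measurableType d}.
Variables (m : {sigma_finite_measure set T -> \bar R}) (K : R.-sfker T ~> T).
Hypothesis sj : symmetric_jumps m K.

(** For a null set N, the function 1_{N^c}(x) 1_N(y) vanishes on the diagonal; after exchanging x
    and y its integral is carried by x in N, hence is 0. So almost no x outside N can jump into N,
    and almost everywhere limits pass to both ends of a jump. *)
Lemma jump_ae (P : T -> Prop) : {ae m, forall x, P x} ->
  {ae m, forall x, P x /\ {ae K x, forall y, P y}}.
Proof.
move=> [N [mN mN0 NP]].
pose F (z : T * T) : R := \1_(~` N) z.1 * \1_N z.2.
have mNc : measurable (~` N) by exact: measurableC.
have mF : measurable_fun setT F.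
  apply: measurable_funM; first exact: (measurableT_comp (measurable_indic mNc) measurable_fst).
  exact: (measurableT_comp (measurable_indic mN) measurable_snd).
have F0 z : 0 <= F z by rewrite mulr_ge0.
have Fd x : F (x, x) = 0.
  rewrite /F/= !indicE; case: (boolP (x \in N)) => xN; last by rewrite mulr0.
  by rewrite memNset ?mul0r// => /(_ (set_mem xN)).
have mEF : measurable_fun setT (EFin \o F) by exact/measurable_EFinP.
have EF0 z : (0 <= (EFin \o F) z)%E by rewrite lee_fin.
have EFd x : ((EFin \o F) (x, x) = 0)%E by rewrite /= Fd.
have I0 x : (0 <= \int[K x]_y (F (x, y))%:E)%E by apply: integral_ge0 => y _; rewrite lee_fin.
have z0 : (\int[m]_x \int[K x]_y (F (x, y))%:E = 0)%E.
  rewrite (sj mEF EF0 EFd).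
  have : {ae m, forall x, ~ N x}.
    by exists N; split=> // x /contrapT.
  move=> aeN; rewrite -(integral0 m setT); apply: ge0_ae_eq_integral => //.
  - have mF' : measurable_fun setT (fun z : T * T => F (z.2, z.1)).
      have ms : measurable_fun setT (fun z : T * T => (z.2, z.1)) by exact: measurable_swap.
      exact: (measurableT_comp mF ms).
    exact: (measurable_int_jump K mF').
  - by move=> x _; apply: integral_ge0 => y _; rewrite lee_fin.
  - apply: filterS aeN => x xN _; rewrite integral0_eq// => y _.
    by rewrite /= /F/= [X in _ * X](_ : _ = 0) ?mulr0// indicE memNset.
have mI : measurable_fun setT (fun x => \int[K x]_y (F (x, y))%:E)%E by exact: measurable_int_jump.
have ae0 : {ae m, forall x, (\int[K x]_y (F (x, y))%:E = 0)%E}.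
  have := (ae_eq_integral_abs m measurableT mI).1.
  under eq_integral do rewrite gee0_abs//.
  by move=> /(_ z0); apply: filterS => x; exact.
have aeN : {ae m, forall x, ~ N x} by exists N; split=> // x /contrapT.
apply: filterS2 aeN ae0 => x xN Kx0; split.
  by apply: contrapT => nP; apply: xN; exact: NP.
exists N; split => //; move: Kx0.
rewrite (eq_integral (fun y => (\1_N y)%:E)); first by rewrite integral_indic// setIT.
by move=> y _; rewrite /F/= indicE mem_set// mul1r.
Qed.

Lemma weighted_energy_fatou (v_ : nat -> T -> R) (v phi : T -> R) :
  (forall n, measurable_fun setT (v_ n)) -> measurable_fun setT v -> measurable_fun setT phi ->
  (forall x, 0 <= phi x) -> {ae m, forall x, v_ n x @[n --> \oo] --> v x} ->
  (weighted_energy m K v phi <= limn_einf (fun n => weighted_energy m K (v_ n) phi))%E.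
Proof.
move=> mv_ mv mphi phi0 cv.
pose B (w : T -> R) (z : T * T) : R := (w z.2 - w z.1) ^+ 2 * phi z.1.
have mB w : measurable_fun setT w -> measurable_fun setT (B w).
  move=> mw; apply: measurable_funM; last exact: measurableT_comp measurable_fst.
  apply: measurable_funX; apply: measurable_funB.
    exact: measurableT_comp measurable_snd.
  exact: measurableT_comp measurable_fst.
have B0 w z : 0 <= B w z by rewrite mulr_ge0 ?sqr_ge0.
have I0 w x : (0 <= \int[K x]_y (B w (x, y))%:E)%E by apply: integral_ge0 => y _; rewrite lee_fin.
rewrite weighted_energy_def jint_def.
rewrite (_ : (fun n => _) = (fun n => \int[m]_x \int[K x]_y (B (v_ n) (x, y))%:E)%E); last first.
  by apply/funext => n; rewrite weighted_energy_def jint_def.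
apply: (@fatou_einf _ _ _ m (fun n x => \int[K x]_y (B (v_ n) (x, y))%:E)%E).
- by move=> n; apply: measurable_int_jump => //; exact: mB.
- by move=> n x; exact: I0.
- by apply: (@measurable_int_jump _ _ _ K (B v)) => //; exact: mB.
- by move=> x; exact: (I0 v x).
apply: filterS (jump_ae cv) => x [cx cy].
apply: (@fatou_einf _ _ _ (K x) (fun n y => (B (v_ n) (x, y))%:E)).
- by move=> n; apply: measurable_EFin_slice; exact: mB.
- by move=> n y; rewrite lee_fin.
- by apply: (@measurable_EFin_slice _ _ _ (B v)); exact: mB.
- by move=> y; rewrite lee_fin; exact: (B0 v (x, y)).
apply: filterS cy => y cy.
have c : (B (v_ n) (x, y))%:E @[n --> \oo] --> (B v (x, y))%:E.
  apply: cvg_EFin; first exact: nearW.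
  apply: cvgM; last exact: cvg_cst.
  have cd : v_ n y - v_ n x @[n --> \oo] --> v y - v x by exact: cvgB.
  by rewrite /= !expr2; exact: cvgM.
by rewrite (cvg_limn_einf_sup c).1.
Qed.

End jump_null_sets.

Section weighted_energy_time.
Context {R : realType} {d} {T : measurableType d}.
Variables (m : {sigma_finite_measure set T -> \bar R}).
Variables (k : R.-spker (measurableTypeR R * T) ~> T) (K : R.-sfker T ~> T).
Hypothesis js : jump_semigroup m k K.
Let sg := js_semigroup js.
Hypothesis cons : forall t, 0 < t -> {ae m, forall x, Pe k t (cst 1%E) x = 1%E}.
Local Notation Pr := (Pr k).
Local Notation Lp := (Lp m).
Local Notation mu := (@lebesgue_measure R).

Implicit Types (f g v w phi : T -> R).

Lemma weighted_energy_ge0 v phi : (forall x, 0 <= phi x) -> (0 <= weighted_energy m K v phi)%E.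
Proof. by move=> p0; rewrite weighted_energy_def; apply: jint_ge0 => z; rewrite mulr_ge0 ?sqr_ge0. Qed.

Lemma measurable_weighted_energy f g : measurable_fun setT f -> measurable_fun setT g ->
  (forall x, 0 <= g x) ->
  measurable_fun setT (fun t : measurableTypeR R => weighted_energy m K (Pr t f) (Pr t g)).
Proof.
move=> mf mg g0; have mPf := measurable_Pr_joint k mf; have mPg := measurable_Pr_joint k mg.
have mphi : measurable_fun setT (fun z : measurableTypeR R * T => z.2) by exact: measurable_snd.
pose F (z : (measurableTypeR R * T) * T) : \bar R :=
  ((Pr z.1.1 f z.2 - Pr z.1.1 f z.1.2) ^+ 2 * Pr z.1.1 g z.1.2)%:E.
have F0 z : (0 <= F z)%E by rewrite lee_fin mulr_ge0 ?sqr_ge0 ?Pr_ge0.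
have mF : measurable_fun setT F.
  have m1 : measurable_fun setT (fun z : (measurableTypeR R * T) * T => Pr z.1.1 f z.1.2).
    exact: (measurableT_comp mPf measurable_fst).
  have m3 : measurable_fun setT (fun z : (measurableTypeR R * T) * T => Pr z.1.1 g z.1.2).
    exact: (measurableT_comp mPg measurable_fst).
  have m2 : measurable_fun setT (fun z : (measurableTypeR R * T) * T => Pr z.1.1 f z.2).
    have h : measurable_fun setT (fun z : (measurableTypeR R * T) * T => (z.1.1, z.2)).
      apply: (@measurable_fun_pair _ _ _ _ _ _ (fun z : (measurableTypeR R * T) * T => z.1.1) snd).
        exact: measurableT_comp measurable_fst measurable_fst.
      exact: measurable_snd.
    exact: (measurableT_comp mPf h).
  apply/measurable_EFinP; apply: measurable_funM => //.
  by apply: measurable_funX; exact: measurable_funB.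
have mI := measurable_int_reindex mphi K mF F0.
have I0 (z : measurableTypeR R * T) : (0 <= \int[K z.2]_y F (z, y))%E.
  by apply: integral_ge0 => y _; exact: F0.
have := @measurable_fun_fubini_tonelli_F _ _ (measurableTypeR R) T R m _ mI I0.
by under [X in _ -> measurable_fun _ X]eq_fun do rewrite weighted_energy_def jint_def.
Qed.

Lemma integral_weighted_energy_bdd (r : R) f g (M : R) : 1 < r -> L2b m f -> L2b m g ->
  (forall x, 0 <= g x) ->
  ((r `^ (r - 1))%:E * \int[m]_x (`|f x| `^ (2 * r))%:E +
   ((r - 1) / r)%:E * \int[m]_x (`|g x| `^ (r / (r - 1)))%:E <= M%:E)%E ->
  (\int[mu]_(t in `]0%R, +oo[) weighted_energy m K (Pr t f) (Pr t g) <= M%:E)%E.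
Proof.
move=> r1 Lf Lg g0 bd.
have mI n : measurable (`[dy n, +oo[%classic : set (measurableTypeR R)) by exact: measurable_itv.
have mJ : measurable (`]0%R, +oo[%classic : set (measurableTypeR R)) by exact: measurable_itv.
pose e n (t : measurableTypeR R) : \bar R :=
  ((varint m k f g (dy n) t * (dy n)^-1%:E) * (\1_(`[dy n, +oo[%classic) t)%:E)%E.
pose G (t : measurableTypeR R) : \bar R :=
  (weighted_energy m K (Pr t f) (Pr t g) * (\1_(`]0%R, +oo[%classic) t)%:E)%E.
have dn0 n : (0 <= (dy n)^-1%:E :> \bar R)%E by rewrite lee_fin invr_ge0 ltW// dy_gt0.
have e0 n t : (0 <= e n t)%E.
  apply: mule_ge0; last by rewrite lee_fin.
  by apply: mule_ge0; [exact: (varint_ge0 m k Lf.2 g0)|exact: dn0].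
have me n : measurable_fun setT (e n).
  apply: emeasurable_funM; last by apply/measurable_EFinP; exact: (measurable_indic (mI n)).
  by apply: emeasurable_funM => //; exact: (measurable_varint m k Lf.2 Lg.2 g0).
have G0 t : (0 <= G t)%E by rewrite /G mule_ge0 ?lee_fin// weighted_energy_ge0// => x; exact: Pr_ge0.
have mG : measurable_fun setT G.
  apply: emeasurable_funM; last by apply/measurable_EFinP; exact: (measurable_indic mJ).
  exact: (measurable_weighted_energy (bdd_meas Lf.2) (bdd_meas Lg.2) g0).
have -> : (\int[mu]_(t in `]0%R, +oo[) weighted_energy m K (Pr t f) (Pr t g) = \int[mu]_t G t)%E.
  rewrite integral_mkcond; apply: eq_integral => t _.
  by rewrite patchE /G indicE; case: (t \in _); rewrite ?mule1 ?mule0.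
have e2 : 2 = 2 * 1 :> R by rewrite mulr1.
have Lf1 : Lp (2 * 1) f by rewrite -e2; exact: Lf.1.
have Lg1 : Lp (2 * 1) g by rewrite -e2; exact: Lg.1.
apply: (fatou_ae me e0 mG G0).
(* The variance limit needs finite energy of P_t f and P_t g, which the case r = 1 provides for
   almost every t. *)
- apply: filterS2 (Esup_fin js (lexx 1) Lf1) (Esup_fin js (lexx 1) Lg1) => t.
  rewrite !psit1 => Ef Eg; have [t0|t0] := ltP 0 t; last first.
    rewrite /G indicE memNset ?mule0; first by apply: limn_einf_ge0 => n; exact: e0.
    by rewrite /= in_itv/= andbT; apply/negP; rewrite -leNgt.
  have c := cvg_vard js (L2b_Pr js t0 Lf) (L2b_Pr js t0 Lg)
    (fun x => Pr_ge0 k t x g0) (Ef t0) (Eg t0).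
  have ce : e n t @[n --> \oo] --> G t.
    rewrite /G indicE mem_set ?mule1/= ?in_itv/= ?t0//.
    apply: cvg_trans c; apply: near_eq_cvg.
    have ht : \forall n \near \oo, @dy R n < t by exact: (cvgr_lt (0:R) cvg_dy).
    near=> n; rewrite /e indicE mem_set ?mule1//=.
    by rewrite in_itv/= andbT; apply: ltW; near: n; exact: ht.
  by rewrite (cvg_limn_einf_sup ce).1.
- move=> n.
  have -> : (\int[mu]_t e n t = \int[mu]_(t in `[dy n, +oo[) (varint m k f g (dy n) t * (dy n)^-1%:E))%E.
    rewrite [RHS]integral_mkcond; apply: eq_integral => t _.
    by rewrite patchE /e indicE; case: (t \in _); rewrite ?mule1 ?mule0.
  rewrite ge0_integralZr//; last 2 first.
  - by apply: measurable_funTS; exact: (measurable_varint m k Lf.2 Lg.2 g0).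
  - by move=> t _; exact: (varint_ge0 m k Lf.2 g0).
  apply: (le_trans (lee_wpmul2r (dn0 n) (integral_varint_le sg cons r1 Lf.2 Lg.2 g0 (dy_gt0 n) bd))).
  by rewrite -EFinM mulfK// gt_eqF// dy_gt0.
Unshelve. all: by end_near. Qed.

Section general_function.
Variables (r : R) (f g : T -> R).
Hypotheses (r1 : 1 < r) (Lf : Lp (2 * r) f) (Lg : L2b m g) (g0 : forall x, 0 <= g x).
Let mf : measurable_fun setT f := Lp_meas Lf.
Let mg : measurable_fun setT g := bdd_meas Lg.2.
Let r22 : 2 <= 2 * r. Proof. by move: r1; lra. Qed.
Let r21 : 1 <= 2 * r. Proof. by move: r1; lra. Qed.

(** Small and large values are both removed, so that the cut function is bounded and lies in L^2. *)
Let cut (N : nat) x : R := if `|f x| <= N%:R then trunc f N x else 0.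

Let mcut N : measurable_fun setT (cut N).
Proof.
apply: measurable_fun_ifT => //; last exact: Lp_meas (Lp2_trunc r22 Lf N).
by apply: measurable_fun_ler => //; exact: measurableT_comp.
Qed.

Let cut_le N x : `|cut N x| <= `|f x|.
Proof. by rewrite /cut /trunc; case: ifP => _; [case: ifP => _|]; rewrite ?normr0. Qed.

Let L2b_cut N : L2b m (cut N).
Proof.
split.
  apply: (Lp_dom (Lp2_trunc r22 Lf N)) => // x.
  by rewrite /cut; case: ifP => // _; rewrite normr0.
split => //; exists N%:R => x; rewrite /cut; case: ifPn => [h|_]; last by rewrite normr0.
by rewrite /trunc; case: ifP => // _; rewrite normr0.
Qed.

Let cut_cvg x : cut N x @[N --> \oo] --> f x.
Proof.
apply: cvg_near_cst; have [fx0|fx0] := eqVneq (f x) 0.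
  by apply: nearW => j; rewrite /cut /trunc fx0 !if_same.
near=> j; rewrite /cut ifT; last by near: j; exact: nbhs_infty_ger.
rewrite /trunc ifT//; near: j.
by apply: near_infty_natSinv_lt (PosNum _) => /=; rewrite normr_gt0.
Unshelve. all: by end_near. Qed.

Let Pr_cut_cvg t : 0 < t -> {ae m, forall x, Pr t (cut N) x @[N --> \oo] --> Pr t f x}.
Proof.
move=> t0; apply: filterS (Lp_ae_integrable sg t0 r21 Lf) => x ifx.
have := @dominated_cvg _ _ _ (k (t, x)) setT measurableT (fun N y => (cut N y)%:E)
  (EFin \o f) (fun y => `|f y|%:E).
move=> H; have {}H : (\int[k (t, x)]_y (cut N y)%:E)%E @[N --> \oo] --> (\int[k (t, x)]_y (f y)%:E)%E.
  apply: H => //.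
  - by move=> N; exact/measurable_EFinP.
  - by move=> y _; apply: cvg_EFin; [exact: nearW|exact: cut_cvg].
  - by have := integrable_abse ifx.
  - by move=> N y _; rewrite lee_fin cut_le.
rewrite PrE; rewrite -(fineK_integral ifx) in H.
apply: (cvg_trans _ (fine_cvg H)); apply: near_eq_cvg; apply: nearW => N.
by rewrite /= -(fineK_integral (Pr_int k t x (L2b_cut N).2)) PrE.
Qed.

Lemma integral_weighted_energy (M : R) :
  ((r `^ (r - 1))%:E * \int[m]_x (`|f x| `^ (2 * r))%:E +
   ((r - 1) / r)%:E * \int[m]_x (`|g x| `^ (r / (r - 1)))%:E <= M%:E)%E ->
  (\int[mu]_(t in `]0%R, +oo[) weighted_energy m K (Pr t f) (Pr t g) <= M%:E)%E.
Proof.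
move=> bd.
have mJ : measurable (`]0%R, +oo[%classic : set (measurableTypeR R)) by exact: measurable_itv.
pose W w (t : measurableTypeR R) : \bar R :=
  (weighted_energy m K (Pr t w) (Pr t g) * (\1_(`]0%R, +oo[%classic) t)%:E)%E.
have W0 w t : (0 <= W w t)%E.
  by rewrite /W mule_ge0 ?lee_fin// weighted_energy_ge0// => x; exact: Pr_ge0.
have mW w : measurable_fun setT w -> measurable_fun setT (W w).
  move=> mw; apply: emeasurable_funM; last by apply/measurable_EFinP; exact: (measurable_indic mJ).
  exact: measurable_weighted_energy.
have WE w : (\int[mu]_(t in `]0%R, +oo[) weighted_energy m K (Pr t w) (Pr t g) = \int[mu]_t W w t)%E.
  rewrite integral_mkcond; apply: eq_integral => t _.
  by rewrite patchE /W indicE; case: (t \in _); rewrite ?mule1 ?mule0.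
have Wneg w t : t <= 0 -> W w t = 0%E.
  move=> t0; rewrite /W indicE memNset ?mule0//.
  by rewrite /= in_itv/= andbT; apply/negP; rewrite -leNgt.
have Wpos w t : 0 < t -> W w t = weighted_energy m K (Pr t w) (Pr t g).
  by move=> t0; rewrite /W indicE mem_set ?mule1//= in_itv/= t0.
rewrite WE; apply: (fatou_ae (g := fun N => W (cut N))) => //.
- by move=> N; exact: mW.
- exact: mW.
- apply: nearW => t; have [t0|t0] := ltP 0 t; last first.
    by rewrite (Wneg _ _ t0); apply: limn_einf_ge0 => n.
  rewrite (Wpos f t t0) (_ : (fun N => W (cut N) t) =
    (fun N => weighted_energy m K (Pr t (cut N)) (Pr t g))); last first.
    by apply/funext => N; exact: Wpos.
  apply: (weighted_energy_fatou (js_symmetric js) _ _ _ _ (Pr_cut_cvg t0)).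
  - by move=> n; exact: measurable_Pr.
  - exact: measurable_Pr.
  - exact: measurable_Pr.
  - by move=> x; exact: Pr_ge0.
move=> N; rewrite -WE; apply: (integral_weighted_energy_bdd r1 (L2b_cut N) Lg g0).
have c0 : (0 <= (r `^ (r - 1))%:E)%E by rewrite lee_fin powR_ge0.
have h : (\int[m]_x (`|cut N x| `^ (2 * r))%:E <= \int[m]_x (`|f x| `^ (2 * r))%:E)%E.
  have := @Np_le _ _ _ m (2 * r) (cut N) f mf (mcut N) (le_trans ler01 r21) (cut_le N).
  by rewrite !Np_def.
exact: (le_trans (leeD2r _ (lee_wpmul2l c0 h)) bd).
Qed.

(** Once P_t has been moved to g, the bound chi <= 1 replaces the restricted carre du champ by the
    full jump integral; p > 2 leaves no need for the exact weight. *)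
Lemma integral_weighted_sqf (M : R) :
  ((r `^ (r - 1))%:E * \int[m]_x (`|f x| `^ (2 * r))%:E +
   ((r - 1) / r)%:E * \int[m]_x (`|g x| `^ (r / (r - 1)))%:E <= M%:E)%E ->
  (\int[m]_x ((g x)%:E * sqf k K f x) <= M%:E)%E.
Proof.
move=> bd; apply: le_trans (integral_weighted_energy bd).
have mEg : measurable_fun setT (EFin \o g) by exact/measurable_EFinP.
have Eg0 x : (0 <= (EFin \o g) x)%E by rewrite lee_fin.
rewrite (sqfE js mf mEg Eg0); apply: ge0_le_integral => //.
- by move=> t _; apply: integral_ge0 => x _; rewrite mule_ge0 ?carre_ge0 ?Pe_ge0.
- apply: measurable_funTS.
  apply: (@measurable_fun_fubini_tonelli_F _ _ (measurableTypeR R) T R m (fun z => Pe k z.1 (EFin \o g) z.2 * carre K (Pr z.1 f) z.2)%E).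
    by apply: emeasurable_funM; [exact: measurable_Pe_joint_cst|exact: measurable_carre_joint].
  by move=> z; rewrite mule_ge0 ?carre_ge0 ?Pe_ge0.
- by apply: measurable_funTS; exact: measurable_weighted_energy.
move=> t _; rewrite weighted_energy_def jint_def.
have mPf := measurable_Pr k t mf; have mPg := measurable_Pr k t mg.
have Pg0 x : 0 <= Pr t g x by exact: Pr_ge0.
pose u := Pr t f.
have mu1 : measurable_fun setT (fun z : T * T => u z.1) by exact: measurableT_comp measurable_fst.
have mu2 : measurable_fun setT (fun z : T * T => u z.2) by exact: measurableT_comp measurable_snd.
have md2 : measurable_fun setT (fun z : T * T => (u z.2 - u z.1) ^+ 2).
  by apply: measurable_funX; exact: measurable_funB.
have md : measurable_fun setT (fun z : T * T => (u z.2 - u z.1) ^+ 2 * Pr t g z.1).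
  by apply: measurable_funM => //; exact: measurableT_comp measurable_fst.
apply: le_intT => [x|||x].
- by rewrite mule_ge0 ?carre_ge0 ?Pe_ge0.
- by apply: emeasurable_funM; [exact: measurable_Pe|exact: measurable_carre].
- apply: (@measurable_int_jump _ _ _ K (fun z : T * T => (u z.2 - u z.1) ^+ 2 * Pr t g z.1)) => //.
  by move=> z; rewrite mulr_ge0 ?sqr_ge0.
rewrite -(PeEb k t x Lg.2 g0) carre_def -/u -ge0_integralZl//; last 3 first.
- apply: (@measurable_EFin_slice _ _ _ (fun z : T * T => (u z.2 - u z.1) ^+ 2 * chi (u z.1) (u z.2))).
  by apply: measurable_funM => //; exact: measurable_chi.
- by move=> y _; rewrite lee_fin mulr_ge0 ?sqr_ge0 ?chi_ge0.
- by rewrite lee_fin.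
apply: le_intT => [y|||y].
- by rewrite -EFinM lee_fin mulr_ge0// mulr_ge0 ?sqr_ge0 ?chi_ge0.
- apply: measurable_funeM.
  apply: (@measurable_EFin_slice _ _ _ (fun z : T * T => (u z.2 - u z.1) ^+ 2 * chi (u z.1) (u z.2))).
  by apply: measurable_funM => //; exact: measurable_chi.
- exact: (measurable_EFin_slice x md).
rewrite -EFinM lee_fin mulrC ler_wpM2r// -[leRHS]mulr1 ler_wpM2l ?sqr_ge0//.
exact: chi_le1.
Qed.

End general_function.

End weighted_energy_time.

Section square_function_upper.
Context {R : realType} {d} {T : measurableType d}.
Variables (m : {sigma_finite_measure set T -> \bar R}).
Variables (k : R.-spker (measurableTypeR R * T) ~> T) (K : R.-sfker T ~> T).
Hypothesis js : jump_semigroup m k K.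
Hypothesis cons : forall t, 0 < t -> {ae m, forall x, Pe k t (cst 1%E) x = 1%E}.
Variables (r : R) (f : T -> R).
Hypotheses (r1 : 1 < r) (Lf : Lp m (2 * r) f).
Let mf : measurable_fun setT f := Lp_meas Lf.
Local Notation S := (sqf k K f).

Let r0 : 0 < r. Proof. by move: r1; lra. Qed.
Let rB0 : 0 < r - 1. Proof. by move: r1; lra. Qed.

Let s (N : nat) x : R := fine (mine (S x) N%:R%:E).

Let s_min N x : (s N x)%:E = mine (S x) N%:R%:E.
Proof.
rewrite fineK// fin_numE; have := sqf_ge0 k K f x; move: (S x) => [y| |]//= y0.
by rewrite -EFin_min.
Qed.

Let s_ge0 N x : 0 <= s N x.
Proof. by rewrite -lee_fin s_min le_min sqf_ge0 lee_fin ler0n. Qed.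

Let s_leN N x : s N x <= N%:R.
Proof. by rewrite -lee_fin s_min ge_min lexx orbT. Qed.

Let s_leS N x : ((s N x)%:E <= S x)%E.
Proof. by rewrite s_min ge_min lexx. Qed.

Let ms N : measurable_fun setT (s N).
Proof.
apply/measurable_EFinP; rewrite (_ : EFin \o s N = fun x => mine (S x) N%:R%:E); last first.
  by apply/funext => x /=; exact: s_min.
by apply: measurable_mine => //; exact: measurable_sqf.
Qed.

Section fixed_set.
Variables (C : set T) (N : nat).
Hypotheses (mC : measurable C) (Cfin : (m C < +oo)%E).

(** The extremal weight of the duality between L^r and its dual: g s and g^(r/(r-1)) both equal s^r
    on C. The cuts at height N and to C make its integral finite. *)
Let g x : R := s N x `^ (r - 1) * \1_C x.

Let g0 x : 0 <= g x. Proof. by rewrite mulr_ge0 ?powR_ge0. Qed.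

Let g_le x : g x <= N%:R `^ (r - 1) * \1_C x.
Proof. by rewrite ler_wpM2r// ge0_ler_powR ?nnegrE// ?ltW. Qed.

Let mg : measurable_fun setT g.
Proof.
apply: measurable_funM; last exact: measurable_indic.
have := @measurable_norm_powR _ _ _ (r - 1) _ (ms N).
by apply: eq_measurable_fun => x _; rewrite ger0_norm.
Qed.

Let fin_int (c : R) (h : T -> R) : 0 <= c -> measurable_fun setT h ->
  (forall x, 0 <= h x) -> (forall x, h x <= c * \1_C x) -> (\int[m]_x (h x)%:E < +oo)%E.
Proof.
move=> c0 mh h0 hc; apply: (@le_lt_trans _ _ (\int[m]_x (c%:E * (\1_C x)%:E))%E).
  apply: le_intT => [x|||x].
  - by rewrite lee_fin.
  - exact/measurable_EFinP.
  - by apply: measurable_funeM; apply/measurable_EFinP; exact: measurable_indic.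
  - by rewrite -EFinM lee_fin.
rewrite ge0_integralZl//; last by apply/measurable_EFinP; exact: measurable_indic.
by rewrite integral_indic// setIT; exact: lte_mul_pinfty.
Qed.

Let Lg : L2b m g.
Proof.
split; last first.
  split => //; exists (N%:R `^ (r - 1)) => x; rewrite ger0_norm//.
  by apply: (le_trans (g_le x)); rewrite ler_piMr ?powR_ge0// indicE; case: (_ \in _).
apply/Lp2P; split => //; apply/integrable_ge0P.
- exact: measurable_funX.
- by move=> x; rewrite sqr_ge0.
apply: (@fin_int ((N%:R `^ (r - 1)) ^+ 2) (fun x => g x ^+ 2)) => //.
- exact: measurable_funX.
- by move=> x; rewrite sqr_ge0.
move=> x; apply: (@le_trans _ _ ((N%:R `^ (r - 1) * \1_C x) ^+ 2)).
  by rewrite ler_pXn2r ?nnegrE// mulr_ge0 ?powR_ge0.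
by rewrite exprMn ler_wpM2l ?sqr_ge0// indicE; case: (_ \in _); rewrite ?expr1n ?expr0n.
Qed.

Let h x : R := s N x `^ r * \1_C x.

Let h0 x : 0 <= h x. Proof. by rewrite mulr_ge0 ?powR_ge0. Qed.

Let mh : measurable_fun setT h.
Proof.
apply: measurable_funM; last exact: measurable_indic.
have := @measurable_norm_powR _ _ _ r _ (ms N).
by apply: eq_measurable_fun => x _; rewrite ger0_norm.
Qed.

Lemma integral_cut_sqf_le :
  (\int[m]_x (s N x `^ r * \1_C x)%:E <= (r * r `^ (r - 1) * nu m (2 * r) f)%:E)%E.
Proof.
have Afin : (\int[m]_x (h x)%:E < +oo)%E.
  apply: (@fin_int (N%:R `^ r) h) => //.
  by move=> x; rewrite ler_wpM2r// ge0_ler_powR ?nnegrE// ?ltW.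
have A0 : (0 <= \int[m]_x (h x)%:E)%E by apply: integral_ge0 => x _; rewrite lee_fin.
have gr x : `|g x| `^ (r / (r - 1)) = h x.
  rewrite /g /h indicE; case: (_ \in _); rewrite ?mulr0 ?mulr1.
    by rewrite ger0_norm ?powR_ge0// -powRrM mulrC divfK// gt_eqF.
  by rewrite normr0 powR0// gt_eqF// divr_gt0.
have gs x : ((h x)%:E <= (g x)%:E * S x)%E.
  apply: (@le_trans _ _ ((g x)%:E * (s N x)%:E)%E); last by rewrite lee_wpmul2l ?lee_fin.
  rewrite -EFinM lee_fin /g /h -(mulr_powRB1_ge0 (ltW r1) (s_ge0 N x)).
  by rewrite le_eqVlt; apply/orP; left; apply/eqP; ring.
pose A := fine (\int[m]_x (h x)%:E)%E.
have AE : (\int[m]_x (h x)%:E)%E = A%:E by rewrite fineK// ge0_fin_numE.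
have bd : ((r `^ (r - 1))%:E * \int[m]_x (`|f x| `^ (2 * r))%:E +
   ((r - 1) / r)%:E * \int[m]_x (`|g x| `^ (r / (r - 1)))%:E <=
   (r `^ (r - 1) * nu m (2 * r) f + (r - 1) / r * A)%:E)%E.
  have -> : (\int[m]_x (`|g x| `^ (r / (r - 1)))%:E)%E = A%:E.
    by rewrite -AE; apply: eq_integral => x _; rewrite gr.
  by rewrite -Np_def (Np_nu Lf) -!EFinM -EFinD.
have main := integral_weighted_sqf js cons r1 Lf Lg g0 bd.
have : (A%:E <= (r `^ (r - 1) * nu m (2 * r) f + (r - 1) / r * A)%:E)%E.
  apply: le_trans main; rewrite -AE; apply: le_intT => //.
  - exact/measurable_EFinP.
  - by apply: emeasurable_funM; [exact/measurable_EFinP|exact: measurable_sqf].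
rewrite -/h AE !lee_fin -(mulrA r).
move: (r `^ (r - 1) * nu m (2 * r) f) => B.
(* Testing gives A <= b + (1 - 1/r) A for the finite number A; absorption multiplies b by r. *)
have aux (a b q : R) : 0 < q -> a <= b + (q - 1) / q * a -> a <= q * b.
  move=> q0 H; rewrite -(ler_pM2l (x := q^-1)) ?invr_gt0// mulrA mulVf ?gt_eqF// mul1r.
  have : (q - 1) / q * a = a - q^-1 * a by field; rewrite gt_eqF.
  by move: H => /[swap] ->; move: (q^-1 * a) => c; lra.
exact: aux.
Qed.

End fixed_set.

Lemma integral_sqf_pow_le :
  (\int[m]_x (S x `^ r) <= (r * r `^ (r - 1) * nu m (2 * r) f)%:E)%E.
Proof.
have [F [FT Fnd Ffin]] := (@sigma_finiteP _ _ _ _ m).1 (sigma_finiteT m).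
have mS := measurable_sqf k K mf.
apply: (@fatou_ae _ _ _ m (fun N x => (s N x `^ r * \1_(F N) x)%:E)).
- move=> N; apply/measurable_EFinP; apply: measurable_funM.
    have := @measurable_norm_powR _ _ _ r _ (ms N).
    by apply: eq_measurable_fun => x _; rewrite ger0_norm.
  exact: measurable_indic (Ffin N).1.
- by move=> N x; rewrite lee_fin mulr_ge0 ?powR_ge0.
- by exact: measurableT_comp (measurable_poweR r) mS.
- by move=> x; exact: poweR_ge0.
- apply: nearW => x.
  have [n0 Fx] : exists n0, forall n, (n0 <= n)%N -> x \in F n.
    have : (\bigcup_i F i) x by rewrite -FT.
    move=> [n0 _ Fx]; exists n0 => n n0n; rewrite inE.
    by have /subsetPset := Fnd _ _ n0n; exact.
  suff c : (s N x `^ r * \1_(F N) x)%:E @[N --> \oo] --> (S x `^ r)%E.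
    by rewrite (cvg_limn_einf_sup c).1.
  have := s_min ^~ x; have := s_ge0 ^~ x; have := sqf_ge0 k K f x.
  case: (S x) => [y| |//] y0 s0 sE.
    rewrite poweR_EFin; apply: cvg_near_cst; near=> N.
    rewrite indicE Fx ?mulr1; last by near: N; exact: nbhs_infty_ge.
    congr ((_ `^ r)%:E); have := sE N; rewrite -EFin_min => -[->].
    by apply/min_idPl; near: N; exact: nbhs_infty_ger.
  rewrite poweRE (negbTE (lt0r_neq0 r0)) eqxx; apply/cvgeyPge => A.
  near=> N; rewrite indicE Fx ?mulr1 ?lee_fin; last by near: N; exact: nbhs_infty_ge.
  have -> : s N x = N%:R.
    by have := sE N; rewrite /mine ltNge leey => -[].
  apply: (@le_trans _ _ (N%:R)); first by near: N; exact: nbhs_infty_ger.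
  rewrite le1r_powR ?(ltW r1)// ler1n; near: N; exact: nbhs_infty_gt.
- by move=> N; exact: (integral_cut_sqf_le _ (Ffin N).1 (Ffin N).2).
Unshelve. all: by end_near. Qed.

End square_function_upper.

(** * State space and transition kernel *)

Section good_balls.
Context {R : realType} {E : pmetricType R}.
Hypothesis HE : @locally_compact_separable R E.

Lemma separating_sequence : exists s : nat -> E, forall (x : E) (e : R), 0 < e ->
  exists n, mdist x (s n) < e.
Proof.
have [_ [S cS dS]] := HE.
have Sx x e : 0 < e -> exists2 y, S y & mdist x y < e.
  move=> e0; have bx : ball x e x by exact: ballxx.
  have [y [by_ Sy]] : (ball x e)^° `&` S !=set0.
    apply: dS; last exact: open_interior.
    by exists x; apply: nbhsx_ballx.
  exists y => //; have := interior_subset by_.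
  by rewrite ballEmdist.
have [y0 Sy0 _] := Sx point 1 ltr01.
have /countable_injP[f injf] := cS.
pose s n := 'pinv_(cst y0) S f n.
exists s => x e e0; have [y Sy xy] := Sx x e e0.
by exists (f y); rewrite /s pinvKV// inE.
Qed.

Lemma mdist_continuous (c : E) : continuous (fun x : E => mdist c x).
Proof.
move=> x; apply/cvgrPdist_lt => e e0.
near=> y; have xy : mdist x y < e.
  by near: y; apply/nbhs_ballP; exists e => // y; rewrite ballEmdist.
have t1 := metric_triangle c x y; have t2 := metric_triangle c y x.
have sy := metric_sym x y.
rewrite ltr_norml; apply/andP; split; move: t1 t2 sy xy; lra.
Unshelve. all: by end_near. Qed.

Lemma small_compact_ball (x : E) : exists2 e : R, 0 < e & precompact (ball x e).
Proof.
have [lc _] := HE; have [U wU [cU clU]] := lc x I.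
have /nbhs_ballP[e e0 eU] : nbhs x U.
  by apply: filterS (wU : nbhs x [set y | setT y -> U y]) => y; exact.
by exists e => //; exists U.
Qed.

Lemma good_balls : exists (c : nat -> E) (rho : nat -> R),
  (forall i, precompact (ball (c i) (rho i))) /\
  (forall (U : set E) x, open U -> U x ->
    exists i, ball (c i) (rho i) x /\ ball (c i) (rho i) `<=` U).
Proof.
have [s sE] := separating_sequence.
have [e0 _ pe0] := small_compact_ball point.
(* Centres in the dense sequence and radii 1/(n+1), enumerated by pickling; indices without a
   precompact ball receive a fixed one, so that the enumeration is total. *)
pose c (i : nat) : E * R := if unpickle i is Some (j, n) then
  (if pselect (precompact (ball (s j) (n.+1%:R^-1 : R))) then (s j, n.+1%:R^-1) else (point, e0))
  else (point, e0).
exists (fst \o c), (snd \o c); split.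
  by move=> i; rewrite /c/=; case: unpickle => [[j n]|//]; case: pselect.
move=> U x oU Ux.
have [e e_gt0 eU] : exists2 e, 0 < e & ball x e `<=` U.
  by have /nbhs_ballP[e /= ep eU] : nbhs x U by [exact: open_nbhs_nbhs]; exists e.
have [e1 e10 pe1] := small_compact_ball x.
pose d := Num.min e e1; have d0 : 0 < d by rewrite lt_min e_gt0.
have [n nd] : exists n : nat, n.+1%:R^-1 < d / 2.
  have d20 : 0 < d / 2 by rewrite divr_gt0.
  have [N _ HN] := near_infty_natSinv_lt (PosNum d20).
  by exists N; exact: (HN N (leqnn N)).
have n0 : 0 < n.+1%:R^-1 :> R by rewrite invr_gt0.
have [j xj] := sE x _ n0.
have aux (q e' a b b' : R) : q < e' / 2 -> a < q -> b < q -> b' <= a + b -> b' < e' by lra.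
have sub : ball (s j) (n.+1%:R^-1 : R) `<=` ball x d.
  move=> y; rewrite !ballEmdist/= => jy.
  exact: aux nd xj jy (metric_triangle x (s j) y).
have pj : precompact (ball (s j) (n.+1%:R^-1 : R)).
  apply: precompact_subset pe1; apply: (subset_trans sub).
  by move=> y; rewrite !ballEmdist/= lt_min => /andP[].
exists (pickle (j, n)); rewrite /c/= pickleK; case: pselect => //= _; split.
  by rewrite ballEmdist/= metric_sym.
apply: (subset_trans sub) => y; rewrite ballEmdist/= lt_min => /andP[ye _].
by apply: eU; rewrite ballEmdist.
Qed.

(** Defined on the compactification, because the paths are right-continuous there; precompactness of
    the ball makes the extension by 0 continuous at the cemetery. *)
Definition bump (c : E) (rho : R) (z : cemetery E) : R :=
  oapp (fun x => Num.max 0 (rho - mdist c x)) 0 z.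

Lemma bump_ge0 c rho z : 0 <= bump c rho z.
Proof. by case: z => [x|] //=; rewrite le_max lexx. Qed.

Lemma bump_gt0 c rho x : (0 < bump c rho (Some x)) = (mdist c x < rho).
Proof. by rewrite /bump/= lt_max ltxx/= subr_gt0. Qed.

Lemma bump_continuous c rho : precompact (ball c rho) ->
  continuous (bump c rho : cemetery E -> R).
Proof.
move=> pc [x|].
  have h : (fun x => Num.max 0 (rho - mdist c x)) @ x --> Num.max 0 (rho - mdist c x).
    have h1 : {for x, continuous (fun y : E => rho - mdist c y : R^o)}.
      by apply: cvgB; [exact: cvg_cst|exact: mdist_continuous].
    have h0 : {for x, continuous (fun _ : E => 0 : R^o)} by exact: cvg_cst.
    exact: (continuous_max h0 h1).
  by move=> A /h; rewrite /nbhs/= /nbhs/=.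
have FN := @nbhs_filter (cemetery E) None.
apply: (@cvg_near_cst _ _ _ _ (nbhs (None : cemetery E)) FN).
have pcc : compact (closure (ball c rho)) by rewrite -precompactE.
exists (closure (ball c rho)); first by split => //; exact: closed_closure.
move=> z [[x nx <-]|->//]; rewrite /= /bump/=.
apply/max_idPl; rewrite subr_le0 leNgt; apply/negP => cx; apply: nx.
by apply: subset_closure; rewrite ballEmdist.
Qed.

(** The functions are min(1, n S_n), where S_n sums the bumps of the first n good balls contained in
    U: a positive bump at x eventually forces the value 1. *)
Lemma open_approx (U : set E) : open U -> exists G : nat -> cemetery E -> R,
  [/\ forall n, continuous (G n), forall n z, 0 <= G n z <= 1 &
      forall z, G n z @[n --> \oo] --> (\1_(Some @` U) z : R)].
Proof.
move=> oU; have [c [rho [pc cover]]] := good_balls.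
pose t i z : R := if pselect (ball (c i) (rho i) `<=` U) then bump (c i) (rho i) z else 0.
have t0 i z : 0 <= t i z by rewrite /t; case: pselect => ? //=; exact: bump_ge0.
have ct i : continuous (t i).
  rewrite /t; case: pselect => ? /=; first exact: bump_continuous.
  exact: cst_continuous.
pose S n z : R := \sum_(i < n) t i z.
have S0 n z : 0 <= S n z by exact: sumr_ge0.
have cS n : continuous (S n).
  elim: n => [|n IH].
    rewrite (_ : S 0 = fun=> 0); first exact: cst_continuous.
    by apply/funext => z; rewrite /S big_ord0.
  rewrite (_ : S n.+1 = fun z => S n z + t n z); last first.
    by apply/funext => z; rewrite /S big_ord_recr.
  by move=> z; exact: (cvgD (IH z) (ct n z)).
exists (fun n z => Num.min 1 (n%:R * S n z)); split.
- move=> n z.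
  have h0 : {for z, continuous (fun _ : cemetery E => 1 : R^o)}.
    exact: (@cst_continuous (cemetery E) R^o 1 z).
  have h1 : {for z, continuous (fun z : cemetery E => n%:R * S n z : R^o)}.
    exact: (cvgM (@cst_continuous (cemetery E) R n%:R z) (cS n z)).
  exact: (continuous_min h0 h1).
- by move=> n z; rewrite le_min ler01 mulr_ge0//= ge_min lexx.
move=> z; have [[x Ux <-{z}]|nU] := pselect ((Some @` U) z); last first.
  rewrite indicE memNset//.
  apply: cvg_near_cst; apply: nearW => n; rewrite /S big1 ?mulr0//.
    by apply/min_idPr.
  move=> i _; rewrite /t; case: pselect => [iU|//] /=.
  case: z nU => [x|//] nU; apply/eqP; rewrite eq_le bump_ge0 andbT leNgt bump_gt0.
  by apply/negP => ix; apply: nU; exists x => //; apply: iU; rewrite ballEmdist.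
have sx : (Some x : cemetery E) \in (Some @` U) by rewrite inE; exists x.
rewrite indicE sx.
have [i [ix iU]] := cover U x oU Ux.
have tx : 0 < t i (Some x).
  by rewrite /t; case: pselect => ? //=; rewrite bump_gt0; move: ix; rewrite ballEmdist.
apply: cvg_near_cst; near=> n; apply/min_idPl.
have ni : (i < n)%N by near: n; exact: nbhs_infty_gt.
have St : t i (Some x) <= S n (Some x).
  by rewrite /S (bigD1 (Ordinal ni))//= lerDl; exact: sumr_ge0.
apply: (@le_trans _ _ (n%:R * t i (Some x))); last by rewrite ler_wpM2l.
rewrite -ler_pdivrMr// ; near: n; exact: nbhs_infty_ger.
Unshelve. all: by end_near. Qed.

(** Measurability is meant in the product sigma-algebra, so the set is written as a countable union
    of products of disjoint balls. *)
Lemma measurable_off_diagonal : measurable (@off_diagonal R E).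
Proof.
have [c [rho [_ cover]]] := good_balls.
have -> : @off_diagonal R E = \bigcup_i \bigcup_(j in [set j |
    ball (c i) (rho i) `&` ball (c j) (rho j) = set0])
    (ball (c i) (rho i) `*` ball (c j) (rho j)).
  apply/seteqP; split => [[x y] /= xy|[x y] [i _ [j /= ij [xi yj]]]]; last first.
    move=> /= exy; have : (ball (c i) (rho i) `&` ball (c j) (rho j)) x.
      by split => //; move: yj => /=; rewrite -exy.
    by rewrite ij.
  have d0 : 0 < mdist x y by rewrite mdist_gt0; apply/eqP.
  pose d := mdist x y / 2; have dd : 0 < d by rewrite divr_gt0.
  have o (z : E) : open ((ball z d)^°) by exact: open_interior.
  have bz (z : E) : (ball z d)^° z by apply: nbhsx_ballx.
  have [i [ix iU]] := cover _ _ (o x) (bz x); have [j [jy jU]] := cover _ _ (o y) (bz y).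
  exists i => //; exists j => //=; apply/seteqP; split => // z [iz jz].
  have := interior_subset (iU _ iz); have := interior_subset (jU _ jz).
  rewrite !ballEmdist/= => yz xz; have := metric_triangle x z y.
  rewrite (metric_sym z y); move: xz yz; rewrite /d; lra.
apply: bigcupT_measurable => i; apply: bigcup_measurable => j _.
have mb k : measurable (ball (c k) (rho k) : set (borel E)).
  apply: sub_sigma_algebra; rewrite (_ : ball _ _ = (fun x => mdist (c k) x) @^-1` [set r | r < rho k]).
    by apply: open_comp => [x _|]; [exact: mdist_continuous|exact: open_lt].
  by rewrite ballEmdist.
exact: measurableX.
Qed.

Lemma radon_sigma_finite (m : {measure set (borel E) -> \bar R}) :
  radon_measure m -> sigma_finite setT m.
Proof.
move=> [mfin _]; have [c [rho [pc cover]]] := good_balls.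
exists (fun i => closure (ball (c i) (rho i))).
  apply/seteqP; split => // x _; have [i [ix _]] := cover setT x openT I.
  by exists i => //; exact: subset_closure.
move=> i; split; last by apply: mfin; rewrite -precompactE.
rewrite -[closure _]setCK; apply: measurableC; apply: sub_sigma_algebra.
by apply: closed_openC; exact: closed_closure.
Qed.

End good_balls.

(** * Joint measurability and the transition kernel *)

Section transition_integral.
Context {R : realType} {E : pmetricType R} {d : measure_display}
  {Omega : measurableType d}.
Variables (X : R -> {mfun Omega >-> borel (cemetery E)}).
Variables (P : R.-pker (borel (cemetery E)) ~> Omega).
Local Notation B := (borel E).
Local Notation tr := (transition X P).
Implicit Types (t s : R) (x : E).

Lemma measurable_alive t (A : set B) : measurable A ->
  measurable (X t @^-1` (Some @` A)).
Proof.
move=> mA; rewrite -[_ @^-1` _]setTI.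
by apply: (@measurable_funPT _ _ _ _ (X t)) => //; exact: measurable_image_Some.
Qed.

(** The Dirac mass at X_t(w), or the zero measure after death: the transition measure is its mixture
    under P_x. *)
Definition alive_dirac t (w : Omega) : {measure set B -> \bar R} :=
  if (X t w : option E) is Some y then [the {measure set B -> \bar R} of dirac (y : B)]
  else [the {measure set B -> \bar R} of mzero].

Let alive_diracE t w (A : set B) : alive_dirac t w A = (\1_(X t @^-1` (Some @` A)) w)%:E.
Proof.
rewrite /alive_dirac indicE; case e : (X t w : option E) => [y|] /=.
  rewrite diracE; suff -> : (y \in A) = (w \in X t @^-1` (Some @` A)) by [].
  apply/idP/idP; rewrite !inE.
    by move=> Ay; exists y => //; rewrite e.
  by move=> [z Az]; rewrite e => -[<-].
rewrite memNset//= => -[z Az]; rewrite e.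
by [].
Qed.

Let moapp t (g : B -> \bar R) w : (forall y, 0 <= g y)%E ->
  measurable_fun setT g -> (\int[alive_dirac t w]_y g y = oapp g 0 (X t w : option E))%E.
Proof.
move=> g0 mg; rewrite /alive_dirac; case: (X t w : option E) => [y|] /=.
  by rewrite integral_dirac// diracT mul1e.
exact: integral_measure_zero.
Qed.

Lemma semigroup_ge0E t (g : B -> \bar R) x : measurable_fun setT g -> (forall y, 0 <= g y)%E ->
  semigroup X P t g x = (\int[tr t x]_y g y)%E.
Proof.
move=> mg g0; rewrite (@integral_mixture _ _ _ _ _ (P (Some x)) (alive_dirac t)) //.
- by apply: eq_integral => w _; rewrite moapp.
- move=> A mA; rewrite (_ : (fun w => _) = (fun w => (\1_(X t @^-1` (Some @` A)) w)%:E)).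
    by apply/measurable_EFinP; apply: measurable_indic; exact: measurable_alive.
  by apply/funext => w; exact: alive_diracE.
- move=> A mA; rewrite (eq_integral (fun w => (\1_(X t @^-1` (Some @` A)) w)%:E)); last first.
    by move=> w _; exact: alive_diracE.
  by rewrite integral_indic ?setIT//; exact: measurable_alive.
Qed.

Lemma semigroupE t (g : B -> \bar R) x : measurable_fun setT g ->
  semigroup X P t g x = (\int[tr t x]_y g y)%E.
Proof.
move=> mg; rewrite /semigroup integralE [RHS]integralE.
rewrite -(semigroup_ge0E t x (measurable_funepos mg) (funepos_ge0 _)).
rewrite -(semigroup_ge0E t x (measurable_funeneg mg) (funeneg_ge0 _)).
congr (_ - _)%E; apply: eq_integral => w _; rewrite ?funeposE ?funenegE.
- by case: (X t w) => [y|] /=; rewrite ?funeposE ?maxxx.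
- case: (X t w) => [y|] /=; first by rewrite funenegE.
  by rewrite oppr0 maxxx.
Qed.

Lemma Pt_transition t (f : B -> R) x : measurable_fun setT f ->
  Pt X P t f x = \int[tr t x]_y f y.
Proof.
move=> mf; have mEf : measurable_fun setT (EFin \o f) by exact/measurable_EFinP.
by rewrite /Pt (semigroupE t x mEf).
Qed.

Lemma transition_le1 t x : (tr t x setT <= 1)%E.
Proof.
rewrite /transition -(@prob_kernel _ _ _ _ _ P (Some x)).
apply: le_measure; rewrite ?inE//.
apply: measurable_alive; exact: (@measurableT _ B).
Qed.

Lemma transitionE t x (A : set B) : measurable A ->
  tr t x A = (\int[P (Some x)]_w (\1_(Some @` A : set (cemetery E)) (X t w))%:E)%E.
Proof.
move=> mA; rewrite /transition.
rewrite (eq_integral (fun w => (\1_(X t @^-1` (Some @` A)) w)%:E)).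
  by rewrite integral_indic ?setIT//; exact: measurable_alive.
by move=> w _; rewrite !indicE; congr ((_ : nat)%:R%:E); apply/idP/idP; rewrite !inE.
Qed.

End transition_integral.

Section joint_measurability.
Context {R : realType} {E : pmetricType R} {d : measure_display}
  {Omega : measurableType d}.
Variables (F : R -> set (set Omega)) (X : R -> {mfun Omega >-> borel (cemetery E)}).
Variables (P : R.-pker (borel (cemetery E)) ~> Omega).
Hypotheses (HE : @locally_compact_separable R E) (HX : hunt_process F X P).
Local Notation B := (borel E).
Local Notation tr := (transition X P).

Lemma measurable_Some : measurable_fun setT (Some : B -> borel (cemetery E)).
Proof.
apply: (@measurability _ _ B (borel (cemetery E)) setT Some (@open (cemetery E))) => //.
move=> _ [V oV <-]; rewrite setTI; apply: sub_sigma_algebra.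
by apply: open_comp => // x _; exact: one_point_compactification_some_continuous.
Qed.

Lemma continuous_measurable_borel {T : ptopologicalType} (f : T -> R) : continuous f ->
  measurable_fun setT (f : borel T -> R).
Proof.
move=> cf; apply: (@measurability _ _ (borel T) (measurableTypeR R) setT f _ (RGenOpens.measurableE R)).
move=> _ [V oV <-]; rewrite setTI; apply: sub_sigma_algebra.
case: oV => a [b ->]; apply: open_comp => //; exact: interval_open.
Qed.

Section continuous_test.
Variable G : cemetery E -> R.
Hypotheses (cG : continuous G) (G01 : forall z, 0 <= G z <= 1).

Definition expect_at (t : R) (x : B) : \bar R := (\int[P (Some x)]_w (G (X t w))%:E)%E.

Let mG : measurable_fun setT (G : borel (cemetery E) -> R).
Proof. exact: continuous_measurable_borel. Qed.

Let mGX t : measurable_fun setT (fun w => (G (X t w))%:E).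
Proof. by apply/measurable_EFinP; exact: measurableT_comp. Qed.

Let GX0 t w : (0 <= (G (X t w))%:E)%E.
Proof. by rewrite lee_fin; have /andP[] := G01 (X t w). Qed.

Lemma measurable_expect_at t : measurable_fun setT (expect_at t).
Proof.
apply: (measurable_int_reindex measurable_Some P (F := fun z => (G (X t z.2))%:E)) => //.
exact: (measurableT_comp (mGX t) measurable_snd).
Qed.

(** The first point of the grid of mesh 1/(n+1) strictly to the right of t; strictness is what the
    limit from the right requires. *)
Let grid (n : nat) (t : R) : R := (Num.truncn (n.+1%:R * t)).+1%:R / n.+1%:R.

Let grid_gt n t : 0 <= t -> t < grid n t.
Proof.
move=> t0; have nt0 : 0 <= n.+1%:R * t by rewrite mulr_ge0.
by rewrite /grid ltr_pdivlMr// mulrC; have /andP[] := truncn_itv nt0.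
Qed.

Let grid_le n t : 0 <= t -> grid n t <= t + n.+1%:R^-1.
Proof.
move=> t0; have nt0 : 0 <= n.+1%:R * t by rewrite mulr_ge0.
rewrite /grid ler_pdivrMr// mulrDl mulVf// -addn1 natrD lerD2r [t * _]mulrC.
by have /andP[] := truncn_itv nt0.
Qed.

Let grid_cvg t : 0 <= t -> grid n t @[n --> \oo] --> t.
Proof.
move=> t0; apply: (@squeeze_cvgr _ _ _ _ (cst t) (fun n => t + n.+1%:R^-1)).
- by apply: nearW => n; rewrite /= (ltW (grid_gt n t0)) grid_le.
- exact: cvg_cst.
- by rewrite -[X in _ --> X]addr0; apply: cvgD; [exact: cvg_cst|exact: cvg_harmonic].
Qed.

Let expect_cvg t x : 0 <= t -> expect_at (grid n t) x @[n --> \oo] --> expect_at t x.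
Proof.
move=> t0; apply: (@dominated_cvg _ _ _ (P (Some x)) setT measurableT _ _ (cst 1%E)) => //.
- move=> w _; apply: cvg_EFin; first exact: nearW.
  have h : (fun s : R => G (X s w)) s @[s --> t^'+] --> G (X t w).
    have h0 := @hunt_right_continuous _ _ _ _ _ _ _ HX w t t0.
    exact: (cvg_comp _ _ h0 (@cG (X t w))).
  by apply: ((cvg_at_rightP _ _ _).1 h (grid ^~ t)); split; [move=> n; exact: grid_gt|exact: grid_cvg].
- apply/integrableP; split; first exact: measurable_cst.
  by rewrite (eq_integral (cst 1%E)) ?integral_cst// ?mul1e ?prob_kernel ?ltry// => w _; rewrite abse1.
- move=> n w _; rewrite gee0_abs// lee_fin; by have /andP[] := G01 (X (grid n t) w).
Qed.

(* By right-continuity of the paths, E_x G(X_t) is the limit along the grid points above [t],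
   and it is a step function of time on each grid. *)
Lemma measurable_expect_joint :
  measurable_fun setT (fun z : measurableTypeR R * B => expect_at (Num.max z.1 0) z.2).
Proof.
have mmax (n : nat) : measurable_fun setT (fun z : measurableTypeR R * B => n.+1%:R * Num.max z.1 0).
  apply: measurable_funM => //; apply: measurable_maxr => //.
apply: (@emeasurable_fun_cvg _ _ _ _ (fun n (z : measurableTypeR R * B) => expect_at (grid n (Num.max z.1 0)) z.2)); last first.
  by move=> z _; apply: expect_cvg; rewrite le_max lexx orbT.
move=> n; pose A j : set (measurableTypeR R * B) :=
  (fun z : measurableTypeR R * B => n.+1%:R * Num.max z.1 0) @^-1` `[j%:R, j.+1%:R[%classic.
have mA j : measurable (A j).
  by rewrite -[A j]setTI; apply: mmax => //; exact: measurable_itv.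
have AE j z : A j z -> Num.truncn (n.+1%:R * Num.max z.1 0) = j.
  rewrite /A/= in_itv/= => h; have n0 : 0 <= n.+1%:R * Num.max z.1 0.
    by rewrite mulr_ge0// le_max lexx orbT.
  by apply/truncn_def.
have -> : setT = \bigcup_j A j.
  apply/seteqP; split => // z _; exists (Num.truncn (n.+1%:R * Num.max z.1 0)) => //.
  by rewrite /A/= in_itv/=; apply: truncn_itv; rewrite mulr_ge0// le_max lexx orbT.
apply/measurable_fun_bigcup => // j.
apply: (eq_measurable_fun (fun z : measurableTypeR R * B => expect_at (j.+1%:R / n.+1%:R) z.2)).
  by move=> z; rewrite inE => /AE e; rewrite /grid e.
apply: measurable_funTS; exact: (measurableT_comp (measurable_expect_at _) measurable_snd).
Qed.

End continuous_test.

(** Open sets are reached as limits of continuous test functions, all Borel sets by Dynkin's lemma.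
    Negative times are sent to 0, where the process is defined. *)
Lemma measurable_transition_joint (A : set B) : measurable A ->
  measurable_fun setT (fun z : measurableTypeR R * B => tr (Num.max z.1 0) z.2 A).
Proof.
pose Q (A : set B) := measurable_fun setT (fun z : measurableTypeR R * B => tr (Num.max z.1 0) z.2 A).
have Qopen (U : set E) : open U -> Q U.
  move=> oU; have [G [cG G01 Glim]] := open_approx HE oU.
  apply: (@emeasurable_fun_cvg _ _ _ _ (fun n (z : measurableTypeR R * B) => expect_at (G n) (Num.max z.1 0) z.2)).
    by move=> n; exact: measurable_expect_joint.
  move=> z _; rewrite transitionE; last exact: sub_sigma_algebra.
  apply: (@dominated_cvg _ _ _ (P (Some z.2)) setT measurableT _ _ (cst 1%E)) => //.
  - move=> n; apply/measurable_EFinP.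
    exact: measurableT_comp (continuous_measurable_borel (cG n)) _.
  - by move=> w _; apply: cvg_EFin; [exact: nearW|exact: Glim].
  - apply/integrableP; split; first exact: measurable_cst.
    by rewrite (eq_integral (cst 1%E)) ?integral_cst// ?mul1e ?prob_kernel ?ltry// => w _; rewrite abse1.
  - by move=> n w _; have /andP[g0 g1] := G01 n (X (Num.max z.1 0) w); rewrite gee0_abs ?lee_fin.
move=> mA; apply: (@dynkin_induction _ B (@open E) Q) => //.
- by move=> U V; exact: openI.
- exact: (Qopen setT openT).
- move=> S mS QS; rewrite /Q.
  have -> : (fun z : measurableTypeR R * B => tr (Num.max z.1 0) z.2 (~` S)) =
    (fun z => (tr (Num.max z.1 0%R) z.2 setT - tr (Num.max z.1 0%R) z.2 S)%E).
    apply/funext => z; rewrite -setTD measureD// ?setTI//.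
    by apply: le_lt_trans (transition_le1 X P _ _) _; rewrite ltry.
  by apply: emeasurable_funB => //; exact: (Qopen setT openT).
- move=> S mS tS QS; rewrite /Q.
  have -> : (fun z : measurableTypeR R * B => tr (Num.max z.1 0) z.2 (\bigcup_k S k)) =
    (fun z => (\sum_(0 <= k <oo) tr (Num.max z.1 0%R) z.2 (S k))%E).
    by apply/funext => z; rewrite measure_semi_bigcup//; exact: bigcupT_measurable.
  by apply: ge0_emeasurable_sum => [k z _ _|k _]; [exact: measure_ge0|exact: QS].
Qed.

Lemma chapman_kolmogorov_transition s t x (A : set B) : 0 < s -> 0 < t -> measurable A ->
  tr (s + t) x A = (\int[tr s x]_y tr t y A)%E.
Proof.
move=> s0 t0 mA; have [sF _ _ _] := hunt_filtration HX.
pose sigma (_ : Omega) : \bar R := s%:E.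
have Fcst u (Q : Prop) : 0 <= u -> F u [set _ | Q].
  move=> u0; have [[F0 FC _] _] := sF u u0.
  have [q|q] := pselect Q.
    by have := FC _ F0; rewrite setD0 (_ : [set _ | Q] = setT)//; apply/seteqP; split.
  by rewrite (_ : [set _ | Q] = set0)//; apply/seteqP; split.
have st : stopping_time F sigma.
  (* A deterministic time is a stopping time because each of its events is empty or the whole
     space. *)
  by split => [w|u u0]; [rewrite lee_fin ltW|exact: (Fcst u (s%:E <= u%:E)%E u0)].
have se : stopped_event F sigma setT.
  by split => // u u0; rewrite setTI; exact: (Fcst u (s%:E <= u%:E)%E u0).
have mSA := measurable_image_Some mA.
have := hunt_strong_markov HX st (Some x) (ltW t0) se mSA.
rewrite setTI /sigma /= => e.
have -> : tr (s + t) x A = P (Some x) [set w | (Some @` A) (X (s + t) w)] by [].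
rewrite e /transition.
have mt : measurable_fun setT (fun y : B => tr t y A).
  have := measurable_transition_joint mA => h.
  have := measurableT_comp h (@pair1_measurable _ _ (measurableTypeR R) B t).
  by rewrite /comp/= (max_l (ltW t0)).
rewrite -(@semigroup_ge0E _ _ _ _ X P s (fun y : B => tr t y A) x mt (fun y => measure_ge0 _ _)).
apply: eq_integral => w _; case: (X s w : option E) => [y|] //=.
(* Here the process is dead at time s: the cemetery is absorbing, so under P_None no mass returns to
   E, in agreement with the value 0 there. *)
have mN : measurable (X t @^-1` [set None]).
  rewrite -[_ @^-1` _]setTI; apply: (@measurable_funPT _ _ _ _ (X t)) => //.
  rewrite (_ : [set None] = ~` (Some @` [set: E])); last first.
    by apply/seteqP; split => [_ -> [y _]//|[y|]//= h]; exfalso; apply: h; exists y.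
  by apply: measurableC; apply: measurable_image_Some; exact: measurableT.
have mA' := measurable_alive X t mA.
apply/eqP; rewrite eq_le measure_ge0 andbT.
have := @prob_kernel _ _ _ _ _ P None.
have -> : setT = X t @^-1` [set None] `|` ~` (X t @^-1` [set None]) by rewrite setUv.
rewrite measureU//; [|exact: measurableC|by rewrite setICr].
rewrite [X in (X + _)%E = _ -> _](_ : _ = 1%E) => [h|]; last exact: (hunt_cemetery HX (ltW t0)).
apply: (@le_trans _ _ (P None (~` (X t @^-1` [set None])))).
  apply: le_measure; rewrite ?inE//; first exact: measurableC.
  by move=> v [y Ay] /= e1 e2; move: e1; rewrite e2.
have {h} : (1 + P None (~` (X t @^-1` [set None])) = 1)%E := h.
by case: (P None _) => [r| |]//= [] h; rewrite lee_fin; lra.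
Qed.

End joint_measurability.

Section transition_kernel.
Context {R : realType} {E : pmetricType R} {d : measure_display}
  {Omega : measurableType d}.
Variables (F : R -> set (set Omega)) (X : R -> {mfun Omega >-> borel (cemetery E)}).
Variables (P : R.-pker (borel (cemetery E)) ~> Omega).
Local Notation B := (borel E).
Local Notation tr := (transition X P).

(* [transition] is only a kernel on times [t >= 0]. *)
Definition ktrans
    of (forall A : set B, measurable A ->
      measurable_fun setT (fun z : measurableTypeR R * B => tr (Num.max z.1 0) z.2 A))
  : measurableTypeR R * B -> {measure set B -> \bar R} :=
  fun z => [the {measure set B -> \bar R} of tr (Num.max z.1 0) z.2].

Section instances.
Variable mtr : forall A : set B, measurable A ->
  measurable_fun setT (fun z : measurableTypeR R * B => tr (Num.max z.1 0) z.2 A).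

HB.instance Definition _ := isKernel.Build _ _ _ _ R (ktrans mtr) mtr.

Let ktrans_le1 : (ereal_sup [set ktrans mtr z [set: B] | z in [set: measurableTypeR R * B]] <= 1)%E.
Proof.
by apply: ge_ereal_sup => _ [z _ <-]; exact: transition_le1.
Qed.

HB.instance Definition _ := Kernel_isSubProbability.Build _ _ _ _ R (ktrans mtr) ktrans_le1.
End instances.

Hypotheses (HE : @locally_compact_separable R E) (HX : hunt_process F X P).

Definition trans_kernel : R.-spker (measurableTypeR R * B) ~> B :=
  [the R.-spker (measurableTypeR R * B) ~> B of ktrans (measurable_transition_joint HE HX)].

Lemma trans_kernelE t x : 0 <= t -> (trans_kernel (t, x) : set B -> \bar R) = tr t x.
Proof. by move=> t0; apply/funext => A; rewrite /trans_kernel /ktrans /= (max_l t0). Qed.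

Lemma Pe_trans t (g : B -> \bar R) x : 0 <= t -> measurable_fun setT g ->
  Pe trans_kernel t g x = semigroup X P t g x.
Proof.
move=> t0 mg; rewrite (semigroupE X P t x mg) Pe_def.
by apply: eq_measure_integral => A mA _; rewrite trans_kernelE.
Qed.

Local Transparent Rintegral.

Lemma Pr_trans t (f : B -> R) x : 0 <= t -> measurable_fun setT f ->
  Pr trans_kernel t f x = Pt X P t f x.
Proof.
move=> t0 mf; rewrite (Pt_transition X P t x mf) PrE.
rewrite /Rintegral; congr fine; apply: eq_measure_integral => A mA _.
by rewrite trans_kernelE.
Qed.

Local Opaque Rintegral.

Lemma trans_kernel_semigroup (m : {measure set B -> \bar R}) :
  m_symmetric X P m -> symmetric_semigroup m trans_kernel.
Proof.
move=> sym; split.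
  move=> s t x A s0 t0 mA.
  rewrite !trans_kernelE ?addr_ge0 ?ltW//.
  rewrite (chapman_kolmogorov_transition HE HX x s0 t0 mA).
  by apply: eq_integral => y _; rewrite trans_kernelE// ltW.
move=> t f g t0 mf mg f0 g0; have := sym t f g t0 mf mg f0 g0.
have e1 : (\int[m]_x (f x * Pe trans_kernel t g x) = \int[m]_x (f x * semigroup X P t g x))%E.
  by apply: eq_integral => x _; rewrite Pe_trans// ltW.
by rewrite e1 => ->; apply: eq_integral => x _; rewrite Pe_trans// ltW.
Qed.

End transition_kernel.

(** * The Dirichlet form as a jump energy *)

Section integral_restriction.
Context {R : realType} {d} {T : measurableType d}.
Variables (mu : {measure set T -> \bar R}) (D : set T) (mD : measurable D).

Let dirac_on (z : T) : {measure set T -> \bar R} :=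
  if z \in D then [the {measure set T -> \bar R} of dirac z]
  else [the {measure set T -> \bar R} of mzero].

Lemma ge0_integral_mrestr (F : T -> \bar R) : measurable_fun setT F ->
  (forall z, 0 <= F z)%E -> (\int[mrestr mu mD]_z F z = \int[mu]_(z in D) F z)%E.
Proof.
move=> mF F0; have dE z B : dirac_on z B = (\1_(B `&` D) z)%:E.
  rewrite /dirac_on indicE in_setI; case: ifP => _; last by rewrite andbF.
  by rewrite andbT -diracE.
rewrite (@integral_mixture _ _ _ _ _ mu dirac_on) //.
- rewrite [RHS]integral_mkcond; apply: eq_integral => z _.
  rewrite patchE /dirac_on; case: ifP => _; last exact: integral_measure_zero.
  by rewrite integral_dirac// diracT mul1e.
- move=> B mB; rewrite (_ : (fun z => _) = (fun z => (\1_(B `&` D) z)%:E)).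
    by apply/measurable_EFinP; apply: measurable_indic; exact: measurableI.
  by apply/funext => z; exact: dE.
- move=> B mB; under eq_integral do rewrite dE.
  by rewrite integral_indic ?setIT//; exact: measurableI.
Qed.

End integral_restriction.

Section jump_integral.
Context {R : realType} {E : pmetricType R}.
Local Notation B := (borel E).
Variables (m : {measure set B -> \bar R}) (J : {measure set (B * B) -> \bar R}).
Variable K : R.-sfker B ~> B.
Hypotheses (JK : jump_kernel m J K) (mO : measurable (@off_diagonal R E)).
Local Notation O := (@off_diagonal R E).

Let mpair x : measurable_fun setT (fun y : B => (x : B, y)).
Proof. exact: measurable_pair1. Qed.

Let kap (x : B) : {measure set (B * B) -> \bar R} :=
  measure_function_pushforward__canonical__measure_function_Measure (K x) (mpair x).

Let kap_off (x : B) : {measure set (B * B) -> \bar R} :=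
  [the {measure set (B * B) -> \bar R} of mrestr (kap x) mO].

Let kap_offE x A : kap_off x A = K x (xsection (A `&` O) x).
Proof. by rewrite xsectionE. Qed.

(** Off the diagonal J is the mixture over m(dx) of the images of K(x, .) under y -> (x, y),
    restricted to that set. *)
Lemma integral_jump (F : B * B -> \bar R) : measurable_fun setT F ->
  (forall z, 0 <= F z)%E -> (forall x, F (x, x) = 0)%E ->
  (\int[J]_(z in O) F z = \int[m]_x \int[K x]_y F (x, y))%E.
Proof.
move=> mF F0 Fd; rewrite -(ge0_integral_mrestr J mO mF F0).
rewrite (@integral_mixture _ _ _ _ _ m kap_off) //.
- apply: eq_integral => x _; rewrite (ge0_integral_mrestr (kap x) mO mF F0).
  rewrite ge0_integral_pushforward//.
  + rewrite [LHS]integral_mkcond; apply: eq_integral => y _; rewrite patchE.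
    case: ifPn => //; rewrite notin_setE /= => /contrapT xy.
    have {}xy : x = y := xy.
    by rewrite -xy Fd.
  + exact: measurable_funTS.
- move=> A mA; rewrite (_ : (fun x => _) = (fun x => \int[K x]_y (\1_(A `&` O) (x, y))%:E)%E).
    have mI : measurable_fun setT (fun z : B * B => (\1_(A `&` O) z)%:E : \bar R).
      by apply/measurable_EFinP; apply: measurable_indic; exact: measurableI.
    have I0 (z : B * B) : (0 <= (\1_(A `&` O) z)%:E :> \bar R)%E by rewrite lee_fin.
    exact: (measurable_int_reindex (@measurable_id _ B setT) K mI I0).
  apply/funext => x; rewrite kap_offE.
  rewrite (eq_integral (fun y => (\1_(xsection (A `&` O) x) y)%:E)).
    by rewrite integral_indic ?setIT//; apply: measurable_xsection; exact: measurableI.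
  by move=> y _; rewrite !indicE mem_xsection.
- move=> A mA; rewrite /= /mrestr JK; last 2 first.
  + exact: measurableI.
  + by apply: subIsetr.
  by apply: eq_integral => x _; rewrite -kap_offE.
Qed.

Hypothesis symJ : symmetric_jump_measure J.

Lemma integral_jump_swap (F : B * B -> \bar R) : measurable_fun setT F ->
  (forall z, 0 <= F z)%E -> (forall x, F (x, x) = 0)%E ->
  (\int[m]_x \int[K x]_y F (x, y) = \int[m]_x \int[K x]_y F (y, x))%E.
Proof.
move=> mF F0 Fd.
have ms : measurable_fun setT (fun z : B * B => (z.2, z.1)) by exact: measurable_swap.
have mFs : measurable_fun setT (fun z : B * B => F (z.2, z.1)) by exact: measurableT_comp mF ms.
rewrite -(integral_jump mF F0 Fd) -(@integral_jump (fun z => F (z.2, z.1)))//.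
rewrite -(ge0_integral_mrestr J mO mF F0) -(ge0_integral_mrestr J mO mFs (fun z => F0 _)).
transitivity (\int[pushforward (mrestr J mO) (fun z : B * B => (z.2, z.1))]_z F z)%E.
  apply: eq_measure_integral => A mA _; rewrite /= /pushforward /mrestr.
  have mAO : measurable (A `&` O) by exact: measurableI.
  rewrite -(symJ mAO (@subIsetr _ A O)); congr (J _).
  apply/seteqP; split => -[x y] /= [Axy]; rewrite /off_diagonal/= => xy; split => //;
    by move=> e; apply: xy.
by rewrite ge0_integral_pushforward// preimage_setT.
Qed.

End jump_integral.

(** * From dyadic times to all small times *)

Section small_time_form.
Context {R : realType} {d} {T : measurableType d}.
Variables (m : {sigma_finite_measure set T -> \bar R})
  (k : R.-spker (measurableTypeR R * T) ~> T).
Hypothesis sg : symmetric_semigroup m k.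
Local Notation Pr := (Pr k).
Local Notation Lp := (Lp m).
Local Notation pform := (pform m k).
Variable w : T -> R.
Hypothesis Lw : Lp 2 w.

Let g t : R := pform t w w.

Let L2dot_ge0 (u : T -> R) : 0 <= \int[m]_x (u x ^+ 2).
Proof. by apply: Rintegral_ge0 => x _; exact: sqr_ge0. Qed.

Let gE t : 0 < t -> g (t + t) = \int[m]_x (w x * w x) - \int[m]_x (Pr t w x * Pr t w x).
Proof. by move=> t0; rewrite /g form_double. Qed.

Let mE t : 0 < t -> \int[m]_x (Pr t w x * Pr t w x) = nu m 2 (Pr t w).
Proof. by move=> t0; apply: eq_Rintegral => x _; rewrite powR2 expr2. Qed.

Lemma pform_mono s t : 0 < s -> s <= t -> pform s w w <= pform t w w.
Proof.
move=> s0 st; have t0 := lt_le_trans s0 st.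
have hh (u : R) : u = u / 2 + u / 2 by field.
have half u : 0 < u -> pform u w w = \int[m]_x (w x * w x) - nu m 2 (Pr (u / 2) w).
  by move=> u0; have u20 : 0 < u / 2 by [rewrite divr_gt0]; rewrite {1}(hh u) -/(g _) (gE u20) (mE u20).
have s20 : 0 < s / 2 by rewrite divr_gt0.
rewrite (half _ s0) (half _ t0) lerD2l lerN2; apply: (nu_mono sg) => //; first by rewrite ler_pM2r.
by rewrite ler1n.
Qed.

(* Expand [0 <= |P_s w - P_t w|^2]. *)
Lemma pform_midconcave s t : 0 < s -> 0 < t ->
  pform (s + s) w w + pform (t + t) w w <= 2 * pform (s + t) w w.
Proof.
have aux (W S U C : R) : 0 <= S - 2 * C + U -> W - S + (W - U) <= 2 * (W - C) by move=> *; lra.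
move=> s0 t0; have := gE s0; have := gE t0; rewrite /g => -> ->.
rewrite (pformE sg (addr_gt0 s0 t0) Lw Lw).
have Ls := Lp2_Pr sg s0 Lw; have Lt := Lp2_Pr sg t0 Lw.
have -> : \int[m]_x (Pr (s + t) w x * w x) = \int[m]_x (Pr s w x * Pr t w x).
  transitivity (\int[m]_x (w x * Pr s (Pr t w) x)); last first.
    by rewrite (Pr_sym2 sg s0 Lw Lt); apply: eq_Rintegral => x _; rewrite mulrC.
  have mPr := measurable_Pr k; have mw := Lp_meas Lw.
  apply: ae_RintegralE.
  - by apply: measurable_funM; [exact: mPr|].
  - by apply: measurable_funM => //; apply: (mPr); exact: mPr.
  - apply: filterS (PrD sg s0 t0 (ler1n R 2) Lw) => x ->.
    by rewrite mulrC.
apply: aux; rewrite [leRHS](_ : _ = \int[m]_x ((Pr s w x - Pr t w x) ^+ 2)); first exact: L2dot_ge0.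
have i1 := Lp2_mul Ls Ls; have i2 := Lp2_mul Ls Lt; have i3 := Lp2_mul Lt Lt.
have i4 := integrable_scalef 2 i2; have i5 := integrable_subf i1 i4.
rewrite -(RintegralZf 2 i2) -(RintegralBf i1 i4) -(RintegralDf i5 i3).
by apply: eq_Rintegral => x _; ring.
Qed.

(** By midpoint concavity the increments along the multiples of t decrease, and the first is at most
    the form at t by [form_half]. *)
Lemma pform_mul_le (n : nat) t : 0 < t -> pform (n.+1%:R * t) w w <= n.+1%:R * pform t w w.
Proof.
move=> t0; have t20 : 0 < t / 2 by rewrite divr_gt0.
have auxg (A G : R) : A <= 2 * G -> A - G <= G by lra.
have auxc (A C G : R) : A + C <= 2 * G -> C - G <= G - A by lra.
have pos (j : nat) : 0 < j.+1%:R * (t / 2) by rewrite mulr_gt0.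
pose c j := g (j.+1%:R * t).
have c1 : c 1%N - c 0%N <= g t.
  rewrite /c mul1r (_ : 2%:R * t = t + t); last by ring.
  by apply: auxg; exact: (form_half sg t0 Lw).
have cc j : c j.+2 - c j.+1 <= c j.+1 - c j.
  have := @pform_midconcave (j.+1%:R * (t / 2)) (j.+3%:R * (t / 2)) (pos j) (pos j.+2).
  rewrite (_ : j.+1%:R * (t / 2) + j.+1%:R * (t / 2) = j.+1%:R * t); last by field.
  rewrite (_ : j.+3%:R * (t / 2) + j.+3%:R * (t / 2) = j.+3%:R * t); last by field.
  rewrite (_ : j.+1%:R * (t / 2) + j.+3%:R * (t / 2) = j.+2%:R * t); last by rewrite -!natr1; field.
  exact: auxc.
have inc j : c j.+1 - c j <= g t.
  by elim: j => [//|j IH]; exact: le_trans (cc j) IH.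
elim: n => [|n IH]; first by rewrite !mul1r.
have := inc n; rewrite /c /g => h.
rewrite [leRHS](_ : _ = n.+1%:R * pform t w w + pform t w w); last by rewrite -[X in X * _ = _]natr1; ring.
move: IH h; move: (pform (n.+2%:R * t) w w) (pform (n.+1%:R * t) w w) => A C.
by move=> IH h; have := lerD IH h; rewrite [C + _]addrC subrK.
Qed.

(** Stands in for the spectral fact that the quotient form/time is nonincreasing: s is compared with
    the next multiple of t, and rounding costs at most the factor 1 + 1/N. Association of the form
    is a limit over all t, whereas [Esup] is dyadic. *)
Lemma pform_ratio_le s t (N : nat) : 0 < t -> (0 < N)%N -> N%:R * t <= s ->
  pform s w w / s <= (1 + N%:R^-1) * (pform t w w / t).
Proof.
move=> t0 N0 Nts; have N0' : 0 < N%:R :> R by rewrite ltr0n.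
have s0 : 0 < s by apply: lt_le_trans Nts; rewrite mulr_gt0.
have st0 : 0 <= s / t by rewrite divr_ge0 ?ltW.
have /andP[nl nu'] := truncn_itv st0; set n := Num.truncn (s / t) in nl nu'.
have nts : n%:R * t <= s by rewrite -ler_pdivlMr.
have snt : s <= n.+1%:R * t by rewrite -ler_pdivrMr// ltW.
have Nn : (N <= n)%N.
  by rewrite -ltnS -(ltr_nat R); apply: le_lt_trans nu'; rewrite ler_pdivlMr.
have P0 := form_ge0 sg t0 Lw.
have h1 := le_trans (pform_mono s0 snt) (pform_mul_le n t0).
rewrite ler_pdivrMr//; apply: (le_trans h1).
have Nn' : N%:R <= n%:R :> R by rewrite ler_nat.
have key : n.+1%:R * t <= (1 + N%:R^-1) * s.
  have : n%:R * t + t <= s + N%:R^-1 * s.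
    apply: lerD => //; rewrite mulrC ler_pdivlMr// mulrC.
    by apply: le_trans nts; rewrite ler_pM2r.
  by rewrite -natr1 !mulrDl !mul1r.
rewrite -(ler_pM2r t0) -!mulrA [_ * t]mulrC (_ : (1 + _) * (_ * _) = ((1 + N%:R^-1) * s) * pform t w w); last first.
  by field; rewrite gt_eqF//= gt_eqF.
by rewrite mulrA ler_wpM2r// mulrC.
Qed.

Lemma pform_ratio_Esup t : 0 < t -> ((pform t w w / t)%:E <= Esup m k w)%E.
Proof.
move=> t0; have E0 := Esup_ge0 sg Lw.
have [EN|] := boolP (Esup m k w \is a fin_num); last first.
  by rewrite ge0_fin_numE// -leNgt leye_eq => /eqP ->; exact: leey.
rewrite -(fineK EN) lee_fin; set L := fine _.
have L0 : 0 <= L by exact: fine_ge0.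
have bd (N : nat) : (0 < N)%N -> pform t w w / t <= (1 + N%:R^-1) * L.
  move=> N0; have N0' : 0 < N%:R :> R by rewrite ltr0n.
  have tN : 0 < t / N%:R by rewrite divr_gt0.
  have := @cvg_dy R => /cvgrPdist_lt/(_ _ tN)[n _ /(_ n (leqnn n))].
  rewrite /= sub0r normrN (ger0_norm (ltW (dy_gt0 n))) => dn.
  apply: (le_trans (@pform_ratio_le t (dy n) N (dy_gt0 n) N0 _)).
    by rewrite mulrC -ler_pdivlMr// ltW.
  have N1 : 0 <= 1 + N%:R^-1 :> R by rewrite addr_ge0 ?invr_ge0.
  apply: (ler_wpM2l N1).
  by rewrite -En_def -lee_fin (fineK EN); exact: En_le_Esup.
apply/ler_addgt0Pr => e e0.
pose N := (Num.truncn (L / e)).+1.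
apply: (le_trans (bd N isT)); rewrite mulrDl mul1r lerD2l.
rewrite mulrC ler_pdivrMr// mulrC -ler_pdivrMr// ltW//.
by have /andP[] := truncn_itv (divr_ge0 L0 (ltW e0)).
Qed.

Lemma cvg_pform_ratio (L : R) : Esup m k w = L%:E ->
  t^-1 * pform t w w @[t --> (0 : R)^'+] --> L.
Proof.
move=> EL; have L0 : 0 <= L by rewrite -lee_fin -EL; exact: Esup_ge0.
apply/cvgrPdist_le => e e0.
have e20 : 0 < e / 2 by rewrite divr_gt0.
have [n Hn] : exists n, L - e / 2 < En m k n w.

  apply: contrapT => /forallNP H.
  have : (Esup m k w <= (L - e / 2)%:E)%E.
    apply: lime_le; first by apply: ereal_nondecreasing_is_cvgn; exact: En_nd.
    by apply: nearW => n; rewrite lee_fin leNgt; apply/negP; exact: H.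
  by rewrite EL lee_fin; move: e20; lra.
pose N := (Num.truncn (L / (e / 2))).+1.
have N0 : 0 < N%:R :> R by rewrite ltr0n.
have LN : L / N%:R <= e / 2.
  rewrite ler_pdivrMr// mulrC -ler_pdivrMr// ltW//.
  by have /andP[] := truncn_itv (divr_ge0 L0 (ltW e20)).
near=> t.
have t0 : 0 < t by near: t; exact: nbhs_right_gt.
have Nt : N%:R * t <= dy n.
  rewrite mulrC -ler_pdivlMr//; near: t; apply: nbhs_right_le.
  by rewrite divr_gt0// dy_gt0.
have up : pform t w w / t <= L by rewrite -lee_fin -EL; exact: pform_ratio_Esup.
have lo := @pform_ratio_le (dy n) t N t0 isT Nt.
rewrite -En_def in lo.
rewrite mulrC ger0_norm ?subr_ge0//.
have h2 : N%:R^-1 * (pform t w w / t) <= e / 2.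
  apply: le_trans LN; rewrite mulrC ler_wpM2r// invr_ge0 ltW//.
move: lo; rewrite mulrDl mul1r; move: h2 Hn up; lra.
Unshelve. all: by end_near.
Qed.

Lemma Esup_cvg (l : R) : t^-1 * pform t w w @[t --> (0 : R)^'+] --> l -> Esup m k w = l%:E.
Proof.
move=> /cvg_at_rightP /(_ (@dy R)) h.
have {}h := h (conj (@dy_gt0 R) (@cvg_dy R)).
apply/cvg_lim => //; apply: cvg_EFin; first exact: nearW.
by apply: cvg_trans h; apply: near_eq_cvg; apply: nearW => n; rewrite /= En_def mulrC.
Qed.

End small_time_form.

Section sigma_finite_pack.
Context {R : realType} {d} {T : measurableType d}.
Variable m : {measure set T -> \bar R}.

(** A copy of the measure that carries the proof of sigma-finiteness, to which the structure can be
    attached. *)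
Definition sigma_finite_copy of sigma_finite setT m : set T -> \bar R := m.

Section copy.
Variable sf : sigma_finite setT m.
HB.instance Definition _ := Measure.on (sigma_finite_copy sf).
HB.instance Definition _ := @Measure_isSigmaFinite.Build d T R (sigma_finite_copy sf) sf.
End copy.

Lemma sigma_finite_pack : sigma_finite setT m ->
  exists m' : {sigma_finite_measure set T -> \bar R}, m = m' :> {measure set T -> \bar R}.
Proof.
move=> sf; exists [the {sigma_finite_measure set T -> \bar R} of sigma_finite_copy sf].
exact: eq_measure.
Qed.

End sigma_finite_pack.

Section Lnorm_power_integral.
Context {R : realType} {d} {T : measurableType d}.
Variables (m : {measure set T -> \bar R}).
Implicit Types (f : T -> R) (p : R).

Lemma Lnorm_powR f p : 0 < p -> ('N[m]_p%:E[EFin \o f] `^ p = Np m p f)%E.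
Proof. by move=> p0; rewrite poweR_Lnorm ?gt_eqF// Np_def. Qed.

Lemma Lnorm_Np f p : 0 < p -> ('N[m]_p%:E[EFin \o f] = Np m p f `^ p^-1)%E.
Proof.
move=> p0; rewrite -(Lnorm_powR f p0) -poweRrM mulfV ?gt_eqF// poweRe1//.
exact: Lnorm_ge0.
Qed.

Lemma Lfun_Lp f p : 0 < p -> f \in Lfun m p%:E <-> Lp m p f.
Proof.
move=> p0; split.
  rewrite inE => /andP[/[!inE]/= mf lf]; split => //.
  by rewrite -(Lnorm_powR f p0); exact: poweR_lty.
move=> [mf lf]; rewrite inE; apply/andP; split; rewrite inE//=.
by rewrite /finite_norm (Lnorm_Np f p0); exact: poweR_lty.
Qed.

Lemma Lnorm_sqrt (g : T -> \bar R) p : 0 < p -> (forall x, 0 <= g x)%E ->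
  (Lnorm m (2 * p)%:E (fun x => g x `^ (2^-1)%R) = (\int[m]_x (g x `^ p)) `^ (2 * p)^-1)%E.
Proof.
move=> p0 g0; rewrite unlock; congr (_ `^ _)%E; apply: eq_integral => x _.
rewrite gee0_abs ?poweR_ge0// -poweRrM; congr (_ `^ _)%E; by field.
Qed.

End Lnorm_power_integral.

Section jump_integral_bounds.
Context {R : realType} {d} {T : measurableType d}.
Variables (m : {sigma_finite_measure set T -> \bar R}) (K : R.-sfker T ~> T).

Lemma jint_le (B1 B2 : T * T -> R) : measurable_fun setT B1 -> measurable_fun setT B2 ->
  (forall z, 0 <= B1 z) -> (forall z, B1 z <= B2 z) -> (jint m K B1 <= jint m K B2)%E.
Proof.
move=> m1 m2 B10 B12.
rewrite (_ : B2 = fun z => B1 z + (B2 z - B1 z)); last by apply/funext => z; rewrite addrC subrK.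
rewrite jintD//; last 2 first.
- exact: measurable_funB.
- by move=> z; rewrite subr_ge0.
by apply: leeDl; apply: jint_ge0 => z; rewrite subr_ge0.
Qed.

(** The pointwise bound (A + C)^2 <= (1 + e) A^2 + (1 + 1/e) C^2, integrated; it does the work of
    the triangle inequality and makes sense for infinite energies. *)
Lemma jform_add_le (u v : T -> R) (e : R) : 0 < e -> measurable_fun setT u -> measurable_fun setT v ->
  (jform m K (fun x => (u x + v x)%R) <= (1 + e)%:E * jform m K u + (1 + e^-1)%:E * jform m K v)%E.
Proof.
have aux (A C : R) : 0 < e -> (A + C) ^+ 2 <= (1 + e) * A ^+ 2 + (1 + e^-1) * C ^+ 2.
  move=> e0; have e1 : e * e^-1 = 1 by rewrite mulfV// gt_eqF.
  have : 0 <= e * (A - e^-1 * C) ^+ 2 by rewrite mulr_ge0 ?sqr_ge0// ltW.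
  rewrite (_ : e * _ = e * A ^+ 2 - 2 * (e * e^-1) * A * C + e^-1 * C ^+ 2 * (e * e^-1)); last by ring.
  by rewrite e1; lra.
move=> e0 mu mv.
have m0 (w : T -> R) : measurable_fun setT w -> measurable_fun setT (fun z : T * T => (w z.2 - w z.1) ^+ 2).
  move=> mw; apply: measurable_funX; apply: measurable_funB.
    exact: measurableT_comp mw measurable_snd.
  exact: measurableT_comp mw measurable_fst.
have e1 : 0 <= 1 + e by rewrite addr_ge0// ltW.
have e2 : 0 <= 1 + e^-1 by rewrite addr_ge0// invr_ge0 ltW.
rewrite !jform_jint -jintZ//; last 2 first.
- exact: m0.
- by move=> z; exact: sqr_ge0.
rewrite -jintZ//; last 2 first.
- exact: m0.
- by move=> z; exact: sqr_ge0.
rewrite -jintD; last 4 first.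
- by apply: measurable_funM => //; exact: m0.
- by apply: measurable_funM => //; exact: m0.
- by move=> z; rewrite mulr_ge0 ?sqr_ge0.
- by move=> z; rewrite mulr_ge0 ?sqr_ge0.
apply: jint_le.
- by apply: (m0 (fun x => u x + v x)); exact: measurable_funD.
- by apply: measurable_funD; apply: measurable_funM => //; exact: m0.
- by move=> z; exact: sqr_ge0.
- move=> z; rewrite (_ : _ - _ = (u z.2 - u z.1) + (v z.2 - v z.1)); last by ring.
  exact: aux.
Qed.

End jump_integral_bounds.

Lemma Np2_add_le {R : realType} {d} {T : measurableType d} (m : {measure set T -> \bar R})
    (u v w : T -> R) : measurable_fun setT u -> measurable_fun setT v -> measurable_fun setT w ->
  {ae m, forall x, w x = u x + v x} ->
  (Np m 2 w <= 2%:E * Np m 2 u + 2%:E * Np m 2 v)%E.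
Proof.
have aux (A C : R) : (A + C) ^+ 2 <= 2 * A ^+ 2 + 2 * C ^+ 2.
  by have := sqr_ge0 (A - C); lra.
move=> mu mv mw wuv.
have m2 (f : T -> R) : measurable_fun setT f -> measurable_fun setT (fun x => (`|f x| `^ 2)%:E).
  by move=> mf; apply/measurable_EFinP; exact: measurable_norm_powR.
have p2 (f : T -> R) x : (0 <= (`|f x| `^ 2)%:E)%E by rewrite lee_fin powR_ge0.
have t0 : (0 <= 2%:E :> \bar R)%E by rewrite lee_fin.
rewrite !Np_def -!ge0_integralZl//; [|exact: m2|exact: m2].
rewrite -ge0_integralD; last 5 first.
- exact: measurableT.
- by move=> x _; rewrite mule_ge0.
- by apply: measurable_funeM; exact: m2.
- by move=> x _; rewrite mule_ge0.
- by apply: measurable_funeM; exact: m2.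
apply: ae_ge0_le_integral => //.
- exact: m2.
- by move=> x _; rewrite adde_ge0 ?mule_ge0.
- by apply: emeasurable_funD; apply: measurable_funeM; exact: m2.
apply: filterS wuv => x -> _.
by rewrite -!EFinM -EFinD lee_fin !powR2.
Qed.

Lemma lee_double {R : realType} (x y : \bar R) (c : R) : (x <= c%:E)%E -> (y <= c%:E)%E ->
  (2%:E * x + 2%:E * y <= (4 * c)%:E)%E.
Proof.
move=> xc yc; have t0 : (0 <= 2%:E :> \bar R)%E by rewrite lee_fin.
have -> : (4 * c)%:E = (2%:E * c%:E + 2%:E * c%:E)%E by rewrite -EFinM -EFinD; congr EFin; ring.
by apply: leeD; exact: lee_wpmul2l.
Qed.

Lemma le_of_dominated {R : realType} (x j : R) : 0 <= j ->
  (forall e dl : R, 0 < e -> 0 < dl ->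
    x <= (1 + e) * ((1 + e) * j + (1 + e^-1) * dl) + (1 + e^-1) * dl) -> x <= j.
Proof.
move=> j0 h; rewrite leNgt; apply/negP => jx.
have xj : 0 < x - j by rewrite subr_gt0.
(* First e is small against (x - j)/(j + 1), then dl small against the coefficient q, which 1/e has
   made large. The two errors are at most (x - j)/2 and (x - j)/4, which contradicts x > j. *)
pose c := (x - j) / (6 * (j + 1)).
have j1 : 0 < 6 * (j + 1) by lra.
have c0 : 0 < c by rewrite divr_gt0.
pose e := Num.min 1 c.
have e0 : 0 < e by rewrite lt_min ltr01.
have e1 : e <= 1 by rewrite ge_min lexx.
have ec : e <= c by rewrite ge_min lexx orbT.
have cj : c * (6 * (j + 1)) = x - j by rewrite /c divfK// gt_eqF.
have i0 : 0 < e^-1 by rewrite invr_gt0.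
pose q := (2 + e) * (1 + e^-1).
have q0 : 0 < q by rewrite /q mulr_gt0; lra.
pose dl := (x - j) / (4 * q).
have q4 : 0 < 4 * q by lra.
have dl0 : 0 < dl by rewrite divr_gt0.
have dq : dl * (4 * q) = x - j by rewrite /dl divfK// gt_eqF.
have := h e dl e0 dl0.
rewrite (_ : _ + _ = (1 + 2 * e + e ^+ 2) * j + dl * q); last by rewrite /q; ring.
have ee : e ^+ 2 <= e by rewrite expr2 ler_piMr// ltW.
have ej : e * j <= c * (j + 1) by apply: ler_pM => //; [exact: ltW|lra].
have eej : e ^+ 2 * j <= e * j by rewrite ler_wpM2r.
rewrite !mulrDl mul1r -mulrA.
move: cj dq ej eej; rewrite [c * (6 * _)]mulrCA [dl * (4 * _)]mulrCA.
move: (c * _) (dl * q) (e * j) (e ^+ 2 * j) => Z1 Z2 Z3 Z4; lra.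
Qed.

Section dirichlet_energy.
Context {R : realType} {E : pmetricType R} {d : measure_display}
  {Omega : measurableType d}.
Local Notation B := (borel E).
Variables (m : {sigma_finite_measure set B -> \bar R})
  (D : set (E -> R)) (a : (E -> R) -> (E -> R) -> R)
  (J : {measure set (B * B) -> \bar R}) (K : R.-sfker B ~> B)
  (F : R -> set (set Omega)) (X : R -> {mfun Omega >-> borel (cemetery E)})
  (P : R.-pker (borel (cemetery E)) ~> Omega).
Hypothesis H : pure_jump_setting m D a J K F X P.
Local Notation k := (trans_kernel (setting_space H) (setting_hunt H)).
Local Notation Lp := (Lp m).

Let sg : symmetric_semigroup m k :=
  trans_kernel_semigroup (setting_space H) (setting_hunt H) (setting_m_symmetric H).

Let SF : Defs.symmetric_form m D a. Proof. by have [] := setting_dirichlet H. Qed.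

Let mO : measurable (@off_diagonal R E) := measurable_off_diagonal (setting_space H).

Let domLp (u : E -> R) : D u -> Lp 2 (u : B -> R).
Proof. by move=> Du; apply/Lfun_Lp => //; exact: (form_domL2 SF). Qed.

Let dom_comb c (u v : E -> R) : D u -> D v -> D (fun x => c * u x + v x).
Proof. exact: (form_dom_lin SF). Qed.

Let dom_sub (u v : E -> R) : D u -> D v -> D (fun x => u x - v x).
Proof.
by move=> Du Dv; rewrite (_ : (fun x => _) = (fun x => -1 * v x + u x)); [exact: dom_comb|apply/funext => x; ring].
Qed.

Let aE_comb c (u v : E -> R) : D u -> D v ->
  a (fun x => c * u x + v x) (fun x => c * u x + v x) = c ^+ 2 * a u u + 2 * c * a u v + a v v.
Proof.
move=> Du Dv; have Dc := dom_comb c Du Dv.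
rewrite (form_lin SF)// (form_sym SF Du Dc) (form_sym SF Dv Dc) !(form_lin SF)//.
by rewrite (form_sym SF Dv Du); ring.
Qed.

Let form_dominated (c : R) (u v : E -> R) (e : R) : c ^+ 2 = 1 -> 0 < e -> D u -> D v ->
  a (fun x => c * u x + v x) (fun x => c * u x + v x) <= (1 + e) * a u u + (1 + e^-1) * a v v.
Proof.
(* Positivity of the form at v - e c u, divided by e, bounds the mixed term because c^2 = 1. *)
move=> c1 e0 Du Dv; have := Defs.form_ge0 SF (dom_comb (- (e * c)) Du Dv); rewrite aE_comb//.
rewrite aE_comb// => h.
have : 0 <= e^-1 * ((- (e * c)) ^+ 2 * a u u + 2 * (- (e * c)) * a u v + a v v).
  by rewrite mulr_ge0// invr_ge0 ltW.
rewrite (_ : e^-1 * _ = c ^+ 2 * (e * a u u) - 2 * c * a u v + e^-1 * a v v); last by field; rewrite gt_eqF.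
rewrite c1 !mulrDl; move: (e^-1 * a v v) (e * a u u) (2 * c * a u v) => Z Y W; lra.
Qed.

Let approxE t (u v : E -> R) : 0 < t -> measurable_fun setT (u : B -> R) ->
  approximating_form X P m t u v = t^-1 * pform m k t u v.
Proof.
move=> t0 mu; rewrite /approximating_form /L2dot pform_def; congr (_ * _).
by apply: eq_Rintegral => x _ /=; rewrite (Pr_trans _ _ _ (ltW t0)).
Qed.

Let approx_cvg (w : E -> R) (l : R) : measurable_fun setT (w : B -> R) ->
  (approximating_form X P m t w w @[t --> (0 : R)^'+] --> l) <->
  (t^-1 * pform m k t w w @[t --> (0 : R)^'+] --> l).
Proof.
move=> mw; have e : \forall t \near (0 : R)^'+,
    approximating_form X P m t w w = t^-1 * pform m k t w w.
  by near=> t; rewrite approxE//; near: t; exact: nbhs_right_gt.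
by split; apply: cvg_trans; apply: near_eq_cvg; near=> t; [|symmetry]; near: t; exact: e.
Unshelve. all: by end_near. Qed.

Lemma Esup_form (w : E -> R) : D w -> Esup m k w = (a w w)%:E.
Proof.
move=> Dw; have Lw := domLp Dw.
have h : t^-1 * pform m k t w w @[t --> (0 : R)^'+] --> a w w.
  exact: ((approx_cvg _ (Lp_meas Lw)).1 ((setting_associated H).2 w w Dw Dw)).
exact: (Esup_cvg h).
Qed.

Lemma Esup_dom (w : B -> R) : Lp 2 w -> (Esup m k w < +oo)%E -> D w.
Proof.
move=> Lw Efin; have EN : Esup m k w \is a fin_num by rewrite ge0_fin_numE// (Esup_ge0 sg).
have wL : w \in Lfun m 2%:E by apply/Lfun_Lp.
apply/((setting_associated H).1 w wL); exists (fine (Esup m k w)).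
apply/(approx_cvg _ (Lp_meas Lw)); apply: (cvg_pform_ratio sg Lw).
by rewrite (fineK EN).
Qed.

Let zero_dom (v : E -> R) : D v -> D (fun=> 0) /\ a (fun=> 0) (fun=> 0) = 0.
Proof.
move=> Dv; have D0 : D (fun=> 0).
  by rewrite (_ : (fun=> 0) = (fun x => v x - v x)); [exact: dom_sub|apply/funext => x; rewrite subrr].
split => //; have := form_lin SF (-1) D0 D0 D0.
rewrite (_ : (fun x : E => -1 * 0 + 0) = (fun=> 0)); last by apply/funext => x; rewrite mulr0 addr0.
by rewrite mulN1r addNr.
Qed.

(** The exceptional set is empty; its capacity is at most the energy of the zero function, which
    lies in the domain as v - v. *)
Let continuous_quasi (v : E -> R) : D v -> continuous v -> quasi_continuous m D a v.
Proof.
move=> Dv cv e e0; have [D0 a0] := zero_dom Dv; exists set0; split.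
- exact: open0.
- apply: (@le_lt_trans _ _ 0%E); last by rewrite lte_fin.
  apply: ereal_inf_lbound; exists (fun=> 0); first by split => //; apply: nearW.
  rewrite /form1 a0 add0r /L2dot; congr EFin.
  by rewrite mulr0 (Rintegral_cst m (@measurableT _ B) 0) mul0r.
- by rewrite setC0; exact: continuous_subspaceT.
Qed.

Lemma jform_continuous (v : E -> R) : D v -> continuous v ->
  (a v v)%:E = ((2^-1)%:E * jform m K v)%E.
Proof.
move=> Dv cv; have qv := continuous_quasi Dv cv.
rewrite (setting_pure_jump H Dv Dv qv qv); congr (_ * _)%E.
have mv := Lp_meas (domLp Dv).
rewrite (eq_integral (fun z : B * B => ((v z.2 - v z.1) ^+ 2)%:E)); last first.
  by move=> z _; rewrite expr2.
rewrite (integral_jump (setting_kernel H) mO (F := fun z : B * B => ((v z.2 - v z.1) ^+ 2)%:E)) //.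
- apply/measurable_EFinP; apply: measurable_funX; apply: measurable_funB.
    exact: measurableT_comp mv measurable_snd.
  exact: measurableT_comp mv measurable_fst.
- by move=> z; rewrite lee_fin sqr_ge0.
- by move=> x; rewrite /= subrr expr0n.
Qed.

Let sjumps : symmetric_jumps m K.
Proof.
by move=> G mG G0 Gd; exact: (integral_jump_swap (setting_kernel H) mO (setting_symmetric_jump H) mG G0 Gd).
Qed.

Let domE (v : E -> R) : D v -> Np m 2 (v : B -> R) = (L2dot m v v)%:E.
Proof.
move=> Dv; rewrite Np_def /L2dot (fineK_integral (Lp2_mul (domLp Dv) (domLp Dv))).
by apply: eq_integral => x _; rewrite powR2 expr2.
Qed.

Let approximant (w : E -> R) (eta dl : R) : D w -> 0 < eta -> 0 < dl ->
  exists v : E -> R, [/\ D v, continuous v,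
    (Np m 2 (fun x : B => (w x - v x)%R) <= dl%:E)%E,
    a (fun x => w x - v x) (fun x => w x - v x) <= dl & a v v <= a w w + eta].
Proof.
move=> Dw eta0 dl0; have A0 := Defs.form_ge0 SF Dw.
have A1 : 0 < a w w + 1 by rewrite ltr_wpDl.
(* Writing v = w - (w - v), this e makes the term with 1/e cost at most eta/2, and [dl'] then does
   the same for the term with 1 + e. *)
pose e := 2 * (a w w + 1) / eta.
have e0 : 0 < e by rewrite divr_gt0// mulr_gt0.
have e1 : 0 < 1 + e by rewrite addr_gt0.
have eA : e^-1 * a w w <= eta / 2.
  rewrite /e invf_div mulrAC ler_pdivrMr ?mulr_gt0//.
  rewrite (_ : eta / 2 * _ = eta * (a w w + 1)); last by field.
  by rewrite ler_pM2l//; lra.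
pose dl' := Num.min dl (eta / 2 / (1 + e)).
have dl'0 : 0 < dl' by rewrite lt_min dl0/= divr_gt0// divr_gt0.
have [v [Dv [cv _] fv]] := (setting_regular H).2 w Dw dl' dl'0.
have Dwv := dom_sub Dw Dv.
have a0 := Defs.form_ge0 SF Dwv.
have l0 : 0 <= L2dot m (fun x => w x - v x) (fun x => w x - v x).
  by apply: Rintegral_ge0 => x _; rewrite -expr2 sqr_ge0.
have fv' : a (fun x => w x - v x) (fun x => w x - v x) +
  L2dot m (fun x => w x - v x) (fun x => w x - v x) < dl' by exact: fv.
have d1 : dl' <= dl by rewrite ge_min lexx.
have d2 : dl' <= eta / 2 / (1 + e) by rewrite ge_min lexx orbT.
exists v; split => //.
- by rewrite (domE Dwv) lee_fin; move: a0 fv' d1; lra.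
- by move: l0 fv' d1; lra.
have c1 : (-1) ^+ 2 = 1 :> R by rewrite sqrrN expr1n.
have := form_dominated c1 e0 Dwv Dw.
rewrite (_ : (fun x => -1 * _ + _) = v); last by apply/funext => x; ring.
move=> /le_trans; apply; rewrite mulrDl mul1r.
have : (1 + e) * a (fun x => w x - v x) (fun x => w x - v x) <= eta / 2.
  rewrite mulrC -ler_pdivlMr//; apply: le_trans d2; move: l0 fv'; lra.
by move: eA; lra.
Qed.

(** Lower semicontinuity: continuous approximants converge almost everywhere along a subsequence,
    and Fatou applies to the jump integral with weight 1; [eta] is their excess energy. *)
Lemma jform_le (w : E -> R) : D w -> (jform m K w <= (2 * a w w)%:E)%E.
Proof.
move=> Dw; have mw : measurable_fun setT (w : B -> R) := Lp_meas (domLp Dw).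
suff bd eta : 0 < eta -> (jform m K w <= (2 * (a w w + eta))%:E)%E.
  apply/lee_addgt0Pr => e e0; have e20 : 0 < e / 2 by rewrite divr_gt0.
  by have := bd _ e20; rewrite (_ : 2 * (a w w + e / 2) = 2 * a w w + e)//; field.
move=> eta0.
have /choice[v_ Hv] : forall n : nat, exists v : E -> R, [/\ D v, continuous v,
    (Np m 2 (fun x : B => (w x - v x)%R) <= (n.+1%:R^-1)%:E)%E,
    a (fun x => w x - v x) (fun x => w x - v x) <= n.+1%:R^-1 & a v v <= a w w + eta].
  by move=> n; apply: approximant => //; rewrite invr_gt0.
have mv n : measurable_fun setT (v_ n : B -> R) by have [Dv _ _ _ _] := Hv n; exact: Lp_meas (domLp Dv).
have [phi phi_ge phi_cvg] : exists2 phi : nat -> nat, (forall i, (i <= phi i)%N) &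
    {ae m, forall x : B, (w x - v_ (phi i) x) ^+ 2 @[i --> \oo] --> (0 : R)}.
  apply: (@ae_subseq _ _ _ m (fun n (x : B) => (w x - v_ n x) ^+ 2)).
  - by move=> n; apply: measurable_funX; exact: measurable_funB.
  - by move=> n x; exact: sqr_ge0.
  move=> e e0 N; pose n := maxn N (Num.truncn e^-1).
  exists n; first exact: leq_maxl.
  have [_ _ h _ _] := Hv n.
  rewrite (eq_integral (fun x : B => (`|w x - v_ n x| `^ 2)%:E)); last first.
    by move=> x _; rewrite powR2.
  rewrite -Np_def; apply: (le_trans h); rewrite lee_fin.
  have ei0 : 0 <= e^-1 by rewrite invr_ge0 ltW.
  have /andP[_ et] := truncn_itv ei0.
  rewrite -[leRHS]invrK lef_pV2 ?posrE ?invr_gt0//.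
  by apply: (le_trans (ltW et)); rewrite ler_nat ltnS leq_maxr.
have cvg_v : {ae m, forall x : B, v_ (phi i) x @[i --> \oo] --> w x}.
  apply: filterS phi_cvg => x /cvgrPdist_lt hx.
  apply/cvgrPdist_lt => e e0; have e20 : 0 < e ^+ 2 by rewrite exprn_gt0.
  apply: filterS (hx _ e20) => i.
  rewrite sub0r normrN ger0_norm ?sqr_ge0// -[X in X < _]real_normK ?num_real//.
  by rewrite ltr_pXn2r// nnegrE ltW.
have jw (u : B -> R) : jform m K u = weighted_energy m K u (fun=> 1).
  rewrite jform_jint weighted_energy_def; congr jint.
  by apply/funext => z; rewrite mulr1.
rewrite jw; apply: (le_trans (weighted_energy_fatou sjumps (v_ := fun i => v_ (phi i)) _ mw _ _ cvg_v)) => //.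
apply: limn_einf_le => i; rewrite -jw.
have [Dv cv _ _ av] := Hv (phi i).
have := jform_continuous Dv cv => e.
have -> : jform m K (v_ (phi i)) = (2 * a (v_ (phi i)) (v_ (phi i)))%:E.
  by rewrite EFinM e muleA -EFinM mulfV// mul1e.
by rewrite lee_fin ler_pM2l.
Qed.

(* Both sides are quadratic, agree on continuous functions and are continuous along the
   approximants given by regularity, the left one by [jform_le]. *)
Lemma jform_form (w : E -> R) : D w -> (a w w)%:E = ((2^-1)%:E * jform m K w)%E.
Proof.
move=> Dw; have A0 := Defs.form_ge0 SF Dw.
have mw : measurable_fun setT (w : B -> R) := Lp_meas (domLp Dw).
have j0 (u : B -> R) : (0 <= jform m K u)%E by rewrite jform_jint; apply: jint_ge0 => z; exact: sqr_ge0.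
have jfin (u : E -> R) : D u -> jform m K u \is a fin_num.
  by move=> Du; rewrite ge0_fin_numE//; apply: le_lt_trans (jform_le Du) _; rewrite ltry.
have jle (u : E -> R) : D u -> fine (jform m K u) <= 2 * a u u.
  by move=> Du; rewrite -lee_fin fineK ?jfin//; exact: jform_le.
pose j := fine (jform m K w).
have jE : jform m K w = j%:E by rewrite /j fineK// jfin.
suff aj : 2 * a w w = j by rewrite jE -aj -EFinM mulKf.
apply/eqP; rewrite eq_le; apply/andP; split; last exact: jle.
have jw0 : 0 <= j by apply: fine_ge0; exact: j0.
apply: (le_of_dominated jw0) => e dl e0 dl0.
have dl20 : 0 < dl / 2 by rewrite divr_gt0.
have [v [Dv cv _ awv _]] := approximant Dw ltr01 dl20.
have Dwv := dom_sub Dw Dv.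
have mv : measurable_fun setT (v : B -> R) := Lp_meas (domLp Dv).
have mwv : measurable_fun setT (fun x : B => w x - v x) := Lp_meas (domLp Dwv).
have i0 : 0 < e^-1 by rewrite invr_gt0.
have jv : fine (jform m K v) = 2 * a v v.
  have := jform_continuous Dv cv; rewrite -(fineK (jfin _ Dv)) -EFinM => -[->].
  by rewrite mulVKf.
have neg : jform m K (fun x : B => v x - w x) = jform m K (fun x : B => w x - v x).
  by rewrite !jform_jint; congr jint; apply/funext => z; ring.
have h1 : 2 * a v v <= (1 + e) * j + (1 + e^-1) * dl.
  have := jform_add_le m K e0 mw (measurable_funB mv mw : measurable_fun setT (fun x : B => v x - w x)).
  rewrite (_ : (fun x => w x + (v x - w x)) = v); last by apply/funext => x; ring.
  rewrite neg -(fineK (jfin _ Dv)) -(fineK (jfin _ Dw)) -(fineK (jfin _ Dwv)) -!EFinM -EFinD lee_fin jv.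
  move=> /le_trans; apply; rewrite lerD2l; apply: ler_wpM2l; first by rewrite addr_ge0// ltW.
  by apply: (le_trans (jle _ Dwv)); rewrite mulrC -ler_pdivlMr.
have c1 : 1 ^+ 2 = 1 :> R by rewrite expr1n.
have := form_dominated c1 e0 Dv Dwv.
rewrite (_ : (fun x => 1 * v x + (w x - v x)) = w); last by apply/funext => x; ring.
move=> h2; have h3 : (1 + e) * (2 * a v v) <= (1 + e) * ((1 + e) * j + (1 + e^-1) * dl).
  by apply: ler_wpM2l h1; rewrite addr_ge0// ltW.
have h4 : (1 + e^-1) * (2 * a (fun x => w x - v x) (fun x => w x - v x)) <= (1 + e^-1) * dl.
  apply: ler_wpM2l; first by rewrite addr_ge0// ltW.
  by rewrite mulrC -ler_pdivlMr.
apply: le_trans (lerD h3 h4).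
by rewrite ![_ * (2 * _)]mulrCA -mulrDr ler_pM2l.
Qed.

(** For u in the domain [form_defect] gives |P_h u - u|^2 <= 2 E_h(u) <= 2 h a(u, u); density of the
    domain and contractivity extend the convergence to L^2. *)
Let L2_continuous (f : B -> R) : Lp 2 f -> forall e : R, 0 < e ->
  exists N, forall n, (N <= n)%N -> (Np m 2 (fun x => (Pr k (dy n) f x - f x)%R) <= e%:E)%E.
Proof.
have aux (e Q2 Q1 A : R) : 0 <= Q2 -> Q1 <= A -> A <= e / 8 -> 2 * Q1 - Q2 <= e / 4 by lra.
move=> Lf e e0; have e160 : 0 < e / 16 by rewrite divr_gt0.
have c0 : 0 < Num.min 1 (e / 16) by rewrite lt_min ltr01.
have [u Du] := form_dom_dense SF (proj2 (Lfun_Lp m f (ltr0n R 2)) Lf) c0.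
have Lu := domLp Du; have mf := Lp_meas Lf; have mu := Lp_meas Lu.
pose g (x : B) := f x - u x => fu.
have mg : measurable_fun setT g by exact: measurable_funB.
have Ng : (Np m 2 g <= (e / 16)%:E)%E.
  rewrite -(Lnorm_powR m g (ltr0n R 2)).
  move: fu; rewrite -/g; have := Lnorm_ge0 m 2%:E (EFin \o g).
  rewrite (_ : EFin \o (f \- u) = EFin \o g)//.
  case: (Lnorm m 2%:E (EFin \o g)) => [x| |]//; rewrite lee_fin lte_fin => x0.
  rewrite lt_min => /andP[x1 xe]; rewrite poweR_EFin lee_fin powR_mulrn//.
  by apply: le_trans (ltW xe); rewrite expr2 ler_piMr// ltW.
have A0 := Defs.form_ge0 SF Du; have A1 : 0 < 8 * (a u u + 1) by rewrite mulr_gt0// ltr_wpDl.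
have e8 : 0 < e / (8 * (a u u + 1)) by rewrite divr_gt0.
have /cvgrPdist_lt/(_ _ e8)[N _ HN] := @cvg_dy R.
exists N => n Nn; have := HN n Nn; rewrite /= sub0r normrN (ger0_norm (ltW (dy_gt0 n))) => dn.
have d0 := @dy_gt0 R n.
have mP (h : B -> R) : measurable_fun setT h -> measurable_fun setT (Pr k (dy n) h) by exact: measurable_Pr.
have Nu : (Np m 2 (fun x : B => (Pr k (dy n) u x - u x)%R) <= (e / 4)%:E)%E.
  have Lu' : Lp 2 (fun x : B => u x - Pr k (dy n) u x).
    have := Lp2_add (-1) (Lp2_Pr sg d0 Lu) Lu.
    by rewrite (_ : (fun x => -1 * _ + _) = (fun x => u x - Pr k (dy n) u x))//; apply/funext => x; ring.
  have /Lp2P[_ iu] := Lu'.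
  rewrite Np_def (eq_integral (fun x : B => ((u x - Pr k (dy n) u x) ^+ 2)%:E)); last first.
    by move=> x _; rewrite powR2 -sqrrN opprB.
  rewrite -(fineK_integral iu) lee_fin (form_defect sg d0 Lu).
  have := form_ge0 sg (addr_gt0 d0 d0) Lu.
  have := En_le_Esup sg n Lu; rewrite (Esup_form Du) lee_fin En_def ler_pdivrMr// => h1 h2.
  have h3 : a u u * dy n <= e / 8.
    apply: (@le_trans _ _ ((a u u + 1) * dy n)); first by rewrite ler_pM2r// lerDl.
    rewrite -ler_pdivlMl ?ltr_wpDl// mulrC; apply: (le_trans (ltW dn)).
    by rewrite le_eqVlt; apply/orP; left; apply/eqP; field; rewrite gt_eqF// ltr_wpDl.
  exact: (aux _ _ _ _ h2 h1 h3).
have NP : (Np m 2 (Pr k (dy n) g) <= Np m 2 g)%E by apply: Np_Pr => //; rewrite ler1n.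
have NPg : (Np m 2 (fun x : B => (Pr k (dy n) g x - g x)%R) <= (e / 4)%:E)%E.
  have Nm : Np m 2 (fun x => (- g x)%R) = Np m 2 g.
    by rewrite !Np_def; apply: eq_integral => x _; rewrite normrN.
  apply: (@le_trans _ _ (2%:E * Np m 2 (Pr k (dy n) g) + 2%:E * Np m 2 (fun x => (- g x)%R))%E).
    apply: Np2_add_le; [exact: mP|exact: measurableT_comp|by apply: measurable_funB => //; exact: mP|].
    by apply: nearW.
  rewrite Nm (_ : e / 4 = 4 * (e / 16)); last by field.
  exact: (lee_double (le_trans NP Ng) Ng).
apply: (@le_trans _ _ (2%:E * Np m 2 (fun x : B => (Pr k (dy n) g x - g x)%R) +
   2%:E * Np m 2 (fun x : B => (Pr k (dy n) u x - u x)%R))%E).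
  apply: Np2_add_le.
  - by apply: measurable_funB => //; exact: mP.
  - by apply: measurable_funB => //; exact: mP.
  - by apply: measurable_funB => //; exact: mP.
  have f1 := Lp_ae_integrable sg d0 (ler1n R 2) Lf.
  have f2 := Lp_ae_integrable sg d0 (ler1n R 2) Lu.
  apply: filterS2 f1 f2 => x i1 i2.
  have -> : Pr k (dy n) g x = Pr k (dy n) f x - Pr k (dy n) u x by rewrite !PrE (RintegralBf i1 i2).
  by rewrite /g; ring.
rewrite (_ : e = 4 * (e / 4)); last by field.
exact: (lee_double NPg Nu).
Qed.

Lemma setting_jump_semigroup : jump_semigroup m k K.
Proof.
split => //.
- move=> w Lw Efin; have Dw := Esup_dom Lw Efin.
  by rewrite (Esup_form Dw); exact: jform_form.
Qed.

End dirichlet_energy.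

(** * Norm inequalities *)

Section poweR_comparison.
Context {R : realType} {d} {T : measurableType d}.
Variables (m : {measure set T -> \bar R}).
Implicit Types (f : T -> R) (p C : R) (I : \bar R).

Lemma Lnorm_le_poweR f p C I : 0 < p -> 0 < C -> (0 <= I)%E ->
  (Np m p f <= C%:E * I)%E ->
  (((C `^ p^-1)^-1)%:E * 'N[m]_p%:E[EFin \o f] <= I `^ p^-1)%E.
Proof.
move=> p0 C0 I0 h; have c0 : 0 < C `^ p^-1 by exact: powR_gt0.
rewrite (Lnorm_Np m f p0) lee_pdivrMl//.
have C0' : (0 <= C%:E)%E by rewrite lee_fin ltW.
rewrite -poweR_EFin -poweRM//.
by apply: gt0_ler_poweR h; rewrite ?invr_ge0 ?(ltW p0)// in_itv/= leey andbT ?Np_ge0// mule_ge0.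
Qed.

Lemma poweR_le_Lnorm f p C I : 0 < p -> 0 < C -> (0 <= I)%E ->
  (I <= C%:E * Np m p f)%E ->
  (I `^ p^-1 <= (C `^ p^-1)%:E * 'N[m]_p%:E[EFin \o f])%E.
Proof.
move=> p0 C0 I0 h; rewrite (Lnorm_Np m f p0).
have C0' : (0 <= C%:E)%E by rewrite lee_fin ltW.
rewrite -poweR_EFin -poweRM ?Np_ge0//.
by apply: gt0_ler_poweR h; rewrite ?invr_ge0 ?(ltW p0)// in_itv/= leey andbT// mule_ge0 ?Np_ge0.
Qed.

End poweR_comparison.

Section constants.
Context {R : realType}.
Implicit Type r : R.

Definition lower_cst r : R :=
  2 * sqf_lower_cst r * ((2 * sqf_lower_cst r)^-1 `^ (r - 1))^-1.

Lemma lower_cst_gt0 r : 0 < r -> 0 < lower_cst r.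
Proof.
move=> r0; have c0 : 0 < 2 * sqf_lower_cst r.
  by rewrite /sqf_lower_cst !mulr_gt0 ?powR_gt0// exprn_gt0.
by rewrite /lower_cst mulr_gt0// invr_gt0 powR_gt0// invr_gt0.
Qed.

Definition upper_cst r : R := r * r `^ (r - 1).

Lemma upper_cst_gt0 r : 0 < r -> 0 < upper_cst r.
Proof. by move=> r0; rewrite /upper_cst mulr_gt0// powR_gt0. Qed.

End constants.

Section square_function_norm.
Context {R : realType} {E : pmetricType R} {d : measure_display}
  {Omega : measurableType d}.
Local Notation B := (borel E).
Variables (m : {sigma_finite_measure set B -> \bar R})
  (D : set (E -> R)) (a : (E -> R) -> (E -> R) -> R)
  (J : {measure set (B * B) -> \bar R}) (K : R.-sfker B ~> B)
  (F : R -> set (set Omega)) (X : R -> {mfun Omega >-> borel (cemetery E)})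
  (P : R.-pker (borel (cemetery E)) ~> Omega).
Hypothesis H : pure_jump_setting m D a J K F X P.
Local Notation k := (trans_kernel (setting_space H) (setting_hunt H)).
Variables (r : R) (f : B -> R).
Hypotheses (r1 : 1 <= r) (Lf : Lp m (2 * r) f).

Let mf : measurable_fun setT f := Lp_meas Lf.
Let js : jump_semigroup m k K := setting_jump_semigroup H.
Let r0 : 0 < r. Proof. by move: r1; lra. Qed.
Let r20 : 0 < 2 * r. Proof. by rewrite mulr_gt0. Qed.

Let PtE t : 0 <= t -> Pt X P t f = Pr k t f.
Proof. by move=> t0; apply/funext => x; rewrite (Pr_trans _ _ x t0 mf). Qed.

Lemma square_functionE : square_function X P K f = (fun x => sqf k K f x `^ (2^-1)%R)%E.
Proof.
apply/funext => x.
suff e : (\int[lebesgue_measure]_(t in `[0%R, +oo[) \int[transition X P t x]_z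
    \int[K z]_(y in ~` [set z])
      ((Pt X P t f y - Pt X P t f z) ^+ 2 * chi (Pt X P t f z) (Pt X P t f y))%:E =
    sqf k K f x)%E.
  by rewrite -e.
rewrite sqf_def; apply: eq_integral => t; rewrite inE/= in_itv/= andbT => t0.
rewrite (PtE t0) Pe_def.
transitivity (\int[transition X P t x]_z carre K (Pr k t f) z)%E.
  (* Removing the point z from the domain is harmless, as the integrand vanishes at y = z. *)
  apply: eq_integral => z _; rewrite carre_def [LHS]integral_mkcond.
  apply: eq_integral => y _; rewrite patchE; case: ifPn => //.
  rewrite notin_setE /= => /contrapT ->.
  by rewrite subrr expr0n/= mul0r.
by apply: eq_measure_integral => A mA _; rewrite trans_kernelE.
Qed.

Lemma Lnorm_square_function :
  (Lnorm m (2 * r)%:E (square_function X P K f) = (\int[m]_x (sqf k K f x `^ r)) `^ (2 * r)^-1)%E.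
Proof.
by rewrite square_functionE; apply: Lnorm_sqrt => // x; exact: sqf_ge0.
Qed.

Let stable : strongly_stable X P m (2 * r) -> nu m (2 * r) (Pr k t f) @[t --> +oo] --> (0 : R).
Proof.
have fL : f \in Lfun m (2 * r)%:E by apply/Lfun_Lp.
move=> /(_ f fL) st; apply/cvgrPdist_lt => e e0.
have e'0 : 0 < e `^ (2 * r)^-1 by exact: powR_gt0.
have /fine_cvgP[fin cv] := st.
move: cv => /cvgrPdist_lt/(_ _ e'0) cv.
near=> t.
have t0 : 0 < t by near: t; exact: nbhs_pinfty_gt.
have LP : Lp m (2 * r) (Pr k t f).
  by apply: (Lp_Pr (js_semigroup js) t0) => //; move: r1; lra.
rewrite sub0r normrN (ger0_norm (nu_ge0 m (2 * r) (Pr k t f))) -lte_fin -(Np_nu LP).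
rewrite -(Lnorm_powR m (Pr k t f) r20) -(PtE (ltW t0)).
have Nt : ('N[m]_(2 * r)%:E[EFin \o Pt X P t f])%E \is a fin_num by near: t.
have lt : `|0 - fine ('N[m]_(2 * r)%:E[EFin \o Pt X P t f])%E| < e `^ (2 * r)^-1 by near: t.
rewrite -(fineK Nt) poweR_EFin lte_fin.
have N0 : 0 <= fine ('N[m]_(2 * r)%:E[EFin \o Pt X P t f])%E by apply: fine_ge0; exact: Lnorm_ge0.
move: lt; rewrite sub0r normrN (ger0_norm N0) => lt.
have := gt0_ltr_powR r20 _ _ lt; rewrite !nnegrE => /(_ N0 (ltW e'0)).
by rewrite -powRrM mulVf ?gt_eqF// powRr1// ltW.
Unshelve. all: by end_near. Qed.

Lemma square_function_lower : 3 <= 2 * r -> strongly_stable X P m (2 * r) ->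
  (((lower_cst r `^ (2 * r)^-1)^-1)%:E * 'N[m]_(2 * r)%:E[EFin \o f] <=
   Lnorm m (2 * r)%:E (square_function X P K f))%E.
Proof.
move=> r3 /stable st; rewrite Lnorm_square_function; apply: Lnorm_le_poweR => //.
- exact: lower_cst_gt0.
- by apply: integral_ge0 => x _; exact: poweR_ge0.
- by rewrite (Np_nu Lf); exact: (nu_le_sqf js r1 Lf r3 st).
Qed.

Lemma square_function_upper : conservative X P m ->
  (Lnorm m (2 * r)%:E (square_function X P K f) <=
   (upper_cst r `^ (2 * r)^-1)%:E * 'N[m]_(2 * r)%:E[EFin \o f])%E.
Proof.
move=> cons; rewrite Lnorm_square_function; apply: poweR_le_Lnorm => //.
- exact: upper_cst_gt0.
- by apply: integral_ge0 => x _; exact: poweR_ge0.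
rewrite (Np_nu Lf) -EFinM /upper_cst.
have [re|rne] := eqVneq r 1.
  rewrite re subrr powRr0 mul1r mul1r mulr1.
  under eq_integral do rewrite poweRe1 ?sqf_ge0//.
  by apply: (integral_sqf_le js); move: Lf; rewrite re mulr1.
apply: (integral_sqf_pow_le js) => //; last by rewrite lt_neqAle eq_sym rne.
move=> t t0.
have h : {ae m, forall x : B, semigroup X P t (cst 1%E) x = 1%E} := cons t t0.
apply: filterS h => x; by rewrite (Pe_trans _ _ x (ltW t0) (measurable_cst _)).
Qed.

End square_function_norm.

Theorem theorem1p3 (R : realType) :
  (forall p : R, 3 <= p ->
     exists2 c : R, 0 < c &
     forall (E : pmetricType R) (m : {measure set (borel E) -> \bar R})
       (D : set (E -> R)) (a : (E -> R) -> (E -> R) -> R)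
       (J : {measure set (borel E * borel E) -> \bar R})
       (K : R.-sfker borel E ~> borel E)
       (d : measure_display) (Omega : measurableType d)
       (F : R -> set (set Omega))
       (X : R -> {mfun Omega >-> borel (cemetery E)})
       (P : R.-pker (borel (cemetery E)) ~> Omega),
     pure_jump_setting m D a J K F X P ->
     strongly_stable X P m p ->
     forall f : borel E -> R, f \in Lfun m p%:E ->
       (c%:E * 'N[m]_p%:E[EFin \o f] <=
        'N[m]_p%:E[square_function X P K f])%E)
  /\
  (forall p : R, 2 <= p ->
     exists2 C : R, 0 < C &
     forall (E : pmetricType R) (m : {measure set (borel E) -> \bar R})
       (D : set (E -> R)) (a : (E -> R) -> (E -> R) -> R)
       (J : {measure set (borel E * borel E) -> \bar R})
       (K : R.-sfker borel E ~> borel E)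
       (d : measure_display) (Omega : measurableType d)
       (F : R -> set (set Omega))
       (X : R -> {mfun Omega >-> borel (cemetery E)})
       (P : R.-pker (borel (cemetery E)) ~> Omega),
     pure_jump_setting m D a J K F X P ->
     strongly_stable X P m p ->
     conservative X P m ->
     forall f : borel E -> R, f \in Lfun m p%:E ->
       ('N[m]_p%:E[square_function X P K f] <=
        C%:E * 'N[m]_p%:E[EFin \o f])%E).
Proof.
split=> p p0.
- have r1 : 1 <= p / 2 by rewrite ler_pdivlMr//; move: p0; lra.
  have pE : p = 2 * (p / 2) by field.
  move: (p / 2) r1 pE => r r1 pE; subst p.
  (* The bound with [lower_cst r] concerns p-th powers, so its inverted p-th root is taken; it is
     fixed before the state space is introduced. *)
  exists ((lower_cst r `^ (2 * r)^-1)^-1).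
    by rewrite invr_gt0 powR_gt0// lower_cst_gt0//; move: r1; lra.
  move=> E m D a J K d Omega F X P H st f fL.
  have [m' mm'] := sigma_finite_pack (radon_sigma_finite (setting_space H) (setting_radon H)).
  subst m; apply: (square_function_lower H r1 _ p0 st).
  by apply/Lfun_Lp => //; move: r1; lra.
- have r1 : 1 <= p / 2 by rewrite ler_pdivlMr//; move: p0; lra.
  have pE : p = 2 * (p / 2) by field.
  move: (p / 2) r1 pE => r r1 pE; subst p.
  exists (upper_cst r `^ (2 * r)^-1).
    by rewrite powR_gt0// upper_cst_gt0//; move: r1; lra.
  move=> E m D a J K d Omega F X P H _ cons f fL.
  have [m' mm'] := sigma_finite_pack (radon_sigma_finite (setting_space H) (setting_radon H)).
  subst m; apply: (square_function_upper H r1 _ cons).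
  by apply/Lfun_Lp => //; move: r1; lra.
Qed.
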